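(* Let $G=(V,E)$ be a graph (directed or undirected) with non-negative integer edge weights, $|V|=n$, $|E|=m$. The Minimum Weight Cycle problem and the All Nodes Shortest Cycles problem on $G$ can be solved in the PRAM model in $\tilde{O}(mn)$ work and $\tilde{O}(n^{1/3})$ parallel time.
   Context: PRAM model (CREW): costs measured by work (total operations) and parallel time (span). $\tilde{O}$ hides factors polylogarithmic in $n$. Minimum Weight Cycle: compute the weight of a shortest simple cycle in $G$. All Nodes Shortest Cycles: for each vertex $u\in V$, compute the weight of a shortest simple cycle through $u$ in $G$. *)

(* Defs.v *)
From HB Require Import structures.
From mathcomp Require Import all_boot all_order all_algebra.
From mathcomp Require Import reals exp.

Set Implicit Arguments.
Unset Strict Implicit.
Unset Printing Implicit Defensive.

(** * Weighted graphs and shortest simple cycles *)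

(* Simple graph on the vertex set {0, ..., n-1}: directed if [dir], undirected
   otherwise.  The value of [wt] outside [adj] is irrelevant. *)
Record wgraph (dir : bool) (n : nat) := WGraph {
  adj : rel 'I_n;
  wt : 'I_n -> 'I_n -> nat;
  adj_irrefl : irreflexive adj;
  adj_sym : ~~ dir -> symmetric adj;
  wt_sym : ~~ dir -> forall u v, adj u v -> wt u v = wt v u
}.

Section Graphs.
Variables (dir : bool) (n : nat) (G : wgraph dir n).

(* An undirected edge is the unordered pair of its end points, so that it is
   counted once although it gives two pairs in [adj G]. *)
Definition num_edges : nat :=
  if dir then #|[set e : 'I_n * 'I_n | adj G e.1 e.2]|
  else #|[set [set e.1; e.2] | e : 'I_n * 'I_n & adj G e.1 e.2]|.

Definition max_weight : nat := \max_u \max_(v | adj G u v) wt G u v.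

(* A cycle is the sequence of its vertices, the last one being followed by the
   first.  A pair of opposite arcs is a cycle of a directed graph, but going
   back and forth along an edge is not a cycle of an undirected graph. *)
Definition simple_cycle (c : seq 'I_n) : bool :=
  [&& cycle (adj G) c, uniq c & (if dir then 2 else 3) <= size c].

Definition cycle_weight (c : seq 'I_n) : nat := \sum_(x <- c) wt G x (next c x).

(* [None] is the answer when no cycle satisfies [P]. *)
Definition shortest_cycle_weight (P : pred (seq 'I_n)) (r : option nat) : Prop :=
  match r with
  | Some d => (exists c, P c /\ cycle_weight c = d)
              /\ (forall c, P c -> d <= cycle_weight c)
  | None => forall c, ~~ P c
  end.

(* [s] lists every edge exactly once, in any order; an undirected edge is listed
   in one, arbitrary, orientation. *)
Definition edge_list (s : seq ('I_n * 'I_n)) : Prop :=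
  [/\ uniq s,
      forall u v, adj G u v = ((u, v) \in s) || (~~ dir && ((v, u) \in s))
    & ~~ dir -> forall u v, (u, v) \in s -> (v, u) \notin s].

End Graphs.

(** * The CREW PRAM *)

(* Synchronous processors running one common program, each with its own program
   counter and registers, over a shared memory.  Computation starts with a single
   processor; others are activated by [Fork], as in the P-RAM of Fortune and
   Wyllie. *)

Inductive binop := Add | Sub | Mul | Div.

Definition eval_binop (o : binop) (x y : nat) : nat :=
  match o with
  | Add => x + y
  | Sub => x - y
  | Mul => x * y
  | Div => x %/ y
  end.

(* Arguments [r], [r1], [r2] are register numbers, [l] is a program line. *)
Inductive instr :=
| Const (r x : nat)              (* R[r] := x *)
| Op (o : binop) (r r1 r2 : nat) (* R[r] := R[r1] o R[r2] *)
| Read (r r1 : nat)              (* R[r] := M[R[r1]] *)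
| Write (r1 r2 : nat)            (* M[R[r1]] := R[r2] *)
| Jzero (r l : nat)              (* if R[r] = 0 then goto l *)
| Fork (l : nat)                 (* activate a processor at l *)
| Halt.

Definition program := seq instr.
Definition memory := nat -> nat.

Record proc := Proc { pc : nat; regs : nat -> nat }.
Record config := Config { shared : memory; active : seq proc }.

Definition upd (f : nat -> nat) (i x : nat) : nat -> nat :=
  fun j => if j == i then x else f j.

Section Machine.
(* [w] is the word size: every value put in a register is reduced modulo 2^w, so
   that unit-cost arithmetic cannot be abused by packing data in huge numbers. *)
Variables (w : nat) (prog : program).

Definition set_reg (p : proc) (r x : nat) : proc :=
  Proc (pc p).+1 (upd (regs p) r (x %% 2 ^ w)).

(* The result consists of the processors replacing [p] (none if it halts, two
   after a fork, the child starting with a copy of the registers of its parent)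
   and of the list of its writes (address, value). *)
Definition proc_step (M : memory) (p : proc) : seq proc * seq (nat * nat) :=
  let R := regs p in
  match nth Halt prog (pc p) with
  | Const r x => ([:: set_reg p r x], [::])
  | Op o r r1 r2 => ([:: set_reg p r (eval_binop o (R r1) (R r2))], [::])
  | Read r r1 => ([:: set_reg p r (M (R r1))], [::])
  | Write r1 r2 => ([:: Proc (pc p).+1 R], [:: (R r1, R r2)])
  | Jzero r l => ([:: Proc (if R r == 0 then l else (pc p).+1) R], [::])
  | Fork l => ([:: Proc (pc p).+1 R; Proc l R], [::])
  | Halt => ([::], [::])
  end.

(* All active processors execute one instruction each, reads preceding writes.
   Reads are unrestricted; two writes to the same cell are an error. *)
Definition step (c : config) : option config :=
  let outs := [seq proc_step (shared c) p | p <- active c] in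
  let writes := flatten (unzip2 outs) in
  if uniq (unzip1 writes) then
    Some (Config (foldr (fun a M => upd M a.1 a.2) (shared c) writes)
                 (flatten (unzip1 outs)))
  else None.

(* [exec c t k M]: from [c], without write conflict, all processors halt after [t]
   parallel steps and [k] executed instructions in total, with final memory [M]. *)
Inductive exec : config -> nat -> nat -> memory -> Prop :=
| exec_done M : exec (Config M [::]) 0 0 M
| exec_step c c' t k M :
    0 < size (active c) -> step c = Some c' -> exec c' t k M ->
    exec c t.+1 (size (active c) + k) M.

End Machine.

(** * Solving graph problems on the PRAM *)

Section Input.
Variables (dir : bool) (n : nat) (G : wgraph dir n).

(* n, m, then a triple (tail, head, weight) for each listed edge. *)
Definition input_words (s : seq ('I_n * 'I_n)) : seq nat :=
  [:: n, size s
    & flatten [seq [:: nat_of_ord e.1; nat_of_ord e.2; wt G e.1 e.2] | e <- s]].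

Definition init_config (s : seq ('I_n * 'I_n)) : config :=
  Config (nth 0 (input_words s)) [:: Proc 0 (fun=> 0)].

(* A word has Theta(log (n + W)) bits, W being the largest edge weight. *)
Definition word_size (c : nat) : nat := c * (trunc_log 2 (n + max_weight G)).+1.

End Input.

(* An output specification relates a graph to the final shared memory. *)
Definition problem (dir : bool) := forall n : nat, wgraph dir n -> memory -> Prop.

(* Output cells hold 0 for "no cycle" and d + 1 for a cycle of weight d. *)
Definition decode (x : nat) : option nat := if x is d.+1 then Some d else None.

Definition minimum_weight_cycle (dir : bool) : problem dir :=
  fun n G M => shortest_cycle_weight G (simple_cycle G) (decode (M 0)).

Definition all_nodes_shortest_cycles (dir : bool) : problem dir :=
  fun n G M => forall u : 'I_n,
    shortest_cycle_weight G (fun c => simple_cycle G c && (u \in c)) (decode (M u)).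

Local Open Scope ring_scope.

(* One program must be correct on all inputs, with work
   O((log n)^k * work_bound n m) and time O((log n)^k * time_bound n m).  For
   n <= 1 there is one graph up to irrelevant data, and log n <= 0: the bounds are
   required for n >= 2. *)
Definition pram_solvable (R : realType) (dir : bool) (P : problem dir)
    (work_bound time_bound : nat -> nat -> R) : Prop :=
  exists (prog : program) (c k : nat) (C : R),
  forall (n : nat) (G : wgraph dir n) (s : seq ('I_n * 'I_n)), edge_list G s ->
  exists (t work : nat) (M : memory),
    [/\ exec (word_size G c) prog (init_config G s) t work M,
        P n G M
      & (1 < n)%N ->
        work%:R <= C * ln n%:R ^+ k * work_bound n (num_edges G) /\
        t%:R <= C * ln n%:R ^+ k * time_bound n (num_edges G)].

(* Main.v *)
Require Import Defs.
From HB Require Import structures.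
From mathcomp Require Import all_boot all_order all_algebra.
From mathcomp Require Import reals exp.
From mathcomp Require Import zify.

(* The algorithm is a derandomised form of the Ullman-Yannakakis and
   Karczmarz-Sankowski shortest path scheme.  Weights are perturbed so that the
   number of arcs of a path can be read off its weight.  For L = 1, 2, 4, ... up to
   about n^(1/3), a set H_L of about n/L vertices meeting every shortest path with
   2L-1 arcs is computed: 2L Bellman-Ford rounds from H_L give trees, the least
   populated layer of each tree between L and 2L has at most n/L vertices, and the
   last L vertices of the tree paths to these layers are hit by H_2L.  The latter is
   a union of polylogarithmically many residue classes modulo integers p >= L, picked
   greedily; averaging over the primes p >= L (their number is bounded by a
   Chebyshev estimate) shows that some class meets a polylogarithmic fraction of the
   remaining paths.  At the top level, whose set has about n^(2/3) vertices, all
   distances are found by repeated max-plus squaring in n^2 work up to logarithms;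
   going down, distances from H_2L to H_L are extended to distances from and to H_L
   by 4L Bellman-Ford rounds.  Since |H_L| L is about n, each level costs mn work and
   time L.  From all distances, a shortest cycle through u closes with an arc into u
   if the graph is directed, and otherwise with an edge joining two distinct subtrees
   of the shortest path tree of u.

   The algorithm is written in a small language of parallel array assignments, whose
   programs are compiled to PRAM code: [tau] and [omg] are the time and the work up to
   the logarithmic cost of spawning processors. *)

Set Implicit Arguments.
Unset Strict Implicit.
Unset Printing Implicit Defensive.

(** Three constraints shape the construction. A greedy hitting set chosen vertex by vertex would
    need about n/L rounds; a residue class modulo p >= L supplies about n/L vertices at once, so few
    rounds suffice. Testing all candidate classes against all paths costs about L^2 times the number
    of paths; keeping one sparse layer per tree leaves n/L paths per tree, so that this too costs
    |H| L n. Finally n^2 work is too much when m < n, hence only ends of arcs are numbered as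
    candidate vertices: there are [N0] of them, at most twice the number of arcs. The exponent 1/3
    comes from the top level: the cube of |H|, the work of a max-plus squaring, must not exceed n^2,
    so |H| is about n^(2/3) and L about n^(1/3). Perturbing the weights does more than count arcs:
    all shortest paths with the same ends get the same number of arcs, so exchanging a segment of a
    path for another shortest one does not shift positions. *)

(** * Parallel array assignments: semantics, costs, and runs of the machine *)

Module Language.

Inductive expr :=
| EC of nat | EV of nat | EX
| EB of binop & expr & expr
| EG of nat & expr
| EI of expr & expr & expr.

Inductive cmd :=
| Asg of nat & expr
| Lg of nat & expr
| Seq of cmd & cmd
| For of nat & nat & cmd
| Par of nat & expr & expr & expr.

Record state := St { rg : nat -> nat; mm : memory }.

(** Arrays 1 to 64 are interleaved with stride 64 from the address [off] on, so each is unbounded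
    and no sizes are declared. Number 0 denotes the raw memory, where the input is found and the
    output is left. *)
Definition ad (off a i : nat) : nat :=
  if a is a'.+1 then off + (i * 64 + a') else i.

Definition A (s : state) (a i : nat) : nat := mm s (ad (rg s 0) a i).
Arguments A : simpl never.

Fixpoint ev (s : state) (i : nat) (e : expr) : nat :=
  match e with
  | EC k => k
  | EV x => rg s x
  | EX => i
  | EB o e1 e2 => eval_binop o (ev s i e1) (ev s i e2)
  | EG a e1 => A s a (ev s i e1)
  | EI c e1 e2 => if ev s i c == 0 then ev s i e2 else ev s i e1
  end.

Definition setv (s : state) (x v : nat) : state := St (upd (rg s) x v) (mm s).
Arguments setv : simpl never.

Definition pwr (s : state) (a : nat) (idx v : expr) (is_ : seq nat) : memory :=
  foldr (fun b M => upd M b.1 b.2) (mm s)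
    [seq (ad (rg s 0) a (ev s i idx), ev s i v) | i <- is_].

Fixpoint run (c : cmd) (s : state) : state :=
  match c with
  | Asg x e => setv s x (ev s 0 e)
  | Lg x e => setv s x (up_log 2 (ev s 0 e))
  | Seq c1 c2 => run c2 (run c1 s)
  | For x y c1 =>
      let n := rg s y in
      setv (iteri n (fun k s' => run c1 (setv s' x k)) s) x n
  | Par a P idx v => St (rg s) (pwr s a idx v (iota 0 (ev s 0 P)))
  end.

Definition lp (x : nat) (c : cmd) (s : state) (k : nat) : state :=
  iteri k (fun k s' => run c (setv s' x k)) s.

Lemma lpS x c s k : lp x c s k.+1 = run c (setv (lp x c s k) x k).
Proof. by []. Qed.

Fixpoint tau (c : cmd) (s : state) : nat :=
  match c with
  | Seq c1 c2 => tau c1 s + tau c2 (run c1 s)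
  | For x y c1 =>
      (\sum_(k < rg s y) (tau c1 (setv (lp x c1 s k) x k)).+1).+1
  | _ => 1
  end.

Fixpoint omg (c : cmd) (s : state) : nat :=
  match c with
  | Seq c1 c2 => omg c1 s + omg c2 (run c1 s)
  | For x y c1 =>
      (\sum_(k < rg s y) (omg c1 (setv (lp x c1 s k) x k)).+1).+1
  | Par a P idx v => ev s 0 P
  | _ => 1
  end.

Fixpoint wrV (c : cmd) : seq nat :=
  match c with
  | Asg x _ | Lg x _ => [:: x]
  | Seq c1 c2 => wrV c1 ++ wrV c2
  | For x _ c1 => x :: wrV c1
  | Par _ _ _ _ => [::]
  end.

Fixpoint wrA (c : cmd) : seq nat :=
  match c with
  | Seq c1 c2 => wrA c1 ++ wrA c2
  | For _ _ c1 => wrA c1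
  | Par a _ _ _ => [:: a]
  | _ => [::]
  end.

(** The compiled loop reads counter and bound afresh in each iteration, whereas [run] fixes the
    number of iterations on entry; they agree if the body changes neither. *)
Fixpoint wf (c : cmd) : bool :=
  match c with
  | Seq c1 c2 => wf c1 && wf c2
  | For x y c1 => [&& x \notin wrV c1, y \notin wrV c1, x != y & wf c1]
  | _ => true
  end.

Fixpoint emax (e : expr) : nat :=
  match e with
  | EC k => k
  | EV x => x
  | EX => 0
  | EB _ e1 e2 => maxn (emax e1) (emax e2)
  | EG a e1 => maxn a (emax e1)
  | EI c e1 e2 => maxn (emax c) (maxn (emax e1) (emax e2))
  end.

(** Exponent of the bound [X ^ esz e] on the values arising in the evaluation of [e] when variables
    and cells are at most [X]. The [3] pays for the address [off + (i * 64 + a')]. *)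
Fixpoint esz (e : expr) : nat :=
  match e with
  | EB _ e1 e2 => esz e1 + esz e2
  | EG a e1 => esz e1 + 3
  | EI c e1 e2 => (esz c + esz e1 + esz e2).+1
  | _ => 1
  end.

(* The largest literal, variable or array number. *)
Fixpoint cmax (c : cmd) : nat :=
  match c with
  | Asg x e | Lg x e => maxn x (emax e)
  | Seq c1 c2 => maxn (cmax c1) (cmax c2)
  | For x y c1 => maxn (maxn x y) (cmax c1)
  | Par a P idx v => maxn a (maxn (emax P) (maxn (emax idx) (emax v)))
  end.

Fixpoint csz (c : cmd) : nat :=
  match c with
  | Asg _ e | Lg _ e => esz e
  | Seq c1 c2 => maxn (csz c1) (csz c2)
  | For _ _ c1 => csz c1
  | Par _ P idx v => maxn (esz P) (maxn (esz idx + 3) (esz v))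
  end.

Section Ok.
Variables X LP : nat.

(** Conditions for the machine to follow [run]. Stored values stay below [X], so that reduction
    modulo the word size never acts; the argument of a logarithm bounds the number of doublings;
    distinct indices make the writes of a step exclusive; and a parallel step has at least one
    processor, since the one with index 0 carries on afterwards. *)
Fixpoint ok (c : cmd) (s : state) : Prop :=
  match c with
  | Asg x e => ev s 0 e <= X
  | Lg x e => ev s 0 e <= 2 ^ LP
  | Seq c1 c2 => ok c1 s /\ ok c2 (run c1 s)
  | For x y c1 => forall k, k < rg s y -> ok c1 (setv (lp x c1 s k) x k)
  | Par a P idx v =>
      [/\ 0 < ev s 0 P,
          forall i, i < ev s 0 P -> ev s i v <= X
        & forall i j, i < ev s 0 P -> j < ev s 0 P ->
            ev s i idx = ev s j idx -> i = j]
  end.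

End Ok.

Definition bd (X : nat) (s : state) : Prop :=
  (forall x, rg s x <= X) /\ (forall a, mm s a <= X).

Lemma ad_inj off a i j : ad off a i = ad off a j -> i = j.
Proof. case: a => [|a] //=; lia. Qed.

Lemma foldr_upd_notin (ws : seq (nat * nat)) (M : memory) a :
  a \notin unzip1 ws -> foldr (fun b M => upd M b.1 b.2) M ws a = M a.
Proof.
elim: ws => //= w ws IH; rewrite inE negb_or => /andP[/negbTE aw] /IH.
by rewrite /upd aw.
Qed.

Lemma foldr_upd_in (ws : seq (nat * nat)) (M : memory) a v :
  uniq (unzip1 ws) -> (a, v) \in ws ->
  foldr (fun b M => upd M b.1 b.2) M ws a = v.
Proof.
elim: ws => //= -[b u] ws IH /= /andP[bn /IH{}IH]; rewrite inE /upd.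
case/orP=> [/eqP[-> ->]|/[dup] aw /IH ->]; first by rewrite eqxx.
case: eqP => // ab; case/negP: bn; rewrite -ab.
by apply/mapP; exists (a, v).
Qed.

Lemma pwr_uniq s a idx v P :
  (forall i j, i < P -> j < P -> ev s i idx = ev s j idx -> i = j) ->
  uniq (unzip1 [seq (ad (rg s 0) a (ev s i idx), ev s i v) | i <- iota 0 P]).
Proof.
move=> inj; rewrite /unzip1 -map_comp map_inj_in_uniq ?iota_uniq //.
by move=> i j; rewrite !mem_iota /= => iP jP /ad_inj/inj; apply.
Qed.

Lemma pwr_at s a idx v P i :
  (forall i j, i < P -> j < P -> ev s i idx = ev s j idx -> i = j) ->
  i < P -> pwr s a idx v (iota 0 P) (ad (rg s 0) a (ev s i idx)) = ev s i v.
Proof.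
move=> inj iP; apply: foldr_upd_in; first exact: pwr_uniq.
by apply/mapP; exists i => //; rewrite mem_iota.
Qed.

Lemma pwr_out s a idx v P b :
  (forall i, i < P -> b != ad (rg s 0) a (ev s i idx)) ->
  pwr s a idx v (iota 0 P) b = mm s b.
Proof.
move=> H; apply: foldr_upd_notin; apply/negP => /mapP[[b' u] /mapP[i]].
by rewrite mem_iota /= => iP [-> _] Eb; case/eqP: (H i iP).
Qed.

Lemma run_rg c s x : x \notin wrV c -> rg (run c s) x = rg s x.
Proof.
elim: c s => [y e|y e|c1 IH1 c2 IH2|y z c IH|a P idx v] s //=.
- by rewrite inE /upd => /negbTE ->.
- by rewrite inE /upd => /negbTE ->.
- by rewrite mem_cat negb_or => /andP[H1 H2]; rewrite IH2 // IH1.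
rewrite inE negb_or => /andP[/negbTE xy H]; rewrite /upd xy.
elim: (rg s z) => //= n IHn; rewrite IH //= /upd xy; exact: IHn.
Qed.

Lemma A_setv s x v a i : 0 != x -> A (setv s x v) a i = A s a i.
Proof. by rewrite /A /= /upd => /negbTE ->. Qed.

(* Array 0 is the raw memory, on which the other arrays live. *)
Lemma run_A c s a i : wf c -> 0 \notin wrV c -> 0 \notin wrA c ->
  all (fun b => b <= 64) (a :: wrA c) -> 0 < a ->
  a \notin wrA c -> A (run c s) a i = A s a i.
Proof.
move=> + + + + a0.
elim: c s => [y e|y e|c1 IH1 c2 IH2|y z c IH|b P idx v] s /=.
- by rewrite inE => _ ne0 _ _ _; rewrite A_setv.
- by rewrite inE => _ ne0 _ _ _; rewrite A_setv.
- rewrite !mem_cat !negb_or all_cat => /andP[w1 w2] /andP[v1 v2] /andP[z1 z2].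
  move=> /and3P[aa b1 b2] /andP[a1 a2].
  by rewrite IH2 // ?IH1 //= ?aa.
- rewrite inE negb_or => /and4P[_ _ _ w] /andP[/negbTE y0 v0] z0 aa az.
  rewrite A_setv ?y0 //; elim: (rg s z) => //= n IHn.
  by rewrite IH // A_setv ?y0.
rewrite !inE => _ _ b0 /and3P[aa ba _] ab; rewrite /A /=.
apply: pwr_out => i' _; case: a a0 aa ab => // a _ aa; case: b b0 ba => // b _ ba.
by rewrite /ad eqn_add2l => ab; apply/eqP; lia.
Qed.

Section Refine.
Variables (w : nat) (prog : program).

(** Unlike [exec] it stops at an arbitrary configuration, so that pieces of code and their costs can
    be concatenated. *)
Inductive runs : config -> nat -> nat -> config -> Prop :=
| runs0 c : runs c 0 0 c
| runsS c c' c'' t k :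
    0 < size (active c) -> step w prog c = Some c' -> runs c' t k c'' ->
    runs c t.+1 (size (active c) + k) c''.

Lemma runs_trans c1 c2 c3 t1 t2 k1 k2 :
  runs c1 t1 k1 c2 -> runs c2 t2 k2 c3 -> runs c1 (t1 + t2) (k1 + k2) c3.
Proof.
elim=> // c c' c'' t k sz st _ IH /IH r.
by rewrite addSn -addnA; apply: runsS r.
Qed.

Lemma runs_exec c1 c2 t1 t2 k1 k2 M :
  runs c1 t1 k1 c2 -> exec w prog c2 t2 k2 M ->
  exec w prog c1 (t1 + t2) (k1 + k2) M.
Proof.
elim=> // c c' c'' t k sz st _ IH /IH r.
by rewrite addSn -addnA; apply: exec_step r.
Qed.

Lemma step_nowrite M ps :
  all (fun p => nilp (proc_step w prog M p).2) ps ->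
  step w prog (Config M ps) =
  Some (Config M (flatten [seq (proc_step w prog M p).1 | p <- ps])).
Proof.
move=> H; rewrite /step /=.
have -> : flatten (unzip2 [seq proc_step w prog M p | p <- ps]) = [::].
  by elim: ps H => //= p ps IH /andP[/nilP -> /IH].
by rewrite /= /unzip1 -map_comp.
Qed.

Definition linstr (M : memory) (r : nat -> nat) (c : instr) : nat -> nat :=
  match c with
  | Const a x => upd r a (x %% 2 ^ w)
  | Op o a r1 r2 => upd r a (eval_binop o (r r1) (r r2) %% 2 ^ w)
  | Read a r1 => upd r a (M (r r1) %% 2 ^ w)
  | _ => r
  end.

Definition is_local (c : instr) : bool :=
  match c with Const _ _ | Op _ _ _ _ | Read _ _ => true | _ => false end.

Definition lrun (M : memory) (code : seq instr) (r : nat -> nat) :=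
  foldl (linstr M) r code.

Definition at_pc (p : nat) (code : seq instr) : Prop :=
  forall i, i < size code -> nth Halt prog (p + i) = nth Halt code i.

Lemma at_cat p c1 c2 :
  at_pc p (c1 ++ c2) -> at_pc p c1 /\ at_pc (p + size c1) c2.
Proof.
move=> H; split=> i ic.
  by rewrite H ?nth_cat ?ic // size_cat ltn_addr.
by rewrite -addnA H ?size_cat ?ltn_add2l // nth_cat ltnNge leq_addr /= addKn.
Qed.

Lemma at_cons p c cs : at_pc p (c :: cs) ->
  nth Halt prog p = c /\ at_pc p.+1 cs.
Proof.
move=> H; split; first by have := H 0 isT; rewrite addn0.
by move=> i ic; rewrite addSnnS H.
Qed.

(** All processors are in lock step at the same line. Compiled code returns to this shape after each
    fork or halt. *)
Definition unif (M : memory) (p : nat) (rs : seq (nat -> nat)) : config :=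
  Config M [seq Proc p r | r <- rs].

Lemma runs_local M p code rs : all is_local code -> at_pc p code ->
  0 < size rs ->
  runs (unif M p rs) (size code) (size code * size rs)
       (unif M (p + size code) [seq lrun M code r | r <- rs]).
Proof.
elim: code p rs => [|c code IH] p rs /=.
  by move=> *; rewrite addn0 map_id; exact: runs0.
move=> /andP[lc lcs] /at_cons[pc pcs] rs0.
have -> : [seq lrun M (c :: code) r | r <- rs] =
          [seq lrun M code r | r <- [seq linstr M r c | r <- rs]].
  by rewrite -map_comp.
have E : size rs = size (active (unif M p rs)) by rewrite size_map.
rewrite mulSn {1}E -addSnnS.
apply: runsS (_ : step _ _ _ = Some (unif M p.+1 [seq linstr M r c | r <- rs])) _.
- by rewrite -E.
- rewrite step_nowrite; last first.
    by elim: (rs) => //= r l ->; rewrite /proc_step /= pc; case: (c) lc.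
  congr (Some (Config _ _)).
  elim: (rs) => //= r l ->; rewrite /proc_step /= pc.
  by case: (c) lc.
by have := IH p.+1 [seq linstr M r c | r <- rs] lcs pcs; rewrite size_map; apply.
Qed.

Lemma runs_step M ps qs :
  0 < size ps ->
  all (fun p => nilp (proc_step w prog M p).2) ps ->
  flatten [seq (proc_step w prog M p).1 | p <- ps] = qs ->
  runs (Config M ps) 1 (size ps) (Config M qs).
Proof.
move=> s0 nw <-; rewrite -[X in runs _ _ X]addn0 -[size ps]/(size (active (Config M ps))).
by apply: runsS (runs0 _) => //; rewrite step_nowrite.
Qed.

End Refine.

End Language.

(** * Branch-free compilation of expressions *)

Module Expressions.
Import Language.

Definition aops (d a : nat) : seq instr :=
  if a is a'.+1 then
    [:: Const d.+1 64; Op Mul d d d.+1; Const d.+1 a'; Op Add d d d.+1;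
        Op Add d 0 d]
  else [::].

(** Registers from [d] on serve as an evaluation stack. A conditional is computed as
    [(1 - z) * e1 + z * e2] with [z = 1 - c], without jumps: the number of instructions is then
    independent of the data, and processors evaluating the same expression stay in lock step. *)
Fixpoint cexp (T : nat) (e : expr) (d : nat) : seq instr :=
  match e with
  | EC k => [:: Const d k]
  | EV x => [:: Const d 0; Op Add d d x]
  | EX => [:: Const d 0; Op Add d d T]
  | EB o e1 e2 => cexp T e1 d ++ cexp T e2 d.+1 ++ [:: Op o d d d.+1]
  | EG a e1 => cexp T e1 d ++ aops d a ++ [:: Read d d]
  | EI c e1 e2 => cexp T c d ++ [:: Const d.+1 1; Op Defs.Sub d d.+1 d] ++
      cexp T e1 d.+1 ++ cexp T e2 d.+2 ++
      [:: Op Mul d.+2 d d.+2; Const d.+3 1; Op Defs.Sub d.+3 d.+3 d;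
          Op Mul d.+1 d.+3 d.+1; Op Add d d.+1 d.+2]
  end.

Lemma cexp_local T e d : all is_local (cexp T e d).
Proof.
elim: e d => //= [o e1 IH1 e2 IH2|a e1 IH|c IHc e1 IH1 e2 IH2] d.
- by rewrite !all_cat IH1 IH2.
- by rewrite !all_cat IH; case: a.
- by rewrite all_cat /= !all_cat IHc IH1 IH2.
Qed.

Lemma lrun_cat w M c1 c2 r : lrun w M (c1 ++ c2) r = lrun w M c2 (lrun w M c1 r).
Proof. exact: foldl_cat. Qed.

Lemma updE f i x : upd f i x i = x. Proof. by rewrite /upd eqxx. Qed.
Lemma updN f i x j : j != i -> upd f i x j = f j.
Proof. by rewrite /upd => /negbTE ->. Qed.

Section Expr.
Variables (w T X : nat).
Hypotheses (T0 : 0 < T) (TX : T <= X) (X64 : 64 <= X).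

Let Xexp k : 0 < X ^ k. Proof. by rewrite expn_gt0; lia. Qed.

Lemma Xle k l : k <= l -> X ^ k <= X ^ l.
Proof. by move=> kl; apply: leq_pexp2l => //; lia. Qed.

Lemma esz_gt0 e : 0 < esz e.
Proof. by elim: e => //= *; lia. Qed.

Lemma Xdbl k l : 0 < k -> 0 < l -> X ^ k + X ^ l <= X ^ (k + l).
Proof.
move=> k0 l0; have h j : 0 < j -> 1 < X ^ j.
  by move=> j0; have := Xle j0; rewrite expn1; lia.
by rewrite expnD; move: (h _ k0) (h _ l0); move: (X ^ k) (X ^ l); nia.
Qed.

Lemma Xaddr k x a' : x <= X ^ k -> a' <= X -> x * 64 + a' + X <= X ^ (k + 3).
Proof.
move=> xk aX; have := Xexp k; rewrite expnD; move: (X ^ k) xk => y xy y0.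
have : X ^ 3 = X * X * X by rewrite !expnS expn0 muln1 mulnA.
move=> ->; have h1 : x * 64 <= y * X by exact: leq_mul.
have h2 : X <= y * X by rewrite leq_pmull.
rewrite !mulnA; move: (y * X) h1 h2 => z h1 h2.
by have : z * 3 <= z * X * X; [rewrite -mulnA leq_mul2l; apply/orP; right; nia|lia].
Qed.

Lemma ev_le s i e : bd X s -> i <= X -> emax e < T -> ev s i e <= X ^ esz e.
Proof.
move=> [bR bM] iX; elim: e => /= [k|x||o e1 IH1 e2 IH2|a e1 IH|c IHc e1 IH1 e2 IH2] h.
- by rewrite expn1; lia.
- by rewrite expn1.
- by rewrite expn1.
- move: h; rewrite gtn_max => /andP[/IH1{}IH1 /IH2{}IH2].
  have D := Xdbl (esz_gt0 e1) (esz_gt0 e2).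
  case: o => /=; first by apply: leq_trans D; exact: leq_add.
  + by apply: leq_trans (leq_subr _ _) (leq_trans IH1 (Xle _)); rewrite leq_addr.
  + by rewrite expnD leq_mul.
  + by apply: leq_trans (leq_div _ _) (leq_trans IH1 (Xle _)); rewrite leq_addr.
- by apply: leq_trans (bM _) _; rewrite -{1}(expn1 X); apply: Xle; lia.
- move: h; rewrite !gtn_max => /and3P[_ /IH1{}IH1 /IH2{}IH2].
  by case: ifP => _; [apply: leq_trans IH2 _|apply: leq_trans IH1 _];
    apply: Xle; lia.
Qed.

Lemma addr_le s i e a : bd X s -> i <= X -> emax e < T -> a < T ->
  ad (rg s 0) a (ev s i e) <= X ^ (esz e + 3).
Proof.
move=> b iX eT aT; have := ev_le b iX eT; case: a aT => [|a] aT /= E.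
  by apply: leq_trans E _; apply: Xle; lia.
by have [bR _] := b; have := bR 0; have := Xaddr E (_ : a <= X); lia.
Qed.

Lemma aops_ok s i e a d r : bd X s -> i <= X -> emax e < T -> a < T -> T < d ->
  X ^ (esz e + 3) < 2 ^ w -> r d = ev s i e -> r 0 = rg s 0 ->
  lrun w (mm s) (aops d a) r d = ad (rg s 0) a (ev s i e) /\
  (forall x, x < d -> lrun w (mm s) (aops d a) r x = r x).
Proof.
move=> b iX h1 aT Td wX Q1 r0; have := addr_le b iX h1 aT.
case: a aT => [|a] aT //= E.
split=> [|x xd]; last by rewrite !updN //; lia.
have n1 : (d == d.+1) = false by lia.
have n2 : (d.+1 == d) = false by lia.
have n3 : (0 == d) = false by lia.
have n4 : (0 == d.+1) = false by lia.
rewrite /upd /= !eqxx ?n1 ?n2 ?n3 ?n4 Q1 r0.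
have X64' : 64 < 2 ^ w.
  by apply: leq_ltn_trans wX; apply: leq_trans X64 _; rewrite -{1}(expn1 X); apply: Xle; lia.
move: X64' E; rewrite /ad; move: (ev s i e) (rg s 0) (2 ^ w) (X ^ _) wX => v off W Y YW X64' E.
have -> : 64 %% W = 64 by rewrite modn_small.
have -> : (v * 64) %% W = v * 64 by rewrite modn_small //; lia.
have -> : a %% W = a by rewrite modn_small //; lia.
have -> : (v * 64 + a) %% W = v * 64 + a by rewrite modn_small //; lia.
by rewrite modn_small //; lia.
Qed.

Lemma cexp_ok s i e d r :
  bd X s -> i <= X -> emax e < T -> X ^ esz e < 2 ^ w ->
  (forall x, x < T -> r x = rg s x) -> r T = i -> T < d ->
  lrun w (mm s) (cexp T e d) r d = ev s i e /\
  (forall x, x < d -> lrun w (mm s) (cexp T e d) r x = r x).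
Proof.
move=> b iX; elim: e d r => /= [k|x||o e1 IH1 e2 IH2|a e1 IH|c IHc e1 IH1 e2 IH2] d r h wX ra ri Td.
- rewrite expn1 in wX; split=> [|x xd]; last by rewrite updN //; lia.
  by rewrite updE modn_small //; lia.
- rewrite expn1 in wX; split=> [|y yd]; last by rewrite !updN //; lia.
  have [bR _] := b; have := bR x.
  rewrite updE /= updE mod0n add0n updN ?ra //; last by lia.
  by move=> xX; rewrite modn_small //; lia.
- rewrite expn1 in wX; split=> [|y yd]; last by rewrite !updN //; lia.
  rewrite updE /= updE mod0n add0n updN ?ri; last by lia.
  by rewrite modn_small //; lia.
- have E := ev_le (e := EB o e1 e2) b iX h; move: E h => /= E; rewrite gtn_max => /andP[h1 h2].
  have w1 : X ^ esz e1 < 2 ^ w by apply: leq_ltn_trans wX; apply: Xle; lia.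
  have w2 : X ^ esz e2 < 2 ^ w by apply: leq_ltn_trans wX; apply: Xle; lia.
  have [Q1 Q2] := IH1 d r h1 w1 ra ri Td.
  rewrite !lrun_cat; set r1 := lrun _ _ _ _ in Q1 Q2 *.
  have [] := IH2 d.+1 r1 h2 w2.
  + by move=> x xT; rewrite Q2 ?ra //; lia.
  + by rewrite Q2 ?ri.
  + by lia.
  set r2 := lrun _ _ _ _ => Q3 Q4; split=> [|x xd] /=.
    by rewrite updE Q4 // Q1 Q3 modn_small //; lia.
  by rewrite updN ?Q4 ?Q2 //; lia.
- move: h; rewrite gtn_max => /andP[aT h1].
  have w1 : X ^ esz e1 < 2 ^ w by apply: leq_ltn_trans wX; apply: Xle; lia.
  have [Q1 Q2] := IH d r h1 w1 ra ri Td.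
  rewrite !lrun_cat; set r1 := lrun _ _ _ _ in Q1 Q2 *.
  have [bR bM] := b.
  set r2 := lrun _ _ (aops d a) r1.
  have r10 : r1 0 = rg s 0 by rewrite Q2; [exact: ra|lia].
  have [] := aops_ok b iX h1 aT Td wX Q1 r10.
  rewrite -/r2 => Q3 Q4; split=> [|x xd] /=; last by rewrite updN ?Q4 ?Q2 //; lia.
  have X2 : X < 2 ^ w.
    by apply: leq_ltn_trans wX; rewrite -{1}(expn1 X); apply: Xle; lia.
  by rewrite updE Q3 modn_small //; apply: leq_ltn_trans X2; exact: bM.
- have E := ev_le (e := EI c e1 e2) b iX h; move: E h => /= E; rewrite !gtn_max => /and3P[hc h1 h2].
  have wc : X ^ esz c < 2 ^ w by apply: leq_ltn_trans wX; apply: Xle; lia.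
  have w1 : X ^ esz e1 < 2 ^ w by apply: leq_ltn_trans wX; apply: Xle; lia.
  have w2 : X ^ esz e2 < 2 ^ w by apply: leq_ltn_trans wX; apply: Xle; lia.
  have E1 := ev_le b iX h1; have E2 := ev_le b iX h2.
  have w3 : 1 < 2 ^ w.
    by apply: leq_ltn_trans wX; apply: leq_trans (Xexp _); lia.
  have [Q1 Q2] := IHc d r hc wc ra ri Td.
  rewrite lrun_cat (lrun_cat _ _ [:: Const d.+1 1; Op Defs.Sub d d.+1 d]) !lrun_cat.
  set r1 := lrun _ _ (cexp T c d) _ in Q1 Q2 *.
  set r2 := lrun _ _ [:: Const _ _; _] _.
  have n1 : (d == d.+1) = false by lia.
  have n2 : (d.+1 == d) = false by lia.
  have [Q3 Q4] : r2 d = 1 - ev s i c /\ (forall x, x < d -> r2 x = r1 x).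
    rewrite /r2 /=; split=> [|x xd]; last by rewrite !updN //; lia.
    by rewrite /upd /= !eqxx n1 Q1 (modn_small w3) modn_small //; lia.
  have [] := IH1 d.+1 r2 h1 w1.
  + by move=> x xT; rewrite Q4 ?Q2 ?ra //; lia.
  + by rewrite Q4 ?Q2 ?ri.
  + by lia.
  set r3 := lrun _ _ _ _ => Q5 Q6.
  have [] := IH2 d.+2 r3 h2 w2.
  + by move=> x xT; rewrite Q6 ?Q4 ?Q2 ?ra //; lia.
  + by rewrite Q6 ?Q4 ?Q2 ?ri //; lia.
  + by lia.
  set r4 := lrun _ _ _ _ => Q7 Q8; split=> [|x xd] /=; last first.
    by rewrite !updN ?Q8 ?Q6 ?Q4 ?Q2 //; lia.
  have n3 : (d == d.+2) = false by lia.
  have n4 : (d.+1 == d.+2) = false by lia.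
  have n5 : (d.+1 == d.+3) = false by lia.
  have n6 : (d.+2 == d.+3) = false by lia.
  have n7 : (d == d.+3) = false by lia.
  have n8 : (d.+2 == d.+1) = false by lia.
  rewrite /upd /= !eqxx ?n1 ?n2 ?n3 ?n4 ?n5 ?n6 ?n7 ?n8 /=.
  rewrite Q7 !Q8 // Q5 !Q6 // Q3 (modn_small w3).
  case: (ev s i c) => [|k].
    by rewrite (subnn 1) subn0 mod0n mul0n mod0n mul1n add0n /= !modn_small //; lia.
  have -> : 1 - k.+1 = 0 by lia.
  by rewrite subn0 !mul0n mod0n addn0 (modn_small w3) mul1n /= !modn_small //; lia.
Qed.

End Expr.

End Expressions.

(** * Code generation and the spawning of processors *)

Module Spawning.
Import Language Expressions.

(* Registers above the program variables [x < T]: [T] is the processor index,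
   [T + 1] the number of processors wanted, [T + 2] a power of two, [T + 3] a
   temporary; expressions are evaluated from [T + 4] on.  After [Fork], parent and
   child take the same number of steps to the common continuation, so that all
   processors keep the same program counter. *)
Definition ckill (T q : nat) : seq instr :=
  [:: Jzero T.+3 q.+2; Jzero T.+2 q.+3; Halt].

(** [p] is the address of the generated code, since jump targets are absolute.
    [Const t 0; Jzero t l] is an unconditional jump, and [Const x 0; Op Add x x y] copies a
    register. The index of a processor is doubled before a fork and the child adds 1 to it, which
    numbers the processors consecutively. *)
Fixpoint ccmd (T : nat) (c : cmd) (p : nat) : seq instr :=
  let D := T.+4 in let t := T.+3 in
  match c with
  | Asg x e => cexp T e D ++ [:: Const x 0; Op Add x x D]
  | Lg x e =>
      let q := p + size (cexp T e D) + 2 in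
      cexp T e D ++ [:: Const x 0; Const T.+2 1] ++
      [:: Op Defs.Sub t D T.+2; Jzero t (q + 7);
          Op Add T.+2 T.+2 T.+2; Const t 1; Op Add x x t; Const t 0; Jzero t q]
  | Seq c1 c2 =>
      ccmd T c1 p ++ ccmd T c2 (p + size (ccmd T c1 p))
  | For x y c1 =>
      let b := ccmd T c1 (p + 3) in
      [:: Const x 0] ++ [:: Op Defs.Sub t y x; Jzero t (p + 7 + size b)] ++ b ++
      [:: Const t 1; Op Add x x t; Const t 0; Jzero t (p + 1)]
  | Par a P idx v =>
      let q := p + size (cexp T P D) + 4 in
      let kq := q + 13 in
      let ev := cexp T idx D ++ aops D a ++ cexp T v D.+1 in
      let wq := kq + 3 + size ev in
      (cexp T P D ++ [:: Const T.+1 0; Op Add T.+1 T.+1 D; Const T 0; Const T.+2 1]) ++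
      [:: Op Defs.Sub t T.+1 T.+2; Jzero t (q + 11)] ++ [:: Op Add T T T] ++
      [:: Fork (q + 6); Const t 0; Jzero t (q + 8); Const t 1; Op Add T T t] ++
      [:: Op Add T.+2 T.+2 T.+2; Const t 0] ++ [:: Jzero t q] ++
      [:: Const T.+2 0; Op Defs.Sub t T.+1 T] ++ ckill T kq ++ ev ++
      [:: Write D D.+1] ++ [:: Const T.+2 0; Const t 1; Op Defs.Sub t t T] ++
      ckill T (wq + 4)
  end.

Lemma filter_iota0 P N : P <= N -> [seq i <- iota 0 N | i < P] = iota 0 P.
Proof.
move=> PN; rewrite -(subnKC PN) iotaD filter_cat add0n.
have -> : [seq i <- iota 0 P | i < P] = iota 0 P.
  by apply/all_filterP/allP => i; rewrite mem_iota.
rewrite -[RHS]cats0; congr cat; apply/eqP; rewrite -[_ == _]negbK -has_filter.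
by apply/hasPn => i; rewrite mem_iota; lia.
Qed.

Section Cmd.
Variables (w : nat) (prog : program) (T X LP Z : nat).
Hypotheses (T0 : 0 < T) (TX : T <= X) (X64 : 64 <= X) (LX : 2 ^ LP <= X).
Hypotheses (Z1 : 1 < Z) (XZ : X ^ Z < 2 ^ w).

Notation runs := (runs w prog).

Let X2 : X + X < 2 ^ w.
Proof.
apply: leq_ltn_trans XZ; apply: leq_trans (_ : X ^ 2 <= _); last first.
  by apply: leq_pexp2l => //; lia.
by rewrite expnS expn1; nia.
Qed.

Let W1 : 1 < 2 ^ w. Proof. by lia. Qed.

Lemma runs_jump M q x l rs : nth Halt prog q = Jzero x l -> 0 < size rs ->
  (forall r, List.In r rs -> r x = 0) ->
  runs (unif M q rs) 1 (size rs) (unif M l rs).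
Proof.
move=> pq rs0 H; rewrite -[X in runs _ _ X](size_map (Proc q)).
apply: runs_step; first by rewrite size_map.
  by elim: (rs) => //= r l' ->; rewrite /proc_step /= pq.
elim: (rs) H => //= r l' IH H; rewrite /proc_step /= pq H; last by left.
by rewrite eqxx /= IH // => r' r'l; apply: H; right.
Qed.

Lemma runs_nojump M q x l rs : nth Halt prog q = Jzero x l -> 0 < size rs ->
  (forall r, List.In r rs -> r x != 0) ->
  runs (unif M q rs) 1 (size rs) (unif M q.+1 rs).
Proof.
move=> pq rs0 H; rewrite -[X in runs _ _ X](size_map (Proc q)).
apply: runs_step; first by rewrite size_map.
  by elim: (rs) => //= r l' ->; rewrite /proc_step /= pq.
elim: (rs) H => //= r l' IH H; rewrite /proc_step /= pq (negbTE (H _ _)); last by left.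
by rewrite /= IH // => r' r'l; apply: H; right.
Qed.

Lemma In_map (f : nat -> nat -> nat) l r :
  List.In r (map f l) -> exists2 i, i \in l & r = f i.
Proof.
elim: l => //= i l IH [<-|/IH[j jl ->]]; first by exists i => //; exact: mem_head.
by exists j => //; rewrite inE jl orbT.
Qed.

(** Processors to be removed jump to [Halt]; the others fall through to a second jump, which is
    always taken because [T.+2] holds 0. Either way two instructions are executed. *)
Lemma runs_kill M q f (l : seq nat) : at_pc prog q (ckill T q) -> 0 < size l ->
  (forall i, i \in l -> f i T.+2 = 0) ->
  exists2 k, k <= 2 * size l &
    runs (unif M q (map f l)) 2 k
         (unif M q.+3 (map f [seq i <- l | f i T.+3 != 0])).
Proof.
move=> /at_cons[q0 /at_cons[q1 /at_cons[q2 _]]] l0 fz.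
have s1 : runs (unif M q (map f l)) 1 (size l)
   (Config M [seq Proc (if f i T.+3 == 0 then q.+2 else q.+1) (f i) | i <- l]).
  rewrite -[X in runs _ _ X](size_map (fun i => Proc q (f i))) /unif -map_comp.
  apply: runs_step; first by rewrite size_map.
    by elim: (l) => //= r l' ->; rewrite /proc_step /= q0.
  by elim: (l) => //= r l' ->; rewrite /proc_step /= q0.
exists (size l + size l); first by rewrite mul2n addnn.
apply: (runs_trans s1).
rewrite -[X in runs _ _ X](size_map (fun i => Proc (if f i T.+3 == 0 then q.+2 else q.+1) (f i))).
apply: runs_step; first by rewrite size_map.
  elim: (l) => //= i l' ->; rewrite /proc_step /=.
  by case: eqP => _; rewrite ?q1 ?q2.
elim: (l) fz => //= i l' IH fz; rewrite /proc_step /= IH; last first.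
  by move=> j jl; apply: fz; rewrite inE jl orbT.
by case: eqP => _ /=; rewrite ?q1 ?q2 //= fz ?mem_head.
Qed.

Lemma fork_list (S : Type) (h0 h1 : nat -> S) N :
  flatten [seq [:: h0 i; h1 i] | i <- iota 0 N] =
  [seq (if odd i then h1 i./2 else h0 i./2) | i <- iota 0 (N + N)].
Proof.
elim: N => // N IH; have -> : N.+1 + N.+1 = (N + N) + 2 by lia.
rewrite -addn1 iotaD (iotaD 0 (N + N)) !map_cat flatten_cat IH /= add0n addnn odd_double /=.
by rewrite add0n doubleK uphalf_double.
Qed.

(** Processor [i] of the doubled list descends from [i./2]. Its index has been doubled beforehand,
    so adding the parity of [i] restores the numbering. *)
Lemma runs_fork M q f N :
  at_pc prog q [:: Fork (q + 3); Const T.+3 0; Jzero T.+3 (q + 5); Const T.+3 1;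
                   Op Add T T T.+3] -> 0 < N ->
  exists g k, [/\ k <= 3 * (N + N),
    runs (unif M q [seq f i | i <- iota 0 N]) 3 k
         (unif M (q + 5) [seq g i | i <- iota 0 (N + N)]),
    (forall i, g i T = (if odd i then (f i./2 T + 1) %% 2 ^ w else f i./2 T)) &
    forall i x, x != T -> x != T.+3 -> g i x = f i./2 x].
Proof.
move=> /at_cons[q0 /at_cons[q1 /at_cons[q2 /at_cons[q3 /at_cons[q4 _]]]]] N0.
have s1 : runs (unif M q [seq f i | i <- iota 0 N]) 1 N
  (Config M (flatten [seq [:: Proc q.+1 (f i); Proc (q + 3) (f i)] | i <- iota 0 N])).
  rewrite -[X in runs _ _ X](size_iota 0).
  rewrite -[X in runs _ _ X](size_map (fun i => Proc q (f i))) /unif -map_comp.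
  apply: runs_step; first by rewrite size_map size_iota.
    by elim: (iota _ _) => //= r l' ->; rewrite /proc_step /= q0.
  by elim: (iota _ _) => //= r l' ->; rewrite /proc_step /= q0.
pose g0 i := upd (f i) T.+3 (0 %% 2 ^ w).
pose g1 i := upd (f i) T.+3 (1 %% 2 ^ w).
pose g2 i := upd (g1 i) T ((f i T + 1) %% 2 ^ w).
have sz (h0 h1 : nat -> proc) : size (flatten [seq [:: h0 i; h1 i] | i <- iota 0 N]) = N + N.
  by rewrite fork_list size_map size_iota.
have s2 : runs (Config M (flatten [seq [:: Proc q.+1 (f i); Proc (q + 3) (f i)] | i <- iota 0 N]))
  1 (N + N)
  (Config M (flatten [seq [:: Proc q.+2 (g0 i); Proc (q + 4) (g1 i)] | i <- iota 0 N])).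
  rewrite -(sz (fun i => Proc q.+1 (f i)) (fun i => Proc (q + 3) (f i))).
  apply: runs_step; first by rewrite sz addn_gt0 N0.
    by elim: (iota _ _) => //= r l' ->; rewrite /proc_step /= q1 !addnS addn0 q3.
  by elim: (iota _ _) => //= r l' ->; rewrite /proc_step /= q1 !addnS addn0 q3.
have s3 : runs (Config M (flatten [seq [:: Proc q.+2 (g0 i); Proc (q + 4) (g1 i)] | i <- iota 0 N]))
  1 (N + N)
  (Config M (flatten [seq [:: Proc (q + 5) (g0 i); Proc (q + 5) (g2 i)] | i <- iota 0 N])).
  rewrite -(sz (fun i => Proc q.+2 (g0 i)) (fun i => Proc (q + 4) (g1 i))).
  apply: runs_step; first by rewrite sz addn_gt0 N0.
    by elim: (iota _ _) => //= r l' ->; rewrite /proc_step /= q2 !addnS addn0 q4.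
  elim: (iota _ _) => //= r l' ->; rewrite /proc_step /= q2 !addnS addn0 q4 /=.
  rewrite /g0 /g2 /g1 updE mod0n /= /set_reg /= updE updN; last by lia.
  by rewrite (modn_small W1).
exists (fun i => if odd i then g2 i./2 else g0 i./2), (N + ((N + N) + (N + N))).
split; first by lia.
- have := runs_trans s1 (runs_trans s2 s3); rewrite fork_list.
  set L := [seq _ | _ <- iota 0 (N + N)] => R.
  have -> : unif M (q + 5) [seq (if odd i then g2 i./2 else g0 i./2) | i <- iota 0 (N + N)]
            = Config M L.
    by rewrite /unif /L -map_comp; congr Config; apply: eq_map => i /=; case: odd.
  exact: R.
- by move=> i; case: odd; rewrite /g2 /g0 ?updE // updN //; lia.
- by move=> i x xT xt; case: odd; rewrite /g2 /g1 /g0 !updN.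
Qed.

Definition agr (s : state) (r : nat -> nat) := forall x, x < T -> r x = rg s x.

(* The doubling loop spawning at least [P] processors. *)
Lemma runs_spawn M q P d f j s :
  at_pc prog q ([:: Op Defs.Sub T.+3 T.+1 T.+2; Jzero T.+3 (q + 11)] ++ [:: Op Add T T T] ++
      [:: Fork (q + 6); Const T.+3 0; Jzero T.+3 (q + 8); Const T.+3 1; Op Add T T T.+3] ++
      [:: Op Add T.+2 T.+2 T.+2; Const T.+3 0] ++ [:: Jzero T.+3 q]) ->
  P <= 2 ^ LP -> d + j = up_log 2 P ->
  (forall i, i < 2 ^ j -> [/\ agr s (f i), f i T = i, f i T.+1 = P & f i T.+2 = 2 ^ j]) ->
  exists g t k, [/\ t <= 11 * d + 2, k <= t * 2 ^ up_log 2 P,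
    runs (unif M q [seq f i | i <- iota 0 (2 ^ j)]) t k
         (unif M (q + 11) [seq g i | i <- iota 0 (2 ^ up_log 2 P)]) &
    forall i, i < 2 ^ up_log 2 P -> [/\ agr s (g i), g i T = i & g i T.+1 = P]].
Proof.
move=> code PL; have [c1 /= c2] := at_cat code.
have [t0 j0] := at_cons c1; have [j1 _] := at_cons j0.
have LPX : up_log 2 P <= LP by apply: up_log_min.
have UX : 2 ^ up_log 2 P <= X by apply: leq_trans LX; rewrite leq_pexp2l.
elim: d j f => [|d IH] j f dj fj.
  rewrite add0n in dj.
  pose g i := linstr w M (f i) (Op Defs.Sub T.+3 T.+1 T.+2).
  have g3 i : i < 2 ^ j -> g i T.+3 = 0.
    move=> /fj[_ _ f1 f2]; rewrite /g /= updE f1 f2.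
    have := up_logP P (isT : 1 < 2); rewrite -dj -subn_eq0 => h.
    by rewrite (eqP h) mod0n.
  exists g, 2, (1 * 2 ^ j + 2 ^ j); split=> //.
  - by rewrite dj; lia.
  - apply: (@runs_trans _ _ _ (unif M (q + 1) [seq g i | i <- iota 0 (2 ^ j)]) _ 1 1).
      have := @runs_local w prog M q [:: Op Defs.Sub T.+3 T.+1 T.+2] [seq f i | i <- iota 0 (2 ^ j)] isT.
      rewrite size_map size_iota -map_comp; apply; last by rewrite expn_gt0.
      by have [] := @at_cat prog q [:: _] _ c1.
    have := @runs_jump M (q + 1) T.+3 (q + 11) [seq g i | i <- iota 0 (2 ^ j)].
    rewrite dj size_map size_iota; apply; first by rewrite addn1.
      by rewrite expn_gt0.
    by move=> r /In_map[i]; rewrite mem_iota -dj => /andP[_ iP] ->; rewrite g3.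
  - move=> i; rewrite -dj => iP; have [fa fT f1 f2] := fj i iP.
    split; rewrite /g /= ?updN //; try lia.
    by move=> x xT; rewrite /= updN ?fa //; lia.
pose N := 2 ^ j.
have NP : N < P.
  rewrite ltnNge; apply/negP => PN.
  have : up_log 2 P <= j by apply: up_log_min.
  by lia.
have N2 : N + N <= 2 ^ up_log 2 P.
  by rewrite addnn -mul2n -expnS leq_pexp2l //; lia.
pose g1 i := linstr w M (f i) (Op Defs.Sub T.+3 T.+1 T.+2).
pose g2 i := linstr w M (g1 i) (Op Add T T T).
have N0 : 0 < N by rewrite expn_gt0.
have r1 : runs (unif M q [seq f i | i <- iota 0 N]) 1 N (unif M (q + 1) [seq g1 i | i <- iota 0 N]).
  have := @runs_local w prog M q [:: Op Defs.Sub T.+3 T.+1 T.+2] [seq f i | i <- iota 0 N] isT.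
  rewrite size_map size_iota -map_comp mul1n; apply; last by [].
  by have [] := @at_cat prog q [:: _] _ c1.
have g13 i : i < N -> g1 i T.+3 != 0.
  move=> /fj[_ _ f1 f2]; rewrite /g1 /= updE f1 f2 modn_small; first by rewrite subn_eq0 -ltnNge.
  by have : P <= X by [exact: leq_trans LX]; lia.
have r2 : runs (unif M (q + 1) [seq g1 i | i <- iota 0 N]) 1 N (unif M (q + 2) [seq g1 i | i <- iota 0 N]).
  have := @runs_nojump M (q + 1) T.+3 (q + 11) [seq g1 i | i <- iota 0 N].
  rewrite size_map size_iota; have -> : (q + 1).+1 = q + 2 by lia.
  apply; rewrite ?addn1 //.
  by move=> r /In_map[i]; rewrite mem_iota => /andP[_ iP] ->; rewrite g13.
have [c3 c4] := @at_cat prog _ [:: _] _ c2.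
have r3 : runs (unif M (q + 2) [seq g1 i | i <- iota 0 N]) 1 N (unif M (q + 3) [seq g2 i | i <- iota 0 N]).
  have := @runs_local w prog M (q + 2) [:: Op Add T T T] [seq g1 i | i <- iota 0 N] isT c3.
  by rewrite size_map size_iota -map_comp mul1n -addnA; apply.
have [c5 c6] := @at_cat prog _ [:: _; _; _; _; _] _ c4.
have [] := @runs_fork M (q + 3) g2 N.
- by rewrite -!addnA; move: c5; rewrite -!addnA.
- by [].
move=> g3 [k3 [k3N]]; rewrite -addnA => r4 g3T g3o.
pose g4 i := linstr w M (linstr w M (g3 i) (Op Add T.+2 T.+2 T.+2)) (Const T.+3 0).
have [c7 c8] := @at_cat prog _ [:: _; _] _ c6.
have r5 : runs (unif M (q + 8) [seq g3 i | i <- iota 0 (N + N)]) 2 (2 * (N + N)) (unif M (q + 10) [seq g4 i | i <- iota 0 (N + N)]).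
  have := @runs_local w prog M (q + 8) [:: Op Add T.+2 T.+2 T.+2; Const T.+3 0] [seq g3 i | i <- iota 0 (N + N)] isT.
  rewrite size_map size_iota -map_comp -addnA; apply; last by rewrite addn_gt0 N0.
  by move: c7; rewrite -!addnA.
have g43 i : g4 i T.+3 = 0 by rewrite /g4 /= updE mod0n.
have r6 : runs (unif M (q + 10) [seq g4 i | i <- iota 0 (N + N)]) 1 (N + N) (unif M q [seq g4 i | i <- iota 0 (N + N)]).
  have := @runs_jump M (q + 10) T.+3 q [seq g4 i | i <- iota 0 (N + N)].
  rewrite size_map size_iota; apply; last by move=> r /In_map[i _ ->].
    by have [] := at_cons c8; rewrite -!addnA.
  by rewrite addn_gt0 N0.
have E2 : 2 ^ j.+1 = N + N by rewrite expnS mul2n -addnn.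
have [||g [t [k [tb kb r7 gP]]]] := IH j.+1 g4; first by lia.
- rewrite E2 => i iN.
  have iN2 : i./2 < N by lia.
  have [fa fT f1 f2] := fj _ iN2.
  have g2T : g2 i./2 T = i./2 + i./2.
    by rewrite /g2 /= updE /g1 /= updN ?fT ?modn_small //; lia.
  split.
  + by move=> x xT; rewrite /g4 /= !updN ?g3o /g2 /g1 /= ?updN ?fa //; lia.
  + rewrite /g4 /= !updN ?g3T ?g2T; try lia.
    by case: ifP => oi; rewrite ?modn_small; lia.
  + by rewrite /g4 /= !updN ?g3o /g2 /g1 /= ?updN ?f1 //; lia.
  + rewrite /g4 /= updN ?updE; last by lia.
    by rewrite !g3o /g2 /g1 /= ?updN ?f2 -/N ?modn_small //; lia.
rewrite E2 in r7.
exists g, (1 + (1 + (1 + (3 + (2 + (1 + t)))))), (N + (N + (N + (k3 + (2 * (N + N) + (N + N + k)))))).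
split=> //; first by lia.
  by rewrite !mulnDl; lia.
exact: runs_trans r1 (runs_trans r2 (runs_trans r3 (runs_trans r4 (runs_trans r5 (runs_trans r6 r7))))).
Qed.

End Cmd.

End Spawning.

(** * Correctness and cost of compiled logarithms and parallel assignments *)

Module Simulation.
Import Language Expressions Spawning.

Lemma tau_gt0 c s : 0 < tau c s.
Proof. by elim: c s => //= c1 IH1 c2 IH2 s; rewrite addn_gt0 IH1. Qed.

Section Bounded.
Variables X LP : nat.
Hypothesis LX : 2 ^ LP <= X.

Lemma bd_setv s x v : bd X s -> v <= X -> bd X (setv s x v).
Proof. by move=> [b1 b2] vX; split=> //= y; rewrite /upd; case: eqP. Qed.

Lemma bd_pwr s a idx v l : bd X s ->
  (forall i, i \in l -> ev s i v <= X) -> forall b, pwr s a idx v l b <= X.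
Proof.
move=> [_ b2]; rewrite /pwr; elim: l => //= i l IH H b; rewrite {1}/upd.
case: eqP => [_|_]; first by apply: H; exact: mem_head.
by apply: IH => j jl; apply: H; rewrite inE jl orbT.
Qed.

Lemma bd_run c s : bd X s -> ok X LP c s -> bd X (run c s).
Proof.
elim: c s => /= [x e|x e|c1 IH1 c2 IH2|x y c IH|a P idx v] s b.
- exact: bd_setv.
- move=> h; apply: bd_setv => //; apply: leq_trans LX.
  by apply: leq_trans (_ : LP <= _); [exact: up_log_min | exact/ltnW/ltn_expl].
- by move=> [/(IH1 _ b)/IH2].
- move=> h; apply: bd_setv; last by have [] := b.
  have [b1 b2] := b; have := leqnn (rg s y).
  elim: {-2}(rg s y) => //= n IHn ny.
  apply: IH; last exact: h.
  by apply: bd_setv; [apply: IHn; lia | apply: leq_trans (b1 y); lia].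
move=> [P0 vX inj]; have [b1 b2] := b; split=> //= c.
by apply: bd_pwr => // i; rewrite mem_iota; exact: vX.
Qed.

Lemma bd_lp x y c s k : bd X s -> ok X LP (For x y c) s -> k <= rg s y ->
  bd X (lp x c s k).
Proof.
move=> b h; elim: k => //= k IH ky; apply: bd_run; last exact: h.
apply: bd_setv; first by apply: IH; lia.
by have [b1 _] := b; apply: leq_trans (b1 y); lia.
Qed.

Lemma lp_rg x c s k y : x != y -> y \notin wrV c -> rg (lp x c s k) y = rg s y.
Proof.
move=> xy yc; elim: k => //= k IH; rewrite run_rg //= updN //.
by rewrite eq_sym.
Qed.

End Bounded.

Section Cmd.
Variables (w : nat) (prog : program) (T X LP Z K : nat).
Hypotheses (T0 : 0 < T) (TX : T <= X) (X64 : 64 <= X) (LX : 2 ^ LP <= X).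
Hypotheses (Z1 : 1 < Z) (XZ : X ^ Z < 2 ^ w).

Notation runs := (runs w prog).

Let X2 : X + X < 2 ^ w.
Proof.
apply: leq_ltn_trans XZ; apply: leq_trans (_ : X ^ 2 <= _); last first.
  by apply: leq_pexp2l => //; lia.
by rewrite expnS expn1; nia.
Qed.

Let W1 : 1 < 2 ^ w. Proof. by lia. Qed.

Let Xs e : e <= Z -> X ^ e < 2 ^ w.
Proof. by move=> eZ; apply: leq_ltn_trans XZ; apply: leq_pexp2l => //; lia. Qed.

Lemma runs1 M p code R : at_pc prog p code -> all is_local code ->
  runs (unif M p [:: R]) (size code) (size code)
    (unif M (p + size code) [:: lrun w M code R]).
Proof. by move=> c l; have := @runs_local w prog M p code [:: R] l c isT; rewrite muln1. Qed.

(* Constant factor between abstract and actual costs. *)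
Definition kap := K + 11 * LP + 30.

Lemma jump1 M q x l R : nth Halt prog q = Jzero x l -> R x = 0 ->
  runs (unif M q [:: R]) 1 1 (unif M l [:: R]).
Proof. by move=> h r0; apply: (@runs_jump w prog M q x l [:: R] h isT) => r [<-|]. Qed.

Lemma nojump1 M q x l R : nth Halt prog q = Jzero x l -> R x != 0 ->
  runs (unif M q [:: R]) 1 1 (unif M q.+1 [:: R]).
Proof. by move=> h r0; apply: (@runs_nojump w prog M q x l [:: R] h isT) => r [<-|]. Qed.

(** [T.+2] is doubled until it reaches [v], and [x] counts the doublings; [d] of them are still to
    come. *)
Lemma runs_lg M q x v d j s R :
  at_pc prog q ([:: Op Defs.Sub T.+3 T.+4 T.+2] ++ [:: Jzero T.+3 (q + 7)] ++
     [:: Op Add T.+2 T.+2 T.+2; Const T.+3 1; Op Add x x T.+3; Const T.+3 0] ++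
     [:: Jzero T.+3 q]) ->
  x < T -> v <= 2 ^ LP -> d + j = up_log 2 v ->
  [/\ R x = j, R T.+4 = v, R T.+2 = 2 ^ j & R T = 0] ->
  (forall y, y < T -> y != x -> R y = rg s y) ->
  exists R' t, [/\ runs (unif M q [:: R]) t t (unif M (q + 7) [:: R']),
    agr T (setv s x (up_log 2 v)) R', R' T = 0 & t <= 7 * d + 2].
Proof.
move=> code xT vL.
have [c1 /at_cat[c2 /at_cat[c3 c4]]] := at_cat code.
have [j2 _] := at_cons c2; have [j4 _] := at_cons c4.
have UL : up_log 2 v <= LP by apply: up_log_min.
have UX : 2 ^ up_log 2 v <= X by apply: leq_trans LX; rewrite leq_pexp2l.
elim: d j R => [|d IH] j R dj [Rx R4 R2 RT] Ro.
  have r1 := runs1 M R c1 isT.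
  set R1 := lrun _ _ _ _ in r1.
  have R13 : R1 T.+3 = 0.
    rewrite /R1 /= updE R4 R2; have := up_logP v (isT : 1 < 2).
    by rewrite -dj add0n -subn_eq0 => /eqP ->; rewrite mod0n.
  exists R1, 2; split=> //.
  - exact: runs_trans r1 (jump1 M j2 R13).
  - move=> y yT; rewrite /R1 /= updN /upd; last by lia.
    by case: eqP => [->|/eqP yx]; [rewrite Rx -dj | exact: Ro].
  - by rewrite /R1 /= updN //; lia.
have NP : 2 ^ j < v.
  rewrite ltnNge; apply/negP => PN.
  have : up_log 2 v <= j by apply: up_log_min.
  by lia.
have N2 : 2 ^ j + 2 ^ j <= 2 ^ up_log 2 v.
  by rewrite addnn -mul2n -expnS leq_pexp2l //; lia.
have jj : j < 2 ^ j by apply: ltn_expl.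
have r1 := runs1 M R c1 isT.
set R1 := lrun _ _ _ _ in r1.
have R13 : R1 T.+3 != 0.
  rewrite /R1 /= updE R4 R2 modn_small; first by rewrite subn_eq0 -ltnNge.
  by have := leq_trans vL LX; lia.
have r2 := nojump1 M j2 R13.
have r3 := runs1 M R1 c3 isT.
set R3 := lrun _ _ _ _ in r3.
have R33 : R3 T.+3 = 0 by rewrite /R3 /= updE mod0n.
have r4 := jump1 M j4 R33.
have [|||R' [t [r5 ag RT' tb]]] := IH j.+1 R3; first by lia.
- have n1 : T.+4 == T.+3 = false by lia.
  have n2 : x == T.+3 = false by lia.
  have n3 : T.+2 == T.+3 = false by lia.
  have n4 : T == T.+3 = false by lia.
  have n5 : T.+4 == T.+2 = false by lia.
  have n6 : x == T.+2 = false by lia.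
  have n7 : T == T.+2 = false by lia.
  have n8 : T.+4 == x = false by lia.
  have n9 : T.+2 == x = false by lia.
  have n10 : T == x = false by lia.
  have n11 : T.+3 == x = false by lia.
  rewrite /R3 /R1 /= /upd ?eqxx ?n1 ?n2 ?n3 ?n4 ?n5 ?n6 ?n7 ?n8 ?n9 ?n10 ?n11.
  rewrite ?eqxx ?n1 ?n2 ?n3 ?n4 ?n5 ?n6 ?n7 ?n8 ?n9 ?n10 ?n11.
  rewrite R2 Rx R4 RT; split=> //.
    by rewrite (modn_small (m := 1)) // addn1 modn_small //; lia.
  by rewrite expnS mul2n -addnn modn_small //; lia.
- by move=> y yT yx; rewrite /R3 /R1 /= !updN ?Ro //; lia.
exists R', (1 + (1 + (4 + (1 + t)))); split=> //; last by lia.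
apply: runs_trans r1 (runs_trans r2 _).
rewrite -addn1; apply: runs_trans r3 _.
exact: runs_trans r4 r5.
Qed.

Lemma refine_lg x e p s R : bd X s -> emax e < T -> x < T -> esz e <= Z ->
  ok X LP (Lg x e) s -> at_pc prog p (ccmd T (Lg x e) p) ->
  size (ccmd T (Lg x e) p) <= K ->
  agr T s R -> R T = 0 ->
  exists R' t, [/\ runs (unif (mm s) p [:: R]) t t
       (unif (mm s) (p + size (ccmd T (Lg x e) p)) [:: R']),
    agr T (run (Lg x e) s) R', R' T = 0 & t <= kap].
Proof.
move=> b eT xT eZ; set M := mm s => /= vL.
set q := p + size (cexp T e T.+4) + 2.
rewrite !size_cat /= => code szK ag RT.
have [ce c1] := at_cat code; have [ci cl] := @at_cat prog _ [:: _; _] _ c1.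
have r1 := runs1 M R ce (cexp_local _ _ _).
have [|Q1 Q2] := cexp_ok (d := T.+4) T0 TX X64 b (leq0n X) eT (Xs eZ) ag RT; first by lia.
set R1 := lrun _ _ _ _ in r1 Q1 Q2.
have r2 := runs1 M R1 ci isT.
set R2 := lrun _ _ _ _ in r2.
have [|||R' [t [r3 ag' RT' tb]]] := @runs_lg M q x (ev s 0 e) (up_log 2 (ev s 0 e)) 0 s R2 cl xT vL.
- by rewrite addn0.
- rewrite /R2 /=; split.
  + by rewrite updN ?updE ?mod0n //; lia.
  + by rewrite !updN //; lia.
  + by rewrite updE modn_small.
  + by rewrite !updN ?Q2 //; lia.
- by move=> y yT yx; rewrite /R2 /= !updN ?Q2 ?ag //; lia.
have UL : up_log 2 (ev s 0 e) <= LP by apply: up_log_min.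
exists R', (size (cexp T e T.+4) + (2 + t)); split=> //; last by rewrite /kap; lia.
have -> : p + (size (cexp T e T.+4) + 9) = q + 7 by rewrite /q; lia.
exact: runs_trans r1 (runs_trans r2 r3).
Qed.

Lemma runs_write M q f l (wr : nat -> nat * nat) d e :
  nth Halt prog q = Write d e -> 0 < size l ->
  {in l, forall i, (f i d, f i e) = wr i} -> uniq (unzip1 (map wr l)) ->
  runs (unif M q (map f l)) 1 (size l)
    (unif (foldr (fun a M => upd M a.1 a.2) M (map wr l)) q.+1 (map f l)).
Proof.
move=> qW l0 H u; rewrite -[X in runs _ _ X](addn0 (size l)).
have -> : size l = size (active (unif M q (map f l))) by rewrite !size_map.
apply: runsS (runs0 _ _ _); first by rewrite !size_map.
rewrite /step /=.
have -> : flatten (unzip2 [seq proc_step w prog M p | p <- [seq Proc q r | r <- map f l]]) = map wr l.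
  elim: (l) H => //= i l' IH H; rewrite /proc_step /= qW /= H ?mem_head //.
  by congr cons; apply: IH => j jl; apply: H; rewrite inE jl orbT.
rewrite u; congr (Some (Config _ _)).
by elim: (l) => //= i l' ->; rewrite /proc_step /= qW.
Qed.

Lemma runs_localf M p code f N : at_pc prog p code -> all is_local code ->
  0 < N ->
  runs (unif M p [seq f i | i <- iota 0 N]) (size code) (size code * N)
       (unif M (p + size code) [seq lrun w M code (f i) | i <- iota 0 N]).
Proof.
move=> c l N0; have := @runs_local w prog M p code [seq f i | i <- iota 0 N] l c.
by rewrite size_map size_iota -map_comp; apply.
Qed.

Lemma runs_killf M q f N P : at_pc prog q (ckill T q) -> 0 < P <= N ->
  (forall i, i < N -> f i T.+2 = 0) ->
  (forall i, i < N -> (f i T.+3 != 0) = (i < P)) ->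
  exists2 k, k <= 2 * N &
    runs (unif M q [seq f i | i <- iota 0 N]) 2 k
         (unif M (q + 3) [seq f i | i <- iota 0 P]).
Proof.
move=> c /andP[P0 PN] fz ft.
have [||k' kb' r'] := @runs_kill w prog T M q f (iota 0 N) c.
- by rewrite size_iota; lia.
- by move=> i; rewrite mem_iota => iN; apply: fz.
exists k'; first by rewrite size_iota in kb'.
have E : [seq i <- iota 0 N | f i T.+3 != 0] = iota 0 P.
  rewrite -(filter_iota0 PN); apply: eq_in_filter => i; rewrite mem_iota => iN.
  exact: ft.
by move: r'; rewrite E !addnS addn0.
Qed.

(** The number of processors is rounded up to a power of two, at most twice what is wanted. The
    surplus is killed before anything is evaluated, and after the write all processors but number 0
    are killed. *)
Lemma refine_par a P idx v p s R : bd X s -> cmax (Par a P idx v) < T ->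
  csz (Par a P idx v) <= Z ->
  ok X LP (Par a P idx v) s -> ev s 0 P <= 2 ^ LP ->
  at_pc prog p (ccmd T (Par a P idx v) p) ->
  size (ccmd T (Par a P idx v) p) <= K ->
  agr T s R -> R T = 0 ->
  exists R' t k, [/\ runs (unif (mm s) p [:: R]) t k
       (unif (mm (run (Par a P idx v) s))
         (p + size (ccmd T (Par a P idx v) p)) [:: R']),
    agr T s R', R' T = 0, t <= kap & k <= 2 * kap * ev s 0 P].
Proof.
move=> b /=; rewrite !gtn_max => /and4P[aT PT iT vT].
rewrite !geq_max => /and3P[PZ iZ vZ] [P0 vX inj] PL.
set N := ev s 0 P in P0 vX inj PL *.
set q := p + size (cexp T P T.+4) + 4; set ec := cexp T idx T.+4 ++ _.
move=> code szK ag RT.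
have [cp _] := at_cat code.
have sp : p + size (cexp T P T.+4 ++ [:: Const T.+1 0; Op Add T.+1 T.+1 T.+4; Const T 0; Const T.+2 1]) = q.
  by rewrite size_cat /= /q addnA.
have {}code : at_pc prog q (([:: Op Defs.Sub T.+3 T.+1 T.+2; Jzero T.+3 (q + 11)] ++ [:: Op Add T T T] ++
      [:: Fork (q + 6); Const T.+3 0; Jzero T.+3 (q + 8); Const T.+3 1; Op Add T T T.+3] ++
      [:: Op Add T.+2 T.+2 T.+2; Const T.+3 0] ++ [:: Jzero T.+3 q]) ++
      [:: Const T.+2 0; Op Defs.Sub T.+3 T.+1 T] ++ ckill T (q + 13) ++ ec ++
      [:: Write T.+4 T.+1.+4] ++ [:: Const T.+2 0; Const T.+3 1; Op Defs.Sub T.+3 T.+3 T] ++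
      ckill T (q + 13 + 3 + size ec + 4)).
  by have [_] := at_cat code; rewrite sp.
have [csp /at_cat[c1 /at_cat[c2 /at_cat[c3 /at_cat[c4 /at_cat[c5 c6]]]]]] := at_cat code.
have {}c1 : at_pc prog (q + 11) [:: Const T.+2 0; Op Defs.Sub T.+3 T.+1 T] := c1.
have {}c2 : at_pc prog (q + 13) (ckill T (q + 13)) by move: c2; rewrite /= -!addnA.
have {}c3 : at_pc prog (q + 16) ec by move: c3; rewrite /= -!addnA.
have {}c4 : at_pc prog (q + 16 + size ec) [:: Write T.+4 T.+1.+4].
  by move: c4; rewrite /= -!addnA.
have {}c5 : at_pc prog (q + 16 + size ec).+1 [:: Const T.+2 0; Const T.+3 1; Op Defs.Sub T.+3 T.+3 T].
  by have -> : (q + 16 + size ec).+1 = q + 16 + size ec + 1 by [lia]; move: c5; rewrite /= -!addnA.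
have {}c6 : at_pc prog (q + 16 + size ec + 4) (ckill T (q + 16 + size ec + 4)).
  by move: c6; rewrite /= -!addnA.
have NX : N <= X by exact: leq_trans LX.
have [ceP cpre] := at_cat cp.
have r1 := runs1 (mm s) R ceP (cexp_local _ _ _).
have [|Q1 Q2] := cexp_ok (d := T.+4) T0 TX X64 b (leq0n X) PT (Xs PZ) ag RT; first by lia.
set R1 := lrun _ _ _ _ in r1 Q1 Q2.
have r2 := runs1 (mm s) R1 cpre isT.
set R2 := lrun _ _ _ _ in r2.
have H2 : [/\ agr T s R2, R2 T = 0, R2 T.+1 = N & R2 T.+2 = 1].
  rewrite /R2 /=; split.
  + by move=> y yT; rewrite !updN ?Q2 ?ag //; lia.
  + by rewrite updN ?updE ?mod0n //; lia.
  + rewrite updN; last by lia.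
    rewrite updN; last by lia.
    rewrite updE updE mod0n add0n updN; last by lia.
    by rewrite Q1 modn_small //; lia.
  + by rewrite updE modn_small.
set NN := 2 ^ up_log 2 N.
have [|g [t [k [tb kb r3 gP]]]] := @runs_spawn w prog T X LP Z T0 TX X64 LX Z1 XZ (mm s) q N (up_log 2 N) (fun=> R2) 0 s csp PL (addn0 _).
  by move=> i; rewrite expn0 ltnS leqn0 => /eqP ->; case: H2.
rewrite -/NN in kb r3 gP.
have LPX : up_log 2 N <= LP by apply: up_log_min.
have NNX : NN <= X by apply: leq_trans LX; rewrite leq_pexp2l.
have NNN : NN <= 2 * N.
  rewrite /NN; case: (ltngtP N 1) => [||->]; rewrite ?up_log1 //; first by lia.
  move=> N1; have := up_log_gtn (isT : 1 < 2) N1.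
  have : 0 < up_log 2 N by rewrite up_log_gt0.
  by case: (up_log 2 N) => //= u _; rewrite expnS; lia.
have NNn : N <= NN by exact: up_logP.
have NN0 : 0 < NN by lia.
have r4 := runs_localf (mm s) g c1 isT NN0.
have [|||k5 k5b r5] := @runs_killf (mm s) (q + 13) (fun i => lrun w (mm s) [:: Const T.+2 0; Op Defs.Sub T.+3 T.+1 T] (g i)) NN N c2.
- by rewrite P0.
- by move=> i _; rewrite /= updN ?updE ?mod0n //; lia.
- move=> i iN; have [_ gT g1] := gP i iN.
  rewrite /= updE !updN ?gT ?g1 ?modn_small; try lia.
set g4 := fun i => lrun w (mm s) [:: Const T.+2 0; Op Defs.Sub T.+3 T.+1 T] (g i) in r5.
have g4P i : i < NN -> agr T s (g4 i) /\ g4 i T = i.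
  move=> iN; have [ga gT g1] := gP i iN; rewrite /g4 /=; split.
    by move=> y yT; rewrite !updN ?ga //; lia.
  by rewrite !updN ?gT //; lia.
rewrite -addnA /= in r5.
have r6 := runs_localf (mm s) g4 c3 _ P0.
set g6 := fun i => lrun w (mm s) ec (g4 i) in r6.
have g6P i : i < N -> [/\ agr T s (g6 i), g6 i T = i,
    g6 i T.+4 = ad (rg s 0) a (ev s i idx) & g6 i T.+1.+4 = ev s i v].
  move=> iN; have [ga gT] := g4P i (leq_trans iN NNn).
  have iX : i <= X by lia.
  have iZ' : esz idx <= Z by lia.
  rewrite /g6 /ec !lrun_cat.
  have [|U1 U2] := cexp_ok (d := T.+4) T0 TX X64 b iX iT (Xs iZ') ga gT; first by lia.
  set h1 := lrun _ _ _ (g4 i) in U1 U2 *.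
  have h10 : h1 0 = rg s 0 by rewrite U2 ?ga //; lia.
  have Td : T < T.+4 by lia.
  have [U3 U4] := aops_ok T0 TX X64 b iX iT aT Td (Xs iZ) U1 h10.
  set h2 := lrun _ _ _ h1 in U3 U4 *.
  have ag2 : agr T s h2 by move=> y yT; rewrite U4 ?U2 ?ga //; lia.
  have h2T : h2 T = i by rewrite U4 ?U2 ?gT //; lia.
  have [|U5 U6] := cexp_ok (d := T.+1.+4) T0 TX X64 b iX vT (Xs vZ) ag2 h2T; first by lia.
  split.
  - by move=> y yT; rewrite U6 ?ag2 //; lia.
  - by rewrite U6 ?h2T //; lia.
  - by rewrite U6 ?U3 //; lia.
  - by [].
have r7 := @runs_write (mm s) (q + 16 + size ec) g6 (iota 0 N)
  (fun i => (ad (rg s 0) a (ev s i idx), ev s i v)) T.+4 T.+1.+4.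
rewrite size_iota in r7.
have {}r7 := fun h => r7 (at_cons c4).1 P0 h (pwr_uniq a v inj).
rewrite -/(pwr s a idx v (iota 0 N)) in r7.
set M' := pwr _ _ _ _ _ in r7 *.
have r8 := runs_localf M' g6 c5 isT P0.
have [|||k9 k9b r9] := @runs_killf M' (q + 16 + size ec + 4) (fun i => lrun w M' [:: Const T.+2 0; Const T.+3 1; Op Defs.Sub T.+3 T.+3 T] (g6 i)) N 1 c6.
- by rewrite P0.
- move=> i _; rewrite /= updN; last by lia.
  by rewrite updN ?updE ?mod0n //; lia.
- move=> i iN; have [_ gT _ _] := g6P i iN.
  rewrite /= updE updE updN; last by lia.
  rewrite updN ?gT; last by lia.
  by rewrite (modn_small W1) modn_small; lia.
have szE : p + size ((cexp T P T.+4 ++ [:: Const T.+1 0; Op Add T.+1 T.+1 T.+4; Const T 0; Const T.+2 1]) ++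
     [:: Op Defs.Sub T.+3 T.+1 T.+2, Jzero T.+3 (q + 11), Op Add T T T, Fork (q + 6),
        Const T.+3 0, Jzero T.+3 (q + 8), Const T.+3 1, Op Add T T T.+3,
        Op Add T.+2 T.+2 T.+2, Const T.+3 0, Jzero T.+3 q, Const T.+2 0,
        Op Defs.Sub T.+3 T.+1 T, Jzero T.+3 (q + 13).+2, Jzero T.+2 (q + 13).+3, Halt
       & ec ++ [:: Write T.+4 T.+1.+4, Const T.+2 0, Const T.+3 1, Op Defs.Sub T.+3 T.+3 T
           & ckill T (q + 13 + 3 + size ec + 4)]]) = q + 16 + size ec + 4 + 3.
  by rewrite size_cat /= !size_cat /= /q; lia.
exists (lrun w M' [:: Const T.+2 0; Const T.+3 1; Op Defs.Sub T.+3 T.+3 T] (g6 0)).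
exists (size (cexp T P T.+4) + (4 + (t + (2 + (2 + (size ec + (1 + (3 + 2)))))))).
exists (size (cexp T P T.+4) + (4 + (k + (2 * NN + (k5 + (size ec * N + (N + (3 * N + k9)))))))).
split.
- rewrite szE; apply: runs_trans r1 _.
  apply: runs_trans r2 (runs_trans r3 _); rewrite -addnA in r4.
  apply: runs_trans r4 (runs_trans r5 (runs_trans (r6 _) (runs_trans (r7 _) (runs_trans _ r9)))).
  + by rewrite !all_cat !cexp_local; case: (a).
  + move=> i; rewrite mem_iota => iN; have [_ _ E1 E2] := g6P i iN; by rewrite E1 E2.
  + by move: r8 => /=; have -> : (q + 16 + size ec).+1 + 3 = q + 16 + size ec + 4 by [lia].
- have [ga _ _ _] := g6P 0 P0 => y yT.
  by rewrite -(ga y yT) [lrun _ _ _ _]/= !updN //; lia.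
- by have [_ gT _ _] := g6P 0 P0; rewrite /= !updN ?gT //; lia.
- by move: szK; rewrite -(leq_add2l p) szE /kap /q; lia.
- have szK' : q + 16 + size ec + 4 + 3 <= p + K by rewrite -szE leq_add2l.
  (* Each spawning step is charged with the final number of processors, hence the logarithmic factor
     in [kap]. *)
  have kt : k <= (11 * LP + 2) * (2 * N).
    by apply: leq_trans kb _; apply: leq_mul => //; lia.
  have : kap = K + 11 * LP + 30 by [].
  move=> ->; rewrite /q in szK'; nia.
Qed.

End Cmd.

End Simulation.

(** * Correctness and cost of the compiler *)

Module Compiler.
Import Language Expressions Spawning Simulation.

Lemma omg_gt0 X LP c s : ok X LP c s -> 0 < omg c s.
Proof.
elim: c s => //= [c1 IH1 c2 IH2|a P idx v] s; last by case.
by case=> /IH1 h _; rewrite addn_gt0 h.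
Qed.

Section Cmd.
Variables (w : nat) (prog : program) (T X LP Z K : nat).
Hypotheses (T0 : 0 < T) (TX : T <= X) (X64 : 64 <= X) (LX : 2 ^ LP <= X).
Hypotheses (Z1 : 1 < Z) (XZ : X ^ Z < 2 ^ w).

Notation runs := (runs w prog).
Notation kap := (kap LP K).

Let X2 : X + X < 2 ^ w.
Proof.
apply: leq_ltn_trans XZ; apply: leq_trans (_ : X ^ 2 <= _); last first.
  by apply: leq_pexp2l => //; lia.
by rewrite expnS expn1; nia.
Qed.

Let W1 : 1 < 2 ^ w. Proof. by lia. Qed.

Let Xs e : e <= Z -> X ^ e < 2 ^ w.
Proof. by move=> eZ; apply: leq_ltn_trans XZ; apply: leq_pexp2l => //; lia. Qed.

(** Every command starts and ends with a single processor whose register [T] is 0; this common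
    interface lets sequences and loops compose. The bound on [omg] limits the processors of each
    parallel step, hence the number of doublings. *)
Lemma refine c p s R : wf c -> cmax c < T -> csz c <= Z -> bd X s ->
  ok X LP c s -> omg c s <= 2 ^ LP -> at_pc prog p (ccmd T c p) ->
  size (ccmd T c p) <= K -> agr T s R -> R T = 0 ->
  exists R' t k, [/\ runs (unif (mm s) p [:: R]) t k
       (unif (mm (run c s)) (p + size (ccmd T c p)) [:: R']),
    agr T (run c s) R' /\ R' T = 0, t <= kap * tau c s & k <= 2 * kap * omg c s].
Proof.
elim: c p s R => [x e|x e|c1 IH1 c2 IH2|x y c IH|a P idx v] p s R wfc cT cZ b okc oL code szK ag RT.
- move: cT; rewrite /= gtn_max => /andP[xT eT].
  move: code szK => /= code; rewrite size_cat /= => szK.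
  have [ce c1] := at_cat code.
  have r1 := runs1 w (mm s) R ce (cexp_local _ _ _).
  have [|Q1 Q2] := cexp_ok (d := T.+4) T0 TX X64 b (leq0n X) eT (Xs cZ) ag RT; first by lia.
  set R1 := lrun _ _ _ _ in r1 Q1 Q2.
  have r2 := runs1 w (mm s) R1 c1 isT.
  set R2 := lrun _ _ _ _ in r2.
  exists R2, (size (cexp T e T.+4) + 2), (size (cexp T e T.+4) + 2); split.
  + by rewrite addnA; exact: runs_trans r1 r2.
  + split; last by rewrite /R2 /= !updN ?Q2 //; lia.
    move=> y yT; rewrite /R2 /=; case: (eqVneq y x) => [->|yx].
      rewrite updE updE mod0n add0n updN ?Q1; last by lia.
      by rewrite updE modn_small //; move: okc => /=; lia.
    by rewrite !updN ?Q2 ?ag //; lia.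
  + by rewrite /Simulation.kap; lia.
  + by rewrite /Simulation.kap; lia.
- move: cT; rewrite /= gtn_max => /andP[xT eT].
  have [R' [t [r ag' RT' tb]]] := refine_lg T0 TX X64 LX Z1 XZ b eT xT cZ okc code szK ag RT.
  exists R', t, t; split=> //; first by rewrite muln1.
  by rewrite /= muln1; lia.
- move: cT cZ wfc okc oL code szK => /=; rewrite gtn_max geq_max.
  move=> /andP[cT1 cT2] /andP[cZ1 cZ2] /andP[w1 w2] [ok1 ok2] oL /at_cat[cd1 cd2].
  rewrite size_cat => szK.
  have [||R1 [t1 [k1 [r1 [ag1 RT1] tb1 kb1]]]] := IH1 p s R w1 cT1 cZ1 b ok1 _ cd1 _ ag RT; try lia.
  have b1 := bd_run LX b ok1.
  have [||R2 [t2 [k2 [r2 [ag2 RT2] tb2 kb2]]]] := IH2 _ _ R1 w2 cT2 cZ2 b1 ok2 _ cd2 _ ag1 RT1; try lia.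
  exists R2, (t1 + t2), (k1 + k2); split=> //.
  + by rewrite addnA; exact: runs_trans r1 r2.
  + by rewrite mulnDr leq_add.
  + by rewrite mulnDr leq_add.
- move: wfc cT cZ okc; rewrite [wf _]/= [cmax _]/= [csz _]/= [ok _ _ _ _]/=.
  move=> /and4P[xc yc xy wfc].
  rewrite !gtn_max => /andP[/andP[xT yT] cT] cZ okc.
  have szb : size (ccmd T c (p + 3)) + 7 <= K.
    by move: szK; rewrite /= !size_cat /=; lia.
  have szE : size (ccmd T (For x y c) p) = size (ccmd T c (p + 3)) + 7.
    by rewrite /= !size_cat /=; lia.
  set b' := size _ in szb szE.
  move: code; rewrite [ccmd _ _ _]/= -/b' => /(@at_cat prog p [:: _])[cd1 cd2].
  have {}cd2 : at_pc prog (p + 1) ([:: Op Defs.Sub T.+3 y x] ++ [:: Jzero T.+3 (p + 7 + b')] ++ ccmd T c (p + 3) ++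
     [:: Const T.+3 1; Op Add x x T.+3; Const T.+3 0] ++ [:: Jzero T.+3 (p + 1)]) by exact: cd2.
  have [cd3 /at_cat[cd4 /at_cat[cd5 /at_cat[cd6 cd7]]]] := at_cat cd2.
  have {}cd4 : at_pc prog (p + 2) [:: Jzero T.+3 (p + 7 + b')] by move: cd4; rewrite /= -!addnA.
  have {}cd5 : at_pc prog (p + 3) (ccmd T c (p + 3)) by move: cd5; rewrite /= -!addnA.
  have {}cd6 : at_pc prog (p + 3 + b') [:: Const T.+3 1; Op Add x x T.+3; Const T.+3 0].
    by move: cd6; rewrite /= -/b' -!addnA.
  have {}cd7 : at_pc prog (p + 3 + b' + 3) [:: Jzero T.+3 (p + 1)].
    by move: cd7; rewrite /= -/b' -!addnA.
  have [j4 _] := at_cons cd4; have [j7 _] := at_cons cd7.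
  pose n := rg s y.
  have nX : n <= X by case: b => b1 _; exact: b1.
  pose Tl k := \sum_(i < k) (tau c (setv (lp x c s i) x i)).+1.
  pose Wl k := \sum_(i < k) (omg c (setv (lp x c s i) x i)).+1.
  have Wle k : k <= n -> Wl k <= Wl n.
    by move=> kn; rewrite /Wl -(subnKC kn) big_split_ord /= leq_addr.
  have loop : forall k, k <= n -> exists R' t w, [/\
     runs (unif (mm s) p [:: R]) t w (unif (mm (lp x c s k)) (p + 1) [:: R']),
     agr T (setv (lp x c s k) x k) R' /\ R' T = 0, t <= 1 + kap * Tl k & w <= 1 + 2 * kap * Wl k].
    elim=> [_|k IHk kn].
      exists (lrun w (mm s) [:: Const x 0] R), 1, 1; split.
      - exact: runs1 cd1 isT.
      - split; last by rewrite /= updN //; lia.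
        by move=> z zT; rewrite /= mod0n /upd; case: eqP => // _; exact: ag.
      - by rewrite /Tl big_ord0; lia.
      - by rewrite /Wl big_ord0; lia.
    have [|R1 [t1 [k1 [r1 [ag1 RT1] tb1 kb1]]]] := IHk; first by lia.
    set M1 := mm (lp x c s k) in r1.
    have R1y : R1 y = n.
      rewrite ag1 // /= updN; last by rewrite eq_sym.
      by rewrite lp_rg.
    have R1x : R1 x = k by rewrite ag1 //= updE.
    have r2 := runs1 w M1 R1 cd3 isT.
    set R2 := lrun _ _ _ _ in r2.
    have R23 : R2 T.+3 != 0.
      by rewrite /R2 /= updE R1y R1x modn_small; lia.
    have r3 := nojump1 w M1 j4 R23.
    have okk := okc k kn.
    have bk : bd X (setv (lp x c s k) x k).
      by apply: bd_setv; [apply: (bd_lp LX b okc); lia | lia].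
    have E1 : p + (1 + 2) = p + 3 by [].
    have ag2 : agr T (setv (lp x c s k) x k) R2.
      by move=> z zT; rewrite /R2 /= updN ?ag1 //; lia.
    have RT2 : R2 T = 0 by rewrite /R2 /= updN ?RT1 //; lia.
    have ok1 : omg c (setv (lp x c s k) x k) <= 2 ^ LP.
      apply: leq_trans oL; rewrite /= -/n -/(Wl n).
      have := Wle k.+1 kn; rewrite {1}/Wl big_ord_recr /=; lia.
    have [||R3 [t3 [k3 [r4 [ag3 RT3] tb3 kb3]]]] := IH (p + 3) _ R2 wfc cT cZ bk okk ok1 _ _ ag2 RT2.
    - by move: cd5.
    - by rewrite -/b'; lia.
    have r5 := runs1 w (mm (lp x c s k.+1)) R3 cd6 isT.
    set R4 := lrun _ _ _ _ in r5.
    have R43 : R4 T.+3 = 0 by rewrite /R4 /= updE mod0n.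
    have r6 := jump1 w (mm (lp x c s k.+1)) j7 R43.
    exists R4, (t1 + (1 + (1 + (t3 + (3 + 1))))), (k1 + (1 + (1 + (k3 + (3 + 1))))); split.
    + apply: runs_trans r1 (runs_trans r2 _).
      have Ea : (p + 2).+1 = p + 3 by lia.
      rewrite Ea in r3; rewrite /= -addnA.
      exact: runs_trans r3 (runs_trans r4 (runs_trans r5 r6)).
    + split; last by rewrite /R4 /= !updN ?RT3 //; lia.
      have R3x : R3 x = k by rewrite ag3 // run_rg //= updE.
      move=> z zT; rewrite /R4 /= [RHS]/upd; case: (eqVneq z x) => [->|zx].
        have n1 : (x == T.+3) = false by lia.
        by rewrite /upd !eqxx n1 R3x (modn_small W1) modn_small; lia.
      by rewrite !updN ?ag3 //; lia.
    + by rewrite /Tl big_ord_recr /= -/(Tl k) mulnDr mulnS; rewrite /Simulation.kap in tb1 tb3 *; lia.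
    + by rewrite /Wl big_ord_recr /= -/(Wl k) mulnDr mulnS; rewrite /Simulation.kap in kb1 kb3 *; lia.
  have [|R1 [t1 [k1 [r1 [ag1 RT1] tb1 kb1]]]] := loop n; first by [].
  set M1 := mm (lp x c s n) in r1.
  have R1y : R1 y = n.
    rewrite ag1 // /= updN; last by rewrite eq_sym.
    by rewrite lp_rg.
  have R1x : R1 x = n by rewrite ag1 //= updE.
  have r2 := runs1 w M1 R1 cd3 isT.
  set R2 := lrun _ _ _ _ in r2.
  have R23 : R2 T.+3 = 0 by rewrite /R2 /= updE R1y R1x subnn mod0n.
  exists R2, (t1 + (1 + 1)), (k1 + (1 + 1)); split.
  + have Ea : p + (b' + 7) = p + 7 + b' by lia.
    rewrite szE Ea; apply: runs_trans r1 (runs_trans r2 _).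
    rewrite [size _]/= -(addnA p 1 1).
    have r3 := jump1 w M1 j4 R23; exact: r3.
  + split; last by rewrite /R2 /= updN ?RT1 //; lia.
    by move=> z zT; rewrite /R2 /= updN ?ag1 //; lia.
  + by rewrite /= -/n -/(Tl n) mulnS; rewrite /Simulation.kap in tb1 *; lia.
  + by rewrite /= -/n -/(Wl n) mulnS; rewrite /Simulation.kap in kb1 *; lia.
have [R' [t [k [r ag' RT' tb kb]]]] := refine_par T0 TX X64 LX Z1 XZ b cT cZ okc oL code szK ag RT.
by exists R', t, k; split=> //; rewrite muln1.
Qed.

End Cmd.

Definition prog_of (c : cmd) : program := ccmd (cmax c).+1 c 0.

Lemma exec_cmd (c : cmd) (M : memory) (X LP w : nat) (s := St (fun=> 0) M) :
  wf c -> (cmax c).+1 <= X -> 64 <= X -> 2 ^ LP <= X ->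
  X ^ (csz c).+2 < 2 ^ w -> (forall a, M a <= X) ->
  ok X LP c s -> omg c s <= 2 ^ LP ->
  exists t k, [/\ exec w (prog_of c) (Config M [:: Proc 0 (fun=> 0)]) t k (mm (run c s)),
    t <= (size (prog_of c) + 11 * LP + 31) * tau c s &
    k <= 2 * (size (prog_of c) + 11 * LP + 31) * omg c s].
Proof.
move=> wfc TX X64 LX XZ MX okc oL.
have bs : bd X s by split.
have [|||R' [t [k [r _ tb kb]]]] := @refine w (prog_of c) (cmax c).+1 X LP (csz c).+2
  (size (prog_of c)) isT TX X64 LX isT XZ c 0 s (fun=> 0) wfc (leqnn _) _ bs okc oL _ (leqnn _) _ erefl; try by [].
  by lia.
(* Past its end the program reads as [Halt], by the default value of [nth], so the last processor
   stops in one more step. *)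
have e1 : exec w (prog_of c) (unif (mm (run c s)) (0 + size (prog_of c)) [:: R']) 1 1 (mm (run c s)).
  rewrite -[1 in X in exec _ _ _ _ X]/(size (active (unif (mm (run c s)) (0 + size (prog_of c)) [:: R'])) + 0).
  apply: exec_step (exec_done _ _ _) => //.
  rewrite step_nowrite; last by rewrite /= /proc_step /= nth_default.
  by rewrite /= /proc_step /= nth_default.
exists (t + 1), (k + 1); split; first exact: runs_exec r e1.
- have := tau_gt0 c s; rewrite /kap in tb; nia.
- have := omg_gt0 okc; rewrite /kap in kb; nia.
Qed.

End Compiler.

(** * Shortest paths with perturbed weights, and sets that meet long ones *)

Module Profits.

(** Positivity of [c] excludes the value 0 of an empty maximum. *)
Lemma bigmax_geP (n : nat) (p : pred nat) (F : nat -> nat) (c : nat) : 0 < c ->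
  (c <= \max_(i < n | p i) F i) <-> exists i, [/\ i < n, p i & c <= F i].
Proof.
move=> c0; split=> [|[i [iN pi cF]]].
  rewrite leqNgt => H; have : exists i : 'I_n, p i && (c <= F i).
    apply/existsP; apply: contraNT H; rewrite negb_exists => /forallP H.
    case: c c0 H => // c _ H; rewrite ltnS; apply/bigmax_leqP => i pi.
    by have := H i; rewrite pi /= -ltnNge.
  by case=> i /andP[pi cF]; exists i; split.
exact: leq_trans cF (leq_bigmax_cond (Ordinal iN) pi).
Qed.

(** One maximum yields both the value and a place where it is attained: they are quotient and
    remainder of the largest key. If the quotient is 0 the remainder means nothing, as the maximum
    may be empty. *)
Lemma key_max n (p : pred nat) (F : nat -> nat) :
  let Y := \max_(e < n | p e) (F e * n + e) in
  Y %/ n = \max_(e < n | p e) F e /\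
  (0 < Y %/ n -> [/\ Y %% n < n, p (Y %% n) & F (Y %% n) = Y %/ n]).
Proof.
move=> Y; have att : 0 < Y %/ n -> [/\ Y %% n < n, p (Y %% n) & F (Y %% n) = Y %/ n].
  move=> Yn0; have n0 : 0 < n by case: (n) Yn0; rewrite ?divn0.
  have Y0 : 0 < Y by apply: leq_trans Yn0 (leq_div _ _).
  have [/(_ (leqnn _))[i [iN pi YF]] _] := bigmax_geP n p (fun e => F e * n + e) Y0.
  have : F i * n + i <= Y by exact: (leq_bigmax_cond (Ordinal iN) pi).
  rewrite -/Y in YF => FY; have -> : Y = F i * n + i by lia.
  by rewrite divnMDl // modnMDl modn_small // divn_small // addn0.
split=> //; apply/eqP; rewrite eqn_leq; apply/andP; split; last first.
  apply/bigmax_leqP => e pe; rewrite leq_divRL; last by case: (n) e {pe} => // -[].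
  by apply: leq_trans (leq_bigmax_cond e pe); rewrite leq_addr.
case: (posnP (Y %/ n)) => [->//|/att[lt pe <-]].
exact: (leq_bigmax_cond (Ordinal lt) pe).
Qed.

(* Arcs are numbered; arc 0 is a sentinel too heavy to be used, and the weight
   [w] of any other arc is replaced by [w * SC + 1], so that the weight of a short
   path modulo [SC] is its number of arcs.  Distances are represented by profits
   [INF - distance], where 0 stands for an unreachable vertex. *)
Record arcs_ok (nv mA : nat) (tl hd wt : nat -> nat) (INF SC : nat)
    (w0 : nat -> nat) : Prop := ArcsOk {
  aok_nv : 0 < nv;
  aok_tl : forall e, e < mA -> tl e < nv;
  aok_hd : forall e, e < mA -> hd e < nv;
  aok_0 : INF <= wt 0;
  aok_INF : 0 < INF;
  aok_wt : forall e, 0 < e < mA -> wt e = w0 e * SC + 1;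
  aok_SC : nv < SC
}.

Section Graph.
Variables (nv mA : nat) (tl hd wt : nat -> nat) (INF SC : nat) (w0 : nat -> nat).
Hypothesis aok : arcs_ok nv mA tl hd wt INF SC w0.
Let nv0 : 0 < nv. Proof. exact: aok_nv aok. Qed.
Let Htl : forall e, e < mA -> tl e < nv. Proof. exact: aok_tl aok. Qed.
Let Hhd : forall e, e < mA -> hd e < nv. Proof. exact: aok_hd aok. Qed.
Let H0 : INF <= wt 0. Proof. exact: aok_0 aok. Qed.
Let INF0 : 0 < INF. Proof. exact: aok_INF aok. Qed.
Let Hwt : forall e, 0 < e < mA -> wt e = w0 e * SC + 1. Proof. exact: aok_wt aok. Qed.
Let HSC : nv < SC. Proof. exact: aok_SC aok. Qed.

Fixpoint chain (u : nat) (es : seq nat) (v : nat) : bool :=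
  if es is e :: es' then [&& e < mA, tl e == u & chain (hd e) es' v] else u == v.

Definition cend (u : nat) (es : seq nat) : nat := last u (map hd es).
Definition wsum (es : seq nat) : nat := \sum_(e <- es) wt e.

Lemma chain_cat u a b v :
  chain u (a ++ b) v = chain u a (cend u a) && chain (cend u a) b v.
Proof.
elim: a u => [|e a IH] u /=; first by rewrite eqxx.
by rewrite IH /cend /= !andbA.
Qed.

Lemma chain_end u es v : chain u es v -> cend u es = v.
Proof. by elim: es u => [|e es IH] u /=; [move/eqP|case/and3P=> _ _ /IH]. Qed.

Lemma chain_lt u es v : chain u es v -> 0 < size es -> (u < nv) && (v < nv).
Proof.
elim: es u => // e es IH u /= /and3P[em /eqP <- c] _; rewrite Htl //=.
case: es c IH => [|e' es] c IH; first by move: c => /= /eqP <-; exact: Hhd.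
by have /andP[] := IH _ c isT.
Qed.

Lemma wsum_cat a b : wsum (a ++ b) = wsum a + wsum b.
Proof. exact: big_cat. Qed.

Lemma wt_gt0 e : e < mA -> 0 < wt e.
Proof. by case: e => [|e] em; [exact: leq_trans H0|rewrite Hwt; lia]. Qed.

Lemma wsum_size u es v : chain u es v -> size es <= wsum es.
Proof.
elim: es u => // e es IH u /= /and3P[em _ /IH].
by rewrite /wsum big_cons; have := wt_gt0 em; rewrite -/(wsum es); lia.
Qed.

(** Bellman-Ford for profits. Truncated subtraction turns a path heavier than its credit into profit
    0, the code of an unreachable vertex, which is also the value of an empty maximum. *)
Fixpoint bf (D : nat -> nat) (k v : nat) : nat :=
  if k is k'.+1 then
    maxn (bf D k' v) (\max_(e < mA | hd e == v) (bf D k' (tl e) - wt e))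
  else D v.

(** The initial values [D] are arbitrary credits: a single source and a row of partially known
    profits are both instances. *)
Lemma bfP D k v c : 0 < c ->
  (c <= bf D k v) <->
  exists x es, [/\ chain x es v, size es <= k & c + wsum es <= D x].
Proof.
move=> c0; elim: k v c c0 => [|k IH] v c c0 /=.
  split=> [cD|[x [[|e es] [] //= /eqP <- _]]]; last by rewrite /wsum big_nil addn0.
  by exists v, [::]; rewrite /= eqxx /wsum big_nil addn0.
split=> [|[x [es [ch sz cD]]]].
  rewrite leq_max => /orP[/IH[]//|]; first by move=> x [es [? ? ?]]; exists x, es; split=> //; lia.
  move/(bigmax_geP mA (fun e => hd e == v) (fun e => bf D k (tl e) - wt e) c0).
  case=> e [em /eqP he ce].
  have c1 : 0 < c + wt e by lia.
  have [|x [es [ch sz cD]]] := (IH (tl e) _ c1).1; first lia.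
  exists x, (rcons es e); rewrite -cats1 chain_cat (chain_end ch) ch /= em he !eqxx.
  by rewrite size_cat addn1 ltnS sz wsum_cat /wsum big_seq1 -/(wsum es); split=> //; lia.
case/lastP: es ch sz cD => [|es e] ch sz cD.
  rewrite leq_max; apply/orP; left; apply/IH => //.
  by exists x, [::]; split.
move: ch sz cD; rewrite -cats1 chain_cat size_cat wsum_cat /= addn1 ltnS.
rewrite -[wsum [:: e]]/(\sum_(x0 <- [:: e]) wt x0) big_seq1 => /andP[ch /and3P[em /eqP te /eqP he]] sz cD.
rewrite leq_max; apply/orP; right.
apply/(bigmax_geP mA (fun e => hd e == v) (fun e => bf D k (tl e) - wt e) c0).
exists e; rewrite em he eqxx; split=> //.
suff : c + wt e <= bf D k (tl e) by lia.
apply/IH; first lia.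
by exists x, es; rewrite te; split=> //; lia.
Qed.

(** Among [nv + 1] visited positions two carry the same vertex; cutting out the closed part between
    them lowers the weight, all arc weights being positive. Hence [nv] rounds in [Pr] reach every
    vertex optimally. *)
Lemma shorten u es v : chain u es v ->
  exists es', [/\ chain u es' v, size es' < nv, wsum es' <= wsum es &
    nv <= size es -> wsum es' < wsum es].
Proof.
elim: {es}(size es) {-2}es (leqnn (size es)) => [|n IH] es.
  by rewrite leqn0 size_eq0 => /eqP -> ch; exists [::]; split=> //=; lia.
move=> szn ch; case: (ltnP (size es) nv) => sz; first by exists es; split=> //; lia.
have lt i : i <= size es -> cend u (take i es) < nv.
  move=> isz; have /andP[c1 c2] : chain u (take i es) (cend u (take i es)) && chain (cend u (take i es)) (drop i es) v.
    by rewrite -chain_cat cat_take_drop.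
  case: i isz c1 c2 => [|i] isz c1 c2; first by have /andP[] := chain_lt ch (leq_trans nv0 sz); rewrite take0.
  have : 0 < size (take i.+1 es) by rewrite size_takel.
  by case/(chain_lt c1)/andP.
have : ~~ uniq [seq cend u (take i es) | i <- iota 0 (size es).+1].
  apply/negP => /uniq_leq_size un.
  have : size [seq cend u (take i es) | i <- iota 0 (size es).+1] <= size (iota 0 nv).
    apply: un => x /mapP[i]; rewrite mem_iota => /andP[_ isz] ->.
    by rewrite mem_iota /= add0n lt //; lia.
  by rewrite size_map !size_iota; lia.
case/(uniqPn 0) => i [j [ij]]; rewrite size_map size_iota => js.
rewrite !(nth_map 0) ?size_iota; try lia.
rewrite !nth_iota ?add0n; try lia.
move=> E; pose es1 := take i es ++ drop j es.
have C1 : chain u es1 v.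
  move: ch; rewrite -{1}(cat_take_drop j es) chain_cat => /andP[cj dj].
  rewrite /es1 chain_cat E dj andbT -E.
  by move: cj; rewrite -{1}(cat_take_drop i (take j es)) take_takel ?chain_cat; [case/andP|lia].
have S1 : size es1 = size es - (j - i).
  by rewrite size_cat size_takel ?size_drop; lia.
have W1 : wsum es1 < wsum es.
  have -> : es = take i es ++ take (j - i) (drop i es) ++ drop j es.
    rewrite -{1}(cat_take_drop i es); congr cat.
    by rewrite -{1}(cat_take_drop (j - i) (drop i es)) drop_drop subnK //; lia.
  rewrite /es1 !wsum_cat; suff : 0 < wsum (take (j - i) (drop i es)) by lia.
  have : chain (cend u (take i es)) (drop i es) v.
    by move: ch; rewrite -{1}(cat_take_drop i es) chain_cat => /andP[].
  rewrite -{1}(cat_take_drop (j - i) (drop i es)) chain_cat => /andP[/wsum_size + _].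
  by rewrite size_take size_drop; case: ifP; lia.
have [||es' [c' s' w' _]] := IH es1; rewrite ?S1 //; first lia.
by exists es'; split=> //; lia.
Qed.

Definition ini (u x : nat) : nat := if x == u then INF else 0.
Definition Pr (u v : nat) : nat := bf (ini u) nv v.

Lemma PrP u v c : 0 < c ->
  (c <= Pr u v) <-> exists es, chain u es v /\ c + wsum es <= INF.
Proof.
move=> c0; split=> [/bfP-/(_ c0)[x [es [ch _]]]|[es [ch cI]]].
  rewrite /ini; case: eqP => [<-|_]; last by lia.
  by move=> cI; exists es.
have [es' [c' s' w' _]] := shorten ch; apply/bfP => //.
by exists u, es'; split=> //; [lia|rewrite /ini eqxx; lia].
Qed.

Lemma chain_Pr u es v : chain u es v -> INF - wsum es <= Pr u v.
Proof.
move=> ch; case: (posnP (INF - wsum es)) => [->//|c0].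
by apply/PrP => //; exists es; split=> //; lia.
Qed.

Lemma Pr_INF u v : Pr u v <= INF.
Proof.
case: (posnP (Pr u v)) => [->//|c0].
by have [/(_ (leqnn _))[es [_ le]] _] := PrP u v c0; apply: leq_trans le; rewrite leq_addr.
Qed.

Lemma Pr_refl u : Pr u u = INF.
Proof.
apply/eqP; rewrite eqn_leq Pr_INF; have := @chain_Pr u [::] u.
by rewrite /= eqxx /wsum big_nil subn0; apply.
Qed.

Definition opt u es v := [/\ chain u es v, wsum es + Pr u v = INF & 0 < Pr u v].

Lemma opt_ex u v : 0 < Pr u v -> exists es, opt u es v.
Proof.
move=> c0; have [/(_ (leqnn _))[es [ch cI]] _] := PrP u v c0.
by exists es; split=> //; have := chain_Pr ch; lia.
Qed.

Lemma opt_nil u : opt u [::] u.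
Proof. by split; rewrite ?Pr_refl //= /wsum big_nil. Qed.

Lemma triangle u z v : Pr u z + Pr z v <= Pr u v + INF.
Proof.
case: (posnP (Pr u z)) => [->|/opt_ex[a [ca wa _]]]; first by have := Pr_INF z v; lia.
case: (posnP (Pr z v)) => [->|/opt_ex[b [cb wb _]]]; first by have := Pr_INF u z; lia.
have := @chain_Pr u (a ++ b) v; rewrite chain_cat (chain_end ca) ca cb wsum_cat.
by move=> /(_ isT); lia.
Qed.

Lemma opt_cat u a b v : opt u (a ++ b) v ->
  [/\ opt u a (cend u a), opt (cend u a) b v &
      Pr u (cend u a) + Pr (cend u a) v = Pr u v + INF].
Proof.
case; rewrite chain_cat wsum_cat => /andP[ca cb] w P0.
have := chain_Pr ca; have := chain_Pr cb.
have := triangle u (cend u a) v; have := Pr_INF u (cend u a).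
have := Pr_INF (cend u a) v.
by split; [split=> //; lia | split=> //; lia | lia].
Qed.

Lemma opt_join u a z b v : 0 < Pr u v -> opt u a z -> opt z b v ->
  Pr u z + Pr z v = Pr u v + INF -> opt u (a ++ b) v.
Proof.
move=> P0 [ca wa a0] [cb wb b0] E; split=> //.
  by rewrite chain_cat (chain_end ca) ca.
by rewrite wsum_cat; lia.
Qed.

Lemma opt_size u es v : opt u es v -> size es < nv.
Proof.
case=> ch w P0; rewrite ltnNge; apply/negP => sz.
have [es' [c' s' w' /(_ sz) lt]] := shorten ch.
by have := chain_Pr c'; lia.
Qed.

Definition hop u v := (INF - Pr u v) %% SC.

Lemma wsum_hop u es v : chain u es v -> wsum es < INF ->
  wsum es = (\sum_(e <- es) w0 e) * SC + size es.
Proof.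
elim: es u => [|e es IH] u; first by rewrite /wsum !big_nil.
rewrite /wsum !big_cons /= => /and3P[em _ ch] lt; rewrite -/(wsum es) in lt *.
have e0 : 0 < e by case: e em lt {ch} => // _; lia.
by rewrite (IH _ ch) ?Hwt ?e0 //; lia.
Qed.

(** The perturbed weight is a multiple of [SC] plus the number of arcs, which is below [nv < SC]. In
    particular all shortest paths from [u] to [v] have equally many arcs. *)
Lemma opt_hop u es v : opt u es v -> size es = hop u v.
Proof.
move=> o; have sz := opt_size o; case: o => ch w P0.
rewrite /hop -w addnK (wsum_hop ch) ?modnMDl ?modn_small //; lia.
Qed.

Lemma bf_sound u D k v : (forall x, D x <= Pr u x) -> bf D k v <= Pr u v.
Proof.
move=> DP; case: (posnP (bf D k v)) => [->//|b0].
have [/(_ (leqnn _))[x [es [ch _ le]]] _] := bfP D k v b0.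
have := chain_Pr ch; have := triangle u x v; have := DP x.
by have := Pr_INF u x; lia.
Qed.

Lemma bf_exact u D k v z b : (forall x, D x <= Pr u x) -> 0 < Pr u v ->
  D z = Pr u z -> Pr u z + Pr z v = Pr u v + INF -> opt z b v ->
  size b <= k -> bf D k v = Pr u v.
Proof.
move=> DP P0 Dz E [cb wb _] sz; apply/eqP; rewrite eqn_leq bf_sound //=.
apply/bfP => //; exists z, b; split=> //; lia.
Qed.

Lemma ini_sound u x : ini u x <= Pr u x.
Proof. by rewrite /ini; case: eqP => // ->; rewrite Pr_refl. Qed.

Lemma bf_ini_exact u k v es : opt u es v -> size es <= k -> bf (ini u) k v = Pr u v.
Proof.
move=> o; have [ch w P0] := o; apply: bf_exact o => //; first exact: ini_sound.
  by rewrite /ini eqxx Pr_refl.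
by rewrite Pr_refl addnC.
Qed.

(* [H] meets all shortest paths with at least [l] arcs. *)
Definition PH (H : nat -> Prop) (l : nat) :=
  forall u es v, opt u es v -> l <= size es ->
  exists2 z, H z & Pr u z + Pr z v = Pr u v + INF.

(* A hit inside a window of [l] arcs starting after [i] arcs. *)
Lemma PH_window H l u es v i : PH H l -> opt u es v -> i + l <= size es ->
  exists a z b, [/\ H z, opt u a z, opt z b v,
    Pr u z + Pr z v = Pr u v + INF &
    [/\ i <= size a <= i + l & size a + size b = size es]].
Proof.
move=> ph o le; have := o; rewrite -{1}(cat_take_drop i es) => /opt_cat[].
set x := cend u _ => ox oxv Ex; move: oxv; rewrite -{1}(cat_take_drop l (drop i es)).
case/opt_cat; set y := cend x _ => oxy oyv Ey.
have [|z Hz Ez] := ph _ _ _ oxy; first by rewrite size_takel // size_drop; lia.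
have [_ _ Puv] := o; have [_ _ Pxy] := oxy.
have I1 := Pr_INF u x; have I2 := Pr_INF x z; have I3 := Pr_INF z y; have I4 := Pr_INF y v.
have I5 := Pr_INF x v; have I6 := Pr_INF x y.
have t1 := triangle u x z; have t2 := triangle z y v; have t3 := triangle u z v.
have [|b1 o1] := @opt_ex x z; first lia.
have [|b2 o2] := @opt_ex z y; first lia.
have Euz : Pr u x + Pr x z = Pr u z + INF by lia.
have Ezv : Pr z y + Pr y v = Pr z v + INF by lia.
have Euv : Pr u z + Pr z v = Pr u v + INF by lia.
have O1 : opt u (take i es ++ b1) z by apply: opt_join ox o1 Euz; lia.
have O2 : opt z (b2 ++ drop l (drop i es)) v by apply: opt_join o2 oyv Ezv; lia.
(* The path through [z] need not follow [es], but between [x] and [y] it has the same number of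
   arcs. *)
have S1 : size (b1 ++ b2) = l.
  have : opt x (b1 ++ b2) y by apply: opt_join o1 o2 Ez; lia.
  by move/opt_hop ->; rewrite -(opt_hop oxy) size_takel // size_drop; lia.
exists (take i es ++ b1), z, (b2 ++ drop l (drop i es)); split=> //.
rewrite !size_cat in S1 *; rewrite size_takel ?size_drop ?size_drop; lia.
Qed.

(** A shortest path with more than [k] arcs is hit within its last [l] arcs, where the starting row
    is already exact, and the rest takes at most [l] rounds; shorter paths are found from [u]
    itself. *)
Lemma down_exact H l k u D v : PH H l -> l <= k -> (forall x, D x <= Pr u x) ->
  D u = INF -> (forall z, H z -> D z = Pr u z) -> bf D k v = Pr u v.
Proof.
move=> ph lk DP Du DH; case: (posnP (Pr u v)) => [P0|P0].
  by apply/eqP; rewrite P0 -leqn0 -P0; exact: bf_sound.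
have [es o] := opt_ex P0; case: (leqP (size es) k) => sz.
  by apply: (bf_exact DP P0 _ _ o) => //; rewrite ?Du Pr_refl // addnC.
have [|a [z [b [Hz oa ob E [/andP[s1 s2] s3]]]]] := PH_window (i := size es - l) ph o; first lia.
by apply: (bf_exact DP P0 (DH _ Hz) E ob); lia.
Qed.

(* Max-plus squaring of the matrix of profits between vertices of [H]. *)
Lemma closure_exact (H : nat -> Prop) l k (C : nat -> nat -> nat -> nat) :
  PH H l -> l < k ->
  (forall a b, H a -> H b -> C 0 a b = bf (ini a) k b) ->
  (forall r a b c, H a -> H b -> H c -> C r a c + C r c b - INF <= C r.+1 a b) ->
  (forall r a b, H a -> H b -> 0 < C r.+1 a b ->
     exists2 c, H c & C r.+1 a b = C r a c + C r c b - INF) ->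
  forall r a b, H a -> H b -> C r a b <= Pr a b /\ (hop a b <= l + 2 ^ r -> C r a b = Pr a b).
Proof.
move=> ph lk C0 Cge Cle; elim=> [|r IH] a b Ha Hb.
  rewrite C0 //; split=> [|hl]; first by apply: bf_sound; exact: ini_sound.
  case: (posnP (Pr a b)) => [P0|P0].
    by apply/eqP; rewrite P0 -leqn0 -P0; apply: bf_sound; exact: ini_sound.
  have [es o] := opt_ex P0; apply: (bf_ini_exact o).
  by rewrite (opt_hop o); move: hl; rewrite expn0; lia.
have sound : C r.+1 a b <= Pr a b.
  case: (posnP (C r.+1 a b)) => [->//|c0].
  have [c Hc ->] := Cle _ _ _ Ha Hb c0.
  have [s1 _] := IH a c Ha Hc; have [s2 _] := IH c b Hc Hb.
  by have := triangle a c b; lia.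
split=> // hl; apply/eqP; rewrite eqn_leq sound /=.
case: (posnP (Pr a b)) => [->//|P0]; have [es o] := opt_ex P0.
have [hs|hs] := leqP (hop a b) (l + 2 ^ r).
  have [_ /(_ hs) E1] := IH a b Ha Hb.
  (* Splitting at [a] itself, whose own profit is [INF], preserves the previous value. *)
  have [_ E2] := IH a a Ha Ha; move: E2; rewrite /hop Pr_refl subnn mod0n => /(_ isT) E2.
  by have := Cge r a b a Ha Hb Ha; rewrite E1 E2; lia.
have so := opt_hop o; rewrite expnS mul2n -addnn in hl.
(* The window of [l] arcs starts [l + 2 ^ r] arcs before the end. A hit in it leaves at most
   [l + 2 ^ r] arcs after it, and at most [l + 2 ^ r] before it as the path has at most
   [l + 2 ^ r.+1] arcs. *)
have [|x [z [y [Hz oa ob E [/andP[s1 s2] s3]]]]] := PH_window (i := size es - (l + 2 ^ r)) ph o; first lia.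
have [_ E1] := IH a z Ha Hz; have [_ E2] := IH z b Hz Hb.
have := Cge r a b z Ha Hb Hz; rewrite E1 ?E2 -?(opt_hop oa) -?(opt_hop ob); lia.
Qed.

(* Ancestors in a tree of limited-hop profits. *)
Section Tree.
Variables (h L : nat) (par : nat -> nat).
Let D x := bf (ini h) (2 * L) x.
Hypothesis par_root : par h = h.
Hypothesis parP : forall x, 0 < D x -> D x < INF ->
  0 < \max_(e < mA | hd e == x) (D (tl e) - wt e) ->
  exists e, [/\ e < mA, hd e = x, par x = tl e &
    D (tl e) - wt e = \max_(e < mA | hd e == x) (D (tl e) - wt e)].

(** Rounds never decrease a profit, so the predecessor that last improved [x] still accounts for its
    value in the final table. *)
Lemma bf_pred D0 k x : D0 x = 0 -> 
  bf D0 k x <= \max_(e < mA | hd e == x) (bf D0 k (tl e) - wt e).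
Proof.
move=> D0x; case: (posnP (bf D0 k x)) => [->//|b0].
have mono y : forall k', bf D0 k' y <= bf D0 k'.+1 y by move=> k'; rewrite /= leq_maxl.
elim: k b0 => [|k IH] b0; first by move: b0; rewrite /= D0x.
have -> : bf D0 k.+1 x = maxn (bf D0 k x) (\max_(e < mA | hd e == x) (bf D0 k (tl e) - wt e)) by [].
case: (leqP (bf D0 k x) (\max_(e < mA | hd e == x) (bf D0 k (tl e) - wt e))) => cmp.
  apply/bigmax_leqP => e he.
  apply: leq_trans (leq_bigmax_cond e he).
  by apply: leq_sub2r; exact: mono.
have : 0 < bf D0 k x by lia.
move/IH=> le; apply: leq_trans le _.
apply/bigmax_leqP => e he; apply: leq_trans (leq_bigmax_cond e he).
by apply: leq_sub2r; exact: mono.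
Qed.

Lemma D_INF x : D x = INF -> x = h.
Proof.
move=> DI; have [|y [es [ch _ le]]] := (bfP (ini h) (2 * L) x INF0).1.
  by rewrite -/(D x) DI.
have := wsum_size ch; move: le; rewrite /ini; case: eqP => [yh le sz|_]; last by lia.
have : size es = 0 by lia.
by move/size0nil => E; move: ch; rewrite E /= yh => /eqP.
Qed.

Lemma D_h : D h = INF.
Proof. by rewrite /D (bf_ini_exact (opt_nil h)) ?Pr_refl. Qed.

Lemma D_le x : D x <= INF.
Proof. apply: leq_trans (Pr_INF h x); apply: bf_sound; exact: ini_sound. Qed.

(** Profits limited to [2 * L] hops need not be exact, but they increase strictly towards the root
    because arc weights are positive; this makes parent chains acyclic. *)
Lemma par_lt x : 0 < D x -> x != h -> D x < D (par x).
Proof.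
move=> D0 xh; have lt : D x < INF.
  by rewrite ltn_neqAle D_le andbT; apply: contraNneq xh => /D_INF ->.
have le : D x <= \max_(e < mA | hd e == x) (D (tl e) - wt e).
  by apply: bf_pred; rewrite /ini (negbTE xh).
have [|e [em he -> E]] := parP D0 lt; first lia.
by have := wt_gt0 em; lia.
Qed.

Lemma iter_par_root t : iter t par h = h.
Proof. by elim: t => //= t ->. Qed.

(** The averaging over primes needs [L] distinct vertices on each tree path, which this provides. *)
Lemma par_inj y s t : 0 < D y -> iter L.-1 par y != h -> s < t -> t < L ->
  iter s par y != iter t par y.
Proof.
move=> Dy yh st tL.
have ne i : i < L -> iter i par y != h.
  move=> iL; apply: contraNneq yh => E.
  have -> : L.-1 = (L.-1 - i) + i by lia.
  by rewrite iterD E iter_par_root.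
have pos i : i < L -> 0 < D (iter i par y).
  elim: i => // i IH iL /=; apply: leq_trans (par_lt (IH _) (ne _ _)); lia.
have inc d i : i + d.+1 < L -> D (iter i par y) < D (iter (i + d.+1) par y).
  elim: d => [|d IH] iL.
    by rewrite addn1 /=; apply: par_lt; [apply: pos|apply: ne]; lia.
  apply: ltn_trans (IH _) _; first lia.
  by rewrite (addnS i d.+1) /=; apply: par_lt; [apply: pos|apply: ne]; lia.
have := inc (t - s).-1 s; have -> : s + (t - s).-1.+1 = t by lia.
by move=> /(_ tL) lt; apply: contraTneq lt => ->; rewrite ltnn.
Qed.

(** Where the limited profit is the true one, a best predecessor is one arc nearer to the root on a
    shortest path, so the argument can be repeated from there. *)
Lemma par_tight y es t : opt h es y -> size es < 2 * L -> t <= size es ->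
  exists2 es', opt h es' (iter t par y) /\ size es' + t = size es &
    Pr h (iter t par y) + Pr (iter t par y) y = Pr h y + INF.
Proof.
move=> o sz; elim: t => [_|t IH ts]; first by exists es; rewrite ?Pr_refl ?addn0.
have [|es' [o' s'] E] := IH; first lia; set x := iter t par y in o' E *.
have Dx : D x = Pr h x by apply: (bf_ini_exact o'); lia.
have [_ _ Px] := o'.
have [c' w' _] := o'.
have ltI : D x < INF.
  rewrite Dx; have := wsum_size c'; lia.
have Mx : \max_(e < mA | hd e == x) (D (tl e) - wt e) = D x.
  apply/eqP; rewrite eqn_leq; apply/andP; split; last first.
    apply: bf_pred; rewrite /ini; case: eqP => // xh.
    by move: ltI; rewrite xh D_h ltnn.
  apply/bigmax_leqP => e /eqP he; rewrite Dx -he.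
  have s1 : D (tl e) <= Pr h (tl e) by apply: bf_sound; exact: ini_sound.
  have ce : chain (tl e) [:: nat_of_ord e] (hd e) by rewrite /= ltn_ord !eqxx.
  have := chain_Pr ce; rewrite /wsum big_seq1.
  by have := triangle h (tl e) (hd e); have := Pr_INF h (tl e); lia.
have [||e [em he pe Ee]] := parP _ ltI; rewrite ?Mx ?Dx //.
have ce : chain (tl e) [:: e] x by rewrite /= em he !eqxx.
have := chain_Pr ce; rewrite /wsum big_seq1 => pe1.
have t1 := triangle h (tl e) x; have t2 := triangle h (tl e) y; have t3 := triangle (tl e) x y.
have s1 : D (tl e) <= Pr h (tl e) by apply: bf_sound; exact: ini_sound.
rewrite Mx Dx in Ee; have I1 := Pr_INF h (tl e).
have pz : 0 < Pr h (tl e) by lia.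
have [es2 o2] := opt_ex pz.
have -> : iter t.+1 par y = tl e by rewrite /= -/x pe.
exists es2; last lia; split=> //.
have o1 : opt (tl e) [:: e] x by split=> //; rewrite /wsum ?big_seq1; lia.
have : opt h (es2 ++ [:: e]) x by apply: opt_join o2 o1 _; lia.
by move/opt_hop; rewrite -(opt_hop o') size_cat /=; lia.
Qed.

End Tree.

(* One level of the construction of hitting sets: [sel h] is a layer of the tree
   of [h] and [H'] meets the [L] last vertices of every tree path to that layer. *)
Lemma up_step (H H' : nat -> Prop) l L (par : nat -> nat -> nat) (sel : nat -> nat) :
  PH H l -> 0 < L ->
  (forall h, H h -> par h h = h) ->
  (forall h x, H h -> let D y := bf (ini h) (2 * L) y in 0 < D x -> D x < INF ->
    0 < \max_(e < mA | hd e == x) (D (tl e) - wt e) ->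
    exists e, [/\ e < mA, hd e = x, par h x = tl e &
    D (tl e) - wt e = \max_(e < mA | hd e == x) (D (tl e) - wt e)]) ->
  (forall h, H h -> L <= sel h < 2 * L) ->
  (forall h y, H h -> let D y := bf (ini h) (2 * L) y in
     0 < D y -> (INF - D y) %% SC = sel h -> y < nv ->
     iter L.-1 (par h) y != h ->
     exists2 t, t < L & H' (iter t (par h) y)) ->
  PH H' (l + 2 * L).
Proof.
move=> ph L0 pr pP sel2 hit u es v o sz.
(* A vertex [h] of [H] occurs among the first [l] arcs. At least [2 * L] arcs follow, so the path
   crosses the selected layer of the tree of [h], at a vertex [y]. *)
have [|a [h [b [Hh oa ob E [/andP[_ s2] s3]]]]] := PH_window (i := 0) ph o; first lia.
have /andP[j1 j2] := sel2 h Hh; set j := sel h in j1 j2.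
have := ob; rewrite -{1}(cat_take_drop j b) => /opt_cat[]; set y := cend h _ => oy oyv Ey.
have sy : size (take j b) = j by rewrite size_takel //; lia.
have Dy : bf (ini h) (2 * L) y = Pr h y by apply: (bf_ini_exact oy); lia.
have [chy _ Py] := oy.
have [||||t tL Ht] := hit h y Hh; rewrite ?Dy //.
- by rewrite -/(hop h y) -(opt_hop oy).
- by have sy0 : 0 < size (take j b) by [lia]; case/andP: (chain_lt chy sy0).
(* [y] is at least [L] arcs away from the root, so [L - 1] steps towards it do not arrive. *)
- have [||es' [o' s'] _] := @par_tight h L (par h) (pr h Hh) (fun x => pP h x Hh) y (take j b) L.-1 oy; rewrite ?sy; try lia.
  apply: contraTneq (leqnn 1) => xh; move: o'; rewrite xh => /opt_hop.
  by rewrite /hop Pr_refl subnn mod0n; lia.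
have [||es' _ Et] := @par_tight h L (par h) (pr h Hh) (fun x => pP h x Hh) y (take j b) t oy; rewrite ?sy; try lia.
exists (iter t (par h) y) => //; set z := iter t (par h) y in Et *.
have := triangle u h z; have := triangle z y v; have := triangle u z v; lia.
Qed.

End Graph.

Section Reverse.
Variables (nv mA : nat) (tl hd wt : nat -> nat) (INF SC : nat) (w0 : nat -> nat).
Hypothesis aok : arcs_ok nv mA tl hd wt INF SC w0.

Lemma arcs_rev : arcs_ok nv mA hd tl wt INF SC w0.
Proof. by case: aok => *; split. Qed.

Lemma chain_rev u es v : chain mA tl hd u es v -> chain mA hd tl v (rev es) u.
Proof.
elim: es u => [|e es IH] u /=; first by move/eqP->; rewrite /= eqxx.
move=> /and3P[em te /IH c]; rewrite rev_cons -cats1 chain_cat (chain_end c) c /=.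
by rewrite em eqxx te.
Qed.

Lemma wsum_rev es : wsum wt (rev es) = wsum wt es.
Proof. by rewrite /wsum; apply: perm_big; rewrite perm_rev. Qed.

End Reverse.

Lemma Pr_rev nv mA tl hd wt INF SC w0 u v : arcs_ok nv mA tl hd wt INF SC w0 ->
  Pr nv mA hd tl wt INF u v = Pr nv mA tl hd wt INF v u.
Proof.
move=> aok; have le t h (ok : arcs_ok nv mA t h wt INF SC w0) x y :
    Pr nv mA t h wt INF x y <= Pr nv mA h t wt INF y x.
  case: (posnP (Pr nv mA t h wt INF x y)) => [->//|/(opt_ex ok)[es [ch w _]]].
  by have := chain_Pr (arcs_rev ok) (chain_rev ch); rewrite wsum_rev; lia.
by apply/eqP; rewrite eqn_leq !le //; exact: arcs_rev.
Qed.

Lemma PH_rev nv mA tl hd wt INF SC w0 H l : arcs_ok nv mA tl hd wt INF SC w0 ->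
  PH nv mA tl hd wt INF H l -> PH nv mA hd tl wt INF H l.
Proof.
move=> aok ph u es v [ch w P0] sz; rewrite !(Pr_rev _ _ aok) in w P0.
have [||z Hz E] := ph v (rev es) u; last 1 first.
- by exists z => //; rewrite !(Pr_rev _ _ aok) addnC.
- by split=> //; [exact: chain_rev ch|rewrite wsum_rev].
- by rewrite size_rev.
Qed.

End Profits.

(** * Primes, residue classes and the averaging argument *)

Module Hitting.

Lemma exp2_bin n : 2 ^ n <= 'C(n.*2, n).
Proof.
elim: n => // n IH; rewrite doubleS binS -(bin_sub (n := n.*2.+1) (m := n.+1)); last lia.
have -> : n.*2.+1 - n.+1 = n by lia.
rewrite addnn -mul2n expnS leq_mul2l /=; apply: leq_trans IH _.
by case: n => // n; rewrite [X in _ <= X]binS leq_addr.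
Qed.

Lemma divn_double_le n d : n.*2 %/ d <= (n %/ d).*2 + 1.
Proof.
case: d => [|d]; first by rewrite !divn0.
rewrite -ltnS -addnS ltn_divLR //.
by have := divn_eq n d.+1; have := ltn_mod n d.+1; nia.
Qed.

Lemma logn_fact_le p n m : prime p -> n <= m ->
  logn p n`! = \sum_(1 <= k < m.+1) n %/ p ^ k.
Proof.
move=> pp nm; rewrite logn_fact // [RHS](big_cat_nat (n := n.+1)) //= [X in _ = _ + X]big1_seq ?addn0 //.
move=> k; rewrite mem_index_iota => /andP[_ /andP[nk _]]; apply: divn_small.
by apply: leq_trans nk (ltnW (ltn_expl _ (prime_gt1 pp))).
Qed.

(** Legendre's formula: a power [p ^ k] contributes at most 1 to the exponent of [p], by
    [divn_double_le], and nothing once it exceeds [2n]. *)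
Lemma bin_pfactor p n : prime p -> 0 < n -> p ^ logn p 'C(n.*2, n) <= n.*2.
Proof.
move=> pp n0; have p1 := prime_gt1 pp; have nn : n <= n.*2 by lia.
have E : logn p 'C(n.*2, n) + (logn p n`!).*2 = logn p (n.*2)`!.
  rewrite -(bin_fact nn) !lognM ?muln_gt0 ?fact_gt0 ?bin_gt0 //.
  by have -> : n.*2 - n = n by [lia]; rewrite addnn.
have n20 : 0 < n.*2 by lia.
set T := trunc_log p n.*2; suff : logn p 'C(n.*2, n) <= T.
  move=> le; apply: leq_trans (trunc_logP p1 n20).
  by rewrite leq_pexp2l // prime_gt0.
rewrite -(leq_add2r (logn p n`!).*2) E (logn_fact_le pp nn) logn_fact // -[X in _ <= _ + X]mul2n big_distrr /=.
have -> : T = \sum_(1 <= k < (n.*2).+1) (k <= T).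
  rewrite (big_cat_nat (n := T.+1)) //=; last first.
    by rewrite ltnS /T; apply: leq_trans (ltnW (ltn_expl T p1)) (trunc_logP p1 n20).
  rewrite (eq_big_nat _ _ (F2 := fun=> 1)); last by move=> k /andP[_]; rewrite ltnS => ->.
  rewrite sum_nat_const_nat muln1 subn1 /= [X in _ + X]big1_seq ?addn0 //.
  by move=> k; rewrite mem_index_iota => /andP[_ /andP[+ _]]; rewrite ltnNge => /negbTE ->.
rewrite -big_split /=; apply: leq_sum => k _; case: (leqP k T) => kT /=.
  by have := divn_double_le n (p ^ k); lia.
by rewrite divn_small ?leq0n //; apply: leq_trans (trunc_log_ltn _ p1) _; rewrite leq_pexp2l // ltnW.
Qed.

Lemma leq_prod_seq_const (I : eqType) (s : seq I) (F : I -> nat) c :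
  {in s, forall i, F i <= c} -> \prod_(i <- s) F i <= c ^ size s.
Proof.
elim: s => [|i s IH] H; first by rewrite big_nil.
rewrite big_cons /= expnS leq_mul ?H ?mem_head // IH // => j js.
by apply: H; rewrite inE js orbT.
Qed.

Lemma leq_const_prod_seq (I : eqType) (s : seq I) (F : I -> nat) c :
  {in s, forall i, c <= F i} -> c ^ size s <= \prod_(i <- s) F i.
Proof.
elim: s => [|i s IH] H; first by rewrite big_nil.
rewrite big_cons /= expnS leq_mul ?H ?mem_head // IH // => j js.
by apply: H; rewrite inE js orbT.
Qed.

Lemma prod_logn n : 0 < n -> n = \prod_(p <- primes n) p ^ logn p n.
Proof. by move=> n0; rewrite {1}(prod_prime_decomp n0) prime_decompE big_map. Qed.

(** Chebyshev's bound: [2 ^ N] is at most the central binomial coefficient, a product of prime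
    powers each at most [2N] over primes at most [2N]. Taking logarithms is immediate since [2N] is
    a power of two. *)
Lemma primes_count b (N := 2 ^ b) :
  N <= b.+1 * count prime (iota 0 N.*2.+1).
Proof.
have N0 : 0 < N by rewrite expn_gt0.
set C := 'C(N.*2, N); have C0 : 0 < C by rewrite bin_gt0; lia.
rewrite -(leq_exp2l (m := 2)) //; apply: leq_trans (exp2_bin N) _.
rewrite expnM -/C (prod_logn C0).
have -> : 2 ^ b.+1 = N.*2 by rewrite expnS mul2n.
apply: leq_trans (leq_prod_seq_const (c := N.*2) _) _.
  by move=> p; rewrite mem_primes => /and3P[pp _ _]; exact: bin_pfactor.
apply: leq_pexp2l; first lia.
rewrite -size_filter; apply: uniq_leq_size; first exact: primes_uniq.
move=> p; rewrite mem_filter mem_iota /= add0n ltnS => pC.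
have := pC; rewrite mem_primes => /and3P[pp _ _]; rewrite pp /=.
apply: leq_trans (bin_pfactor pp N0); rewrite -{1}(expn1 p) leq_exp2l ?logn_gt0 //; exact: prime_gt1.
Qed.

Lemma size_primes_lt d k : 0 < d -> d < 2 ^ k -> size (primes d) <= k.
Proof.
move=> d0 dk; rewrite leqNgt; apply/negP => lt.
suff : 2 ^ size (primes d) <= d.
  by apply/negP; rewrite -ltnNge; apply: leq_trans dk _; rewrite leq_pexp2l // ltnW.
rewrite {2}(prod_logn d0); apply: leq_const_prod_seq => p pd.
have := pd; rewrite mem_primes => /and3P[/prime_gt1 p1 _ _].
by apply: (leq_trans p1); move: pd; rewrite -logn_gt0 -(leq_exp2l _ _ p1) expn1.
Qed.

Section Greedy.

Definition dis (p : nat) (l : seq nat) : nat :=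
  \sum_(c < p) ((c : nat) \in [seq x %% p | x <- l]).

Fixpoint col (p : nat) (l : seq nat) : nat :=
  if l is x :: l' then count (fun y => x %% p == y %% p) l' + col p l' else 0.

(** Each element opens a new class or collides with one of the others counted so far. *)
Lemma dis_col p l : 0 < p -> size l <= dis p l + col p l.
Proof.
move=> p0; elim: l => // x l IH /=.
have xp : x %% p < p by rewrite ltn_mod.
have E : dis p (x :: l) = (x %% p \notin [seq x %% p | x <- l]) + dis p l.
  rewrite /dis (bigD1 (Ordinal xp)) //= [in RHS](bigD1 (Ordinal xp)) //= inE eqxx addnA /=.
  congr (_ + _); first by case: (_ \in _).
  apply: eq_bigr => c cx; rewrite inE; suff /negbTE -> : (c : nat) != x %% p by [].
  by apply: contraNneq cx => E; apply/eqP/val_inj.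
rewrite E; case: (boolP (_ \in _)) => [xin|_] /=; last lia.
have : has (fun y => x %% p == y %% p) l.
  by case/mapP: xin => y yl Exy; apply/hasP; exists y => //; exact/eqP.
by rewrite has_count; lia.
Qed.

(** A prime modulo which [x] and [y] agree divides their difference, and a positive number below
    [2 ^ k] has at most [k] prime divisors. *)
Lemma count_cong (Q : seq nat) x y k : uniq Q -> all prime Q ->
  x < 2 ^ k -> y < 2 ^ k -> x != y -> count (fun p => x %% p == y %% p) Q <= k.
Proof.
move=> uQ pQ; wlog yx : x y / y < x.
  move=> W xk yk xy; case: (ltngtP x y) xy => // lt _; last by apply: W; rewrite // gtn_eqF.
  by rewrite (eq_count (a2 := fun p => y %% p == x %% p)) ?W // ?gtn_eqF // => p; rewrite eq_sym.
move=> xk yk _; apply: leq_trans (_ : size (primes (x - y)) <= k); last first.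
  by apply: size_primes_lt; lia.
rewrite -size_filter; apply: uniq_leq_size; first exact: filter_uniq.
move=> p; rewrite mem_filter mem_primes => /andP[Exy /(allP pQ) ->]; rewrite subn_gt0 yx /=.
by rewrite -eqn_mod_dvd // ltnW.
Qed.

Lemma sum_col (Q : seq nat) k l : uniq Q -> all prime Q ->
  uniq l -> all (fun x => x < 2 ^ k) l ->
  2 * \sum_(p <- Q) col p l <= k * (size l * size l).
Proof.
move=> uQ pQ; elim: l => [|x l IH] /=; first by rewrite big1.
move=> /andP[xl ul] /andP[xk lk]; rewrite big_split /= mulnDr.
have le : \sum_(p <- Q) count (fun y => x %% p == y %% p) l <= k * size l.
  have E : \sum_(p <- Q) count (fun y => x %% p == y %% p) l =
    \sum_(y <- l) count (fun p => x %% p == y %% p) Q.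
    under eq_bigr do rewrite -sum1_count big_mkcond /=.
    rewrite exchange_big /=; apply: eq_bigr => y _.
    by rewrite -sum1_count [RHS]big_mkcond.
  rewrite E big_seq; apply: leq_trans (_ : \sum_(y <- l | y \in l) k <= _).
    apply: leq_sum => y yl; apply: count_cong => //; first exact: (allP lk).
    by apply: contraNneq xl => ->.
  by rewrite -big_seq big_const_seq count_predT iter_addn_0 leqnn.
have := IH ul lk; move: (size l) (\sum_(p <- Q) _) (\sum_(p <- Q) _) le => n S1 S2 le le2.
have -> : k * (n.+1 * n.+1) = k * (n * n) + 2 * (k * n) + k by nia.
lia.
Qed.

Variables (K L k Pm : nat) (a : nat -> seq nat) (un : nat -> bool).
Hypothesis (L0 : 0 < L).
Hypothesis aP : forall s, s < K -> un s ->
  [/\ uniq (a s), size (a s) = L & all (fun x => x < 2 ^ k) (a s)].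

Definition cnt (p c : nat) : nat :=
  \sum_(s < K) (un s && (c \in [seq x %% p | x <- a s])).

(** Two members of a set collide modulo at most [k] primes, so over more than [k * L] primes a set
    meets on average at least [L / 2] classes. A prime has fewer than [Pm] classes, hence some class
    meets a fraction [L / (2 * Pm)] of the sets; otherwise counting the incidences by sets and by
    classes gives contradictory totals. *)
Lemma greedy : k * L < count prime (iota L (Pm - L)) ->
  exists p c, [/\ L <= p < Pm, c < p & (\sum_(s < K) un s) * L <= 2 * Pm * cnt p c].
Proof.
set Q := [seq p <- iota L (Pm - L) | prime p]; set U := \sum_(s < K) _.
rewrite -size_filter -/Q => Qk.
have uQ : uniq Q by rewrite filter_uniq // iota_uniq.
have pQ : all prime Q by exact: filter_all.
have inQ p : p \in Q -> L <= p < Pm.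
  by rewrite mem_filter mem_iota => /andP[_]; lia.
pose ex := has (fun p => has (fun c => U * L <= 2 * Pm * cnt p c) (iota 0 p)) Q.
case: (boolP ex) => [/hasP[p pQ' /hasP[c]]|nex].
  by rewrite mem_iota => /andP[_ cp] le; exists p, c; split=> //; exact: inQ.
have H p c : p \in Q -> c < p -> 2 * Pm * cnt p c < U * L.
  move=> pq cp; rewrite ltnNge; apply: contra nex => le.
  by apply/hasP; exists p => //; apply/hasP; exists c; rewrite ?mem_iota.
have UL : 0 < U * L.
  have [p pq] : exists p, p \in Q by case: (Q) Qk => // p q _; exists p; exact: mem_head.
  by have /andP[Lp _] := inQ p pq; apply: leq_ltn_trans (H p 0 pq _); lia.
have S1 : U * (size Q * L) <= 2 * \sum_(p <- Q) \sum_(c < p) cnt p c.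
  have -> : \sum_(p <- Q) \sum_(c < p) cnt p c = \sum_(s < K) un s * \sum_(p <- Q) dis p (a s).
    under eq_bigr do rewrite exchange_big /=.
    rewrite exchange_big /=; apply: eq_bigr => s _.
    rewrite big_distrr /=; apply: eq_bigr => p _; rewrite /dis big_distrr /=.
    by apply: eq_bigr => c _; case: (un s); rewrite ?mul1n ?mul0n.
  rewrite /U big_distrl big_distrr /=; apply: leq_sum => s _.
  case: (boolP (un s)) => us; rewrite ?mul0n ?muln0 // !mul1n.
  have [ua sa ka] := aP (ltn_ord s) us.
  have := sum_col uQ pQ ua ka; rewrite sa => le.
  have : size Q * L <= \sum_(p <- Q) (dis p (a s) + col p (a s)).
    rewrite -sum1_size big_distrl /= big_seq [X in _ <= X]big_seq; apply: leq_sum => p pq.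
    by rewrite mul1n -sa; apply: dis_col; have := inQ p pq; lia.
  rewrite big_split /= => le2; have : k * (L * L) <= size Q * L by rewrite mulnA leq_mul2r ltnW ?orbT.
  lia.
have S2 : 2 * Pm * \sum_(p <- Q) \sum_(c < p) cnt p c <= size Q * (Pm * (U * L).-1).
  rewrite -sum1_size big_distrl big_distrr /= big_seq [X in _ <= X]big_seq; apply: leq_sum => p pq.
  rewrite mul1n big_distrr /=; apply: leq_trans (_ : \sum_(c < p) (U * L).-1 <= _).
    by apply: leq_sum => c _; have := H p c pq (ltn_ord c); lia.
  rewrite sum_nat_const card_ord leq_mul2r; have /andP[_ pP] := inQ p pq.
  by rewrite (ltnW pP) orbT.
have Q0 : 0 < size Q by lia.
have P0 : 0 < Pm.
  have [p pq] : exists p, p \in Q by case: (Q) Q0 => // p q _; exists p; exact: mem_head.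
  by have := inQ p pq; lia.
exfalso; have lt : size Q * (Pm * (U * L).-1) < size Q * (Pm * (U * L)).
  by rewrite !ltn_pmul2l //; lia.
have := leq_mul (leqnn Pm) S1; move: lt S2; move: (\sum_(p <- Q) _) => B.
move: (U * L).-1 => UL1; nia.
Qed.

End Greedy.

(** This is [(1 - 1/q) ^ q <= 1/2] without denominators. *)
Lemma exp_half q : 0 < q -> 2 * q.-1 ^ q <= q ^ q.
Proof.
case: q => // q _ /=; case: (posnP q) => [->|q0]; first by [].
(* Bernoulli's inequality [1 + k/q <= (1 + 1/q) ^ k]. *)
have bern : forall k, q ^ k * (q + k) <= q * q.+1 ^ k.
  elim=> [|k IH]; first by rewrite !expn0 mul1n addn0 muln1.
  rewrite !expnS; move: (q ^ k) (q.+1 ^ k) IH => x y IH; nia.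
have := bern q.+1; rewrite addnS -addSn => h.
have : q ^ q.+1 * (q.+1 + q) <= q * q.+1 ^ q.+1 by rewrite [_ + q]addnC addnS -addSn addnC.
move: (q ^ q.+1) (q.+1 ^ q.+1) => x y hh; nia.
Qed.

End Hitting.

(** * From shortest path profits to shortest simple cycles *)

Module Cycles.
Import Profits.

Section PathWeight.
Variables (T : eqType) (F : T -> T -> nat).

Fixpoint pathw (x : T) (p : seq T) : nat :=
  if p is y :: q then F x y + pathw y q else 0.

Lemma pathw_cat x p q : pathw x (p ++ q) = pathw x p + pathw (last x p) q.
Proof. by elim: p x => //= y p IH x; rewrite IH addnA. Qed.

Lemma sum_next_at y0 y p : uniq (y :: p) ->
  \sum_(x <- y :: p) F x (path.next_at x y0 y p) = pathw y (rcons p y0).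
Proof.
elim: p y => [|z p IH] y; first by rewrite big_seq1 /= eqxx addn0.
rewrite big_cons [path.next_at y _ _ _]/= eqxx => /andP[yn un] /=.
rewrite -IH //; congr (_ + _); rewrite big_seq [RHS]big_seq; apply: eq_bigr => x xin.
by case: eqP => // xy; rewrite -xy xin in yn.
Qed.

End PathWeight.

Lemma cycle_weightE dir n (G : wgraph dir n) (c : seq 'I_n) u : uniq c -> u \in c ->
  exists p, [/\ perm_eq c (u :: p), uniq (u :: p), cycle (adj G) c = cycle (adj G) (u :: p),
     size c = size (u :: p) & cycle_weight G c = pathw (wt G) u (rcons p u)].
Proof.
move=> uc; case/rot_to => i p E; exists p.
have up : uniq (u :: p) by rewrite -E rot_uniq.
split=> //; rewrite -?E ?perm_rot ?rot_cycle ?size_rot //.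
  by rewrite perm_sym perm_rot.
rewrite -(sum_next_at (wt G) u up) /cycle_weight.
rewrite -(perm_big _ (permEl (perm_rot i c))) /= E.
by apply: eq_bigr => x _; rewrite -(next_rot i uc) E.
Qed.

Section Cycles.
Variables (dir : bool) (n : nat) (G : wgraph dir n).
Variables (mA : nat) (tl hd awt w0 : nat -> nat) (INF SC : nat).
Notation nv := n.+1.
Hypothesis aok : arcs_ok nv mA tl hd awt INF SC w0.
Let Hwt : forall e, 0 < e < mA -> awt e = w0 e * SC + 1. Proof. exact: aok_wt aok. Qed.
Let H0 : INF <= awt 0. Proof. exact: aok_0 aok. Qed.
Let INF0 : 0 < INF. Proof. exact: aok_INF aok. Qed.
Let HSC : nv < SC. Proof. exact: aok_SC aok. Qed.
Hypothesis (arc1 : forall e, 0 < e < mA -> exists u v : 'I_n,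
  [/\ adj G u v, tl e = u, hd e = v & w0 e = wt G u v]).
Hypothesis (arc2 : forall u v : 'I_n, adj G u v -> exists e,
  [/\ 0 < e < mA, tl e = u, hd e = v & w0 e = wt G u v]).
Hypothesis (big : forall c, simple_cycle G c -> SC * cycle_weight G c + size c < INF).

Notation chain := (chain mA tl hd).
Notation wsum := (wsum awt).
Notation Pr := (Pr n.+1 mA tl hd awt INF).
Notation opt := (opt n.+1 mA tl hd awt INF).
Notation pathw := (pathw (wt G)).

Lemma chain_path (u : 'I_n) es v : chain u es v -> wsum es < INF ->
  exists p : seq 'I_n, [/\ map val p = map hd es, path (adj G) u p,
    size p = size es & wsum es = SC * pathw u p + size p].
Proof.
elim: es u => [|e es IH] u /=; first by exists [::]; rewrite /Profits.wsum big_nil muln0.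
move=> /and3P[em /eqP te ch]; rewrite /Profits.wsum big_cons -/(wsum es) => lt.
have e0 : 0 < e < mA by rewrite em andbT; case: e em lt {te ch} => // _; lia.
have [x [y [axy tx hy w]]] := arc1 e0.
rewrite hy in ch; have [|p [mp pp sp wp]] := IH y ch; first lia.
have xu : x = u by apply: val_inj; rewrite /= -tx.
exists (y :: p); rewrite /= mp hy -xu axy pp sp; split=> //.
by rewrite wp (Hwt e0) w sp mulnDr; lia.
Qed.

Lemma path_chain (u : 'I_n) p : path (adj G) u p ->
  exists es, [/\ chain u es (last u p), size es = size p &
    wsum es = SC * pathw u p + size p].
Proof.
elim: p u => [|y p IH] u /=; first by exists [::]; rewrite /= eqxx /Profits.wsum big_nil muln0.
move=> /andP[/arc2[e [e0 te he w]] /IH[es [ch se we]]].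
exists (e :: es); rewrite /= te he eqxx ch se; split=> //; first by case/andP: e0 => _ ->.
by rewrite /Profits.wsum big_cons -/(wsum es) we (Hwt e0) w mulnDr; lia.
Qed.

(** Returning to the start would make a nonempty segment a shortest path from a vertex to itself,
    whose number of arcs is 0. *)
Lemma opt_uniq u es v : opt u es v -> uniq (u :: map hd es).
Proof.
elim: es u => [|e es IH] u o //.
rewrite cons_uniq; apply/andP; split; last first.
  by have [_ o2 _] := opt_cat aok (a := [:: e]) o; exact: IH o2.
apply/negP => /(nthP 0)[i]; rewrite size_map => isz E.
have := o; rewrite -(cat_take_drop i.+1 (e :: es)) => /(opt_cat aok)[o1 _ _].
have Eu : cend hd u (take i.+1 (e :: es)) = u.
  rewrite /cend map_take -nth_last size_takel ?size_map // nth_take //.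
  by rewrite (set_nth_default 0) ?size_map.
rewrite Eu in o1; have := opt_hop aok o1.
by rewrite size_takel // /hop (Pr_refl aok) subnn mod0n.
Qed.

(** [best] is the largest profit of a cycle in [P], or 0 if there is none. The length of the cycle
    enters because every arc carries a perturbation of 1. *)
Definition cyc_spec (P : pred (seq 'I_n)) (best : nat) :=
  (forall c, P c -> INF - (SC * cycle_weight G c + size c) <= best) /\
  (0 < best -> exists2 c, P c & SC * cycle_weight G c + size c + best = INF).

(** A simple cycle is shorter than [SC], so division by [SC] removes the perturbation, and a cycle
    of least perturbed weight has least weight. *)
Lemma cyc_decode (P : pred (seq 'I_n)) best :
  (forall c, P c -> simple_cycle G c) -> cyc_spec P best ->
  shortest_cycle_weight G P (decode (if best == 0 then 0 else ((INF - best) %/ SC).+1)).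
Proof.
move=> Ps [lo ex]; have szn c : P c -> size c < SC.
  move=> /Ps/and3P[_ uc _]; apply: leq_ltn_trans HSC.
  by have := max_card (mem c); rewrite (card_uniqP uc) card_ord => /leqW.
case: eqP => [b0|/eqP b0] /=.
  move=> c; apply/negP => Pc; have := lo c Pc; have := big (Ps c Pc); lia.
have [|c Pc E] := ex; first lia.
have -> : (INF - best) %/ SC = cycle_weight G c.
  by rewrite -E addnK mulnC divnMDl ?divn_small ?szn ?addn0 //; lia.
split; first by exists c.
move=> c' Pc'; have := lo c' Pc'; have := szn c' Pc'; have := big (Ps c' Pc').
have := szn c Pc; nia.
Qed.

Lemma cyc_spec_max (P : 'I_n -> pred (seq 'I_n)) (best : nat -> nat) :
  (forall u : 'I_n, cyc_spec (P u) (best u)) ->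
  cyc_spec (fun c => [exists u, P u c]) (\max_(u < n) best u).
Proof.
move=> H; split=> [c /existsP[u Pc]|b0].
  by apply: leq_trans (leq_bigmax u); exact: (H u).1.
have n0 : 0 < #|'I_n|.
  by rewrite card_ord; case: (n) best b0 {H} => // best; rewrite big_ord0.
have [u E] := eq_bigmax (fun u : 'I_n => best u) n0.
have [|c Pc Ec] := (H u).2; first by rewrite -E.
by exists c; [apply/existsP; exists u|rewrite E].
Qed.

Lemma cyc_spec_eq (P Q : pred (seq 'I_n)) best : P =1 Q -> cyc_spec P best -> cyc_spec Q best.
Proof.
move=> PQ [h1 h2]; split=> [c|/h2[c]]; rewrite -?PQ; first exact: h1.
by exists c; rewrite -?PQ.
Qed.

(** A shortest path repeats no vertex, so closing it by an arc into [u] gives a simple cycle; it has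
    two vertices because there are no loops. Conversely the arc of a cycle into [u] shows that the
    maximum is large enough. *)
Lemma directed_cyc (u : 'I_n) : dir ->
  cyc_spec (fun c => simple_cycle G c && (u \in c))
    (\max_(e < mA | hd e == u) (Pr u (tl e) - awt e)).
Proof.
move=> d; split=> [c /andP[/and3P[cc uc sc] uin]|b0].
  have [p [_ up Ec Es Ew]] := cycle_weightE G uc uin.
  move: cc; rewrite Ec /= rcons_path => /andP[pp /arc2[e [e0 te he we]]].
  have em : e < mA by case/andP: e0.
  have [es [ch se wes]] := path_chain pp.
  have hee : hd (Ordinal em) == u by rewrite /= he.
  apply: leq_trans (leq_bigmax_cond (Ordinal em) hee).
  have := chain_Pr aok ch.
  rewrite /= te (Hwt e0) we Ew -cats1 pathw_cat /= addn0 Es /=.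
  by rewrite wes mulnDr; lia.
have [/(_ (leqnn _))[e [em /eqP he /= ge]] _] := bigmax_geP mA (fun e => hd e == u) (fun e => Pr u (tl e) - awt e) b0.
set best := \max_(e < mA | _) _ in b0 ge *.
have le : Pr u (tl e) - awt e <= best.
  have hee : hd (Ordinal em) == u by rewrite /= he.
  exact: (leq_bigmax_cond (Ordinal em) hee).
have P0 : 0 < Pr u (tl e) by lia.
have [es o] := opt_ex aok P0.
have [ch w _] := o; have [|p [mp pp sp wp]] := chain_path ch; first lia.
have uo := opt_uniq o; rewrite -mp -[X in X :: _]/(val u) -map_cons (map_inj_uniq val_inj) in uo.
have e0 : 0 < e < mA.
  rewrite em andbT lt0n; apply/eqP => e0; rewrite e0 in ge.
  have := Pr_INF aok u (tl 0); lia.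
have [x [y [axy tx hy we]]] := arc1 e0.
have yu : y = u by apply: val_inj; rewrite /= -hy.
have lx : last u p = x.
  apply: val_inj; rewrite /= -tx -(chain_end ch) /cend -mp.
  by symmetry; exact: (last_map val p u).
rewrite yu in axy we.
have cyc : cycle (adj G) (u :: p) by rewrite /= rcons_path pp lx.
have sz : 1 < size (u :: p).
  by case: (p) lx => //= xu; move: axy; rewrite -xu adj_irrefl.
exists (u :: p); first by rewrite mem_head andbT /simple_cycle cyc uo d.
have [q [_ uq _ _ Ew]] := cycle_weightE G uo (mem_head u p).
have -> : cycle_weight G (u :: p) = pathw u (rcons p u).
  by rewrite /cycle_weight /= (sum_next_at (wt G) u uo).
rewrite -cats1 pathw_cat /= addn0 lx -we mulnDr.
by rewrite (Hwt e0) in ge le; lia.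
Qed.

Lemma leq_sub_split I a b w p1 p2 t : I - a <= p1 -> I - b <= p2 -> a + w + b <= t ->
  I - t <= p1 + p2 - I - w.
Proof. lia. Qed.

Section Undirected.
Hypothesis und : ~~ dir.

Let asym : symmetric (adj G). Proof. exact: adj_sym und. Qed.

Let size3 : (if dir then 2 else 3) = 3. Proof. by rewrite (negbTE und). Qed.

Lemma last_rev_belast (T : Type) (y : T) p : last (last y p) (rev (belast y p)) = y.
Proof. by elim: p y => //= z p IH y; rewrite rev_cons last_rcons. Qed.

Lemma pathw_rev (u : 'I_n) p : path (adj G) u p ->
  pathw (last u p) (rev (belast u p)) = pathw u p.
Proof.
elim: p u => //= y p IH u /andP[uy py].
rewrite rev_cons -cats1 pathw_cat IH // last_rev_belast /= addn0 addnC.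
by rewrite (wt_sym und) 1?asym.
Qed.

Lemma path_rev_sym (u : 'I_n) p : path (adj G) u p -> path (adj G) (last u p) (rev (belast u p)).
Proof. by rewrite rev_path => pp; rewrite (eq_path (e' := adj G)) // => x y; exact: asym. Qed.

Lemma Pr_path (u : 'I_n) p : path (adj G) u p ->
  INF - (SC * pathw u p + size p) <= Pr u (last u p).
Proof. by move=> /path_chain[es [ch se <-]]; exact (chain_Pr aok ch). Qed.

Lemma Pr_sym (u v : 'I_n) : Pr u v = Pr v u.
Proof.
suff le (x y : 'I_n) : Pr x y <= Pr y x by apply/eqP; rewrite eqn_leq !le.
case: (posnP (Pr x y)) => [->//|/(opt_ex aok)[es [ch w P0]]].
have [|p [mp pp sp wp]] := chain_path ch; first lia.
have lp : last x p = y.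
  apply: val_inj; rewrite /= -(chain_end ch) /cend -mp.
  by symmetry; exact: (last_map val p x).
have := Pr_path (path_rev_sym pp).
by rewrite last_rev_belast pathw_rev // size_rev size_belast lp; lia.
Qed.

Variables (u : 'I_n) (par lab : nat -> nat).
Hypothesis parP : forall x, x < n -> x != u -> 0 < Pr u x ->
  exists e, [/\ e < mA, hd e = x, par x = tl e & Pr u (tl e) = Pr u x + awt e].
Hypothesis labP : forall x, x < n -> x != u -> 0 < Pr u x ->
  lab x = if par x == u then x else lab (par x).

(** [lab x] names the child of [u] whose subtree contains [x]. The induction is on [INF - Pr u x],
    which decreases strictly towards the root. *)
Lemma tree_path (x : 'I_n) : x != u -> 0 < Pr u x -> exists q : seq 'I_n,
  [/\ path (adj G) x (rcons q u), lab x = last x q,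
      uniq (x :: q), u \notin x :: q &
  [/\ {in x :: q, forall z : 'I_n, lab z = lab x},
      {in x :: q, forall z : 'I_n, Pr u x <= Pr u z} &
      SC * pathw x (rcons q u) + size (x :: q) + Pr u x = INF]].
Proof.
move: {2}(INF - Pr u x) (leqnn (INF - Pr u x)) => k.
elim: k x => [|k IH] x kx xu Px.
  have [e [em he _ E]] := parP (ltn_ord x) xu Px.
  by have := Pr_INF aok u (tl e); have := wt_gt0 aok em; lia.
have [e [em he pe E]] := parP (ltn_ord x) xu Px.
have PI := Pr_INF aok u (tl e).
have e0 : 0 < e < mA by rewrite em andbT lt0n; apply/eqP => e0; move: E PI; rewrite e0; lia.
have [y [x' [ayx te he' we]]] := arc1 e0.
have E' : x' = x by apply: val_inj; rewrite /= -he'.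
subst x'; have lx := labP (ltn_ord x) xu Px.
rewrite te in pe E; rewrite pe in lx.
have wxy : wt G x y = wt G y x by rewrite (wt_sym und) // asym.
have aw := Hwt e0.
case: (eqVneq y u) => [yu|yu].
  move: lx; rewrite yu eqxx => lx; rewrite yu in ayx we wxy E.
  exists [::]; rewrite /= asym ayx /= inE eq_sym xu; split=> //; split.
  - by move=> z; rewrite inE => /eqP ->.
  - by move=> z; rewrite inE => /eqP ->.
  - by move: E; rewrite (Pr_refl aok) wxy -we; nia.
have yu' : (y : nat) == u = false by apply: negbTE.
rewrite yu' in lx.
have wt0 := wt_gt0 aok em.
have [||q [pq ly uq nu [lq Pq w]]] := IH y _ yu; try lia.
exists (y :: q); split.
- by rewrite /= asym ayx.
- by rewrite lx ly.
- rewrite cons_uniq uq andbT; apply/negP => /Pq; lia.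
- by rewrite inE negb_or eq_sym xu.
split=> [z|z|].
- by rewrite inE => /orP[/eqP -> //|/lq ->].
- by rewrite inE => /orP[/eqP -> //|/Pq]; lia.
- by rewrite /= mulnDr wxy -we; move: w => /=; nia.
Qed.

(** The root has no label. An edge at [u] is compared through its other end: it qualifies if that
    end is not its own label, that is, not a child of [u]. *)
Definition lcond e := (if tl e == u then hd e else lab (tl e)) !=
                      (if hd e == u then tl e else lab (hd e)).

(** A discrete intermediate value argument: labels change between two neighbours, or the last equals
    the first. *)
Lemma und_split (v : 'I_n) q : u \notin v :: q ->
  (exists p1 y p2, [/\ q = p1 ++ y :: p2 & lab (last v p1) != lab y]) \/
  lab (last v q) = lab v.
Proof.
elim: q v => [|y q IH] v nu; first by right.
case: (eqVneq (lab v) (lab y)) => [E|E]; last by left; exists [::], y, q.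
have [|[p1 [z [p2 [-> ne]]]]|->] := IH y.
- by apply: contra nu => h; rewrite inE h orbT.
- by left; exists (y :: p1), z, p2.
- by right.
Qed.

(** If the labels are constant along a cycle without [u], the common label cannot equal both
    neighbours of [u], which differ as the cycle has three vertices; the edge to one of them then
    qualifies. Conversely a qualifying edge closes tree paths that meet only in [u], and their
    weight is read off the profits. *)
Lemma und_cyc : cyc_spec (fun c => simple_cycle G c && (u \in c))
  (\max_(e < mA | lcond e) (Pr u (tl e) + Pr u (hd e) - INF - awt e)).
Proof.
split=> [c /andP[/and3P[cc uc sc] uin]|b0].
  have [p [_ up Ec Es Ew]] := cycle_weightE G uc uin.
  rewrite size3 Es in sc; rewrite Ec /= in cc.
  have nu : u \notin p by case/andP: up.
  have vneq (x y : 'I_n) : ((x : nat) == y) = (x == y) by [].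
  have [p1 [y [p2 [Ep co]]]] : exists p1 y p2, rcons p u = p1 ++ y :: p2 /\
     ((if last u p1 == u then y : nat else lab (last u p1)) !=
      (if y == u then last u p1 : nat else lab y)).
    case: p up {Ec Es Ew cc} nu sc => // v q up nu sc.
    have vu : v != u by move: nu; rewrite inE negb_or eq_sym => /andP[].
    have lu : last v q != u by apply: contraNneq nu => <-; exact: mem_last.
    case: (eqVneq (lab v) v) => [lv|lv]; last first.
      by exists [::], v, (rcons q u); rewrite /= eqxx (negbTE vu); split=> //; rewrite eq_sym.
    have [[p1 [y [p2 [Eq ne]]]]|E] := und_split nu.
      exists (v :: p1), y, (rcons p2 u); rewrite /= Eq rcons_cat; split=> //.
      have yin : y \in q by rewrite Eq mem_cat mem_head orbT.
      have yu : y != u by apply: contraNneq nu => <-; rewrite inE yin orbT.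
      have l1 : last v p1 != u.
        apply: contraNneq nu => <-; rewrite Eq; have := mem_last v p1.
        by rewrite !inE mem_cat => /orP[->//|->]; rewrite orbT.
      by rewrite (negbTE l1) (negbTE yu).
    exists (v :: q), u, [::]; rewrite -cats1 eqxx /= (negbTE lu); split=> //.
    rewrite E lv; apply: contraTneq up => lvq.
    have : last v q = v by apply: val_inj.
    case: (q) sc => // z q' _ /= lz; have vin : v \in z :: q' by rewrite -lz mem_last.
    by rewrite vin /= andbF.
  have pu : path (adj G) u (p1 ++ y :: p2) by rewrite -Ep.
  move: pu; rewrite cat_path /= => /and3P[pp1 /[dup] axy /arc2[e [e0 te he we]] pp2].
  have em : e < mA by case/andP: e0.
  have le : lcond (Ordinal em) by rewrite /lcond /= te he !vneq.
  apply: leq_trans (leq_bigmax_cond (Ordinal em) le); rewrite /= te he.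
  have lst : last y p2 = u by have := congr1 (last u) Ep; rewrite last_rcons last_cat /=.
  have := Pr_path pp2; rewrite lst (Pr_sym y u) => h2; apply: leq_sub_split (Pr_path pp1) h2 _.
  have := congr1 size Ep; rewrite size_rcons size_cat /= => sp.
  rewrite Ew Es /= sp Ep pathw_cat /= (Hwt e0) we; clear; rewrite !mulnDr (mulnC SC (wt _ _ _)); lia.
have [/(_ (leqnn _))[e [em co /= ge]] _] := bigmax_geP mA lcond (fun e => Pr u (tl e) + Pr u (hd e) - INF - awt e) b0.
set best := \max_(e < mA | _) _ in b0 ge *.
have le : Pr u (tl e) + Pr u (hd e) - INF - awt e <= best by exact: (leq_bigmax_cond (Ordinal em) co).
have I1 := Pr_INF aok u (tl e); have I2 := Pr_INF aok u (hd e).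
have e0 : 0 < e < mA.
  by rewrite em andbT lt0n; apply/eqP => e0; rewrite e0 in ge I1 I2; lia.
have [x [y [axy te he we]]] := arc1 e0.
have aw := Hwt e0; rewrite te he in le ge I1 I2.
have xyn : x != y by apply: contraTneq axy => ->; rewrite adj_irrefl.
have Px : 0 < Pr u x by lia.
have Py : 0 < Pr u y by lia.
(* The edge from [u] to [z] closes the tree path of [z]; since [lab z != z] this path has an inner
   vertex, so the cycle has at least three. *)
have one (z : 'I_n) : z != u -> 0 < Pr u z -> adj G u z -> lab z != z ->
  exists2 c, simple_cycle G c && (u \in c) & SC * (cycle_weight G c) + size c + (Pr u z) = INF + SC * wt G u z + 1.
  move=> zu Pz auz lz; have [q [pq lq uq nuq [_ _ w]]] := tree_path zu Pz.
  have uu : uniq (u :: z :: q) by rewrite cons_uniq nuq.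
  exists (u :: z :: q); last first.
    rewrite /cycle_weight [\sum_(x <- _) _](sum_next_at (wt G) u uu) /=.
    by rewrite mulnDr; move: w => /=; clear; lia.
  rewrite mem_head andbT /simple_cycle uu size3 /= auz pq /=.
  by case: (q) lq lz => //= ->; rewrite eqxx.
move: co; rewrite /lcond te he; case: (eqVneq (x : nat) u) => xu.
  have {}xu : x = u by exact: val_inj.
  subst x; have yu : (y : nat) == u = false by apply/negbTE; rewrite eq_sym in xyn.
  rewrite yu => ly.
  have [||||c cP E] := one y; rewrite // 1?eq_sym //.
  exists c => //; move: ge le; rewrite (Pr_refl aok) addKn aw we; lia.
case: (eqVneq (y : nat) u) => yu lxy.
  have {}yu : y = u by exact: val_inj.
  subst y.
  have [||||c cP E] := one x; rewrite // 1?asym //.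
  exists c => //; move: ge le; rewrite (Pr_refl aok) addnK aw we (wt_sym und axy); lia.
have [q [pq lq uq nuq [Lq _ w]]] := tree_path (xu : x != u) Px.
have [r [pr lr ur nur [Lr _ w']]] := tree_path (yu : y != u) Py.
(* Labels are constant on each tree path and differ between the two, so the paths share no vertex
   besides [u]. *)
have dj : ~~ has (mem (rev (x :: q))) (y :: r).
  apply/hasPn => z zr; rewrite /= mem_rev; apply/negP => zq.
  by case/negP: lxy; rewrite -(Lq _ zq) -(Lr _ zr).
have uu : uniq (u :: rev (x :: q) ++ y :: r).
  by rewrite cons_uniq mem_cat mem_rev negb_or nuq nur cat_uniq rev_uniq uq ur dj.
have back : path (adj G) u (rev (x :: q)).
  have := path_rev_sym pq; rewrite last_rcons (_ : belast x (rcons q u) = x :: q) //.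
  by rewrite belast_rcons.
have lback : last u (rev (x :: q)) = x by rewrite rev_cons last_rcons.
have wback : pathw u (rev (x :: q)) = pathw x (rcons q u).
  by have := pathw_rev pq; rewrite last_rcons belast_rcons.
exists (u :: rev (x :: q) ++ y :: r).
  rewrite mem_head andbT /simple_cycle uu size3 /= rcons_cat cat_path back lback /=.
  by rewrite axy pr /= size_cat size_rev /=; clear; lia.
rewrite /cycle_weight [\sum_(x <- _) _](sum_next_at (wt G) u uu) rcons_cat pathw_cat wback lback /=.
rewrite size_cat size_rev /=; move: b0 ge le w w' => /=.
rewrite aw we !mulnDr (mulnC SC (wt _ _ _)).
move: best (SC * _) (SC * _) (wt _ _ _ * _) (Pr _ _) (Pr _ _) (size q) (size r); clear; lia.
Qed.

End Undirected.

End Cycles.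

End Cycles.

(** * Program logic with time and work bounds *)

Module Hoare.
Import Language Expressions Spawning Simulation Compiler Profits.

Declare Scope ex_scope.
Delimit Scope ex_scope with ex.
Bind Scope ex_scope with expr.
Arguments EG a%_nat_scope e%_ex_scope.
Arguments EI c%_ex_scope x%_ex_scope y%_ex_scope : rename.
Arguments Asg x%_nat_scope e%_ex_scope.
Arguments Lg x%_nat_scope e%_ex_scope.
Arguments Par a%_nat_scope P%_ex_scope idx%_ex_scope v%_ex_scope.
Notation "'$' x" := (EV x) (at level 2, x at level 1, format "'$' x") : ex_scope.
Notation "'#' k" := (EC k) (at level 2, k at level 1, format "'#' k") : ex_scope.
Notation "a + b" := (EB Add a b) : ex_scope.
Notation "a - b" := (EB Defs.Sub a b) : ex_scope.
Notation "a * b" := (EB Mul a b) : ex_scope.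
Notation "a %/ b" := (EB Div a b) : ex_scope.

Definition emod (a b : expr) : expr := (a - a %/ b * b)%ex.
Definition ELt (a b x y : expr) : expr := EI (b - a)%ex x y.
Definition EEq (a b x y : expr) : expr := EI ((a - b) + (b - a))%ex y x.
Definition emax2 (a b : expr) : expr := ELt a b b a.
Notation "a %% b" := (emod a b) : ex_scope.
Notation "c1 ;; c2" := (Seq c1 c2) (at level 100, right associativity).

Lemma ev_mod s i a b : ev s i (emod a b) = ev s i a %% ev s i b.
Proof. by rewrite /= {1}(divn_eq (ev s i a) (ev s i b)) addKn. Qed.

Lemma ev_ELt s i a b x y : ev s i (ELt a b x y) =
  if ev s i a < ev s i b then ev s i x else ev s i y.
Proof. by rewrite /= subn_eq0 ltnNge; case: leqP. Qed.

Lemma ev_EEq s i a b x y : ev s i (EEq a b x y) =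
  if ev s i a == ev s i b then ev s i x else ev s i y.
Proof. by rewrite /= addn_eq0 !subn_eq0 -eqn_leq. Qed.

Lemma ev_max s i a b : ev s i (emax2 a b) = maxn (ev s i a) (ev s i b).
Proof. exact: ev_ELt. Qed.

Lemma ev_EG s i a e : ev s i (EG a e) = A s a (ev s i e). Proof. by []. Qed.
Lemma ev_add s i a b : ev s i (a + b)%ex = ev s i a + ev s i b. Proof. by []. Qed.
Lemma ev_sub s i a b : ev s i (a - b)%ex = ev s i a - ev s i b. Proof. by []. Qed.
Lemma ev_mul s i a b : ev s i (a * b)%ex = ev s i a * ev s i b. Proof. by []. Qed.
Lemma ev_div s i a b : ev s i (a %/ b)%ex = ev s i a %/ ev s i b. Proof. by []. Qed.
Lemma ev_V s i x : ev s i (EV x) = rg s x. Proof. by []. Qed.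
Lemma ev_C s i x : ev s i (EC x) = x. Proof. by []. Qed.
Lemma ev_X s i : ev s i EX = i. Proof. by []. Qed.
Lemma ev_I s i c a b : ev s i (EI c a b) = if ev s i c == 0 then ev s i b else ev s i a.
Proof. by []. Qed.
Definition evE := (ev_mod, ev_max, ev_ELt, ev_EEq, ev_EG, ev_add, ev_sub, ev_mul,
  ev_div, ev_V, ev_C, ev_X, ev_I).

(* Expressions whose value is at most that of a variable, a cell or a literal. *)
Fixpoint small (e : expr) : bool :=
  match e with
  | EC k => k <= 64
  | EV _ | EG _ _ => true
  | EX => false
  | EB Defs.Sub a _ => small a
  | EB Div a _ => small a
  | EB _ _ _ => false
  | EI _ a b => small a && small b
  end.

Lemma rg_setv s x v y : rg (setv s x v) y = if y == x then v else rg s y.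
Proof. by []. Qed.

(* [s'] agrees with [s] outside the variables [V] and the arrays [B]. *)
Definition fr (V B : seq nat) (s s' : state) : Prop :=
  (forall x, x \notin V -> rg s' x = rg s x) /\
  (forall a i, 0 < a <= 64 -> a \notin B -> A s' a i = A s a i).

Definition good (c : cmd) : bool :=
  [&& wf c, 0 \notin wrV c, 0 \notin wrA c & all (fun b => b <= 64) (wrA c)].

Lemma fr_run c s : good c -> fr (wrV c) (wrA c) s (run c s).
Proof.
case/and4P=> w v0 a0 al; split=> [x|a i /andP[a1 a64] an]; first exact: run_rg.
by apply: run_A => //=; rewrite a64.
Qed.

Lemma fr_trans V B V' B' s s' s'' : fr V B s s' -> fr V' B' s' s'' ->
  fr (V ++ V') (B ++ B') s s''.
Proof.
move=> [f1 f2] [f3 f4]; split=> [x|a i a0]; rewrite mem_cat negb_or => /andP[h1 h2].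
  by rewrite f3 ?f1.
by rewrite f4 ?f2.
Qed.

Section Hoare.
Variables X LP : nat.
Hypotheses (X64 : 64 <= X) (LX : 2 ^ LP <= X).

Lemma smallP s i e : bd X s -> small e -> ev s i e <= X.
Proof.
move=> [b1 b2]; elim: e => [k|x||o a IHa b IHb|a e _|c IHc a IHa b IHb] /=.
- by move=> k64; apply: leq_trans X64.
- by move=> _; exact: b1.
- by [].
- case: o => //= /IHa h; first by apply: leq_trans (leq_subr _ _) h.
  by apply: leq_trans (leq_div _ _) h.
- by move=> _; exact: b2.
- by case/andP=> /IHa ha /IHb hb; case: ifP.
Qed.

(** A total correctness triple for one initial state. Boundedness of the state is a premise and no
    part of the conclusion, because [bd_run] carries it through every [ok] command. *)
Variant hr (c : cmd) (s : state) (t w : nat) (Q : state -> Prop) : Prop :=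
  Hr of bd X s -> [/\ ok X LP c s, tau c s <= t, omg c s <= w & Q (run c s)].

Lemma hr_weak c s t w t' w' (Q Q' : state -> Prop) :
  hr c s t w Q -> t <= t' -> w <= w' -> (forall s', Q s' -> Q' s') -> hr c s t' w' Q'.
Proof.
case=> h tt ww QQ; split=> /h[o h1 h2 /QQ h3].
by split=> //; [apply: leq_trans tt|apply: leq_trans ww].
Qed.

(** The second command also receives the frame of the first, so an intermediate postcondition speaks
    only of what has changed. *)
Lemma hr_seq c1 c2 s t1 w1 t2 w2 (Q1 Q : state -> Prop) : good c1 ->
  hr c1 s t1 w1 Q1 ->
  (forall s1, fr (wrV c1) (wrA c1) s s1 -> Q1 s1 -> hr c2 s1 t2 w2 Q) ->
  hr (Seq c1 c2) s (t1 + t2) (w1 + w2) Q.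
Proof.
move=> g [h1] h2; split=> b; have [o1 a1 a2 q1] := h1 b.
have [h3] := h2 _ (fr_run s g) q1; have [o2 b1 b2 q2] := h3 (bd_run LX b o1).
by split=> //=; apply: leq_add.
Qed.

Lemma hr_asg x e s (Q : state -> Prop) : (bd X s -> ev s 0 e <= X) ->
  Q (setv s x (ev s 0 e)) -> hr (Asg x e) s 1 1 Q.
Proof. by move=> h q; split=> b; split=> //=; exact: h. Qed.

Lemma hr_lg x e s (Q : state -> Prop) : ev s 0 e <= 2 ^ LP ->
  Q (setv s x (up_log 2 (ev s 0 e))) -> hr (Lg x e) s 1 1 Q.
Proof. by move=> h q; split. Qed.

Lemma hr_par a P idx v s p (Q : state -> Prop) : 0 < a <= 64 ->
  ev s 0 P = p -> 0 < p -> (bd X s -> forall i, i < p -> ev s i v <= X) ->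
  (forall i j, i < p -> j < p -> ev s i idx = ev s j idx -> i = j) ->
  (forall s', rg s' =1 rg s -> (forall i, i < p -> A s' a (ev s i idx) = ev s i v) ->
    (forall j, (forall i, i < p -> j != ev s i idx) -> A s' a j = A s a j) ->
    (forall b j, 0 < b <= 64 -> b != a -> A s' b j = A s b j) -> Q s') ->
  hr (Par a P idx v) s 1 p Q.
Proof.
move=> a64 EP p0 vX inj q; split=> b; rewrite /= EP; split=> //.
  by split=> //; exact: vX.
have adE x y c : 0 < c <= 64 -> ad (rg s 0) c x = ad (rg s 0) a y -> c = a /\ x = y.
  by case: c a a64 {EP vX inj q} => // c [//|a] a64 c64 /=; lia.
apply: q => //= [i ip|j jn|c j c64 ca]; rewrite /A /=.
- exact: pwr_at.
- by apply: pwr_out => i ip; apply/eqP => /(adE _ _ _ a64)[_] /eqP; apply/negP; exact: jn.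
- by apply: pwr_out => i ip; apply/eqP => /(adE _ _ _ c64)[/eqP]; rewrite (negbTE ca).
Qed.

Lemma hr_map a P v s p (Q : state -> Prop) : 0 < a <= 64 ->
  ev s 0 P = p -> 0 < p -> (bd X s -> forall i, i < p -> ev s i v <= X) ->
  (forall s', rg s' =1 rg s -> (forall i, A s' a i = if i < p then ev s i v else A s a i) ->
    (forall b j, 0 < b <= 64 -> b != a -> A s' b j = A s b j) -> Q s') ->
  hr (Par a P EX v) s 1 p Q.
Proof.
move=> a64 EP p0 vX q; apply: hr_par => // s' h1 h2 h3 h4; apply: q => // i.
by case: ifP => ip; [exact: h2|apply: h3 => j jp /=; apply: contraFneq ip => ->].
Qed.

Lemma hr_map1 a P v s p : 0 < a <= 64 ->
  ev s 0 P = p -> 0 < p -> (bd X s -> forall i, i < p -> ev s i v <= X) ->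
  hr (Par a P EX v) s 1 p
    (fun s' => forall i, A s' a i = if i < p then ev s i v else A s a i).
Proof. by move=> *; apply: hr_map. Qed.

Lemma hr_asg1 x e s : (bd X s -> ev s 0 e <= X) ->
  hr (Asg x e) s 1 1 (eq (setv s x (ev s 0 e))).
Proof. by move=> h; apply: hr_asg. Qed.

Lemma hr_for x y c s n t w (I : nat -> state -> Prop) (Q : state -> Prop) :
  good (For x y c) -> rg s y = n -> I 0 s ->
  (forall k s', k < n -> fr (x :: wrV c) (wrA c) s s' -> I k s' ->
     hr c (setv s' x k) t w (I k.+1)) ->
  (forall s', fr (x :: wrV c) (wrA c) s s' -> I n s' -> Q (setv s' x n)) ->
  hr (For x y c) s (n * t.+1).+1 (n * w.+1).+1 Q.
Proof.
move=> g En I0 Is q; split=> b; have := g => /and4P[/= /and4P[xc yc xy wc] v0 a0 al].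
have gc : good c.
  by rewrite /good wc a0 al !andbT; move: v0; rewrite inE negb_or => /andP[].
have x0 : 0 != x by move: v0; rewrite inE negb_or => /andP[].
have H k : k <= n -> [/\ bd X (lp x c s k), fr (x :: wrV c) (wrA c) s (lp x c s k),
     I k (lp x c s k) & forall j, j < k -> [/\ ok X LP c (setv (lp x c s j) x j),
       tau c (setv (lp x c s j) x j) <= t & omg c (setv (lp x c s j) x j) <= w]].
  elim: k => [_|k IH kn]; first by split.
  have [b' f' i' h'] := IH (ltnW kn).
  have bk : bd X (setv (lp x c s k) x k).
    by apply: bd_setv => //; rewrite ltnW // (leq_trans kn) // -En; case: b => b1 _; exact: b1.
  have [h1] := Is k _ kn f' i'; have [o1 t1 w1 q1] := h1 bk.
  split=> //.
  - by rewrite lpS; exact: (bd_run LX bk o1).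
  - have [g1 g2] := fr_run (setv (lp x c s k) x k) gc; have [f1 f2] := f'.
    split=> [z|a i a64 an]; last by rewrite lpS g2 // A_setv ?f2.
    rewrite inE negb_or => /andP[zx zc]; rewrite lpS g1 // rg_setv (negbTE zx) f1 //.
    by rewrite inE negb_or zx.
  - by move=> j; rewrite ltnS leq_eqVlt => /orP[/eqP ->|/h'].
have [b' f' i' h'] := H n (leqnn n).
split.
- by move=> k; rewrite En => /h'[].
- rewrite /= En ltnS; apply: leq_trans (_ : \sum_(k < n) t.+1 <= _).
    by apply: leq_sum => k _; rewrite ltnS; have [] := h' k (ltn_ord k).
  by rewrite sum_nat_const card_ord.
- rewrite /= En ltnS; apply: leq_trans (_ : \sum_(k < n) w.+1 <= _).
    by apply: leq_sum => k _; rewrite ltnS; have [] := h' k (ltn_ord k).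
  by rewrite sum_nat_const card_ord.
- by rewrite /= -/(lp x c s (rg s y)) En; exact: q.
Qed.

End Hoare.

End Hoare.

(** * Segmented prefix scans and lists of arcs with a common head *)

Module Scans.
Import Language Expressions Spawning Simulation Compiler Profits Hoare.

Notation vnv := 4 (only parsing).
Notation vmA := 5 (only parsing).
Notation vLG := 9 (only parsing).
Notation vkx := 30 (only parsing).
Notation vsh := 31 (only parsing).
Notation vbf := 32 (only parsing).
Notation vrd := 33 (only parsing).

Notation aW := 3 (only parsing).
Notation aX := 8 (only parsing).
Notation aY := 9 (only parsing).
Notation aS := 10 (only parsing).

Definition opE (b : bool) (x y : expr) : expr := if b then emax2 x y else (x + y)%ex.
Definition opb (b : bool) : nat -> nat -> nat := if b then maxn else addn.

(** Prefix maxima or sums in all rows of length [ln] at once, by windows of doubling length.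
    Comparing [EX %% ln] with the shift keeps a window from reaching into the previous row. *)
Definition scan (b : bool) (a : nat) (tot ln : expr) : cmd :=
  Asg vsh #1 ;;
  For vkx vLG
    (Par a tot EX (opE b (EG a EX)
       (ELt (EX %% ln) $vsh #0 (EG a (EX - $vsh))))%ex ;;
     Asg vsh ($vsh + $vsh)%ex).

Lemma ev_op s i b x y : ev s i (opE b x y) = opb b (ev s i x) (ev s i y).
Proof. by case: b; [exact: ev_max|]. Qed.

Lemma opb_window b (f : nat -> nat) j d : d <= j ->
  opb b (\big[opb b/0]_(j.+1 - d <= t < j.+1) f t)
        (\big[opb b/0]_((j - d).+1 - d <= t < (j - d).+1) f t) =
  \big[opb b/0]_(j.+1 - (d + d) <= t < j.+1) f t.
Proof.
move=> dj; have E : (j - d).+1 = j.+1 - d by lia.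
case: b => /=; rewrite E subnDA [RHS](big_cat_nat (n := j.+1 - d)) ?leq_subr //=.
  by rewrite maxnC.
by rewrite addnC.
Qed.

Lemma opb_le_full b (f : nat -> nat) m n :
  \big[opb b/0]_(m <= t < n) f t <= \big[opb b/0]_(0 <= t < n) f t.
Proof.
case: (leqP m n) => mn; last by rewrite big_geq ?leq0n // ltnW.
by case: b => /=; rewrite [X in _ <= X](big_cat_nat (n := m)) //= ?leq_maxr ?leq_addl.
Qed.

(* [e] has value [v] in any state that agrees with [s] outside [V] and [B]. *)
Definition cst (V B : seq nat) (s : state) (e : expr) (v : nat) : Prop :=
  forall s' i, fr V B s s' -> ev s' i e = v.

Lemma fr_refl V B s : fr V B s s. Proof. by []. Qed.

Lemma fr_sub V B V' B' s s' : all (mem V') V -> all (mem B') B -> fr V B s s' -> fr V' B' s s'.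
Proof.
move=> /allP VV /allP BB [f1 f2]; split=> [x xV|a i a0 aB].
  by apply: f1; apply: contra xV; exact: VV.
by apply: f2 => //; apply: contra aB; exact: BB.
Qed.

Lemma fr_setv V B s s' x v : x != 0 -> fr V B s s' -> fr (x :: V) B s (setv s' x v).
Proof.
move=> x0 [f1 f2]; split=> [y|a i a0 aB].
  by rewrite inE negb_or rg_setv => /andP[/negbTE -> yV]; exact: f1.
by rewrite A_setv 1?eq_sym // f2.
Qed.

Lemma good_par a P idx v : 0 < a <= 64 -> good (Par a P idx v).
Proof. by case: a => // a /andP[_ a64]; rewrite /good /= a64. Qed.

Lemma idx_lt h e H l : h < H -> e < l -> h * l + e < H * l.
Proof. by move=> hH el; have : h.+1 * l <= H * l by [rewrite leq_mul2r hH orbT]; rewrite mulSn; lia. Qed.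

Lemma idx_div h e l : e < l -> (h * l + e) %/ l = h.
Proof. by move=> el; rewrite divnMDl ?divn_small ?addn0 //; lia. Qed.

Lemma idx_mod h e l : e < l -> (h * l + e) %% l = e.
Proof. by move=> el; rewrite modnMDl modn_small. Qed.

Lemma div_lt i H l : i < H * l -> i %/ l < H.
Proof. by case: l => [|l] h; [rewrite muln0 in h|rewrite ltn_divLR]. Qed.

Lemma mod_lt i H l : i < H * l -> i %% l < l.
Proof. by case: l => [|l] h; [rewrite muln0 in h|rewrite ltn_mod]. Qed.

Section Macros.
Variables X LP : nat.
Hypotheses (X64 : 64 <= X) (LX : 2 ^ LP <= X).
Notation hr := (hr X LP).

Lemma scan_good b a tot ln : 0 < a <= 64 -> good (scan b a tot ln).
Proof. by case: a => // a /andP[_ a64]; rewrite /good /= a64. Qed.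

Lemma hr_scan b a tot ln s T l LG (Q : state -> Prop) : 0 < a <= 64 ->
  cst [:: vsh; vkx] [:: a] s tot T -> cst [:: vsh; vkx] [:: a] s ln l ->
  rg s vLG = LG -> 0 < T -> 0 < l -> l <= 2 ^ LG -> 2 ^ LG <= X ->
  (bd X s -> forall r j, j < l -> r * l + j < T ->
     \big[opb b/0]_(0 <= t < j.+1) A s a (r * l + t) <= X) ->
  (forall s', fr [:: vsh; vkx] [:: a] s s' ->
     (forall r j, j < l -> r * l + j < T ->
       A s' a (r * l + j) = \big[opb b/0]_(0 <= t < j.+1) A s a (r * l + t)) -> Q s') ->
  hr (scan b a tot ln) s (3 * LG + 2) ((T + 2) * LG + 2) Q.
Proof.
move=> a64 cT cl EL T0 l0 lLG LGX vX q; split=> bs.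
pose F k r j := \big[opb b/0]_(j.+1 - 2 ^ k <= t < j.+1) A s a (r * l + t).
pose I k s' := rg s' vsh = 2 ^ k /\ fr [:: vsh; vkx] [:: a] s s' /\
  forall r j, j < l -> r * l + j < T -> A s' a (r * l + j) = F k r j.
have step k s' : k < LG -> I k s' ->
   hr (Par a tot EX (opE b (EG a EX) (ELt (EX %% ln) $vsh #0 (EG a (EX - $vsh))))%ex ;;
     Asg vsh ($vsh + $vsh)%ex) (setv s' vkx k) (1 + 1) (T + 1) (I k.+1).
  move=> kL [Esh [f0 AF]]; set s1 := setv s' vkx k.
  have f1 : fr [:: vsh; vkx] [:: a] s s1.
    by apply: fr_sub (fr_setv k (isT : vkx != 0) f0); rewrite /= ?mem_head.
  have val i : i < T -> ev s1 i (opE b (EG a EX) (ELt (EX %% ln) $vsh #0 (EG a (EX - $vsh))))%ex = F k.+1 (i %/ l) (i %% l).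
    move=> iT; rewrite ev_op !evE (cl s1 i f1) rg_setv /= Esh !A_setv //.
    rewrite {1}(divn_eq i l) AF ?ltn_mod -?divn_eq //.
    rewrite /F expnS mul2n -addnn; case: ltnP => cmp.
      rewrite (_ : opb b _ 0 = \big[opb b/0]_((i %% l).+1 - 2 ^ k <= t < (i %% l).+1) A s a (i %/ l * l + t)); last first.
        by case: (b); rewrite /= ?maxn0 ?addn0.
      by congr bigop.body; congr index_iota; lia.
    have -> : i - 2 ^ k = i %/ l * l + (i %% l - 2 ^ k) by rewrite {1}(divn_eq i l) addnBA.
    rewrite AF; first exact: opb_window.
      by apply: leq_ltn_trans (leq_subr _ _) _; rewrite ltn_mod.
    by apply: leq_ltn_trans iT; rewrite {3}(divn_eq i l) leq_add2l leq_subr.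
  apply: (hr_seq LX) => //; first exact: good_par.
    apply: (hr_map1 X64 LX (p := T)) => //; first exact: (cT _ _ f1).
    move=> _ i iT; rewrite val //; apply: leq_trans (opb_le_full _ _ _ _) _.
    by apply: vX => //; rewrite ?ltn_mod -?divn_eq.
  move=> s2 f12 A2; have R2 : rg s2 =1 rg s1 by move=> x; exact: f12.1.
  apply: hr_asg.
    move=> _; rewrite !evE !R2 /s1 rg_setv /= Esh addnn -mul2n -expnS.
    by apply: leq_trans LGX; rewrite leq_pexp2l.
  split; first by rewrite rg_setv eqxx !evE !R2 /s1 rg_setv /= Esh addnn -mul2n -expnS.
  split.
    apply: fr_sub (fr_setv _ (isT : vsh != 0) (fr_trans f1 f12)); rewrite /= ?mem_head //.
  move=> r j jl rT; rewrite A_setv // A2 rT val //.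
  by rewrite divnMDl // (divn_small jl) addn0 modnMDl (modn_small jl).
have h : hr (scan b a tot ln) s (1 + (LG * 3).+1) (1 + (LG * (T + 1).+1).+1) Q.
  apply: (hr_seq LX) => //.
    by apply: hr_asg1 => /= _; lia.
  move=> s1 _ <-; apply: (hr_for LX (n := LG) (I := I)) => //=.
  - by case: (a) a64 => // a' /andP[_ h]; rewrite /good /= h.
  - split; first by rewrite rg_setv /= expn0.
    split; first by apply: fr_sub (fr_setv _ (isT : vsh != 0) (fr_refl [::] [::] s)).
    move=> r j jl rT; rewrite A_setv // /F expn0 subSS subn0.
    by case: (b); rewrite big_nat1.
  - by move=> k s' kL _ Ik; exact: step.
  - move=> s' _ [Esh [f0 AF]]; apply: q.
      by apply: fr_sub (fr_setv _ (isT : vkx != 0) f0); rewrite /= ?mem_head.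
    move=> r j jl rT; rewrite A_setv // AF // /F.
    by rewrite (eqP (_ : j.+1 - 2 ^ LG == 0)) // subn_eq0; apply: leq_trans lLG.
have [|||hh] := @hr_weak _ _ _ _ _ _ (3 * LG + 2) ((T + 2) * LG + 2) _ Q h; try lia; last exact: hh.
by [].
Qed.

Lemma hr_scan1 b a tot ln s T l LG : 0 < a <= 64 ->
  cst [:: vsh; vkx] [:: a] s tot T -> cst [:: vsh; vkx] [:: a] s ln l ->
  rg s vLG = LG -> 0 < T -> 0 < l -> l <= 2 ^ LG -> 2 ^ LG <= X ->
  (bd X s -> forall r j, j < l -> r * l + j < T ->
     \big[opb b/0]_(0 <= t < j.+1) A s a (r * l + t) <= X) ->
  hr (scan b a tot ln) s (5 * LG.+1) (5 * LG.+1 * T) (fun s' =>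
     forall r j, j < l -> r * l + j < T ->
       A s' a (r * l + j) = \big[opb b/0]_(0 <= t < j.+1) A s a (r * l + t)).
Proof.
move=> a64 cT cl EL T0 l0 lL LX' vX.
have h := hr_scan a64 cT cl EL T0 l0 lL LX' vX (fun s' _ h => h).
apply: (hr_weak h) => //; first lia.
by move: T0; clear; nia.
Qed.

End Macros.

Section Pointers.
Variables (mA : nat) (hd : nat -> nat).

(** Arcs with the same head form a list from the last one backwards, ended by arc 0, which is fixed
    by [prevf]. A maximum over the arcs into a vertex, whose number varies, thus becomes a maximum
    along a list, suited to pointer doubling. *)
Definition prevf (e : nat) : nat := \max_(e' < e | hd e' == hd e) e'.
Definition lastf (v : nat) : nat := \max_(e < mA | hd e == v) e.

Lemma prevf_le e : prevf e <= e.-1.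
Proof. by apply/bigmax_leqP => i _; have := ltn_ord i; lia. Qed.

Lemma prevf_hd e : 0 < prevf e -> hd (prevf e) = hd e.
Proof.
move=> p0; have [/(_ (leqnn _))[i [ie /eqP hi le]] _] := bigmax_geP e (fun e' => hd e' == hd e) id p0.
suff -> : prevf e = i by [].
apply/eqP; rewrite eqn_leq le /=.
have hi' : hd (Ordinal ie) == hd e by apply/eqP.
exact: (leq_bigmax_cond (Ordinal ie) hi').
Qed.

Lemma iter_prev_cover d e e0 : 0 < e -> e <= e0 -> hd e = hd e0 -> e0 - e <= d ->
  exists2 j, j <= d & iter j prevf e0 = e.
Proof.
elim: d e0 => [|d IH] e0 e1 le he ld; first by exists 0 => //=; lia.
have [->|ne] := eqVneq e e0; first by exists 0.
have lt : e < e0 by lia.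
have hi : hd (Ordinal lt) == hd e0 by apply/eqP.
have ep : e <= prevf e0 := leq_bigmax_cond (Ordinal lt) hi.
have := prevf_le e0 => pl.
have [||j jd E] := IH (prevf e0) e1 ep; rewrite ?prevf_hd //; try lia.
by exists j.+1; rewrite ?iterSr.
Qed.

Lemma iter_prev_hd j e : 0 < iter j prevf e -> hd (iter j prevf e) = hd e.
Proof.
elim: j => //= j IH h; rewrite prevf_hd // IH //.
by have := prevf_le (iter j prevf e); lia.
Qed.

Lemma iter_prev_le j e : iter j prevf e <= e.
Proof. by elim: j => //= j IH; have := prevf_le (iter j prevf e); lia. Qed.

Lemma lastf_hd v : 0 < lastf v -> hd (lastf v) = v.
Proof.
move=> l0; have [/(_ (leqnn _))[i [im /eqP hi le]] _] := bigmax_geP mA (fun e => hd e == v) id l0.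
have hi' : hd (Ordinal im) == v by apply/eqP.
have le2 : i <= lastf v := leq_bigmax_cond (Ordinal im) hi'.
by have -> : lastf v = i by apply/eqP; rewrite eqn_leq le.
Qed.

(** Once the list is exhausted the pointer stays at arc 0, which contributes nothing by [F 0 = 0];
    any [n >= mA] therefore gives the same maximum. *)
Lemma ptr_max (F : nat -> nat) n v : 0 < mA -> mA <= n -> F 0 = 0 ->
  \max_(j < n) F (iter j prevf (lastf v)) = \max_(e < mA | hd e == v) F e.
Proof.
move=> m0 mn F0; have lm : lastf v < mA.
  have : lastf v <= mA.-1 by apply/bigmax_leqP => i _; have := ltn_ord i; lia.
  lia.
apply/eqP; rewrite eqn_leq; apply/andP; split.
  apply/bigmax_leqP => j _; case: (posnP (iter j prevf (lastf v))) => [->|p0]; first by rewrite F0.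
  have lt : iter j prevf (lastf v) < mA by apply: leq_ltn_trans lm; exact: iter_prev_le.
  have hv : hd (Ordinal lt) == v.
    rewrite /= iter_prev_hd //.
    have l0 : 0 < lastf v by apply: leq_trans p0 (iter_prev_le _ _).
    exact/eqP/lastf_hd.
  exact: (leq_bigmax_cond (Ordinal lt) hv).
apply/bigmax_leqP => e he; case: (posnP e) => [->|e0]; first by rewrite F0.
have el : e <= lastf v := leq_bigmax_cond e he.
have hl : hd e = hd (lastf v).
  have l0 : 0 < lastf v by lia.
  by rewrite lastf_hd // (eqP he).
have [j jd <-] := iter_prev_cover e0 el hl (leqnn _).
have jn : j < n by apply: leq_ltn_trans jd _; lia.
exact: (leq_bigmax (Ordinal jn)).
Qed.

Lemma max_dbl (F : nat -> nat) n :
  maxn (\max_(j < n) F j) (\max_(j < n) F (n + j)) = \max_(j < n + n) F j.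
Proof. by rewrite big_split_ord. Qed.

End Pointers.

End Scans.

(** * Parallel Bellman-Ford rounds *)

Module BellmanFord.
Import Language Expressions Spawning Simulation Compiler Profits Hoare Scans.

(** One round for [eH] sources at once. Keys carry the arc number as remainder, so the result also
    determines parents. Row [k] of [aP] jumps [2 ^ k] arcs back in the list of a head; after the
    round with [vkx = k] an arc accounts for [2 ^ k.+1] arcs of its list. *)
Definition relax (aT aP aL aD aV : nat) (eH : expr) : cmd :=
  Par aX (eH * $vmA) EX
    ((EG aD (EX %/ $vmA * $vnv + EG aT (EX %% $vmA)) - EG aW (EX %% $vmA)) * $vmA
     + EX %% $vmA) ;;
  For vkx vLG (Par aX (eH * $vmA) EX
    (emax2 (EG aX EX) (EG aX (EX %/ $vmA * $vmA + EG aP ($vkx * $vmA + EX %% $vmA))))) ;;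
  Par aV (eH * $vnv) EX (EG aX (EX %/ $vnv * $vmA + EG aL (EX %% $vnv))).

Definition bford (aT aP aL aD : nat) (eH : expr) : cmd :=
  For vbf vrd (relax aT aP aL aD aY eH ;;
    Par aD (eH * $vnv) EX (emax2 (EG aD EX) (EG aY EX %/ $vmA))).

(* Pointers from each arc to an earlier arc with the same head. *)
Definition pre (aH aP aL : nat) : cmd :=
  Par aS ($vnv * $vmA) EX (EEq (EG aH (EX %% $vmA)) (EX %/ $vmA) (EX %% $vmA) #0) ;;
  scan true aS ($vnv * $vmA) $vmA ;;
  Par aL $vnv EX (EG aS (EX * $vmA + ($vmA - #1))) ;;
  Par aP $vmA EX (EG aS (EG aH EX * $vmA + (EX - #1))) ;;
  For vkx vLG (Par aP $vmA (($vkx + #1) * $vmA + EX)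
    (EG aP ($vkx * $vmA + EG aP ($vkx * $vmA + EX)))).

Definition arr_ok (l : seq nat) : bool := all (fun a => 0 < a <= 64) l.

Section Rel.
Variables X LP : nat.
Hypotheses (X64 : 64 <= X) (LX : 2 ^ LP <= X).
Notation hr := (hr X LP).
Variables (nv mA LG INF : nat) (wt : nat -> nat).
Hypotheses (nv0 : 0 < nv) (mA0 : 0 < mA) (mL : mA <= 2 ^ LG) (LGX : 2 ^ LG <= X).
Hypotheses (IX : INF.+1 * mA <= X) (W0 : INF <= wt 0).

Definition envG (s : state) : Prop :=
  [/\ rg s vnv = nv, rg s vmA = mA, rg s vLG = LG &
      forall e, e < mA -> A s aW e = wt e].

(** Stated for arbitrary [tl] and [hd], since the tables are kept for the graph and, with the two
    exchanged, for its reverse. *)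
Definition envO (tl hd : nat -> nat) (aT aP aL : nat) (s : state) : Prop :=
  [/\ forall e, e < mA -> A s aT e = tl e,
      forall k e, k <= LG -> e < mA -> A s aP (k * mA + e) = iter (2 ^ k) (prevf hd) e &
      forall v, v < nv -> A s aL v = lastf mA hd v].

Lemma envG_fr V B s s' : fr V B s s' -> ~~ has (mem V) [:: vnv; vmA; vLG] ->
  aW \notin B -> envG s -> envG s'.
Proof.
move=> [f1 f2] /=; rewrite orbF !negb_or => /and3P[v1 v2 v3] aB [e1 e2 e3 e4].
by split; rewrite ?f1 // => e em; rewrite f2 ?e4.
Qed.

Lemma envO_fr V B tl hd aT aP aL s s' : fr V B s s' -> arr_ok [:: aT; aP; aL] ->
  ~~ has (mem B) [:: aT; aP; aL] ->
  envO tl hd aT aP aL s -> envO tl hd aT aP aL s'.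
Proof.
move=> [f1 f2] /= /and4P[a1 a2 a3 _]; rewrite orbF !negb_or => /and3P[n1 n2 n3] [e1 e2 e3].
split=> [e em|k e kl em|v vn]; rewrite f2 //; [exact: e1|exact: e2|exact: e3].
Qed.

Section Orient.
Variables (tl hd : nat -> nat) (aT aP aL aD aV : nat) (eH : expr) (Hn : nat).
Hypothesis Htl : forall e, e < mA -> tl e < nv.
Hypothesis ar : arr_ok [:: aT; aP; aL; aD; aV].
Hypothesis dj : aX \notin [:: aT; aP; aL; aD].

Lemma hr_relax s : envG s -> envO tl hd aT aP aL s ->
  cst [:: vkx] [:: aX] s eH Hn -> 0 < Hn ->
  (forall i, i < Hn * nv -> A s aD i <= INF) ->
  hr (relax aT aP aL aD aV eH) s (4 * LG.+1) (4 * LG.+1 * (Hn * (mA + nv)))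
    (fun s' => forall h v, h < Hn -> v < nv -> A s' aV (h * nv + v) =
       \max_(e < mA | hd e == v) ((A s aD (h * nv + tl e) - wt e) * mA + e)).
Proof.
move=> eg eo cH Hn0 DI; have [En Em EL EW] := eg; have [ET EP ELs] := eo.
have /= /and5P[aT0 aP0 aL0 aD0 /andP[aV0 _]] := ar.
have := dj; rewrite !inE !negb_or => /and4P[dT dP dL dD].
have eof s' : fr [:: vkx] [:: aX] s s' -> envO tl hd aT aP aL s'.
  move=> f'; apply: (envO_fr f') eo; first by rewrite /= aT0 aP0 aL0.
  by rewrite /= !inE ![_ == aX]eq_sym (negbTE dT) (negbTE dP) (negbTE dL).
pose F h e := (A s aD (h * nv + tl e) - wt e) * mA + e.
have FX h e : h < Hn -> e < mA -> F h e <= X.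
  move=> hH em; apply: leq_trans IX; rewrite mulSn addnC; apply: leq_add; last exact: ltnW.
  by rewrite leq_mul2r; apply/orP; right; apply: leq_trans (leq_subr _ _) (DI _ _); exact: (idx_lt hH (Htl em)).
apply: (hr_weak (t := 1 + ((LG * 2).+1 + 1)) (w := Hn * mA + ((LG * (Hn * mA).+1).+1 + Hn * nv))
   (Q := fun s' => forall h v, h < Hn -> v < nv -> A s' aV (h * nv + v) =
       \max_(e < mA | hd e == v) ((A s aD (h * nv + tl e) - wt e) * mA + e))) => //.
2: by lia.
2: by have : 0 < Hn * mA by [rewrite muln_gt0 Hn0]; rewrite mulnDr; clear; nia.
apply: (hr_seq LX) => //.
  apply: (hr_map1 X64 LX (p := Hn * mA)) => //.
  - by rewrite !evE (cH s 0 (fr_refl _ _ _)) Em.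
  - by rewrite muln_gt0 Hn0.
  move=> _ i iH; have iH' := div_lt iH; have im := mod_lt iH.
  by rewrite !evE Em En ET // EW //; exact: FX.
move=> s1 f1 X1; have {}X1 h e : h < Hn -> e < mA -> A s1 aX (h * mA + e) = F h e.
  move=> hH em; rewrite X1 idx_lt // !evE Em En idx_div // idx_mod // ET // EW //.
have eg1 := envG_fr f1 isT isT eg.
apply: (hr_seq LX) => //.
  apply: (hr_for LX (n := LG) (t := 1) (w := Hn * mA)
     (I := fun k s' => forall h e, h < Hn -> e < mA ->
        A s' aX (h * mA + e) = \max_(j < 2 ^ k) F h (iter j (prevf hd) e))
     (Q := fun s' => forall h e, h < Hn -> e < mA ->
        A s' aX (h * mA + e) = \max_(j < 2 ^ LG) F h (iter j (prevf hd) e))) => //.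
  - by have [_ _ ->] := eg1.
  - by move=> h e hH em; rewrite X1 // expn0 big_ord1.
  - move=> k s' kL f' Ik; set s2 := setv s' vkx k.
    have f2 : fr [:: vkx] [:: aX] s s2.
      by apply: fr_sub (fr_trans f1 (fr_setv k (isT : vkx != 0) f')).
    have [En2 Em2 EL2 EW2] := envG_fr f2 isT isT eg.
    have val i : i < Hn * mA -> ev s2 i (emax2 (EG aX EX) (EG aX (EX %/ $vmA * $vmA + EG aP ($vkx * $vmA + EX %% $vmA)))) =
       \max_(j < 2 ^ k.+1) F (i %/ mA) (iter j (prevf hd) (i %% mA)).
      move=> iH; have iH' := div_lt iH; have im := mod_lt iH.
      have [_ EP2 _] := eof s2 f2; rewrite !evE Em2 rg_setv /= EP2 ?(ltnW kL) //.
      rewrite !A_setv // {1}(divn_eq i mA) Ik // Ik //; last first.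
        by apply: leq_ltn_trans im; exact: iter_prev_le.
      have -> : 2 ^ k.+1 = 2 ^ k + 2 ^ k by rewrite expnS mul2n addnn.
      rewrite -(max_dbl (fun j => F (i %/ mA) (iter j (prevf hd) (i %% mA)))); congr (maxn _ _).
      by apply: eq_bigr => j _; rewrite addnC iterD.
    apply: (hr_weak (Q := fun s3 => forall i, A s3 aX i = if i < Hn * mA then ev s2 i (emax2 (EG aX EX) (EG aX (EX %/ $vmA * $vmA + EG aP ($vkx * $vmA + EX %% $vmA)))) else A s2 aX i)).
    + apply: (hr_map1 X64 LX (p := Hn * mA)) => //.
      * by rewrite !evE (cH _ 0 f2) Em2.
      * by rewrite muln_gt0 Hn0.
      * move=> _ i iH; rewrite val //; have iH' := div_lt iH; have im := mod_lt iH.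
        by apply/bigmax_leqP => j _; apply: FX => //; apply: leq_ltn_trans im; exact: iter_prev_le.
    + by [].
    + by [].
    + by move=> s3 E h e hH em; rewrite E idx_lt // val ?idx_lt // idx_div // idx_mod.
move=> s2 f2 X2; have {}f2 : fr [:: vkx] [:: aX] s s2 by apply: fr_sub (fr_trans f1 f2).
have [En2 Em2 EL2 EW2] := envG_fr f2 isT isT eg.
have val i : i < Hn * nv -> ev s2 i (EG aX (EX %/ $vnv * $vmA + EG aL (EX %% $vnv))) =
   \max_(e < mA | hd e == i %% nv) F (i %/ nv) e.
  move=> iH; have iH' := div_lt iH; have im := mod_lt iH.
  have lm : lastf mA hd (i %% nv) < mA.
    by rewrite -(prednK mA0) ltnS; apply/bigmax_leqP => e _; have := ltn_ord e; lia.
  have [_ _ EL2'] := eof s2 f2; rewrite !evE Em2 En2 EL2' // X2 //.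
  apply: ptr_max => //; rewrite /F; suff -> : A s aD (i %/ nv * nv + tl 0) - wt 0 = 0 by [].
  apply/eqP; rewrite subn_eq0; apply: leq_trans W0; apply: DI; exact: (idx_lt iH' (Htl mA0)).
apply: (hr_weak (Q := fun s3 => forall i, A s3 aV i = if i < Hn * nv then ev s2 i (EG aX (EX %/ $vnv * $vmA + EG aL (EX %% $vnv))) else A s2 aV i)).
- apply: (hr_map1 X64 LX (p := Hn * nv)) => //.
  + by rewrite !evE (cH _ 0 f2) En2.
  + by rewrite muln_gt0 Hn0.
  + by move=> b i _; exact: (smallP X64).
- by [].
- by [].
- by move=> s3 E h v hH vn; rewrite E idx_lt // val ?idx_lt // idx_div // idx_mod.
Qed.

End Orient.

Lemma hr_bford tl hd aT aP aL aD eH Hn s r :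
  (forall e, e < mA -> tl e < nv) -> arr_ok [:: aT; aP; aL; aD] ->
  aX \notin [:: aT; aP; aL; aD] -> aY \notin [:: aT; aP; aL; aD] ->
  aD \notin [:: aT; aP; aL; aW] ->
  envG s -> envO tl hd aT aP aL s ->
  cst [:: vkx; vbf] [:: aX; aY; aD] s eH Hn -> 0 < Hn -> rg s vrd = r ->
  (forall i, i < Hn * nv -> A s aD i <= INF) ->
  hr (bford aT aP aL aD eH) s (8 * LG.+1 * r.+1) (8 * LG.+1 * (r.+1 * (Hn * (mA + nv))))
    (fun s' => (forall h v, h < Hn -> v < nv -> A s' aD (h * nv + v) =
       bf mA tl hd wt (fun x => A s aD (h * nv + x)) r v) /\
       forall i, i < Hn * nv -> A s' aD i <= INF).
Proof.
move=> Htl ar dX dY dD eg eo cH Hn0 Er DI.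
have /= /and5P[aT0 aP0 aL0 aD0 _] := ar.
pose B h k v := bf mA tl hd wt (fun x => A s aD (h * nv + x)) k v.
have Bx h k v : h < Hn -> v < nv -> B h k v <= INF.
  move=> hH; elim: k v => [|k IH] v vn; first by apply: DI; exact: idx_lt.
  rewrite /B /= geq_max IH //=; apply/bigmax_leqP => e _.
  by apply: leq_trans (leq_subr _ _) (IH _ _); exact: Htl.
have Hm : 0 < Hn * mA by rewrite muln_gt0 Hn0.
have h : hr (bford aT aP aL aD eH) s (r * (4 * LG.+1 + 1).+1).+1
   (r * (4 * LG.+1 * (Hn * (mA + nv)) + Hn * nv).+1).+1
   (fun s' => (forall h v, h < Hn -> v < nv -> A s' aD (h * nv + v) = B h r v) /\
       forall i, i < Hn * nv -> A s' aD i <= INF).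
  apply: (hr_for LX (n := r) (I := fun k s' => forall h v, h < Hn -> v < nv -> A s' aD (h * nv + v) = B h k v)) => //.
  - by case: (aD) aD0 => // a /andP[_ h]; rewrite /good /= h.
  - move=> k s' kr f' Ik; set s2 := setv s' vbf k.
    have f2 : fr [:: vkx; vbf] [:: aX; aY; aD] s s2.
      apply: fr_sub (fr_setv k (isT : vbf != 0) f'); rewrite /= ?mem_head //.
      by rewrite !inE eqxx !orbT.
    have eg2 : envG s2.
      by apply: (envG_fr f2) => //; move: dD; rewrite !inE; clear; lia.
    have eo2 : envO tl hd aT aP aL s2.
      apply: (envO_fr f2) eo => /=; first by rewrite aT0 aP0 aL0.
      by move: dX dY dD; rewrite !inE; clear; lia.
    have D2 h v : h < Hn -> v < nv -> A s2 aD (h * nv + v) = B h k v.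
      by move=> hH vn; rewrite A_setv // Ik.
    apply: (hr_seq LX) => //.
      apply: (hr_relax Htl _ dX eg2 eo2 _ Hn0).
      + by rewrite /= aT0 aP0 aL0 aD0.
      + move=> s3 i f3; apply: cH; apply: fr_sub (fr_trans f2 f3); rewrite /= ?mem_head //.
        by rewrite !inE eqxx !orbT.
      + by move=> i iH; rewrite (divn_eq i nv) D2 ?Bx ?(div_lt iH) ?(mod_lt iH).
    move=> s3 f3 Y3; have f3' : fr [:: vkx; vbf] [:: aX; aY; aD] s s3.
      apply: fr_sub (fr_trans f2 f3); rewrite /= ?mem_head //.
      by rewrite !inE eqxx !orbT.
    have [En3 Em3 _ _] : envG s3.
      by apply: (envG_fr f3') => //; move: dD; rewrite !inE; clear; lia.
    have val i : i < Hn * nv -> ev s3 i (emax2 (EG aD EX) (EG aY EX %/ $vmA)) = B (i %/ nv) k.+1 (i %% nv).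
      move=> iH; have iH' := div_lt iH; have im := mod_lt iH.
      rewrite !evE Em3 f3.2 //; last by move: dX dY; rewrite !inE; clear; lia.
      rewrite {1 2}(divn_eq i nv) D2 // Y3 // /B /=; congr (maxn _ _).
      have [-> _] := key_max mA (fun e => hd e == i %% nv) (fun e => A s2 aD (i %/ nv * nv + tl e) - wt e).
      by apply: eq_bigr => e _; rewrite D2 // Htl.
    apply: (hr_weak (Q := fun s4 => forall i, A s4 aD i = if i < Hn * nv then ev s3 i (emax2 (EG aD EX) (EG aY EX %/ $vmA)) else A s3 aD i)).
    + apply: (hr_map1 X64 LX (p := Hn * nv)) => //.
      * by rewrite !evE (cH _ 0 f3') En3.
      * by rewrite muln_gt0 Hn0.
      * by move=> b i _; exact: (smallP X64).
    + by [].
    + by [].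
    + by move=> s4 E h v hH vn; rewrite E idx_lt // val ?idx_lt // idx_div // idx_mod.
  - move=> s' f' I'; split=> [h v hH vn|i iH]; first by rewrite A_setv // I'.
    by rewrite A_setv // (divn_eq i nv) I' ?Bx ?(div_lt iH) ?(mod_lt iH).
apply: (hr_weak h) => //; first by clear; nia.
have k1 : (4 * LG.+1 * (Hn * (mA + nv)) + Hn * nv).+1 <= 8 * LG.+1 * (Hn * (mA + nv)).
  by move: Hm; rewrite mulnDr; move: (Hn * mA) (Hn * nv) => x y; clear; nia.
rewrite mulnCA mulSn; have := leq_mul (leqnn r) k1; move: k1.
by clear; nia.
Qed.

(** A table of vertices against arcs with prefix maxima replaces sorting the arcs by head; its
    [nv * mA] cells are within the work bound. *)
Lemma hr_pre hd aH aP aL s :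
  (forall e, e < mA -> hd e < nv) -> arr_ok [:: aH; aP; aL] ->
  aS \notin [:: aH; aP; aL] -> uniq [:: aH; aP; aL; aW] ->
  envG s -> (forall e, e < mA -> A s aH e = hd e) ->
  hr (pre aH aP aL) s (10 * LG.+1) (10 * LG.+1 * (nv * mA))
    (fun s' => (forall k e, k <= LG -> e < mA -> A s' aP (k * mA + e) = iter (2 ^ k) (prevf hd) e) /\
      forall v, v < nv -> A s' aL v = lastf mA hd v).
Proof.
move=> Hhd ar dS dj eg EH.
have /= /and4P[aH0 aP0 aL0 _] := ar.
have [d2 d4 d5 d6 [d7 d8]] : [/\ aH != aL, aP != aL, aP != aW, aL != aW & aS != aH /\ aS != aL].
  by move: dj dS; rewrite /= !inE; clear=> h1 h2; repeat split; lia.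
have nm0 : 0 < nv * mA by rewrite muln_gt0 nv0.
apply: (hr_weak (t := 1 + (5 * LG.+1 + (1 + (1 + (LG * 2).+1)))) (w := nv * mA + (5 * LG.+1 * (nv * mA) + (nv + (mA + (LG * mA.+1).+1))))
  (Q := (fun s' => (forall k e, k <= LG -> e < mA -> A s' aP (k * mA + e) = iter (2 ^ k) (prevf hd) e) /\
      forall v, v < nv -> A s' aL v = lastf mA hd v))) => //; last 2 first.
- by clear; lia.
- by move: nv0 mA0; clear; nia.
have [En Em EL EW] := eg.
apply: (hr_seq LX) => //.
  apply: (hr_map1 X64 LX (p := nv * mA)) => //; first by rewrite !evE En Em.
  move=> b i iH; rewrite !evE Em; case: ifP => // _.
  by have := mod_lt iH; have := mL; lia.
move=> s1 f1 S1.
have {}S1 v e : v < nv -> e < mA -> A s1 aS (v * mA + e) = if hd e == v then e else 0.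
  by move=> vn em; rewrite S1 idx_lt // !evE Em idx_mod // idx_div // EH.
have [En1 Em1 EL1 EW1] := envG_fr f1 isT isT eg.
apply: (hr_seq LX); first exact: scan_good.
  apply: (hr_scan1 X64 LX (T := nv * mA) (l := mA) (LG := LG)) => //.
  - by move=> s' i f'; rewrite !evE !f'.1 // En1 Em1.
  - by move=> s' i f'; rewrite !evE !f'.1.
  by move=> [_ b2] r j _ _; rewrite big_mkord; apply/bigmax_leqP => t _; exact: b2.
move=> s2 f2 S2; have f2' := fr_trans f1 f2.
have {}S2 v e : v < nv -> e < mA -> A s2 aS (v * mA + e) = \max_(e' < e.+1 | hd e' == v) e'.
  move=> vn em; rewrite S2 ?idx_lt // big_mkord [RHS]big_mkcond /=.
  by apply: eq_bigr => e' _; rewrite S1 //; apply: leq_trans em; rewrite ltnS -ltnS.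
have [En2 Em2 EL2 EW2] := envG_fr f2' isT isT eg.
apply: (hr_seq LX); first exact: good_par.
  apply: (hr_map1 X64 LX (p := nv)) => //.
  by move=> b i _; exact: (smallP X64).
move=> s3 f3 L3.
have {}L3 v : v < nv -> A s3 aL v = lastf mA hd v.
  move=> vn; rewrite L3 vn !evE Em2 S2 //; last by rewrite subn1 prednK.
  by rewrite subn1 prednK.
have f3' := fr_trans f2' f3.
have EH3 e : e < mA -> A s3 aH e = hd e.
  by move=> em; rewrite f3'.2 ?EH //= !inE; move: d2 d7; clear; lia.
have eg3 : envG s3 by apply: (envG_fr f3') eg => //=; rewrite !inE; move: d6; clear; lia.
have [En3 Em3 EL3 EW3] := eg3.
have S3 v e : v < nv -> e < mA -> A s3 aS (v * mA + e) = \max_(e' < e.+1 | hd e' == v) e'.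
  by move=> vn em; rewrite f3.2 ?S2 //= inE.
apply: (hr_seq LX); first exact: good_par.
  apply: (hr_map1 X64 LX (p := mA)) => //.
  by move=> b i _; exact: (smallP X64).
move=> s4 f4 P4.
have {}P4 e : e < mA -> A s4 aP e = prevf hd e.
  move=> em; rewrite P4 em !evE Em3 EH3 // S3 ?Hhd //; last by lia.
  rewrite /prevf; case: e em => [|e] em; last by rewrite subn1.
  rewrite big_ord0; apply/eqP; rewrite -leqn0; apply/bigmax_leqP => e' _.
  by have := ltn_ord e'; lia.
have f4' := fr_trans f3' f4.
have eg4 : envG s4 by apply: (envG_fr f4') eg => //=; rewrite !inE; move: d6 d5; clear; lia.
have L4 v : v < nv -> A s4 aL v = lastf mA hd v.
  by move=> vn; rewrite f4.2 ?L3 // inE; move: d4; clear; lia.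
apply: (hr_for LX (n := LG) (I := fun k s' => forall k' e, k' <= k -> e < mA ->
   A s' aP (k' * mA + e) = iter (2 ^ k') (prevf hd) e)) => //.
- by case: (aP) aP0 => // a /andP[_ h]; rewrite /good /= h.
- by have [_ _ ->] := eg4.
- by move=> k' e; rewrite leqn0 => /eqP -> em; rewrite mul0n P4.
- move=> k s' kL f' Ik; set s5 := setv s' vkx k.
  have f5 := fr_setv k (isT : vkx != 0) f'.
  have [En5 Em5 EL5 EW5] : envG s5.
    by apply: (envG_fr f5) eg4 => //=; rewrite !inE; move: d5; clear; lia.
  have P5 k' e : k' <= k -> e < mA -> A s5 aP (k' * mA + e) = iter (2 ^ k') (prevf hd) e.
    by move=> kk em; rewrite A_setv // Ik.
  apply: (hr_par X64 LX (p := mA)) => //.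
  + by move=> b i _; exact: (smallP X64).
  + by move=> i j _ _; rewrite !evE => /eqP; rewrite eqn_add2l => /eqP.
  move=> s6 R6 in6 out6 F6 k' e; rewrite leq_eqVlt => /orP[/eqP ->|kk] em.
    have := in6 e em; rewrite !evE Em5 rg_setv /= addn1 => ->.
    rewrite P5 // P5 //; last by apply: leq_ltn_trans em; exact: iter_prev_le.
    by rewrite expnS mul2n -addnn iterD.
  rewrite ltnS in kk; rewrite out6 ?P5 // => i im; rewrite !evE Em5 rg_setv /= addn1.
  have : k'.+1 * mA <= k.+1 * mA by rewrite leq_mul2r ltnS kk orbT.
  by rewrite mulSn; lia.
move=> s' f' I'; split=> [k e kL em|v vn]; first by rewrite A_setv // I'.
by rewrite A_setv // f'.2 ?L4 // inE; move: d4; clear; lia.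
Qed.

End Rel.

End BellmanFord.

(** * Trees, parents and sparse layers *)

Module Layers.
Import Language Expressions Spawning Simulation Compiler Profits Hoare Scans BellmanFord.

Notation vn := 2 (only parsing).
Notation vm := 3 (only parsing).
Notation vN0 := 6 (only parsing).
Notation vINF := 7 (only parsing).
Notation vSC := 8 (only parsing).
Notation vC1 := 10 (only parsing).
Notation vRR := 11 (only parsing).
Notation vELL := 12 (only parsing).
Notation vL := 13 (only parsing).
Notation vHn := 14 (only parsing).
Notation vHn' := 15 (only parsing).
Notation vPm := 16 (only parsing).
Notation vK := 17 (only parsing).
Notation vZl := 18 (only parsing).
Notation vZ := 19 (only parsing).
Notation vNP := 20 (only parsing).
Notation vpp := 21 (only parsing).
Notation vsg := 22 (only parsing).
Notation vHM := 23 (only parsing).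
Notation vt1 := 24 (only parsing).
Notation vt2 := 25 (only parsing).
Notation vlv := 34 (only parsing).
Notation vrn := 35 (only parsing).
Notation vch := 36 (only parsing).
Notation vsq := 37 (only parsing).
Notation vdn := 38 (only parsing).

Notation aTL := 1 (only parsing).
Notation aHD := 2 (only parsing).
Notation aPf := 4 (only parsing).
Notation aLf := 5 (only parsing).
Notation aPb := 6 (only parsing).
Notation aLb := 7 (only parsing).
Notation aH0 := 11 (only parsing).
Notation aIDX := 12 (only parsing).
Notation aHS := 13 (only parsing).
Notation aHSZ := 14 (only parsing).
Notation aH := 15 (only parsing).
Notation aD := 16 (only parsing).
Notation aPAR := 17 (only parsing).
Notation aLAY := 18 (only parsing).
Notation aKEY := 19 (only parsing).
Notation aSEL := 20 (only parsing).
Notation aCH := 21 (only parsing).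
Notation aUN := 22 (only parsing).
Notation aB := 23 (only parsing).
Notation aCC := 24 (only parsing).
Notation aKK := 25 (only parsing).
Notation aINV := 26 (only parsing).
Notation aC := 27 (only parsing).
Notation aT3 := 28 (only parsing).
Notation aF := 29 (only parsing).
Notation aG := 30 (only parsing).
Notation aF' := 31 (only parsing).
Notation aG' := 32 (only parsing).
Notation aH' := 33 (only parsing).
Notation aV2 := 34 (only parsing).
Notation aLAB := 35 (only parsing).
Notation aQ := 36 (only parsing).
Notation aBEST := 37 (only parsing).

Definition treeD : cmd :=
  Par aD ($vHn * $vnv) EX (EEq (EX %% $vnv) (EG aH (EX %/ $vnv)) $vINF #0) ;;
  Asg vrd ($vL + $vL) ;;
  bford aTL aPf aLf aD $vHn.

(* Parents in the trees stored in array [aV], roots being their own parents. *)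
Definition parents (aV : nat) : cmd :=
  relax aTL aPf aLf aV aY $vHn ;;
  Par aPAR ($vHn * $vnv) EX
    (EEq (EG aV EX) $vINF (EX %% $vnv) (EG aTL (EG aY EX %% $vmA))).

Definition hopE (aV : nat) (i : expr) : expr := (($vINF - EG aV i) %% $vSC)%ex.

(** The prefix counts in [aLAY] serve twice: the last of a row is the size of the layer, and the
    others later number its vertices. Maximising [nv + 1 - size], with the layer as remainder,
    selects a least populated one; the [1] keeps the quotient positive. *)
Definition layers : cmd :=
  Par aLAY ($vHn * $vL * $vnv) EX
    (EI (EG aD (EX %/ $vnv %/ $vL * $vnv + EX %% $vnv))
       (EEq (hopE aD (EX %/ $vnv %/ $vL * $vnv + EX %% $vnv))
          ($vL + EX %/ $vnv %% $vL) #1 #0) #0) ;;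
  scan false aLAY ($vHn * $vL * $vnv) $vnv ;;
  Par aKEY ($vHn * $vL) EX
    (($vnv + #1 - EG aLAY (EX * $vnv + ($vnv - #1))) * $vL + EX %% $vL) ;;
  scan true aKEY ($vHn * $vL) $vL ;;
  Par aSEL $vHn EX (EG aKEY (EX * $vL + ($vL - #1)) %% $vL).

Lemma hr_post X LP c s t w (Q Q' : state -> Prop) :
  hr X LP c s t w Q -> (forall s', Q s' -> Q' s') -> hr X LP c s t w Q'.
Proof. by move=> h q; apply: hr_weak h _ _ q. Qed.

Lemma hr_cost X LP c s t w t' w' Q :
  hr X LP c s t w Q -> t <= t' -> w <= w' -> hr X LP c s t' w' Q.
Proof. by move=> h tt ww; apply: hr_weak h tt ww _. Qed.

Section Tree.
Variables X LP : nat.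
Hypotheses (X64 : 64 <= X) (LX : 2 ^ LP <= X).
Notation hr := (hr X LP).
Variables (nv mA LG INF SC : nat) (tl hd wt w0 : nat -> nat).
Hypothesis aok : arcs_ok nv mA tl hd wt INF SC w0.
Hypotheses (mA0 : 0 < mA) (mL : mA <= 2 ^ LG) (LGX : 2 ^ LG <= X).
Hypotheses (IX : INF.+1 * mA <= X).
Let nv0 : 0 < nv. Proof. exact: aok_nv aok. Qed.
Let W0 : INF <= wt 0. Proof. exact: aok_0 aok. Qed.

Definition envI (s : state) : Prop :=
  [/\ envG nv mA LG wt s, envO nv mA LG tl hd aTL aPf aLf s,
      envO nv mA LG hd tl aHD aPb aLb s, rg s vINF = INF & rg s vSC = SC].

Definition envI_V : seq nat := [:: vnv; vmA; vLG; vINF; vSC].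
Definition envI_A : seq nat := [:: aW; aTL; aPf; aLf; aHD; aPb; aLb].

Lemma envI_fr V B s s' : fr V B s s' -> ~~ has (mem V) envI_V ->
  ~~ has (mem B) envI_A -> envI s -> envI s'.
Proof.
move=> f hV hB [e1 e2 e3 e4 e5]; have [f1 f2] := f.
move: hV hB; rewrite /= !negb_or.
move=> /and5P[v1 v2 v3 v4 /andP[v5 _]] /and5P[b1 b2 b3 b4 /and4P[b5 b6 b7 _]].
split; rewrite ?f1 //.
- by apply: (envG_fr f) e1; rewrite //= !negb_or v1 v2 v3.
- by apply: (envO_fr f) e2; rewrite //= !negb_or b2 b3 b4.
- by apply: (envO_fr f) e3; rewrite //= !negb_or b5 b6 b7.
Qed.

Lemma hr_treeD s L Hn : envI s -> rg s vL = L -> rg s vHn = Hn -> 0 < Hn -> L + L <= X ->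
  hr treeD s (8 * LG.+1 * (2 * L).+1 + 2)
     (8 * LG.+1 * ((2 * L).+1 * (Hn * (mA + nv))) + Hn * nv + 1)
     (fun s' => (forall h v, h < Hn -> v < nv -> A s' aD (h * nv + v) =
        bf mA tl hd wt (ini INF (A s aH h)) (2 * L) v) /\
        (forall i, i < Hn * nv -> A s' aD i <= INF)).
Proof.
move=> e EL EH Hn0 LX2; have [eg eo _ EI _] := e; have [En Em _ _] := eg.
have INFX : INF <= X by move: IX mA0; clear; nia.
apply: (hr_cost (t := 1 + (1 + 8 * LG.+1 * (2 * L).+1))
  (w := Hn * nv + (1 + 8 * LG.+1 * ((2 * L).+1 * (Hn * (mA + nv)))))).
2: by clear; lia.
2: by clear; lia.
apply: (hr_seq LX) => //.
  apply: (hr_map1 X64 LX (p := Hn * nv)) => //; first by rewrite !evE EH En.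
    by rewrite muln_gt0 Hn0.
  by move=> b i iH; rewrite !evE EI; case: ifP.
move=> s1 f1 D1; apply: (hr_seq LX) => //.
  by apply: hr_asg1 => _; rewrite !evE f1.1 // EL.
move=> s2 f2 E2; have f12 := fr_trans f1 f2.
have e2 := envI_fr f12 isT isT e; have [eg2 eo2 _ _ _] := e2.
have D2 h v : h < Hn -> v < nv -> A s2 aD (h * nv + v) = ini INF (A s aH h) v.
  move=> hH vn; rewrite f2.2 // D1 idx_lt // !evE En EI idx_mod // idx_div //.
apply: (hr_post (Q := fun s' => (forall h v, h < Hn -> v < nv -> A s' aD (h * nv + v) =
       bf mA tl hd wt (fun x => A s2 aD (h * nv + x)) (2 * L) v) /\
       forall i, i < Hn * nv -> A s' aD i <= INF)) => //.
  apply: (hr_bford X64 LX nv0 mA0 mL LGX IX W0) => //.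
  - exact: aok_tl aok.
  - by move=> s' i f'; rewrite !evE f'.1 // f12.1.
  - by have := congr1 (fun s => rg s vrd) E2; rewrite rg_setv /= f1.1 // EL => <-; lia.
  - by move=> i iH; rewrite (divn_eq i nv) D2 ?(div_lt iH) ?(mod_lt iH) // /ini; case: ifP.
move=> s' [H1 H2]; split=> // h v hH vn; rewrite H1 //.
elim: (2 * L) v vn => [|k IH] v vn /=; first exact: D2.
rewrite IH //; congr (maxn _ _); apply: eq_bigr => e' _; rewrite IH //.
exact: aok_tl aok _ (ltn_ord e').
Qed.

(** Only a root has profit [INF]. Where no arc arrives with positive profit, the parent is left
    unspecified. *)
Definition parent_of (Dh : nat -> nat) (p : nat -> nat) : Prop := forall x, x < nv ->
  if Dh x == INF then p x = x else
  0 < \max_(e < mA | hd e == x) (Dh (tl e) - wt e) ->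
  exists e, [/\ e < mA, hd e = x, p x = tl e &
    Dh (tl e) - wt e = \max_(e < mA | hd e == x) (Dh (tl e) - wt e)].

Lemma hr_parents s aV Hn : envI s -> rg s vHn = Hn -> 0 < Hn ->
  0 < aV <= 64 -> aV \notin [:: aX; aY; aPAR] -> nv <= X ->
  (forall i, i < Hn * nv -> A s aV i <= INF) ->
  hr (parents aV) s (4 * LG.+1 + 1) (4 * LG.+1 * (Hn * (mA + nv)) + Hn * nv)
     (fun s' => forall h, h < Hn ->
        parent_of (fun v => A s aV (h * nv + v)) (fun v => A s' aPAR (h * nv + v))).
Proof.
move=> e EH Hn0 aV0 aVn nX DI; have [eg eo _ EI _] := e; have [En Em _ _] := eg.
have aVX : aV != aX by move: aVn; rewrite !inE; clear; lia.
have aVY : aV != aY by move: aVn; rewrite !inE; clear; lia.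
apply: (hr_seq LX).
- by case: (aV) aV0 => // a /andP[_ h]; rewrite /good /= h.
- apply: (hr_relax X64 LX nv0 mA0 mL LGX IX W0 (aok_tl aok)) eg eo _ Hn0 DI.
  + by rewrite /= aV0.
  + by rewrite !inE; move: aVX; clear; lia.
  + by move=> s' i f'; rewrite !evE f'.1.
move=> s1 f1 Y1; have [[En1 Em1 _ _] [ET1 _ _] _ EI1 _] := envI_fr f1 isT isT e.
have V1 i : A s1 aV i = A s aV i by rewrite f1.2 //= !inE; move: aVX aVY; clear; lia.
apply: (hr_post (Q := fun s' => forall i, A s' aPAR i = if i < Hn * nv then
   ev s1 i (EEq (EG aV EX) $vINF (EX %% $vnv) (EG aTL (EG aY EX %% $vmA)))%ex else A s1 aPAR i)) => //.
  apply: (hr_map1 X64 LX (p := Hn * nv)) => //.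
  - by rewrite !evE f1.1 // EH En1.
  - by rewrite muln_gt0 Hn0.
  - move=> b i iH; rewrite !evE; case: ifP => _; last exact: b.2.
    by rewrite En1; apply: leq_trans nX; rewrite ltnW // (mod_lt iH).
move=> s2 P2 h hH x xn; rewrite P2 idx_lt // !evE V1 EI1 En1 Em1.
case: eqP => _; first by rewrite idx_mod.
rewrite Y1 // => M0.
have [E1 E2] := key_max mA (fun e => hd e == x) (fun e => A s aV (h * nv + tl e) - wt e).
have [|h1 /eqP h2 h3] := E2; first by rewrite E1.
set Yk := \max_(e < mA | _) (_ * mA + e) in E1 E2 h1 h2 h3 *.
exists (Yk %% mA); split=> //; first by rewrite ET1.
by rewrite h3 E1.
Qed.

(* Number of vertices with index at most [v] in layer [L + j] of tree [h]. *)
Definition bitf (Dh : nat -> nat) (l v : nat) : bool := (0 < Dh v) && ((INF - Dh v) %% SC == l).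

Lemma hr_layers s L Hn : envI s -> rg s vL = L -> rg s vHn = Hn -> 0 < Hn -> 0 < L ->
  (forall i, i < Hn * nv -> A s aD i <= INF) ->
  nv <= 2 ^ LG -> L <= 2 ^ LG -> nv.+2 * L <= X ->
  hr layers s (13 * LG.+1) (13 * LG.+1 * (Hn * L * nv))
   (fun s' => exists sel, [/\ forall h, h < Hn -> A s' aSEL h = sel h /\ sel h < L,
     forall h v, h < Hn -> v < nv -> A s' aLAY ((h * L + sel h) * nv + v) =
       \sum_(t < v.+1) bitf (fun v => A s aD (h * nv + v)) (L + sel h) t &
     forall h, h < Hn -> (\sum_(t < nv) bitf (fun v => A s aD (h * nv + v)) (L + sel h) t) * L <= nv]).
Proof.
move=> e EL EH Hn0 L0 DI nL LL XL; have [eg eo _ EI ES] := e; have [En Em EG' _] := eg.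
pose bt h l v := bitf (fun v => A s aD (h * nv + v)) l v.
have nX : nv <= X by apply: leq_trans XL; nia.
have HL0 : 0 < Hn * L by rewrite muln_gt0 Hn0.
have HLn0 : 0 < Hn * L * nv by rewrite muln_gt0 HL0.
apply: (hr_cost (t := 1 + (5 * LG.+1 + (1 + (5 * LG.+1 + 1))))
  (w := Hn * L * nv + (5 * LG.+1 * (Hn * L * nv) + (Hn * L + (5 * LG.+1 * (Hn * L) + Hn))))).
2: by clear; lia.
2: {
  have h1 : Hn * L <= Hn * L * nv by rewrite leq_pmulr.
  have h2 : Hn <= Hn * L by rewrite leq_pmulr.
  move: (Hn * L * nv) (Hn * L) h1 h2 HLn0 => x y; clear; nia. }
apply: (hr_seq LX) => //.
  apply: (hr_map1 X64 LX (p := Hn * L * nv)) => //; first by rewrite !evE EH EL En.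
  by move=> b i _; exact: (smallP X64).
move=> s1 f1 L1.
have {}L1 h j v : h < Hn -> j < L -> v < nv ->
   A s1 aLAY ((h * L + j) * nv + v) = bt h (L + j) v.
  move=> hH jL vn; rewrite L1 idx_lt ?idx_lt // /hopE !evE En EL EI ES.
  rewrite idx_mod // (idx_div (h * L + j)) // idx_div // idx_mod // /bt /bitf.
  by case: (A s _ _) => [|d] //=; case: ifP.
have e1 := envI_fr f1 isT isT e; have [[En1 Em1 EG1 _] _ _ EI1 ES1] := e1.
have bsum h l v : \sum_(t < v) bt h l t <= v.
  rewrite -[X in _ <= X]card_ord -sum1_card; apply: leq_sum => t _.
  by case: (bt _ _ _).
have LY h j v : h < Hn -> j < L -> v < nv ->
   \big[opb false/0]_(0 <= t < v.+1) A s1 aLAY ((h * L + j) * nv + t) = \sum_(t < v.+1) bt h (L + j) t.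
  move=> hH jL vn; rewrite /= big_mkord; apply: eq_bigr => t _; rewrite L1 //.
  by apply: leq_trans vn; rewrite ltnS -ltnS.
apply: (hr_seq LX); first exact: scan_good.
  apply: (hr_scan1 X64 LX (T := Hn * L * nv) (l := nv) (LG := LG)) => //.
  - by move=> s' i f'; rewrite !evE !f'.1 // !f1.1 // EH EL En.
  - by move=> s' i f'; rewrite !evE !f'.1 // f1.1.
  move=> _ r j jn rj; have rr : r < Hn * L by have := div_lt rj; rewrite idx_div.
  rewrite (divn_eq r L) LY ?(div_lt rr) ?(mod_lt rr) //.
  by apply: leq_trans (bsum _ _ _) _; lia.
move=> s2 f2 L2.
have {}L2 h j v : h < Hn -> j < L -> v < nv ->
   A s2 aLAY ((h * L + j) * nv + v) = \sum_(t < v.+1) bt h (L + j) t.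
  by move=> hH jL vn; rewrite L2 ?idx_lt // ?LY //; apply: idx_lt => //; exact: idx_lt.
have f12 := fr_trans f1 f2; have [[En2 Em2 EG2 _] _ _ _ _] := envI_fr f12 isT isT e.
have EL2 : rg s2 vL = L by rewrite f12.1.
have EH2 : rg s2 vHn = Hn by rewrite f12.1.
pose cn h j := \sum_(t < nv) bt h (L + j) t.
have val q : q < Hn * L -> ev s2 q (($vnv + #1 - EG aLAY (EX * $vnv + ($vnv - #1))) * $vL + EX %% $vL)%ex
   = (nv + 1 - cn (q %/ L) (q %% L)) * L + q %% L.
  move=> qH; rewrite !evE En2 EL2 {1}(divn_eq q L) L2 ?(div_lt qH) ?(mod_lt qH) //; last by lia.
  by rewrite subn1 prednK.
apply: (hr_seq LX); first exact: good_par.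
  apply: (hr_map1 X64 LX (p := Hn * L)) => //; first by rewrite !evE EH2 EL2.
  move=> _ q qH; rewrite val //; apply: leq_trans XL; have := mod_lt qH; move: (q %% L) => z zl.
  have : (nv + 1 - cn (q %/ L) z) * L <= nv.+1 * L by rewrite leq_mul2r; lia.
  by rewrite (mulSn nv.+1); lia.
move=> s3 f3 K3; have {}K3 h j : h < Hn -> j < L -> A s3 aKEY (h * L + j) = (nv + 1 - cn h j) * L + j.
  by move=> hH jL; rewrite K3 idx_lt // val ?idx_lt // idx_div // idx_mod.
have f13 := fr_trans f12 f3.
apply: (hr_seq LX); first exact: scan_good.
  apply: (hr_scan1 X64 LX (T := Hn * L) (l := L) (LG := LG)) => //.
  - by move=> s' i f'; rewrite !evE !f'.1 // !f13.1 // EH EL.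
  - by move=> s' i f'; rewrite !evE !f'.1 // f13.1.
  - by rewrite f13.1.
  by move=> [_ b2] r j _ _; rewrite big_mkord; apply/bigmax_leqP => t _; exact: b2.
move=> s4 f4 K4; have f14 := fr_trans f13 f4.
have EL4 : rg s4 vL = L by rewrite f14.1.
pose key h := \max_(j < L | xpredT j) ((nv + 1 - cn h j) * L + j).
have {}K4 h : h < Hn -> A s4 aKEY (h * L + (L - 1)) = key h.
  move=> hH; have lt : L - 1 < L by lia.
  rewrite K4 ?idx_lt //= subn1 prednK // big_mkord.
  by apply: eq_bigr => j _; rewrite K3.
apply: (hr_map X64 LX (p := Hn)) => //.
- by rewrite !evE f14.1.
- by move=> b i _; exact: (smallP X64).
move=> s5 R5 S5 F5; exists (fun h => key h %% L).
have f5 i : A s5 aLAY i = A s2 aLAY i by rewrite F5 // f4.2 // f3.2.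
split.
- by move=> h hH; rewrite S5 hH !evE EL4 K4 // ltn_mod.
- by move=> h v hH vn; rewrite f5 L2 // ltn_mod.
move=> h hH; rewrite -/(cn h (key h %% L)).
have [E1 E2] := key_max L xpredT (fun j => nv + 1 - cn h j); rewrite -/(key h) in E1 E2.
have big_ge : nv + 1 - cn h 0 <= key h %/ L by rewrite E1; exact: (leq_bigmax (Ordinal L0)).
have cle j : cn h j <= nv by exact: bsum.
have [|k1 _ k3] := E2; first by have := cle 0; lia.
have le j : j < L -> cn h (key h %% L) <= cn h j.
  move=> jL; have : nv + 1 - cn h j <= key h %/ L by rewrite E1; exact: (leq_bigmax (Ordinal jL)).
  by rewrite -k3; have := cle j; have := cle (key h %% L); lia.
(* The [L] candidate layers are disjoint, so the least has at most [nv / L] vertices. *)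
apply: leq_trans (_ : \sum_(j < L) cn h j <= _).
  by rewrite mulnC -{1}[L]card_ord -sum_nat_const; apply: leq_sum => j _; exact: le.
rewrite exchange_big /= -[X in _ <= X]card_ord -sum1_card; apply: leq_sum => t _.
rewrite /bt /bitf; case: (0 < _) => /=; last by rewrite big1.
case: (boolP [exists j : 'I_L, (INF - A s aD (h * nv + t)) %% SC == L + j]) => [/existsP[j /eqP ->]|].
  rewrite (bigD1 j) //= eqxx big1 ?addn0 // => j' j'j.
  by rewrite eqn_add2l (_ : (j : nat) == j' = false) //; apply/negbTE; rewrite eq_sym.
by rewrite negb_exists => /forallP H; rewrite big1 // => j _; rewrite (negbTE (H j)).
Qed.

End Tree.

End Layers.

(** * Tables of tree paths and of the residue classes meeting them *)

Module Samples.
Import Language Expressions Spawning Simulation Compiler Profits Hitting Hoare Scans BellmanFord Layers.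

(* The vertices of the selected layers are numbered [h * vZl + rank]; column [i] of
   [aCH] lists the ancestors of vertex number [i].  Writes above row 0 that stem
   from the other vertices are overwritten or never read. *)
Definition sets : cmd :=
  Asg vZl ($vnv %/ $vL + #1) ;;
  Asg vK ($vHn * $vZl) ;;
  Asg vt1 ($vL - #1) ;;
  Par aCH $vK EX $vnv ;;
  Par aCH ($vHn * $vnv)
    (EI (EG aD EX)
      (EEq (hopE aD EX) ($vL + EG aSEL (EX %/ $vnv))
        (EX %/ $vnv * $vZl +
          (EG aLAY ((EX %/ $vnv * $vL + EG aSEL (EX %/ $vnv)) * $vnv + EX %% $vnv) - #1))
        ($vK + EX)) ($vK + EX))
    (EX %% $vnv) ;;
  For vch vt1 (Par aCH $vK (($vch + #1) * $vK + EX)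
    (EG aPAR (EX %/ $vZl * $vnv + EG aCH ($vch * $vK + EX)))) ;;
  Par aUN $vK EX (ELt (EG aCH EX) $vnv
    (EEq (EG aCH ($vt1 * $vK + EX)) (EG aH (EX %/ $vZl)) #0 #1) #0).

(** Row [(q, i)] marks the classes modulo [L + q] met by path [i]. The vertices of a path are
    treated one after the other, so that simultaneous writes fall into different rows. *)
Definition residues : cmd :=
  Par aB ($vNP * $vK * $vPm) EX #0 ;;
  For vch vL (Par aB ($vNP * $vK)
    (EX * $vPm + EG aIDX (EG aCH ($vch * $vK + EX %% $vK)) %% ($vL + EX %/ $vK)) #1).

(** All moduli from [L] up to [Pm] compete, so primality is never tested: the winner does at least
    as well as the prime of [greedy]. Members of the class beyond [N0] are replaced by index 0,
    which gives all classes the same length [vZ]. *)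
Definition hit_round : cmd :=
  Par aCC ($vNP * $vPm * $vK) EX
    (EI (EG aUN (EX %% $vK))
      (EG aB ((EX %/ $vK %/ $vPm * $vK + EX %% $vK) * $vPm + EX %/ $vK %% $vPm)) #0) ;;
  scan false aCC ($vNP * $vPm * $vK) $vK ;;
  Par aKK ($vNP * $vPm) EX (EG aCC (EX * $vK + ($vK - #1)) * ($vNP * $vPm) + EX) ;;
  scan true aKK ($vNP * $vPm) ($vNP * $vPm) ;;
  Asg vpp (EG aKK ($vNP * $vPm - #1) %% ($vNP * $vPm)) ;;
  Par aH' $vZ ($vrn * $vZ + EX)
    (EG aH0 (ELt ($vpp %% $vPm + EX * ($vL + $vpp %/ $vPm)) $vN0
               ($vpp %% $vPm + EX * ($vL + $vpp %/ $vPm)) #0)) ;;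
  Par aUN $vK EX
    (EI (EG aUN EX) (EI (EG aB (($vpp %/ $vPm * $vK + EX) * $vPm + $vpp %% $vPm)) #0 #1) #0).

Definition hits : cmd := residues ;; For vrn vRR hit_round.

Lemma leq_expl a b k : a <= b -> a ^ k <= b ^ k.
Proof. by case: k => // k ab; rewrite leq_exp2r. Qed.

(** [q * k] rounds, each keeping at most a fraction [1 - 1/q], leave at most [U / 2 ^ k < 1]. *)
Lemma decay_exp q k U V : 0 < q -> U < 2 ^ k ->
  V * q ^ (q * k) <= q.-1 ^ (q * k) * U -> V = 0.
Proof.
move=> q0 Uk VU; have h : 2 ^ k * q.-1 ^ (q * k) <= q ^ (q * k).
  by rewrite !expnM -expnMn leq_expl // exp_half.
have Q0 : 0 < q ^ (q * k) by rewrite expn_gt0 q0.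
case: V VU => // V VU; exfalso.
case: (posnP (q.-1 ^ (q * k))) => [E|E]; first by move: VU; rewrite E; lia.
by move: (q ^ (q * k)) (q.-1 ^ (q * k)) (2 ^ k) h VU Uk Q0 E; clear => a b c; nia.
Qed.

Section Sets.
Variables X LP : nat.
Hypotheses (X64 : 64 <= X) (LX : 2 ^ LP <= X).
Notation hr := (hr X LP).
Variables (nv INF SC L Hn : nat) (sel : nat -> nat).
Hypotheses (nv0 : 0 < nv) (Hn0 : 0 < Hn) (L0 : 0 < L).
Let Zl := nv %/ L + 1.
Let K := Hn * Zl.

Lemma hr_sets s (D := fun h v => A s aD (h * nv + v))
    (b := fun h v => bitf INF SC (D h) (L + sel h) v) :
  rg s vnv = nv -> rg s vINF = INF -> rg s vSC = SC -> rg s vL = L -> rg s vHn = Hn ->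
  (forall h, h < Hn -> A s aSEL h = sel h /\ sel h < L) ->
  (forall h v, h < Hn -> v < nv ->
     A s aLAY ((h * L + sel h) * nv + v) = \sum_(t < v.+1) b h t) ->
  (forall h, h < Hn -> (\sum_(t < nv) b h t) * L <= nv) ->
  nv.+1 <= X -> K <= X ->
  hr sets s (2 * L + 8) (L * K.+1 + 2 * K + Hn * nv + 8) (fun s' =>
   exists y : nat -> nat, [/\ rg s' vK = K,
    forall i t, i < K -> t < L ->
      A s' aCH (t * K + i) = iter t (fun x => A s aPAR (i %/ Zl * nv + x)) (y i),
    forall i, i < K -> A s' aUN i = (y i < nv) &&
      (iter L.-1 (fun x => A s aPAR (i %/ Zl * nv + x)) (y i) != A s aH (i %/ Zl)),
    forall h v, h < Hn -> v < nv -> b h v -> exists2 i, i < K & i %/ Zl = h /\ y i = v &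
    forall i, i < K -> y i < nv -> b (i %/ Zl) (y i)]).
Proof.
move=> En EIN ES EL EH Esel Elay few nX KX.
have Zl0 : 0 < Zl by rewrite /Zl addn1.
have K0 : 0 < K by rewrite muln_gt0 Hn0.
apply: (hr_cost (t := 1 + (1 + (1 + (1 + (1 + (((L - 1) * 2).+1 + 1))))))
  (w := 1 + (1 + (1 + (K + (Hn * nv + (((L - 1) * K.+1).+1 + K))))))).
2: by move: L0; clear; lia.
2: by move: L0; clear; case: L => // l _; rewrite subn1 mulSn /=; lia.
apply: (hr_seq LX) => //.
  apply: hr_asg1 => _; rewrite !evE En EL; apply: leq_trans nX.
  by rewrite addn1 ltnS leq_div.
move=> s1 f1 E1; have EZ1 : rg s1 vZl = Zl by rewrite -E1 rg_setv /= En EL.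
apply: (hr_seq LX) => //.
  by apply: hr_asg1 => _; rewrite !evE EZ1 f1.1 // EH.
move=> s2 f2 E2; have EK2 : rg s2 vK = K by rewrite -E2 rg_setv /= EZ1 f1.1 // EH.
have f12 := fr_trans f1 f2.
apply: (hr_seq LX) => //.
  apply: hr_asg1 => b'; rewrite !evE; apply: leq_trans (leq_subr _ _) _; exact: b'.1.
move=> s3 f3 E3; have Et3 : rg s3 vt1 = L - 1 by rewrite -E3 rg_setv /= f12.1 // EL.
have f13 := fr_trans f12 f3.
have EZ3 : rg s3 vZl = Zl by rewrite f3.1 // f2.1.
have EK3 : rg s3 vK = K by rewrite f3.1.
apply: (hr_seq LX) => //.
  by apply: (hr_map1 X64 LX (p := K)) => // b' i _; exact: (smallP X64).
move=> s4 f4 C4; have f14 := fr_trans f13 f4.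
(* A selected vertex goes to the slot given by its tree and its rank in the layer, any other one
   beyond row 0; this keeps the simultaneous writes exclusive. *)
pose idx i := if b (i %/ nv) (i %% nv) then i %/ nv * Zl + (\sum_(t < (i %% nv).+1) b (i %/ nv) t - 1) else K + i.
pose idxe := (EI (EG aD EX)
      (EEq (hopE aD EX) ($vL + EG aSEL (EX %/ $vnv))
        (EX %/ $vnv * $vZl +
          (EG aLAY ((EX %/ $vnv * $vL + EG aSEL (EX %/ $vnv)) * $vnv + EX %% $vnv) - #1))
        ($vK + EX)) ($vK + EX))%ex.
have Eidx i : i < Hn * nv -> ev s4 i idxe = idx i.
  move=> iH; have hH := div_lt iH; have vn := mod_lt iH.
  have [En4 EL4 EI4 ES4] : [/\ rg s4 vnv = nv, rg s4 vL = L, rg s4 vINF = INF & rg s4 vSC = SC].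
    by rewrite !f14.1.
  have EK4 : rg s4 vK = K by rewrite f4.1.
  have EZ4 : rg s4 vZl = Zl by rewrite f4.1.
  have A4 a j : a \in [:: aD; aSEL; aLAY] -> A s4 a j = A s a j.
    by move=> aa; rewrite f14.2 //; move: aa; rewrite /= !inE; clear; lia.
  rewrite /idxe /hopE !evE !A4 // En4 EL4 EI4 ES4 EK4 EZ4.
  have [-> sl] := Esel _ hH; rewrite Elay // /idx /b /bitf /D -(divn_eq i nv).
  by case: (A s 16 i) => [|d] //=; case: eqP.
have psum h m n : m <= n -> \sum_(t < m) b h t <= \sum_(t < n) b h t.
  by move=> mn; rewrite -!(big_mkord xpredT (fun t => nat_of_bool (b h t))) [X in _ <= X](big_cat_nat (n := m)) //= leq_addr.
have rk h v : h < Hn -> v < nv -> b h v -> 0 < \sum_(t < v.+1) b h t <= nv %/ L.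
  move=> hH vn bv; rewrite big_ord_recr /= bv addn1 /= leq_divRL // mulnC.
  apply: leq_trans (few h hH); rewrite mulnC leq_mul2r; apply/orP; right.
  by have := psum h v.+1 nv vn; rewrite big_ord_recr /= bv addn1.
have idxK i : i < Hn * nv -> (idx i < K) = b (i %/ nv) (i %% nv).
  move=> iH; rewrite /idx; case: ifP => [bi|_]; last by lia.
  have := rk _ _ (div_lt iH) (mod_lt iH) bi => /andP[r1 r2].
  by apply: idx_lt; [exact: div_lt iH|rewrite /Zl; lia].
have idxi i j : i < Hn * nv -> j < Hn * nv -> idx i = idx j -> i = j.
  move=> iH jH E; have := idxK j jH; rewrite -E idxK // => Eb; move: E Eb; rewrite /idx.
  case: ifP => bi; case: ifP => bj //; last by lia.
  have /andP[r1 r2] := rk _ _ (div_lt iH) (mod_lt iH) bi.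
  have /andP[r3 r4] := rk _ _ (div_lt jH) (mod_lt jH) bj.
  have rZ z : 0 < z <= nv %/ L -> z - 1 < Zl by rewrite /Zl; clear; lia.
  move=> E _; have := congr1 (fun x => x %/ Zl) E; rewrite !idx_div ?rZ ?r1 ?r3 //.
  move=> Eh; move: E; rewrite Eh => /eqP; rewrite eqn_add2l => /eqP Er.
  rewrite (divn_eq i nv) (divn_eq j nv) Eh; congr (_ + _); rewrite Eh in bi r1 r2 Er.
  have {}Er : \sum_(t < (i %% nv).+1) b (j %/ nv) t = \sum_(t < (j %% nv).+1) b (j %/ nv) t
    by move: Er r1 r3; clear; lia.
  (* Ranks increase strictly at each selected vertex, so equal ranks in one tree mean the same
     vertex. *)
  case: (ltngtP (i %% nv) (j %% nv)) => // lt.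
    by have := psum (j %/ nv) _ _ lt; rewrite Er [X in X <= _]big_ord_recr /= bj; lia.
  by have := psum (j %/ nv) _ _ lt; rewrite -Er [X in X <= _]big_ord_recr /= bi; lia.
apply: (hr_seq LX (Q1 := fun s5 => (forall i, i < Hn * nv -> A s5 aCH (idx i) = i %% nv) /\
     forall j, (forall i, i < Hn * nv -> j != idx i) -> A s5 aCH j = A s4 aCH j)) => //.
  apply: (hr_par X64 LX (p := Hn * nv)) => //.
  - by rewrite !evE f4.1 // f13.1 // EH f4.1 // f13.1 // En.
  - by rewrite muln_gt0 Hn0.
  - move=> _ i iH; rewrite !evE f4.1 // f13.1 // En; apply: leq_trans nX.
    by rewrite ltnW // ltnS ltnW // (mod_lt iH).
  - by move=> i j iH jH; rewrite -/idxe !Eidx //; exact: idxi.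
  move=> s5 R5 in5 out5 F5; split=> [i iH|j jn].
    by rewrite -Eidx // in5 // !evE f4.1 // f13.1 // En.
  by apply: out5 => i iH; rewrite -/idxe Eidx // jn.
move=> s5 f5 [in5 out5]; have f15 := fr_trans f14 f5.
have EK5 : rg s5 vK = K by rewrite f5.1 // f4.1.
have EZ5 : rg s5 vZl = Zl by rewrite f5.1 // f4.1.
have Et5 : rg s5 vt1 = L - 1 by rewrite f5.1 // f4.1.
pose y := A s5 aCH; pose pf i x := A s aPAR (i %/ Zl * nv + x).
pose I k s' := forall i t, i < K -> t <= k -> A s' aCH (t * K + i) = iter t (pf i) (y i).
apply: (hr_seq LX (Q1 := I (L - 1))) => //.
  apply: (hr_for LX (I := I)) => //.
  - by move=> i t iK; rewrite leqn0 => /eqP ->.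
  - move=> k s' kL f' Ik; set s6 := setv s' vch k.
    have f6 := fr_setv k (isT : vch != 0) f'.
    have EK6 : rg s6 vK = K by rewrite f6.1.
    have EZ6 : rg s6 vZl = Zl by rewrite f6.1.
    have En6 : rg s6 vnv = nv by rewrite f6.1 // f15.1.
    apply: (hr_par X64 LX (p := K)) => //.
    + by move=> b' i _; exact: (smallP X64).
    + by move=> i j _ _; rewrite !evE => /eqP; rewrite eqn_add2l => /eqP.
    move=> s7 R7 in7 out7 F7 i t iK; rewrite leq_eqVlt => /orP[/eqP ->|tk].
      have := in7 i iK; rewrite !evE EK6 EZ6 En6 rg_setv /= addn1 => ->.
      by rewrite f6.2 // f15.2 // A_setv // Ik.
    rewrite ltnS in tk; rewrite out7 ?A_setv ?Ik // => i' iK'; rewrite !evE EK6 rg_setv /= addn1.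
    have : t.+1 * K <= k.+1 * K by rewrite leq_mul2r ltnS tk orbT.
    by rewrite mulSn; lia.
move=> s6 f6 I6; have f16 := fr_trans f15 f6.
have EK6 : rg s6 vK = K by rewrite f6.1.
have EZ6 : rg s6 vZl = Zl by rewrite f6.1.
have Et6 : rg s6 vt1 = L - 1 by rewrite f6.1.
apply: (hr_map X64 LX (p := K)) => //.
  move=> b' i _; rewrite !evE; case: ifP => // _; case: ifP => // _.
  exact: leq_trans X64.
move=> s7 R7 U7 F7; exists y; split.
- by rewrite R7.
- by move=> i t iK tL; rewrite F7 // I6 //; lia.
- move=> i iK; rewrite U7 iK !evE EK6 EZ6 Et6 f16.1 // En.
  have := I6 i 0 iK (leq0n _); rewrite mul0n add0n /= => ->.
  rewrite I6 // f16.2 // subn1.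
  by case: ifP => //= _; case: eqP.
- move=> h v hH vn bv; have ii := idx_lt hH vn.
  exists (idx (h * nv + v)); first by rewrite idxK // idx_div // idx_mod.
  split; last by rewrite /y in5 // idx_mod.
  have /andP[r1 r2] := rk _ _ hH vn bv.
  by rewrite /idx idx_div // idx_mod // bv idx_div // /Zl; lia.
move=> i iK yn; case: (boolP [exists j : 'I_(Hn * nv), i == idx j]) => [/existsP[j /eqP Ei]|].
  have jH := ltn_ord j; have := idxK j jH; rewrite -Ei iK => /esym bj.
  rewrite Ei /y in5 //; move: (bj); rewrite /idx bj => bj'.
  have /andP[r1 r2] := rk _ _ (div_lt jH) (mod_lt jH) bj.
  by rewrite idx_div // /Zl; lia.
(* A slot that received no vertex still holds the initial mark [nv]. *)
rewrite negb_exists => /forallP H; exfalso; move: yn; rewrite /y out5 => [|j jH].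
  by rewrite C4 iK !evE f13.1 // En ltnn.
exact: (H (Ordinal jH)).
Qed.

End Sets.

End Samples.

(** * Greedy choice of residue classes hitting all tree paths *)

Module Sampling.
Import Language Expressions Spawning Simulation Compiler Profits Hitting Hoare Scans BellmanFord Layers Samples.

Section Hits.
Variables X LP : nat.
Hypotheses (X64 : 64 <= X) (LX : 2 ^ LP <= X).
Notation hr := (hr X LP).
Variables (LG L Pm NP K Z N0 : nat) (ch : nat -> nat -> nat) (idx h0 : nat -> nat).
Hypotheses (L0 : 0 < L) (K0 : 0 < K) (NP0 : 0 < NP) (PmE : Pm = NP + L) (Z0 : 0 < Z).
Hypotheses (KL : K <= 2 ^ LG) (NL : NP * Pm <= 2 ^ LG) (LGX : 2 ^ LG <= X).
Hypothesis KX : K.+1 * (NP * Pm) <= X.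

Definition envH (s : state) : Prop :=
  [/\ [/\ rg s vLG = LG, rg s vL = L, rg s vPm = Pm & rg s vK = K],
      [/\ rg s vNP = NP, rg s vZ = Z & rg s vN0 = N0] &
      [/\ forall i t, i < K -> t < L -> A s aCH (t * K + i) = ch t i,
          forall x, A s aIDX x = idx x & forall j, A s aH0 j = h0 j]].

Lemma envH_fr V B s s' : fr V B s s' ->
  ~~ has (mem V) [:: vLG; vL; vPm; vK; vNP; vZ; vN0] ->
  ~~ has (mem B) [:: aCH; aIDX; aH0] -> envH s -> envH s'.
Proof.
move=> [f1 f2] /=; rewrite !orbF !negb_or.
move=> /and5P[v1 v2 v3 v4 /and3P[v5 v6 v7]] /and3P[b1 b2 b3] [[e1 e2 e3 e4] [e5 e6 e7] [e8 e9 e10]].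
by split; split; rewrite ?f1 //; move=> *; rewrite f2 //; auto.
Qed.

Definition aset (i : nat) : seq nat := [seq idx (ch t i) | t <- iota 0 L].
Definition inres (p c i : nat) : bool := c \in [seq x %% p | x <- aset i].
Definition envB (s : state) : Prop := forall q i c, q < NP -> i < K -> c < Pm ->
  A s aB ((q * K + i) * Pm + c) = inres (L + q) c i.

Let Pm0 : 0 < Pm. Proof. by rewrite PmE addn_gt0 NP0. Qed.
Let NPP0 : 0 < NP * Pm. Proof. by rewrite muln_gt0 NP0. Qed.

Lemma hr_residues s : envH s ->
  hr residues s (2 * L + 2) (NP * K * Pm + L * (NP * K + 1) + 1) envB.
Proof.
move=> e; have [[_ EL EP EK] [EN _ _] _] := e.
have NK0 : 0 < NP * K by rewrite muln_gt0 NP0.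
apply: (hr_cost (t := 1 + (L * 2).+1) (w := NP * K * Pm + (L * (NP * K).+1).+1)); last 2 first.
- by clear; lia.
- by clear; lia.
apply: (hr_seq LX) => //.
  apply: (hr_map1 X64 LX (p := NP * K * Pm)) => //; first by rewrite !evE EN EK EP.
  by rewrite muln_gt0 NK0.
move=> s1 f1 B1; have e1 := envH_fr f1 isT isT e.
pose I k s' := forall q i c, q < NP -> i < K -> c < Pm ->
  A s' aB ((q * K + i) * Pm + c) = (c \in [seq idx (ch t i) %% (L + q) | t <- iota 0 k]).
apply: (hr_for LX (n := L) (I := I)) => //.
- by have [[_ ->]] := e1.
- by move=> q i c qN iK cP; rewrite B1 idx_lt // idx_lt.
- move=> k s' kL f' Ik; set s2 := setv s' vch k.
  have f2 : fr [:: vch] [:: aB] s s2 by apply: fr_sub (fr_trans f1 (fr_setv k (isT : vch != 0) f')).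
  have [[_ EL2 EP2 EK2] [EN2 _ _] [EC2 EI2 _]] := envH_fr f2 isT isT e.
  pose ie := (EX * $vPm + EG aIDX (EG aCH ($vch * $vK + EX %% $vK)) %% ($vL + EX %/ $vK))%ex.
  have Eie j : j < NP * K -> ev s2 j ie = j * Pm + idx (ch k (j %% K)) %% (L + j %/ K) /\
      idx (ch k (j %% K)) %% (L + j %/ K) < Pm.
    move=> jN; rewrite /ie !evE EL2 EP2 EK2 rg_setv /= EC2 ?(mod_lt jN) // EI2; split=> //.
    apply: leq_trans (_ : L + j %/ K <= _); first by rewrite ltn_mod addn_gt0 L0.
    by rewrite PmE addnC leq_add2r ltnW // (div_lt jN).
  apply: (hr_par X64 LX (p := NP * K)) => //.
  + by rewrite !evE EN2 EK2.
  + by move=> _ i _; apply: leq_trans X64.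
  + move=> i j iN jN; rewrite -/ie; have [-> l1] := Eie i iN; have [-> l2] := Eie j jN.
    by move/(congr1 (fun x => x %/ Pm)); rewrite !idx_div.
  move=> s3 R3 in3 out3 F3 q i c qN iK cP.
  have -> : iota 0 k.+1 = rcons (iota 0 k) k by rewrite -[k.+1]addn1 iotaD add0n cats1.
  rewrite map_rcons mem_rcons in_cons.
  have jN := idx_lt qN iK; have := Eie _ jN; rewrite idx_mod // idx_div // => -[Ej lj].
  case: (c =P idx (ch k i) %% (L + q)) => [->|ne]; first by rewrite -Ej in3.
  rewrite out3 ?A_setv ?Ik // => j jN'; rewrite -/ie.
  have [-> l1] := Eie j jN'; apply/eqP => E.
  have Ed : q * K + i = j by have := congr1 (fun x => x %/ Pm) E; rewrite !idx_div.
  move: E; rewrite -Ed idx_mod // idx_div // => /eqP; rewrite eqn_add2l => /eqP.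
  exact: ne.
- move=> s' f' I' q i c qN iK cP; rewrite A_setv // I' // /inres /aset.
  by rewrite -map_comp.
Qed.

Lemma hr_round s (un : nat -> bool) r : envH s -> envB s -> rg s vrn = r ->
  (forall i, i < K -> A s aUN i = un i) ->
  hr hit_round s (12 * LG.+1 + 4) (12 * LG.+1 * (NP * Pm * K) + Z + K + 1) (fun s' =>
    exists p c, [/\ L <= p < Pm,
      forall p' c', L <= p' < Pm -> c' < p' -> cnt K aset un p' c' <= cnt K aset un p c,
      forall j, j < r * Z -> A s' aH' j = A s aH' j,
      forall t, t < Z -> A s' aH' (r * Z + t) = h0 (if c + t * p < N0 then c + t * p else 0) &
      forall i, i < K -> A s' aUN i = un i && ~~ inres p c i]).
Proof.
move=> e eB Er EU; have [[EG' EL EP EK] [EN EZ E0] _] := e.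
have T0 : 0 < NP * Pm * K by rewrite muln_gt0 NPP0.
apply: (hr_cost (t := 1 + (5 * LG.+1 + (1 + (5 * LG.+1 + (1 + (1 + 1))))))
  (w := NP * Pm * K + (5 * LG.+1 * (NP * Pm * K) + (NP * Pm + (5 * LG.+1 * (NP * Pm) + (1 + (Z + K))))))).
2: by clear; lia.
2: { have : NP * Pm <= NP * Pm * K by rewrite leq_pmulr.
     by move: (NP * Pm * K) (NP * Pm); clear; nia. }
apply: (hr_seq LX) => //.
  apply: (hr_map1 X64 LX (p := NP * Pm * K)) => //; first by rewrite !evE EN EK EP.
  by move=> b i _; exact: (smallP X64).
move=> s1 f1 C1; have e1 := envH_fr f1 isT isT e.
have {}C1 q i : q < NP * Pm -> i < K -> A s1 aCC (q * K + i) = un i && inres (L + q %/ Pm) (q %% Pm) i.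
  move=> qN iK; rewrite C1 idx_lt // !evE EK EP idx_mod // idx_div // EU // eB ?(div_lt qN) ?ltn_mod //.
  by case: (un i).
(* The pair of a modulus and a class is coded by one number. Every modulus gets [Pm] classes; those
   not below it are empty and count 0. *)
pose F q := cnt K aset un (L + q %/ Pm) (q %% Pm).
have CCs q j : q < NP * Pm -> j < K -> \big[opb false/0]_(0 <= t < j.+1) A s1 aCC (q * K + t) =
   \sum_(i < j.+1) (un i && inres (L + q %/ Pm) (q %% Pm) i).
  move=> qN jK; rewrite /= big_mkord; apply: eq_bigr => t _; rewrite C1 //.
  by apply: leq_trans jK; rewrite ltnS -ltnS.
have sumK (b : nat -> bool) j : \sum_(i < j) b i <= j.
  by rewrite -[X in _ <= X]card_ord -sum1_card; apply: leq_sum => t _; case: (b t).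
have FK q : F q <= K by rewrite /F /cnt; exact: (sumK (fun i => un i && inres (L + q %/ Pm) (q %% Pm) i)).
have KX' : K <= X by apply: leq_trans KX; apply: leq_trans (leqnSn K) _; rewrite leq_pmulr.
apply: (hr_seq LX); first exact: scan_good.
  apply: (hr_scan1 X64 LX (T := NP * Pm * K) (l := K) (LG := LG)) => //.
  - by move=> s' i f'; have [[_ _ EP' EK'] [EN' _ _] _] := envH_fr f' isT isT e1; rewrite !evE EP' EK' EN'.
  - by move=> s' i f'; have [[_ _ _ EK'] _ _] := envH_fr f' isT isT e1; rewrite !evE EK'.
  - by have [[]] := e1.
  move=> _ q j jK qj; have qN : q < NP * Pm by have := div_lt qj; rewrite idx_div.
  rewrite CCs //; apply: leq_trans (_ : j.+1 <= X); last by apply: leq_trans KX'.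
  exact: (sumK (fun i => un i && inres (L + q %/ Pm) (q %% Pm) i)).
move=> s2 f2 C2; have f12 := fr_trans f1 f2; have e2 := envH_fr f12 isT isT e.
have {}C2 q : q < NP * Pm -> A s2 aCC (q * K + (K - 1)) = F q.
  move=> qN; have lt : K - 1 < K by rewrite subn1 ltn_predL.
  by rewrite C2 ?idx_lt // CCs // subn1 prednK.
have [[_ EL2 EP2 EK2] [EN2 _ _] _] := e2.
apply: (hr_seq LX); first exact: good_par.
  apply: (hr_map1 X64 LX (p := NP * Pm)) => //; first by rewrite !evE EN2 EP2.
  move=> _ q qN; rewrite !evE EK2 EN2 EP2 C2 //; apply: leq_trans KX.
  by rewrite mulSn addnC leq_add ?(ltnW qN) // leq_mul2r FK orbT.
move=> s3 f3 K3; have f13 := fr_trans f12 f3; have e3 := envH_fr f13 isT isT e.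
have {}K3 q : q < NP * Pm -> A s3 aKK q = F q * (NP * Pm) + q.
  by move=> qN; rewrite K3 qN !evE EK2 EN2 EP2 C2.
have [[_ EL3 EP3 EK3] [EN3 _ _] _] := e3.
apply: (hr_seq LX); first exact: scan_good.
  apply: (hr_scan1 X64 LX (T := NP * Pm) (l := NP * Pm) (LG := LG)) => //.
  - by move=> s' i f'; have [[_ _ EP' EK'] [EN' _ _] _] := envH_fr f' isT isT e3; rewrite !evE EP' EN'.
  - by move=> s' i f'; have [[_ _ EP' EK'] [EN' _ _] _] := envH_fr f' isT isT e3; rewrite !evE EP' EN'.
  - by have [[]] := e3.
  by move=> [_ b2] q j _ _; rewrite big_mkord; apply/bigmax_leqP => t _; exact: b2.
move=> s4 f4 K4; have f14 := fr_trans f13 f4; have e4 := envH_fr f14 isT isT e.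
pose Y := \max_(q < NP * Pm | xpredT q) (F q * (NP * Pm) + q).
have {}K4 : A s4 aKK (NP * Pm - 1) = Y.
  have lt : NP * Pm - 1 < NP * Pm by rewrite subn1 ltn_predL.
  have := K4 0 _ lt; rewrite mul0n add0n => ->; last by [].
  by rewrite /= subn1 prednK // big_mkord; apply: eq_bigr => q _; rewrite add0n K3.
have [[_ EL4 EP4 EK4] [EN4 EZ4 _] _] := e4.
apply: (hr_seq LX) => //.
  apply: hr_asg1 => b; rewrite !evE EN4 EP4; apply: leq_trans (leq_mod _ _) _; exact: b.2.
move=> s5 f5 V5; have f15 := fr_trans f14 f5.
have [[_ EL5 EP5 EK5] [EN5 EZ5 E05] [_ _ EH5]] := envH_fr f15 isT isT e.
have {V5}EV : rg s5 vpp = Y %% (NP * Pm) by rewrite -V5 rg_setv eqxx !evE EN4 EP4 K4.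
set q := Y %% (NP * Pm) in EV.
have qN : q < NP * Pm by rewrite ltn_mod.
have Fq q' : q' < NP * Pm -> F q' <= F q.
  move=> q'N; have [E1 E2] := key_max (NP * Pm) xpredT F; rewrite -/Y in E1 E2.
  have le : F q' <= Y %/ (NP * Pm) by rewrite E1; exact: (leq_bigmax (Ordinal q'N)).
  case: (posnP (Y %/ (NP * Pm))) => [z|/E2[_ _ Eq]]; last by rewrite /q Eq.
  by move: le; rewrite z leqn0 => /eqP ->.
apply: (hr_seq LX (Q1 := fun s6 => (forall j, j < r * Z -> A s6 aH' j = A s aH' j) /\
   forall t, t < Z -> A s6 aH' (r * Z + t) =
     let c := q %% Pm in let p := L + q %/ Pm in h0 (if c + t * p < N0 then c + t * p else 0))).
- exact: good_par.
- have Er5 : rg s5 vrn = r by rewrite f15.1.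
  apply: (hr_par X64 LX (p := Z)) => //.
  + by move=> b i _; exact: (smallP X64).
  + by move=> i j _ _; rewrite !evE => /eqP; rewrite eqn_add2l => /eqP.
  move=> s6 R6 in6 out6 _; split=> [j jr|t tZ].
    rewrite out6 ?f15.2 // => i iZ; rewrite !evE Er5 EZ5; move: jr; clear; lia.
  have := in6 t tZ; rewrite !evE Er5 EZ5 E05 EL5 EP5 EV => ->.
  by rewrite EH5.
move=> s6 f6 [H61 H62]; have f16 := fr_trans f15 f6.
have [[_ EL6 EP6 EK6] [EN6 EZ6 E06] [_ _ EH6]] := envH_fr f16 isT isT e.
apply: (hr_map X64 LX (p := K)) => //.
  move=> b i _; rewrite !evE; case: ifP => // _; case: ifP => // _; exact: leq_trans X64.
move=> s7 R7 U7 F7; exists (L + q %/ Pm), (q %% Pm); split.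
- by rewrite leq_addr /= {2}PmE addnC ltn_add2r (div_lt qN).
- move=> p' c' /andP[p1 p2] c1.
  have cP : c' < Pm by apply: leq_trans c1 (ltnW p2).
  have q'N : (p' - L) * Pm + c' < NP * Pm by apply: idx_lt => //; move: p2 p1; rewrite PmE; clear; lia.
  by have := Fq _ q'N; rewrite /F idx_div // idx_mod // subnKC.
- by move=> j jr; rewrite F7 // H61.
- by move=> t tZ; rewrite F7 // H62.
move=> i iK; rewrite U7 iK !evE EP6 EK6 f6.1 // EV.
rewrite !f16.2 // EU // eB ?(div_lt qN) ?ltn_mod //.
by case: (un i); case: (inres _ _ _).
Qed.

Variables (C1 RR k : nat) (un : nat -> bool).
Hypotheses (C10 : 0 < C1) (PmC : Pm = L * C1) (RRE : RR = 2 * C1 * LG) (RR0 : 0 < RR).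
Hypotheses (N00 : 0 < N0) (ZE : Z = N0 %/ L + 1) (KL' : K < 2 ^ LG).
Hypothesis prim : k * L < count prime (iota L (Pm - L)).
Hypothesis unP : forall i, i < K -> un i ->
  uniq (aset i) /\ forall x, x \in aset i -> x < 2 ^ k /\ x < N0.

Lemma hr_hits s : envH s -> rg s vRR = RR -> (forall i, i < K -> A s aUN i = un i) ->
  hr hits s (2 * L + 17 * LG.+1 * RR + 3) (20 * LG.+1 * RR * (NP * Pm * K) + RR * Z)
    (fun s' => (forall j, j < RR * Z -> exists2 x, x < N0 & A s' aH' j = h0 x) /\
       forall i, i < K -> un i ->
       exists j t, [/\ j < RR * Z, t < L & A s' aH' j = h0 (idx (ch t i))]).
Proof.
move=> e ER EU; have T0 : 0 < NP * Pm * K by rewrite muln_gt0 NPP0.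
apply: (hr_cost (t := 2 * L + 2 + (RR * (12 * LG.+1 + 4).+1).+1)
  (w := NP * K * Pm + L * (NP * K + 1) + 1 + (RR * (12 * LG.+1 * (NP * Pm * K) + Z + K + 1).+1).+1)).
2: by move: RR0; clear; nia.
2: {
  have h1 : L * (NP * K) <= NP * Pm * K.
    by rewrite mulnCA -mulnA leq_mul2l leq_mul2r PmE leq_addl !orbT.
  have h2 : K <= NP * Pm * K by rewrite leq_pmull.
  have h3 : L <= NP * Pm * K.
    apply: leq_trans (_ : NP * Pm <= _); last by rewrite leq_pmulr.
    by apply: leq_trans (_ : Pm <= _); [rewrite PmE leq_addl|rewrite leq_pmull].
  have -> : NP * K * Pm = NP * Pm * K by rewrite mulnAC.
  move: (NP * Pm * K) h1 h2 h3 T0 => T; rewrite mulnDr; move: (L * (NP * K)) RR0 LG.+1 (ltn0Sn LG); clear.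
  move=> u R0 G G0 h1 h2 h3 T0; have g1 : T <= G * T by rewrite leq_pmull.
  have k1 : RR <= RR * (G * T) by rewrite leq_pmulr // muln_gt0 G0.
  have k2 : RR * K <= RR * (G * T) by rewrite leq_mul2l (leq_trans h2 g1) orbT.
  have k3 : T <= RR * (G * T) by apply: leq_trans g1 _; rewrite leq_pmull.
  have -> : RR * (12 * G * T + Z + K + 1).+1 = 12 * (RR * (G * T)) + RR * Z + RR * K + RR + RR by lia.
  have -> : 20 * G * RR * T = 20 * (RR * (G * T)) by lia.
  lia. }
apply: (hr_seq LX (Q1 := envB)) => //; first exact: hr_residues e.
move=> s1 f1 B1; have e1 := envH_fr f1 isT isT e.
have {EU}U1 i : i < K -> A s1 aUN i = un i by move=> iK; rewrite f1.2 ?EU.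
(* As [Pm = L * C1], the fraction [L / (2 * Pm)] of [greedy] is [1 / q], and [RR = q * LG] rounds
   bring fewer than [2 ^ LG] paths down to none. *)
pose q := 2 * C1; have q0 : 0 < q by rewrite muln_gt0.
pose J r s' := exists un' : nat -> bool, [/\ forall i, i < K -> A s' aUN i = un' i,
  forall i, i < K -> un' i -> un i,
  forall i, i < K -> un i -> ~~ un' i -> exists j t, [/\ j < r * Z, t < L & A s' aH' j = h0 (idx (ch t i))]
  & (forall j, j < r * Z -> exists2 x, x < N0 & A s' aH' j = h0 x) /\
    (\sum_(i < K) un' i) * q ^ r <= q.-1 ^ r * \sum_(i < K) un i].
apply: (hr_for LX (n := RR) (I := J)) => //.
- by rewrite f1.1.
- exists un; split=> //; first by move=> i _ ->.
  by split=> //; rewrite muln1 mul1n.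
- move=> r s' rR f' [un' [u1 u2 u3 [u5 u4]]]; set s2 := setv s' vrn r.
  have f2 := fr_setv r (isT : vrn != 0) f'.
  have e2 := envH_fr f2 isT isT e1.
  have B2 : envB s2 by move=> p i c pN iK cP; rewrite f2.2 // B1.
  apply: (hr_post (hr_round (un := un') (r := r) e2 B2 _ _)) => //.
  move=> s3 [p [c [/andP[Lp pP] best H1 H2 U3]]].
  have p0 : 0 < p by apply: leq_trans Lp.
  have aP i : i < K -> un' i -> [/\ uniq (aset i), size (aset i) = L & all (fun x => x < 2 ^ k) (aset i)].
    move=> iK /(u2 i iK) /(unP iK)[h1 h2]; split=> //; first by rewrite size_map size_iota.
    by apply/allP => x /h2[].
  have [p1 [c1 [p1P c1p gr]]] := greedy L0 aP prim.
  have {}gr : \sum_(i < K) un' i <= q * cnt K aset un' p c.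
    rewrite -(leq_pmul2r L0); apply: leq_trans gr _.
    rewrite (_ : q * _ * L = 2 * Pm * cnt K aset un' p c).
      by rewrite leq_mul2l best ?orbT.
    by rewrite /q PmC; clear; lia.
  have split : \sum_(i < K) (un' i && ~~ inres p c i) + cnt K aset un' p c = \sum_(i < K) un' i.
    rewrite /cnt -big_split /=; apply: eq_bigr => i _; rewrite -/(inres p c i).
    by case: (un' i); case: (inres p c i).
  exists (fun i => un' i && ~~ inres p c i); split=> //.
  + by move=> i iK /andP[/(u2 i iK)].
  + move=> i iK ui; rewrite negb_and negbK => nu.
    case: (boolP (un' i)) => [u'|u']; last first.
      have [j [t [jr tL E]]] := u3 i iK ui u'; exists j, t; split=> //.
        by rewrite mulSn; move: jr; clear; lia.
      by rewrite H1.
    move: nu; rewrite u' /= => /mapP[x xa cE]; have [_ /(_ x xa)[_ xN]] := unP iK ui.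
    case/mapP: (xa) => t; rewrite mem_iota add0n => /andP[_ tL] xE.
    (* Since [p >= L], a class has at most [N0 %/ L + 1 = Z] members below [N0]. *)
    have xp : x %/ p < Z by rewrite ZE addn1 ltnS (leq_trans (leq_div2r p (ltnW xN))) // leq_div2l.
    exists (r * Z + x %/ p), t; split=> //; first by rewrite mulSn addnC ltn_add2r.
    by rewrite H2 // cE addnC -divn_eq xN xE.
  split.
    move=> j jr; case: (ltnP j (r * Z)) => jrZ; first by rewrite H1 //; exact: u5.
    have jE : j = r * Z + (j - r * Z) by rewrite subnKC.
    have jZ : j - r * Z < Z by move: jr jrZ; rewrite mulSn; clear; lia.
    by rewrite jE H2 //; case: ifP => cN; eexists; try reflexivity.
  rewrite !expnS; move: u4 split gr; clear -q0.
  move: (\sum_(i < K) un' i) (cnt _ _ _ _ _) (\sum_(i < K) un i) => S cn S0.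
  move: (\sum_(i < K) _) (q ^ r) (q.-1 ^ r) => S' Q Q' u4 sp gr.
  have h : S' * q <= q.-1 * S by rewrite -sp; move: gr; rewrite -sp; case: (q) q0 => // q' _; clear; nia.
  apply: leq_trans (_ : q.-1 * S * Q <= _); first by rewrite mulnA leq_mul2r h orbT.
  by rewrite -!mulnA leq_mul2l u4 orbT.
move=> s2 f2 [un' [u1 u2 u3 [u5 u4]]]; split=> // i iK ui.
case: (boolP (un' i)) => u'; last first.
  have [j [t [jr tL E]]] := u3 i iK ui u'; exists j, t; split=> //.
exfalso; have S0 : \sum_(i < K) un i < 2 ^ LG.
  apply: leq_ltn_trans KL'; rewrite -[X in _ <= X]card_ord -sum1_card.
  by apply: leq_sum => t _; case: (un t).
rewrite RRE -/q in u4; have := decay_exp q0 S0 u4.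
by move/eqP; rewrite sum_nat_eq0 => /forallP /(_ (Ordinal iK)) /=; rewrite u'.
Qed.

End Hits.

End Sampling.

(** * Parameters of the levels and sizes of the hitting sets *)

Module Params.
Import Language Expressions Spawning Simulation Compiler Profits Hitting Hoare Scans BellmanFord Layers Samples Sampling.

(** The set of level [L] is stored from cell [L * vHM] on. All levels are kept, because the way down
    uses them again. Level 1 is the list of all [N0] candidates. *)
Definition getH : cmd :=
  Asg vHn (EEq $vL #1 $vN0 ($vRR * ($vN0 %/ ($vL %/ #2) + #1))) ;;
  Par aH $vHn EX (EG aHS ($vL * $vHM + EX)).

Definition up_body : cmd :=
  getH ;; treeD ;; parents aD ;; layers ;; sets ;;
  Asg vPm ($vL * $vC1) ;; Asg vNP ($vPm - $vL) ;; Asg vZ ($vN0 %/ $vL + #1) ;;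
  hits ;;
  Asg vL ($vL + $vL) ;;
  Par aHS ($vRR * $vZ) ($vL * $vHM + EX) (EG aH' EX).

(** [h0] lists [N0] candidates and [idx] numbers them; only ends of arcs are to be covered, and
    [N0 <= 2 * mA] keeps [N0 * nv] within the work bound. [p_prim] supplies the primes for [greedy]
    at each level, indices having [y] bits. [p_BB] bounds the sizes of the hitting tables by
    [2 ^ LG]. By the last two fields [2 ^ ELL] is at least the cube root of [N0] and at most
    [4 * N0]. *)
Record params_ok (X nv mA : nat) (tl hd wt : nat -> nat) (INF SC : nat) (w0 : nat -> nat)
    (LG N0 C1 RR ELL HM y : nat) (idx h0 : nat -> nat) : Prop := ParamsOk {
  p_aok : arcs_ok nv mA tl hd wt INF SC w0;
  p_mA : 0 < mA;
  p_mL : mA <= 2 ^ LG;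
  p_LGX : 2 ^ LG <= X;
  p_IX : INF.+1 * mA <= X;
  p_N0 : 0 < N0 <= nv;
  p_N0m : N0 <= 2 * mA;
  p_cov : forall e v, e < mA -> v = tl e \/ v = hd e -> h0 (idx v) = v /\ idx v < N0;
  p_h0 : forall j, j < N0 -> h0 j < nv;
  p_y : N0 <= 2 ^ y;
  p_prim : forall i, i < ELL -> y * 2 ^ i < count prime (iota (2 ^ i) (2 ^ i * C1 - 2 ^ i));
  p_C1 : 1 < C1;
  p_RR : RR = 2 * C1 * LG;
  p_LG : 0 < LG;
  p_BB : 8 * RR * C1 ^ 2 * nv.+1 ^ 4 < 2 ^ LG;
  p_HM : RR * N0.+1 <= HM;
  p_ELL : 2 ^ ELL <= 4 * N0;
  p_ELL3 : N0 <= (2 ^ ELL) ^ 3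
}.

Definition inl (f : nat -> nat) (n z : nat) : Prop := exists2 j, j < n & f j = z.

Section Up.
Variables X LP : nat.
Hypotheses (X64 : 64 <= X) (LX : 2 ^ LP <= X).
Notation hr := (hr X LP).
Variables (nv mA : nat) (tl hd wt : nat -> nat) (INF SC : nat) (w0 : nat -> nat).
Variables (LG N0 C1 RR ELL HM y : nat) (idx h0 : nat -> nat).
Hypothesis pok : params_ok X nv mA tl hd wt INF SC w0 LG N0 C1 RR ELL HM y idx h0.
Let aok := p_aok pok.
Let nv0 : 0 < nv. Proof. exact: aok_nv aok. Qed.
Let mA0 := p_mA pok.
Let mL := p_mL pok.
Let LGX := p_LGX pok.
Let IX := p_IX pok.
Let N00 : 0 < N0. Proof. by have /andP[] := p_N0 pok. Qed.
Let N0n : N0 <= nv. Proof. by have /andP[] := p_N0 pok. Qed.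
Let C11 := p_C1 pok.
Let RR0 : 0 < RR. Proof. by rewrite (p_RR pok) !muln_gt0 (p_LG pok) (ltnW C11). Qed.
Let BB := p_BB pok.

Notation envI := (envI nv mA LG INF SC tl hd wt).
Notation PH := (PH nv mA tl hd wt INF).

Definition envP (s : state) : Prop :=
  [/\ envI s,
      [/\ rg s vN0 = N0, rg s vC1 = C1, rg s vRR = RR, rg s vHM = HM & rg s vELL = ELL],
      forall x, A s aIDX x = idx x & forall j, A s aH0 j = h0 j].

Definition envP_V : seq nat := envI_V ++ [:: vN0; vC1; vRR; vHM; vELL].
Definition envP_A : seq nat := envI_A ++ [:: aIDX; aH0].

Lemma envP_fr V B s s' : fr V B s s' -> ~~ has (mem V) envP_V ->
  ~~ has (mem B) envP_A -> envP s -> envP s'.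
Proof.
move=> f; rewrite !has_cat => /norP[v1 v2] /norP[b1 b2].
move=> [e1 [e2 e3 e4 e5 e6] e7 e8]; have [f1 f2] := f.
move: v2 b2; rewrite /= !negb_or => /and5P[v2 v3 v4 v5 /andP[v6 _]] /and3P[b3 b4 _].
split; first exact: envI_fr f v1 b1 e1.
- by split; rewrite f1.
- by move=> x; rewrite f2.
- by move=> x; rewrite f2.
Qed.

Definition hsz (L : nat) : nat := if L == 1 then N0 else RR * (N0 %/ (L %/ 2) + 1).

(** The third bound makes all levels equally expensive: the number of sources times the number of
    rounds is linear in [N0] up to the factor [RR]. *)
Lemma hszP i : i <= ELL ->
  [/\ 0 < hsz (2 ^ i), hsz (2 ^ i) <= RR * N0.+1 & hsz (2 ^ i) * 2 ^ i <= 6 * RR * N0].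
Proof.
rewrite /hsz; case: i => [_|i iE]; first by rewrite expn0 /=; move: RR0 N00; clear; split; nia.
have p0 : 0 < 2 ^ i by rewrite expn_gt0.
have -> : (2 ^ i.+1 == 1) = false by rewrite expnS; clear; lia.
have -> : 2 ^ i.+1 %/ 2 = 2 ^ i by rewrite expnS mulKn.
have le : 2 ^ i.+1 <= 4 * N0 by apply: leq_trans (p_ELL pok); rewrite leq_pexp2l.
split; first by rewrite muln_gt0 RR0 addn1.
  by rewrite leq_mul2l addn1 ltnS leq_div orbT.
have : N0 %/ 2 ^ i * 2 ^ i <= N0 by exact: leq_trunc_div.
rewrite expnS in le *; rewrite -(mulnA RR) (_ : 6 * RR * N0 = RR * (6 * N0)); last by clear; lia.
by rewrite leq_mul2l => h; apply/orP; right; move: le h; rewrite mulnDl mulnCA; clear; lia.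
Qed.

Lemma RR_LG k : k <= RR * N0.+1 * nv.+1 -> k < 2 ^ LG.
Proof.
move=> h; apply: leq_ltn_trans BB; apply: leq_trans h _.
have h' : N0.+1 <= nv.+1 by [].
have c0 : 0 < C1 ^ 2 by rewrite expn_gt0 ltnW.
rewrite -mulnA; apply: leq_mul; first by move: c0; clear; nia.
apply: leq_trans (_ : nv.+1 ^ 2 <= _); last by rewrite leq_pexp2l.
by rewrite -mulnn leq_mul.
Qed.

Lemma hr_getH s i Hl : i <= ELL -> envP s -> rg s vL = 2 ^ i ->
  (forall j, j < hsz (2 ^ i) -> A s aHS (2 ^ i * HM + j) = Hl j) ->
  hr getH s 2 (1 + hsz (2 ^ i)) (fun s' => rg s' vHn = hsz (2 ^ i) /\
     forall j, j < hsz (2 ^ i) -> A s' aH j = Hl j).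
Proof.
move=> iE [_ [E0 _ ER EM _] _ _] EL EH; have [h1 h2 h3] := hszP iE.
have Ev : ev s 0 (EEq $vL #1 $vN0 ($vRR * ($vN0 %/ ($vL %/ #2) + #1)))%ex = hsz (2 ^ i).
  by rewrite !evE EL E0 ER.
apply: (hr_seq LX (t1 := 1) (w1 := 1) (t2 := 1) (w2 := hsz (2 ^ i))) => //.
  apply: hr_asg1 => _; rewrite Ev; apply: leq_trans LGX; apply: ltnW; apply: RR_LG.
  by apply: leq_trans h2 _; rewrite leq_pmulr.
move=> s1 f1 E1; have EHn : rg s1 vHn = hsz (2 ^ i) by rewrite -E1 rg_setv eqxx Ev.
apply: (hr_map X64 LX (p := hsz (2 ^ i))) => //.
  by move=> b j _; exact: (smallP X64).
move=> s2 R2 H2 F2; split=> [|j jH]; first by rewrite R2.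
by rewrite H2 jH !evE !f1.1 // EL EM f1.2 // EH.
Qed.

Lemma tree_of h L p Dv : h < nv -> (forall v, v < nv -> Dv v = bf mA tl hd wt (ini INF h) (2 * L) v) ->
  parent_of nv mA INF tl hd wt Dv p ->
  p h = h /\ forall x, let D y := bf mA tl hd wt (ini INF h) (2 * L) y in
    0 < D x -> D x < INF -> 0 < \max_(e < mA | hd e == x) (D (tl e) - wt e) ->
    exists e, [/\ e < mA, hd e = x, p x = tl e &
      D (tl e) - wt e = \max_(e < mA | hd e == x) (D (tl e) - wt e)].
Proof.
move=> hn ED pp; split; first by have := pp h hn; rewrite ED // (D_h aok) eqxx.
move=> x D x0 xI m0; have [_] := bigmax_geP mA (fun e => hd e == x) (fun e => D (tl e) - wt e) m0.
have [/(_ (leqnn _))[e [em /eqP eh _]] _ _] := bigmax_geP mA (fun e => hd e == x) (fun e => D (tl e) - wt e) m0.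
have xn : x < nv by rewrite -eh; exact: (aok_hd aok).
have E : \max_(e < mA | hd e == x) (Dv (tl e) - wt e) = \max_(e < mA | hd e == x) (D (tl e) - wt e).
  by apply: eq_bigr => e' _; rewrite ED //; apply: (aok_tl aok).
have := pp x xn; rewrite ED // (ltn_eqF xI) E => /(_ m0)[e' [e1 e2 e3 e4]].
by exists e'; split=> //; rewrite -e4 ED //; apply: (aok_tl aok).
Qed.

(** A tree vertex other than the root is the head of an arc, so the numbering is faithful on tree
    paths and residues of [idx] do identify their vertices. *)
Lemma tree_cov h L p v t : p h = h ->
  (forall x, let D y := bf mA tl hd wt (ini INF h) (2 * L) y in
    0 < D x -> D x < INF -> 0 < \max_(e < mA | hd e == x) (D (tl e) - wt e) ->
    exists e, [/\ e < mA, hd e = x, p x = tl e &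
      D (tl e) - wt e = \max_(e < mA | hd e == x) (D (tl e) - wt e)]) ->
  0 < bf mA tl hd wt (ini INF h) (2 * L) v -> iter L.-1 p v != h -> t < L ->
  h0 (idx (iter t p v)) = iter t p v /\ idx (iter t p v) < N0.
Proof.
move=> ph pP Dv nh tL; set D := bf mA tl hd wt (ini INF h) (2 * L) in Dv.
have nit j : j < L -> iter j p v != h.
  move=> jL; apply: contraNneq nh => E; have -> : L.-1 = L.-1 - j + j by move: jL; clear; lia.
  by rewrite iterD E (iter_par_root ph).
have Dit j : j < L -> 0 < D (iter j p v).
  elim: j => [//|j IH] jL; apply: ltn_trans (IH (ltnW jL)) _.
  exact: (par_lt aok ph pP (IH (ltnW jL)) (nit j (ltnW jL))).
set x := iter t p v; have x0 : 0 < D x by exact: Dit.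
have xI : D x < INF.
  rewrite ltn_neqAle (D_le aok) andbT; apply: contraNneq (nit t tL) => /(D_INF aok ph) E.
  exact/eqP.
have m0 : 0 < \max_(e < mA | hd e == x) (D (tl e) - wt e).
  apply: leq_trans x0 _; apply: (bf_pred aok ph).
  by rewrite /ini (negbTE (nit t tL)).
have [e [em eh _ _]] := pP x x0 xI m0.
by apply: (p_cov pok em); right.
Qed.

Lemma sizes i (L := 2 ^ i) : i < ELL ->
  [/\ L <= 2 * N0, L * C1 < 2 ^ LG, (L * C1 - L) * (L * C1) <= 2 ^ LG, hsz L * (nv %/ L + 1) < 2 ^ LG &
   nv.+2 * L <= X /\ (hsz L * (nv %/ L + 1)).+1 * ((L * C1 - L) * (L * C1)) <= X].
Proof.
move=> iE; have [h1 h2 _] := hszP (ltnW iE); rewrite -/L in h1 h2.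
have LN : L <= 2 * N0.
  have := leq_trans (leq_pexp2l (isT : 0 < 2) iE) (p_ELL pok).
  by rewrite expnS /L; clear; lia.
have L0 : 0 < L by rewrite expn_gt0.
set a := nv.+1; have La : L <= 2 * a by move: LN N0n; rewrite /a; clear; lia.
have Ka : hsz L * (nv %/ L + 1) <= RR * (a * a).
  rewrite mulnA leq_mul //; last by rewrite /a addn1 ltnS leq_div.
  by apply: leq_trans h2 _; rewrite leq_mul2l ltnS N0n orbT.
have Pa : (L * C1 - L) * (L * C1) <= 4 * C1 ^ 2 * (a * a).
  apply: leq_trans (_ : (2 * a * C1) * (2 * a * C1) <= _).
    have h : L * C1 <= 2 * a * C1 by rewrite leq_mul2r La orbT.
    by apply: leq_mul => //; apply: leq_trans (leq_subr _ _) h.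
  by rewrite -mulnn; clear; lia.
have a0 : 0 < a * a by [].
have a4 : a * a * (a * a) = a ^ 4 by rewrite (expnD a 2 2) -mulnn.
have c0 : 0 < C1 ^ 2 by rewrite expn_gt0 ltnW.
have cc : C1 <= C1 ^ 2 by rewrite -mulnn leq_pmulr // ltnW.
have a1 : a <= a * a by rewrite leq_pmulr.
have R1 : 0 < RR * (a * a) by rewrite muln_gt0 RR0.
have big x : x <= 8 * (RR * (a * a)) * (C1 ^ 2 * (a * a)) -> x < 2 ^ LG.
  move=> h; apply: leq_ltn_trans BB; rewrite -/a -a4; move: h; clear.
  by move: (a * a) (C1 ^ 2) => u v; rewrite (_ : 8 * (RR * u) * (v * u) = 8 * RR * v * (u * u)) //; clear; lia.
have c1 : 0 < C1 ^ 2 * (a * a) by rewrite muln_gt0 c0.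
have b1 : C1 ^ 2 * (a * a) <= RR * (a * a) * (C1 ^ 2 * (a * a)) by rewrite leq_pmull.
have b2 : RR * (a * a) <= RR * (a * a) * (C1 ^ 2 * (a * a)) by rewrite leq_pmulr.
have b3 : a * a <= C1 ^ 2 * (a * a) by rewrite leq_pmull.
have b4 : C1 * a <= C1 ^ 2 * (a * a) by rewrite leq_mul.
split=> //.
- apply: big; apply: leq_trans (_ : 2 * a * C1 <= _); first by rewrite leq_mul2r La orbT.
  by move: b4 b1; rewrite -(mulnA 8) -(mulnA 2) (mulnC a); clear; lia.
- apply: ltnW; apply: big; apply: leq_trans Pa _.
  by move: b1; rewrite -(mulnA 8) -(mulnA 4); clear; lia.
- by apply: big; apply: leq_trans Ka _; move: b2; rewrite -(mulnA 8); clear; lia.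
split; apply: leq_trans LGX; apply: ltnW; apply: big.
  apply: leq_trans (_ : 2 * a * (2 * a) <= _); first by apply: leq_mul => //; rewrite /a; clear; lia.
  by move: b3 b1; rewrite -(mulnA 8); clear; lia.
apply: leq_trans (_ : (2 * (RR * (a * a))) * (4 * (C1 ^ 2 * (a * a))) <= _).
  by apply: leq_mul; [move: Ka R1; clear; lia|rewrite (mulnA 4)].
by clear; lia.
Qed.

(** [N0 * mA] uses [N0 <= nv], and [N0 * nv] uses [N0 <= 2 * mA]. *)
Lemma work_Q i (L := 2 ^ i) : i <= ELL -> hsz L * L * (mA + nv) <= 18 * RR * (mA * nv).
Proof.
move=> iE; have [_ _ h] := hszP iE; apply: leq_trans (leq_mul h (leqnn _)) _.
have h1 : N0 * mA <= mA * nv by rewrite mulnC leq_mul2l N0n orbT.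
have h2 : N0 * nv <= 2 * (mA * nv) by rewrite mulnA leq_mul2r (p_N0m pok) orbT.
rewrite -!mulnA mulnDr (_ : 18 * _ = 6 * (RR * (3 * (mA * nv)))); last by clear; lia.
by rewrite !leq_mul2l /=; apply/orP; right; move: h1 h2; clear; lia.
Qed.

End Up.

End Params.

(** * From the hitting set of level L to that of level 2L *)

Module LevelUp.
Import Language Expressions Spawning Simulation Compiler Profits Hitting Hoare Scans BellmanFord Layers Samples Sampling Params.

Section Up.
Variables X LP : nat.
Hypotheses (X64 : 64 <= X) (LX : 2 ^ LP <= X).
Notation hr := (hr X LP).
Variables (nv mA : nat) (tl hd wt : nat -> nat) (INF SC : nat) (w0 : nat -> nat).
Variables (LG N0 C1 RR ELL HM y : nat) (idx h0 : nat -> nat).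
Hypothesis pok : params_ok X nv mA tl hd wt INF SC w0 LG N0 C1 RR ELL HM y idx h0.
Let aok := p_aok pok.
Let nv0 : 0 < nv. Proof. exact: aok_nv aok. Qed.
Let mA0 := p_mA pok.
Let mL := p_mL pok.
Let LGX := p_LGX pok.
Let IX := p_IX pok.
Let N00 : 0 < N0. Proof. by have /andP[] := p_N0 pok. Qed.
Let N0n : N0 <= nv. Proof. by have /andP[] := p_N0 pok. Qed.
Let C11 := p_C1 pok.
Let RR0 : 0 < RR. Proof. by rewrite (p_RR pok) !muln_gt0 (p_LG pok) (ltnW C11). Qed.
Let BB := p_BB pok.

Notation envI := (envI nv mA LG INF SC tl hd wt).
Notation PH := (PH nv mA tl hd wt INF).

Notation envP := (envP nv mA tl hd wt INF SC LG N0 C1 RR ELL HM idx h0).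
Notation hsz := (hsz N0 RR).

(** [up_step] adds [2 * L] to [2 * L - 1], which is the required length for level [2 * L]. In the
    work one factor [RR] comes from the number of sources and one from the greedy rounds, and
    [C1 ^ 2] from the number of candidate classes. *)
Lemma hr_up_body s i Hl (L := 2 ^ i) : i < ELL -> envP s -> rg s vL = L ->
  (forall j, j < hsz L -> A s aHS (L * HM + j) = Hl j) ->
  (forall j, j < hsz L -> Hl j < nv) -> PH (inl Hl (hsz L)) (2 * L - 1) ->
  hr up_body s (100 * LG.+1 * RR * L) (3000 * LG.+1 * RR ^ 2 * C1 ^ 2 * (mA * nv)) (fun s' =>
    [/\ rg s' vL = 2 * L,
      forall L' j, L' <= L -> j < HM -> A s' aHS (L' * HM + j) = A s aHS (L' * HM + j) &
      exists Hl', [/\ forall j, j < hsz (2 * L) -> A s' aHS (2 * L * HM + j) = Hl' j,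
        forall j, j < hsz (2 * L) -> Hl' j < nv &
        PH (inl Hl' (hsz (2 * L))) (2 * (2 * L) - 1)]]).
Proof.
move=> iE e EL EH Hln PHl; have [z1 z2 z3] := hszP pok (ltnW iE).
have [y1 y2 y3 y4 [y5 y6]] := sizes pok iE; rewrite -/L in z1 z2 z3 y1 y2 y3 y4 y5 y6.
set Hn := hsz L in EH Hln PHl z1 z2 z3 y4 y6 *.
have L0 : 0 < L by rewrite expn_gt0.
pose Zl := nv %/ L + 1; pose K := Hn * Zl; pose Pm := L * C1; pose NP := Pm - L; pose Z := N0 %/ L + 1.
have PmE : Pm = NP + L by rewrite subnK // leq_pmulr // ltnW.
have NP0 : 0 < NP by rewrite subn_gt0 -{1}[L]muln1 ltn_pmul2l.
have Zl0 : 0 < Zl by rewrite /Zl addn1.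
have K0 : 0 < K by rewrite muln_gt0 z1.
have h2L : hsz (2 * L) = RR * Z.
  by rewrite /Params.hsz mulKn // (_ : (2 * L == 1) = false) //; move: L0; clear; lia.
have LLX : L + L <= X.
  by apply: leq_trans y5; rewrite addnn -mul2n leq_mul2r; apply/orP; right.
have nvX : nv.+1 <= X by apply: leq_trans y5; apply: leq_trans (leqnSn _) _; exact: leq_pmulr.
have nvL : nv <= 2 ^ LG by apply: ltnW; apply: (RR_LG pok); move: nv0 RR0 N00; clear; nia.
have LL : L <= 2 ^ LG by apply: leq_trans (ltnW y2); rewrite leq_pmulr // ltnW.
(* The exact costs are left open, fixed by the rules applied in the block, and compared with the
   stated bounds afterwards. *)
apply: hr_cost.
{ apply: (hr_seq LX); [by []|exact: (hr_getH X64 LX pok (ltnW iE) e EL EH)|].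
  move=> s1 f1 [EHn1 H1]; have e1 := envP_fr f1 isT isT e; have [eI1 _ _ _] := e1.
  have EL1 : rg s1 vL = L by rewrite f1.1.
  apply: (hr_seq LX); [by []|exact: (hr_treeD X64 LX aok mA0 mL LGX IX eI1 EL1 EHn1 z1 LLX)|].
  move=> s2 f2 [D2 D2I]; have f12 := fr_trans f1 f2; have e2 := envP_fr f12 isT isT e; have [eI2 _ _ _] := e2.
  have EL2 : rg s2 vL = L by rewrite f12.1.
  have EHn2 : rg s2 vHn = Hn by rewrite f2.1.
  apply: (hr_seq LX); [by []|exact: (hr_parents X64 LX aok mA0 mL LGX IX eI2 EHn2 z1 (isT : 0 < aD <= 64) isT (ltnW nvX) D2I)|].
  move=> s3 f3 P3; have f13 := fr_trans f12 f3; have e3 := envP_fr f13 isT isT e; have [eI3 _ _ _] := e3.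
  have EL3 : rg s3 vL = L by rewrite f13.1.
  have EHn3 : rg s3 vHn = Hn by rewrite f3.1.
  have D3 j : A s3 aD j = A s2 aD j by rewrite f3.2.
  have D3I j : j < Hn * nv -> A s3 aD j <= INF by rewrite D3; exact: D2I.
  apply: (hr_seq LX); [by []|exact: (hr_layers X64 LX aok mA0 mL LGX IX eI3 EL3 EHn3 z1 L0 D3I nvL LL y5)|].
  move=> s4 f4 [sel [S4 Y4 W4]]; have f14 := fr_trans f13 f4; have e4 := envP_fr f14 isT isT e; have [eI4 _ _ _] := e4.
  have EL4 : rg s4 vL = L by rewrite f14.1.
  have EHn4 : rg s4 vHn = Hn by rewrite f4.1.
  have [[En4 _ _ _] _ _ EI4 ES4] := eI4.
  have D4 j : A s4 aD j = A s3 aD j by rewrite f4.2.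
  have bE h v : bitf INF SC (fun v => A s4 aD (h * nv + v)) (L + sel h) v =
      bitf INF SC (fun v => A s3 aD (h * nv + v)) (L + sel h) v by rewrite /bitf !D4.
  apply: (hr_seq LX); [by []|apply: (hr_sets X64 LX (sel := sel) nv0 z1 L0 En4 EI4 ES4 EL4 EHn4 S4 _ _ nvX _)|].
  - by move=> h v hH vn; rewrite Y4 //; apply: eq_bigr => t _; rewrite bE.
  - move=> h hH; rewrite (eq_bigr _ (fun (t : 'I_nv) _ => congr1 nat_of_bool (bE h t))); exact: W4.
  - by apply: leq_trans LGX; apply: ltnW.
  move=> s5 f5; rewrite -/Zl -/K => -[v [EK5 C5 U5 cov5 snd5]].
  have f15 := fr_trans f14 f5; have e5 := envP_fr f15 isT isT e.
  have [eI5 [EN5 EC5 ER5 EM5 EE5] EX5 EH5] := e5.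
  have EL5 : rg s5 vL = L by rewrite f15.1.
  apply: (hr_seq LX); [by []|apply: hr_asg1 => _|].
    by rewrite !evE EL5 EC5 (leq_trans (ltnW y2)).
  move=> s6 f6 E6; have EP6 : rg s6 vPm = Pm by rewrite -E6 rg_setv eqxx !evE EL5 EC5.
  apply: (hr_seq LX); [by []|apply: hr_asg1 => _|].
    rewrite !evE EP6; apply: leq_trans (leq_subr _ _) _; exact: leq_trans (ltnW y2) LGX.
  move=> s7 f7 E7; have EN7 : rg s7 vNP = NP by rewrite -E7 rg_setv eqxx !evE EP6 f6.1 // EL5.
  have f57 := fr_trans f6 f7.
  apply: (hr_seq LX); [by []|apply: hr_asg1 => _|].
    rewrite !evE !f57.1 // EN5 EL5; apply: leq_trans nvX.
    by rewrite addn1 ltnS (leq_trans (leq_div _ _)).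
  move=> s8 f8 E8; have EZ8 : rg s8 vZ = Z by rewrite -E8 rg_setv eqxx !evE !f57.1 // EN5 EL5.
  have f58 := fr_trans f57 f8; have f18 := fr_trans f15 f58; have e8 := envP_fr f18 isT isT e.
  have [eI8 [EN8 EC8 ER8 EM8 EE8] EX8 EH8] := e8.
  pose p j x := A s4 aPAR (j * nv + x).
  pose ch t j := iter t (p (j %/ Zl)) (v j).
  (* Slots without a vertex are discarded, and also paths that reach the root too early, which is
     possible where limited profits are not exact; such paths might repeat the root. *)
  pose un j := (v j < nv) && (ch L.-1 j != Hl (j %/ Zl)).
  have H4 j : j < Hn -> A s4 aH j = Hl j by move=> jH; rewrite f4.2 // f3.2 // f2.2 // H1.
  have Kd j : j < K -> j %/ Zl < Hn by exact: div_lt.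
  have tr j : j < Hn -> let D x := bf mA tl hd wt (ini INF (Hl j)) (2 * L) x in
    [/\ p j (Hl j) = Hl j, forall x, 0 < D x -> D x < INF -> 0 < \max_(e < mA | hd e == x) (D (tl e) - wt e) ->
      exists e, [/\ e < mA, hd e = x, p j x = tl e & D (tl e) - wt e = \max_(e < mA | hd e == x) (D (tl e) - wt e)]
      & forall x, x < nv -> A s4 aD (j * nv + x) = D x].
    move=> jH D; have ED x : x < nv -> A s2 aD (j * nv + x) = D x by move=> xn; rewrite D2 // H1.
    have pE x : p j x = A s3 aPAR (j * nv + x) by rewrite /p f4.2.
    have pp : parent_of nv mA INF tl hd wt (fun x => A s2 aD (j * nv + x)) (p j).
      move=> x xn; have := P3 j jH x xn; rewrite -/(p j x) pE; by [].
    have [t1 t2] := tree_of pok (Hln j jH) ED pp.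
    by split=> // x xn; rewrite D4 D3 ED.
  have UC j t : j < K -> un j -> t < L -> h0 (idx (ch t j)) = ch t j /\ idx (ch t j) < N0.
    move=> jK /andP[vn nh] tL; have [t1 t2 t3] := tr _ (Kd j jK).
    apply: (tree_cov pok t1 t2) => //; have := snd5 j jK vn; rewrite /bitf t3 // => /andP[+ _].
    by [].
  have eh : envH LG L Pm NP K Z N0 ch idx h0 s8.
    have [[_ _ EG8 _] _ _ _ _] := eI8.
    have EL8 : rg s8 vL = L by rewrite f58.1.
    have EP8 : rg s8 vPm = Pm by rewrite f8.1 // f7.1.
    have EK8 : rg s8 vK = K by rewrite f58.1.
    have EN8' : rg s8 vNP = NP by rewrite f8.1.
    by split; split=> // j t jK tL; rewrite f58.2 // C5.
  have U8 j : j < K -> A s8 aUN j = un j.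
    by move=> jK; rewrite f58.2 // U5 // H4 // Kd.
  have unP j : j < K -> un j -> uniq (aset L ch idx j) /\
     forall x, x \in aset L ch idx j -> x < 2 ^ y /\ x < N0.
    move=> jK uj; split; last first.
      move=> x /mapP[t]; rewrite mem_iota add0n => /andP[_ tL] ->.
      by have [_ h] := UC j t jK uj tL; split=> //; apply: leq_trans h (p_y pok).
    rewrite map_inj_in_uniq ?iota_uniq // => t t'; rewrite !mem_iota !add0n => /andP[_ tL] /andP[_ tL'] E.
    have [c1 _] := UC j t jK uj tL; have [c2 _] := UC j t' jK uj tL'.
    have {}E : ch t j = ch t' j by rewrite -c1 -c2 E.
    have [t1 t2 t3] := tr _ (Kd j jK); have /andP[vn nh] := uj.
    have Dv : 0 < bf mA tl hd wt (ini INF (Hl (j %/ Zl))) (2 * L) (v j).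
      by have := snd5 j jK vn; rewrite /bitf t3 // => /andP[].
    case: (ltngtP t t') => // lt; exfalso.
      by have := par_inj aok t1 t2 Dv nh lt tL'; rewrite -/(ch t j) -/(ch t' j) E eqxx.
    by have := par_inj aok t1 t2 Dv nh lt tL; rewrite -/(ch t j) -/(ch t' j) E eqxx.
  apply: (hr_seq LX); [by []|apply: (hr_hits X64 LX L0 K0 NP0 PmE _ _ y3 LGX _ _ erefl (p_RR pok) RR0 N00 erefl y4 (p_prim pok iE) unP eh ER8 U8)|].
  - by rewrite /Z addn1.
  - exact: ltnW.
  - exact: y6.
  - exact: ltnW.
  move=> s9 f9 [H9' H9]; have f19 := fr_trans f18 f9; have e9 := envP_fr f19 isT isT e.
  have [_ [EN9 EC9 ER9 EM9 EE9] _ _] := e9.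
  apply: (hr_seq LX); [by []|apply: hr_asg1 => _|].
    by rewrite !evE f19.1 // EL.
  move=> s10 f10 E10; have EL10 : rg s10 vL = 2 * L by rewrite -E10 rg_setv eqxx !evE f19.1 // EL mul2n addnn.
  have f110 := fr_trans f19 f10; have [_ [EN10 EC10 ER10 EM10 EE10] _ _] := envP_fr f110 isT isT e.
  have EZ10 : rg s10 vZ = Z by rewrite f10.1 // f9.1.
  apply: (hr_par X64 LX (p := RR * Z)) => //.
  - by rewrite !evE ER10 EZ10.
  - by rewrite muln_gt0 RR0 /Z addn1.
  - by move=> b j _; exact: (smallP X64).
  - by move=> j j' _ _; rewrite !evE => /eqP; rewrite eqn_add2l => /eqP.
  move=> s11 R11 in11 out11 F11; split.
  - by rewrite R11.
  - move=> L' j L'L jM; rewrite out11 ?f110.2 // => j' _; rewrite !evE EL10 EM10.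
    have : L' * HM <= L * HM by rewrite leq_mul2r L'L orbT.
    have : L.+1 * HM <= 2 * L * HM by rewrite leq_mul2r; apply/orP; right; move: L0; clear; lia.
    by rewrite mulSn; move: jM; clear; lia.
  have in11' j : j < RR * Z -> A s11 aHS (2 * L * HM + j) = A s9 aH' j.
    by move=> jZ; have := in11 j jZ; rewrite !evE EL10 EM10 f10.2.
  exists (A s9 aH'); rewrite h2L; split=> //.
    by move=> j /H9'[x xN ->]; exact: (p_h0 pok).
  rewrite (_ : 2 * (2 * L) - 1 = 2 * L - 1 + 2 * L); last by move: L0; clear; lia.
  (* The list may repeat a vertex while trees belong to positions; the tree of a vertex is the one
     at its first position. *)
  pose jof h := find (fun j => Hl j == h) (iota 0 Hn).
  have jofP h : inl Hl Hn h -> jof h < Hn /\ Hl (jof h) = h.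
    move=> [j jH E]; have hs : has (fun j => Hl j == h) (iota 0 Hn).
      by apply/hasP; exists j; rewrite ?mem_iota ?E.
    have lt : jof h < Hn by rewrite /jof -[X in _ < X](size_iota 0 Hn) -has_find.
    by split=> //; have := nth_find 0 hs; rewrite -/(jof h) nth_iota // => /eqP.
  apply: (up_step aok (H := inl Hl Hn) (par := fun h => p (jof h)) (sel := fun h => L + sel (jof h))) => //.
  - by move=> h /jofP[jH E]; have [+ _ _] := tr _ jH; rewrite E.
  - by move=> h x /jofP[jH E] D; have [_ + _] := tr _ jH; rewrite E; exact.
  - move=> h /jofP[jH E]; have [_ sl] := S4 _ jH.
    by rewrite leq_addr mul2n -addnn ltn_add2l.
  move=> h x /jofP[jH E] D x0 xl xn nh; have [_ _ t3] := tr _ jH.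
  have bx : bitf INF SC (fun v => A s4 aD (jof h * nv + v)) (L + sel (jof h)) x.
    by rewrite /bitf t3 // E x0 xl eqxx.
  have [j jK [jd vj]] := cov5 _ _ jH xn bx.
  have uj : un j by rewrite /un /ch jd vj xn E.
  have [j' [t [j'Z tL E']]] := H9 j jK uj.
  have [c1 _] := UC j t jK uj tL.
  by exists t => //; exists j' => //; rewrite E' c1 /ch jd vj.
}
- rewrite (_ : 100 * LG.+1 * RR * L = 100 * (LG.+1 * (RR * L))); last by clear; lia.
  have u1 : 0 < RR * L by rewrite muln_gt0 RR0.
  have u2 : L <= RR * L by rewrite leq_pmull.
  have u3 : RR <= RR * L by rewrite leq_pmulr.
  have u4 : LG.+1 * L <= LG.+1 * (RR * L) by rewrite leq_mul2l u2 orbT.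
  have u5 : LG.+1 * RR <= LG.+1 * (RR * L) by rewrite leq_mul2l u3 orbT.
  have u6 : LG.+1 <= LG.+1 * (RR * L) by rewrite leq_pmulr.
  have u7 : RR * L <= LG.+1 * (RR * L) by rewrite leq_pmull.
  move: (RR * L) u1 u2 u3 u4 u5 u6 u7 => RL; rewrite -!(mulnA 8) !(mulnS _ (2 * L)) -!(mulnA 17) (mulnCA _ 2).
  move: (LG.+1 * L) (LG.+1 * RR) (LG.+1 * RL) L0 (leq0n LG) => a b c; clear; lia.
have Q1 := work_Q pok (ltnW iE); rewrite -/L -/Hn in Q1.
rewrite -/Zl -/K; set MN := mA * nv in Q1 *.
set Q := Hn * L * (mA + nv) in Q1.
(* [K] slots are about [Hn * nv / L], thanks to the sparse layers; the [3] absorbs the rounding in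
   [Zl]. *)
have LK : L * K <= 3 * (Hn * nv).
  rewrite /K mulnCA [3 * _]mulnCA leq_mul2l; apply/orP; right.
  rewrite /Zl mulnDr muln1; have : L * (nv %/ L) <= nv by rewrite mulnC leq_trunc_div.
  by move: y1 N0n; clear; lia.
have QE : L * (Hn * (mA + nv)) = Q by rewrite mulnCA mulnA.
have q1 : Hn * (mA + nv) <= Q by rewrite -QE leq_pmull.
have q2 : Hn * nv <= Hn * (mA + nv) by rewrite leq_mul2l leq_addl orbT.
have q3 : Hn * L * nv <= Q by rewrite leq_mul2l leq_addl orbT.
have q4 : Hn <= Hn * nv by rewrite leq_pmulr.
have q5 : L <= L * K by rewrite leq_pmulr.
have q6 : K <= L * K by rewrite leq_pmull.
have Q0 : 0 < Q by apply: leq_trans (leq_trans z1 (leq_trans q4 q2)) q1.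
have c0 : 0 < C1 ^ 2 by rewrite expn_gt0 ltnW.
(* About [(L * C1) ^ 2] classes against [Hn * nv / L] paths: the table costs as much as the
   Bellman-Ford rounds, up to [C1 ^ 2]. *)
have q7 : NP * Pm * K <= 3 * (C1 ^ 2 * Q).
  apply: leq_trans (_ : L * C1 * (L * C1) * K <= _).
    by rewrite leq_mul2r leq_mul2r leq_subr !orbT.
  rewrite (_ : L * C1 * (L * C1) * K = C1 ^ 2 * (L * (L * K))); last by rewrite -mulnn; clear; lia.
  rewrite [3 * _]mulnCA leq_mul2l; apply/orP; right; apply: leq_trans (_ : L * (3 * (Hn * nv)) <= _).
    by rewrite leq_mul2l LK orbT.
  by rewrite mulnCA leq_mul2l (mulnA L) (mulnC L) q3.
have MN0 : 0 < MN by rewrite muln_gt0 mA0 nv0.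
have q8 : RR * Z <= 3 * (RR * MN).
  rewrite mulnCA leq_mul2l; apply/orP; right; apply: leq_trans (_ : N0 + 1 <= _).
    by rewrite leq_add2r leq_div.
  have : N0 <= 2 * MN; last by move: MN0; clear; lia.
  by apply: leq_trans (p_N0m pok) _; rewrite leq_mul2l /MN leq_pmulr.
set G := LG.+1; have G0 : 0 < G by [].
set W := G * (RR * (C1 ^ 2 * Q)).
have w1 : G * RR * (NP * Pm * K) <= 3 * W.
  by rewrite /W -mulnA [3 * _]mulnCA leq_mul2l [3 * _]mulnCA leq_mul2l q7 !orbT.
have RC : 0 < RR * C1 ^ 2 by rewrite muln_gt0 RR0.
have w2 : G * Q <= W by rewrite /W leq_mul2l mulnA leq_pmull ?orbT.
have w3 : Q <= G * Q by rewrite leq_pmull.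
have w4 : RR * MN <= G * RR ^ 2 * C1 ^ 2 * MN.
  rewrite leq_mul2r; apply/orP; right; rewrite -mulnn; move: RR0 c0 G0; clear.
  by move: (C1 ^ 2) G => u v; move=> *; rewrite (_ : v * (RR * RR) * u = RR * (v * RR * u)) ?leq_pmulr ?muln_gt0 //; [lia..|lia].
have w5 : W <= 18 * (G * RR ^ 2 * C1 ^ 2 * MN).
  rewrite /W; apply: leq_trans (_ : G * (RR * (C1 ^ 2 * (18 * RR * MN))) <= _).
    by rewrite !leq_mul2l Q1 !orbT.
  by rewrite -[RR ^ 2]mulnn; clear; lia.
rewrite (_ : 3000 * G * RR ^ 2 * C1 ^ 2 * MN = 3000 * (G * RR ^ 2 * C1 ^ 2 * MN)); last by clear; lia.
have g1 : G * (Hn * (mA + nv)) <= G * Q by rewrite leq_mul2l q1 orbT.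
have g2 : G * (Hn * L * nv) <= G * Q by rewrite leq_mul2l q3 orbT.
have -> : 8 * G * ((2 * L).+1 * (Hn * (mA + nv))) = 16 * (G * Q) + 8 * (G * (Hn * (mA + nv))).
  by rewrite -QE; clear; lia.
have -> : 4 * G * (Hn * (mA + nv)) = 4 * (G * (Hn * (mA + nv))) by rewrite -(mulnA 4).
have -> : 13 * G * (Hn * L * nv) = 13 * (G * (Hn * L * nv)) by rewrite -(mulnA 13).
have -> : 20 * G * RR * (NP * Pm * K) = 20 * (G * RR * (NP * Pm * K)) by rewrite -!(mulnA 20).
rewrite (mulnS L K) -/L -/Hn.
move: (G * (NP * Pm * K)) (G * RR * (NP * Pm * K)) (G * (Hn * (mA + nv))) (G * (Hn * L * nv)) (G * Q) (G * RR ^ 2 * C1 ^ 2 * MN) w1 w2 w3 w4 w5 g1 g2 => x1 x2 x3 x4 x5 x6.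
move: (RR * MN) q8 => x7; move: (RR * Z) => x8.
move: LK q1 q2 q4 q5 q6 z1 L0 Q0; move: (L * K) (Hn * (mA + nv)) (Hn * nv) W; clear; lia.
Qed.

End Up.

End LevelUp.

(** * Programs for all levels, and the hitting sets built on the way up *)

Module Ascent.
Import Language Expressions Spawning Simulation Compiler Profits Hitting Hoare Scans BellmanFord Layers Samples Sampling Params LevelUp.

(** The list may contain a vertex several times, so writing positions directly would conflict; a
    maximum over each row of an [nv] by [eN] table avoids this. Positions are shifted by 1 to let 0
    mean absent. *)
Definition invert (aL aR : nat) (eN : expr) : cmd :=
  Par aQ ($vnv * eN) EX (EEq (EG aL (EX %% eN)) (EX %/ eN) (EX %% eN + #1) #0) ;;
  scan true aQ ($vnv * eN) eN ;;
  Par aR $vnv EX (EG aQ (EX * eN + (eN - #1))).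

(** The starting row of [h] has [INF] at [h], known profits at the vertices of the coarser set,
    found through [aINV], and 0 elsewhere; this is the situation of [down_exact]. *)
Definition rows (aT aP aL aS aD : nat) : cmd :=
  Par aD ($vHn * $vnv) EX (EEq (EX %% $vnv) (EG aH (EX %/ $vnv)) $vINF
    (EI (EG aINV (EX %% $vnv))
      (EG aS ((EG aINV (EX %% $vnv) - #1) * $vnv + EG aH (EX %/ $vnv))) #0)) ;;
  bford aT aP aL aD $vHn.

Definition up : cmd :=
  Asg vL #1 ;; Par aHS $vN0 ($vHM + EX) (EG aH0 EX) ;; For vlv vELL up_body.

(** Cell [(a, b, c)] of the cube combines profits from [a] to [c] and from [c] to [b]. [vINF] is
    subtracted once, since each profit contains it. *)
Definition square : cmd :=
  Par aT3 ($vHn * $vHn * $vHn) EX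
    (EG aC (EX %/ $vHn %/ $vHn * $vHn + EX %% $vHn) +
     EG aC (EX %% $vHn * $vHn + EX %/ $vHn %% $vHn) - $vINF) ;;
  scan true aT3 ($vHn * $vHn * $vHn) $vHn ;;
  Par aC ($vHn * $vHn) EX (EG aT3 (EX * $vHn + ($vHn - #1))).

Definition top : cmd :=
  getH ;; treeD ;;
  Par aC ($vHn * $vHn) EX (EG aD (EX %/ $vHn * $vnv + EG aH (EX %% $vHn))) ;;
  For vsq vLG square ;;
  invert aH aINV $vHn ;;
  Par aF' ($vHn * $vnv) EX (EI (EG aINV (EX %% $vnv))
    (EG aC (EX %/ $vnv * $vHn + (EG aINV (EX %% $vnv) - #1))) #0) ;;
  Par aG' ($vHn * $vnv) EX (EI (EG aINV (EX %% $vnv))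
    (EG aC ((EG aINV (EX %% $vnv) - #1) * $vHn + EX %/ $vnv)) #0) ;;
  Par aH' $vHn EX (EG aH EX) ;;
  Asg vHn' $vHn.

(** Profits from the finer set need those from it to the coarser one, which are the backward table
    of the previous level, and conversely; hence both orientations are kept and swapped. [4 * L]
    rounds suffice because the coarser set meets paths with [4 * L - 1] arcs. *)
Definition down_body : cmd :=
  getH ;; invert aH' aINV $vHn' ;; Asg vrd ($vL * #4) ;;
  rows aTL aPf aLf aG' aF ;; rows aHD aPb aLb aF' aG ;;
  Par aF' ($vHn * $vnv) EX (EG aF EX) ;;
  Par aG' ($vHn * $vnv) EX (EG aG EX) ;;
  Par aH' $vHn EX (EG aH EX) ;;
  Asg vHn' $vHn ;; Asg vL ($vL %/ #2).

Definition down : cmd := Asg vt1 ($vELL + #1) ;; For vdn vt1 down_body.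

Definition inverse (Hl : nat -> nat) (Hn x r : nat) : Prop :=
  if r is j.+1 then j < Hn /\ Hl j = x else forall j, j < Hn -> Hl j <> x.

Lemma hr_invert X LP s aL aR eN nv N LG : 64 <= X -> 2 ^ LP <= X -> 0 < nv -> 0 < N ->
  rg s vnv = nv -> rg s vLG = LG -> cst [:: vsh; vkx] [:: aQ] s eN N -> N <= 2 ^ LG -> 2 ^ LG <= X ->
  0 < aL <= 64 -> 0 < aR <= 64 -> aL != aQ ->
  hr X LP (invert aL aR eN) s (7 * LG.+1) (7 * LG.+1 * (nv * N)) (fun s' =>
    forall x, x < nv -> inverse (A s aL) N x (A s' aR x)).
Proof.
move=> X64 LX nv0 N0 En EL cN NL LGX aL0 aR0 aLQ.
have nN0 : 0 < nv * N by rewrite muln_gt0 nv0.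
apply: (hr_cost (t := 1 + (5 * LG.+1 + 1)) (w := nv * N + (5 * LG.+1 * (nv * N) + nv))).
2: by clear; lia.
2: { have : nv <= nv * N by rewrite leq_pmulr.
     by move: (nv * N); clear; nia. }
apply: (hr_seq LX); [by []|apply: (hr_map1 X64 LX (p := nv * N)) => //|].
- by rewrite !evE En (cN _ _ (fr_refl _ _ _)).
- move=> _ i iN; rewrite !evE (cN _ _ (fr_refl _ _ _)); case: ifP => // _.
  by rewrite addn1 (leq_trans _ LGX) // (leq_trans _ NL) // (mod_lt iN).
move=> s1 f1 Q1; have cN1 s' i : fr [:: vsh; vkx] [:: aQ] s1 s' -> ev s' i eN = N.
  by move=> f; apply: cN; apply: fr_sub (fr_trans f1 f).
apply: (hr_seq LX); [exact: scan_good|apply: (hr_scan1 X64 LX (T := nv * N) (l := N) (LG := LG)) => //|].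
- by move=> s' i f; rewrite !evE f.1 // f1.1 // En (cN1 _ _ f).
- by rewrite f1.1.
- by move=> [_ b2] r j _ _; rewrite big_mkord; apply/bigmax_leqP => t _; exact: b2.
move=> s2 f2 Q2; have f12 := fr_trans f1 f2.
apply: (hr_map X64 LX (p := nv)) => //; first by rewrite !evE f12.1.
  by move=> b i _; exact: (smallP X64).
move=> s3 _ R3 _ x xn; have f12' : fr [:: vsh; vkx] [:: aQ] s s2 by apply: fr_sub f12.
rewrite R3 xn !evE (cN _ _ f12').
have lt : N - 1 < N by rewrite subn1 ltn_predL.
rewrite Q2 ?idx_lt //= subn1 prednK // big_mkord.
have QE (t : 'I_N) : A s1 aQ (x * N + t) = if A s aL t == x then t.+1 else 0.
  by rewrite Q1 idx_lt // !evE (cN _ _ (fr_refl _ _ _)) idx_mod // idx_div // addn1.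
rewrite (eq_bigr _ (fun t _ => QE t)) -(big_mkord xpredT (fun t => if A s aL t == x then t.+1 else 0)) big_mkord.
case E : (\max_(t < N) _) => [|r] /=.
  move=> j jN Ej; have := leq_bigmax (F := fun t : 'I_N => if A s aL t == x then t.+1 else 0) (Ordinal jN).
  by rewrite /= Ej eqxx E.
have [h _] := bigmax_geP N xpredT (fun t => if A s aL t == x then t.+1 else 0) (ltn0Sn r).
have [|t [tN _]] := h; first by rewrite E.
have le (t' : nat) : t' < N -> (if A s aL t' == x then t'.+1 else 0) <= r.+1.
  by move=> t'N; rewrite -E; exact: (leq_bigmax (F := fun t : 'I_N => if A s aL t == x then t.+1 else 0) (Ordinal t'N)).
have := le t tN; case: eqP => // Ex tr rt.
by have <- : t = r by move: tr rt; clear; lia.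
Qed.

Section Up.
Variables X LP : nat.
Hypotheses (X64 : 64 <= X) (LX : 2 ^ LP <= X).
Notation hr := (hr X LP).
Variables (nv mA : nat) (tl hd wt : nat -> nat) (INF SC : nat) (w0 : nat -> nat).
Variables (LG N0 C1 RR ELL HM y : nat) (idx h0 : nat -> nat).
Hypothesis pok : params_ok X nv mA tl hd wt INF SC w0 LG N0 C1 RR ELL HM y idx h0.
Let aok := p_aok pok.
Let nv0 : 0 < nv. Proof. exact: aok_nv aok. Qed.
Let mA0 := p_mA pok.
Let mL := p_mL pok.
Let LGX := p_LGX pok.
Let IX := p_IX pok.
Let N00 : 0 < N0. Proof. by have /andP[] := p_N0 pok. Qed.
Let N0n : N0 <= nv. Proof. by have /andP[] := p_N0 pok. Qed.
Let C11 := p_C1 pok.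
Let RR0 : 0 < RR. Proof. by rewrite (p_RR pok) !muln_gt0 (p_LG pok) (ltnW C11). Qed.
Let BB := p_BB pok.

Notation envI := (envI nv mA LG INF SC tl hd wt).
Notation PH := (PH nv mA tl hd wt INF).

Notation envP := (envP nv mA tl hd wt INF SC LG N0 C1 RR ELL HM idx h0).
Notation hsz := (hsz N0 RR).
Notation Pr := (Pr nv mA tl hd wt INF).

(** The length [2 * 2 ^ i - 1] is 1 at level 0, where every nonempty path is to be met, and then
    follows the increments of [up_step]. *)
Definition lev (s : state) (i : nat) (Hl : nat -> nat) : Prop :=
  [/\ forall j, j < hsz (2 ^ i) -> A s aHS (2 ^ i * HM + j) = Hl j,
      forall j, j < hsz (2 ^ i) -> Hl j < nv &
      PH (inl Hl (hsz (2 ^ i))) (2 * 2 ^ i - 1)].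

Lemma hr_up s : envP s ->
  hr up s (4 + ELL * (100 * LG.+1 * RR * 2 ^ ELL).+1)
     (3 + N0 + ELL * (3000 * LG.+1 * RR ^ 2 * C1 ^ 2 * (mA * nv)).+1) (fun s' =>
    rg s' vL = 2 ^ ELL /\ forall i, i <= ELL -> exists Hl, lev s' i Hl /\
      (i = 0 -> forall j, j < N0 -> Hl j = h0 j)).
Proof.
move=> e; have [_ [EN EC ER EM EE] EI EH] := e.
apply: (hr_cost (t := 1 + (1 + (ELL * (100 * LG.+1 * RR * 2 ^ ELL).+1).+1))
  (w := 1 + (N0 + (ELL * (3000 * LG.+1 * RR ^ 2 * C1 ^ 2 * (mA * nv)).+1).+1))).
2: by clear; lia.
2: by clear; lia.
apply: (hr_seq LX); [by []|by apply: hr_asg1 => _; exact: leq_trans X64|].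
move=> s1 f1 E1; have EL1 : rg s1 vL = 1 by rewrite -E1 rg_setv.
apply: (hr_seq LX (Q1 := fun s2 => forall j, j < N0 -> A s2 aHS (1 * HM + j) = h0 j)); first by [].
  apply: (hr_par X64 LX (p := N0)) => //.
  - by rewrite !evE f1.1.
  - by move=> b i _; exact: (smallP X64).
  - by move=> i j _ _; rewrite !evE => /eqP; rewrite eqn_add2l => /eqP.
  move=> s2 _ in2 _ _ j jN; have := in2 j jN; rewrite !evE f1.1 // EM mul1n => ->.
  by rewrite f1.2.
move=> s2 f2 H2; have f12 := fr_trans f1 f2; have e2 := envP_fr f12 isT isT e.
pose I k s' := rg s' vL = 2 ^ k /\ forall i, i <= k -> exists Hl, lev s' i Hl /\
      (i = 0 -> forall j, j < N0 -> Hl j = h0 j).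
apply: (hr_for LX (I := I)) => //.
- by have [_ [_ _ _ _ ->]] := e2.
- split; first by rewrite f2.1.
  move=> i; rewrite leqn0 => /eqP ->; exists h0; split=> //; split; rewrite ?expn0 //.
  - exact: (p_h0 pok).
  (* A nonempty path starts with an arc, whose tail is among the candidates. *)
  move=> u es v [ch _ _]; case: es ch => // e' es /= /and3P[em /eqP eu _] _.
  have [c1 c2] := p_cov pok em (or_introl (esym eu)).
  by exists u; [exists (idx u)|rewrite (Pr_refl aok) addnC].
- move=> k s' kL f' [EL' lv]; set s3 := setv s' vlv k.
  have f3 := fr_setv k (isT : vlv != 0) f'.
  have e3 := envP_fr f3 isT isT e2.
  have [Hl [[l1 l2 l3] _]] := lv k (leqnn k).
  apply: hr_weak (hr_up_body X64 LX pok kL e3 EL' l1 l2 l3) _ _ _ => //.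
    by rewrite leq_mul2l leq_pexp2l ?(ltnW kL) ?orbT.
  move=> s4 [E4 old [Hl' [h1 h2 h3]]]; split; first by rewrite E4 -expnS.
  move=> i; rewrite leq_eqVlt => /orP[/eqP ->|ik].
    by exists Hl'; split=> //; rewrite /lev expnS.
  have [Hl0 [[m1 m2 m3] m4]] := lv i ik; exists Hl0; split=> //; split=> // j jH.
  rewrite old; first exact: m1.
    by rewrite leq_pexp2l.
  apply: leq_trans jH _; have [_ h _] := hszP pok (leq_trans (ik : i <= k) (ltnW kL)).
  exact: leq_trans h (p_HM pok).
Qed.

End Up.

End Ascent.

(** * Closure at the top level and one step down *)

Module Descent.
Import Language Expressions Spawning Simulation Compiler Profits Hitting Hoare Scans BellmanFord Layers Samples Sampling Params LevelUp Ascent.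

Section Rows.
Variables X LP : nat.
Hypotheses (X64 : 64 <= X) (LX : 2 ^ LP <= X).
Notation hr := (hr X LP).
Variables (nv mA : nat) (tl hd wt : nat -> nat) (INF SC : nat) (w0 : nat -> nat) (LG : nat).
Hypothesis aok : arcs_ok nv mA tl hd wt INF SC w0.
Hypotheses (mA0 : 0 < mA) (mL : mA <= 2 ^ LG) (LGX : 2 ^ LG <= X) (IX : INF.+1 * mA <= X).
Notation Pr := (Pr nv mA tl hd wt INF).
Notation PH := (PH nv mA tl hd wt INF).

Lemma hr_rows s aT aP aL aS aD Hn Hl N H' l r :
  arr_ok [:: aT; aP; aL; aS; aD] -> aX \notin [:: aT; aP; aL; aD] -> aY \notin [:: aT; aP; aL; aD] ->
  aD \notin [:: aT; aP; aL; aW] ->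
  envG nv mA LG wt s -> envO nv mA LG tl hd aT aP aL s -> rg s vINF = INF ->
  rg s vHn = Hn -> 0 < Hn -> rg s vrd = r ->
  (forall j, j < Hn -> A s aH j = Hl j) -> (forall j, j < Hn -> Hl j < nv) ->
  (forall j, j < N -> H' j < nv) ->
  (forall x, x < nv -> inverse H' N x (A s aINV x)) ->
  (forall j u, j < N -> inl Hl Hn u -> A s aS (j * nv + u) = Pr u (H' j)) ->
  PH (inl H' N) l -> l <= r ->
  hr (rows aT aP aL aS aD) s (8 * LG.+1 * r.+1 + 1) (8 * LG.+1 * (r.+1 * (Hn * (mA + nv))) + Hn * nv)
    (fun s' => forall h v, h < Hn -> v < nv -> A s' aD (h * nv + v) = Pr (Hl h) v).
Proof.
move=> ar dX dY dD eg eo EIN EHn Hn0 Er EH Hln H'n inv val PHl lr.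
have nv0 := aok_nv aok; have [En Em EG' EW] := eg.
have /= /and5P[aT0 aP0 aL0 aS0 /andP[aD0 _]] := ar.
have IX' : INF <= X by apply: leq_trans IX; move: mA0; clear; nia.
(* Total version of the starting row: 0 outside the vertex range, and exact where [aINV] reports a
   vertex of the coarser set. *)
pose D h x := if x == Hl h then INF else if x < nv then
  (if A s aINV x is j.+1 then Pr (Hl h) x else 0) else 0.
have Dle h x : D h x <= Pr (Hl h) x.
  rewrite /D; case: eqP => [->|_]; first by rewrite (Pr_refl aok).
  by case: ifP => // _; case: (A _ _ _).
pose e1 := (EEq (EX %% $vnv) (EG aH (EX %/ $vnv)) $vINF
    (EI (EG aINV (EX %% $vnv))
      (EG aS ((EG aINV (EX %% $vnv) - #1) * $vnv + EG aH (EX %/ $vnv))) #0))%ex.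
have val1 i : i < Hn * nv -> ev s i e1 = D (i %/ nv) (i %% nv).
  move=> iH; have hH := div_lt iH; have xn := mod_lt iH.
  rewrite /e1 !evE En EIN EH // /D xn; case: eqP => // _.
  have := inv _ xn; case: (A s aINV _) => // j [jN Hj].
  by rewrite subn1 /= val // ?Hj //; exists (i %/ nv).
apply: (hr_cost (t := 1 + 8 * LG.+1 * r.+1) (w := Hn * nv + 8 * LG.+1 * (r.+1 * (Hn * (mA + nv))))).
2: by clear; lia.
2: by clear; lia.
apply: (hr_seq LX); [exact: good_par|apply: (hr_map1 X64 LX (p := Hn * nv)) => //|].
- by rewrite !evE EHn En.
- by rewrite muln_gt0 Hn0.
- move=> _ i iH; rewrite -/e1 val1 //; apply: leq_trans (Dle _ _) (leq_trans (Pr_INF aok _ _) IX').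
rewrite -/e1; move=> s1 f1 D1.
have {}D1 h x : h < Hn -> x < nv -> A s1 aD (h * nv + x) = D h x.
  by move=> hH xn; rewrite D1 idx_lt // val1 ?idx_lt // idx_div // idx_mod.
have eg1 : envG nv mA LG wt s1.
  by apply: (envG_fr f1) eg => //; move: dD; rewrite /= !inE; clear; lia.
have eo1 : envO nv mA LG tl hd aT aP aL s1.
  apply: (envO_fr f1) eo; first by rewrite /= aT0 aP0 aL0.
  by move: dD; rewrite /= !inE; clear; lia.
apply: (hr_post (Q := fun s' => (forall h v, h < Hn -> v < nv -> A s' aD (h * nv + v) =
       bf mA tl hd wt (fun x => A s1 aD (h * nv + x)) r v) /\
       forall i, i < Hn * nv -> A s' aD i <= INF)).
  apply: (hr_bford X64 LX nv0 mA0 mL LGX IX (aok_0 aok) (aok_tl aok)) => //.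
  - by rewrite /= aT0 aP0 aL0 aD0.
  - by move=> s' i f'; rewrite !evE f'.1 // f1.1.
  - by rewrite f1.1.
  - move=> i iH; rewrite (divn_eq i nv) D1 ?(div_lt iH) ?(mod_lt iH) //.
    exact: leq_trans (Dle _ _) (Pr_INF aok _ _).
move=> s' [H1 _] h v hH vn; rewrite H1 //.
transitivity (bf mA tl hd wt (D h) r v).
  elim: r v vn {Er lr H1} => [|k IH] v vn /=; first exact: D1.
  rewrite IH //; congr (maxn _ _); apply: eq_bigr => e' _; rewrite IH //.
  exact: aok_tl aok _ (ltn_ord e').
have HH := @down_exact _ _ _ _ _ _ _ _ aok _ _ _ (Hl h) (D h) v PHl lr; apply: HH => //; first by rewrite /D eqxx.
move=> z [j jN <-]; rewrite /D; case: eqP => [->|_]; first by rewrite (Pr_refl aok).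
rewrite H'n //; have := inv _ (H'n j jN); case: (A s aINV _) => // /(_ j jN); by [].
Qed.

End Rows.

Section Up.
Variables X LP : nat.
Hypotheses (X64 : 64 <= X) (LX : 2 ^ LP <= X).
Notation hr := (hr X LP).
Variables (nv mA : nat) (tl hd wt : nat -> nat) (INF SC : nat) (w0 : nat -> nat).
Variables (LG N0 C1 RR ELL HM y : nat) (idx h0 : nat -> nat).
Hypothesis pok : params_ok X nv mA tl hd wt INF SC w0 LG N0 C1 RR ELL HM y idx h0.
Let aok := p_aok pok.
Let nv0 : 0 < nv. Proof. exact: aok_nv aok. Qed.
Let mA0 := p_mA pok.
Let mL := p_mL pok.
Let LGX := p_LGX pok.
Let IX := p_IX pok.
Let N00 : 0 < N0. Proof. by have /andP[] := p_N0 pok. Qed.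
Let N0n : N0 <= nv. Proof. by have /andP[] := p_N0 pok. Qed.
Let C11 := p_C1 pok.
Let RR0 : 0 < RR. Proof. by rewrite (p_RR pok) !muln_gt0 (p_LG pok) (ltnW C11). Qed.
Let BB := p_BB pok.

Notation envI := (envI nv mA LG INF SC tl hd wt).
Notation PH := (PH nv mA tl hd wt INF).

Notation envP := (envP nv mA tl hd wt INF SC LG N0 C1 RR ELL HM idx h0).
Notation hsz := (hsz N0 RR).
Notation Pr := (Pr nv mA tl hd wt INF).
Notation lev := (lev nv mA tl hd wt INF N0 RR HM).
Let Q i := hsz (2 ^ i) * 2 ^ i * (mA + nv).
Notation MN := (mA * nv).
Notation G := LG.+1.

(* Exact profits between the [N] vertices [Hl] and the vertices of [U], both ways. *)
Definition known (s : state) (N : nat) (Hl : nat -> nat) (U : nat -> Prop) : Prop :=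
  [/\ rg s vHn' = N, 0 < N <= RR * N0.+1,
      forall j, j < N -> A s aH' j = Hl j /\ Hl j < nv &
      forall j u, j < N -> U u -> A s aF' (j * nv + u) = Pr (Hl j) u /\
                               A s aG' (j * nv + u) = Pr u (Hl j)].

Lemma hr_down_body s i Hl N H' l (L := 2 ^ i) : i <= ELL -> envP s -> rg s vL = L ->
  lev s i Hl -> known s N H' (inl Hl (hsz L)) -> PH (inl H' N) l -> l <= 4 * L ->
  hr down_body s (100 * G * L) (8 * G * (10 * Q i) + 28 * G * RR * MN + 20 * Q i)
    (fun s' => rg s' vL = L %/ 2 /\ known s' (hsz L) Hl (fun u => u < nv)).
Proof.
move=> iE e EL lv kn PHl lL; have [l1 l2 l3] := lv; have [z1 z2 z3] := hszP pok iE.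
rewrite -/L in l1 l2 l3 z1 z2 z3; set Hn := hsz L in kn l1 l2 l3 z1 z2 z3 *.
have [k1 /andP[k2 k3] k4 k5] := kn.
have nX : nv.+1 <= X.
  by apply: leq_trans LGX; apply: (RR_LG pok); move: nv0 RR0 N00; clear; nia.
have L4 : L * 4 <= X.
  apply: leq_trans LGX; apply: leq_trans (ltnW BB).
  apply: leq_trans (_ : 16 * nv <= _).
    have := p_ELL pok; have : L <= 2 ^ ELL by rewrite leq_pexp2l.
    by move: N0n; clear; lia.
  apply: leq_mul; last by apply: leq_trans (leqnSn nv) _; rewrite -{1}[nv.+1]expn1 leq_pexp2l.
  by move: RR0 C11; rewrite -mulnn; clear; case: RR => // r; case: C1 => [|[|c]] //; clear; lia.
have NLG : N < 2 ^ LG by apply: (RR_LG pok); apply: leq_trans k3 _; rewrite leq_pmulr.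
have HLG : Hn < 2 ^ LG by apply: (RR_LG pok); apply: leq_trans z2 _; rewrite leq_pmulr.
apply: hr_cost.
{ apply: (hr_seq LX); [by []|exact: (hr_getH X64 LX pok iE e EL l1)|].
  move=> s1 f1 [EHn1 H1]; have e1 := envP_fr f1 isT isT e.
  have [[[En1 Em1 EG1 _] _ _ _ _] _ _ _] := e1.
  apply: (hr_seq LX); [by []|apply: (hr_invert (eN := $vHn') (N := N) (nv := nv) (LG := LG)) => //|].
  - by move=> s' j f'; rewrite !evE f'.1 // f1.1.
  - exact: ltnW.
  move=> s2 f2 I2; have f12 := fr_trans f1 f2; have e2 := envP_fr f12 isT isT e.
  have {}I2 x : x < nv -> inverse H' N x (A s2 aINV x).
    move=> xn; have := I2 x xn; rewrite /inverse; have AE j : j < N -> A s1 aH' j = H' j.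
      by move=> jN; rewrite f1.2 //; have [->] := k4 j jN.
    case: (A s2 aINV x) => [h j jN|j [jN <-]]; last by rewrite AE.
    by rewrite -AE //; exact: h.
  apply: (hr_seq LX); [by []|apply: hr_asg1 => _; by rewrite !evE f12.1 // EL|].
  move=> s3 f3 E3; have f13 := fr_trans f12 f3; have e3 := envP_fr f13 isT isT e.
  have Er3 : rg s3 vrd = 4 * L by rewrite -E3 rg_setv eqxx !evE f12.1 // EL mulnC.
  have [[eg3 eo3 eb3 EI3 _] _ _ _] := e3.
  have EHn3 : rg s3 vHn = Hn by rewrite f3.1 // f2.1.
  have H3 j : j < Hn -> A s3 aH j = Hl j by move=> jH; rewrite f3.2 // f2.2 // H1.
  have I3 x : x < nv -> inverse H' N x (A s3 aINV x) by move=> xn; rewrite f3.2 //; exact: I2.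
  have H'n j : j < N -> H' j < nv by move=> /k4[].
  apply: (hr_seq LX); [by []|apply: (hr_rows X64 LX aok mA0 mL LGX IX _ _ _ _ eg3 eo3 EI3 EHn3 z1 Er3 H3 l2 H'n I3 _ PHl lL) => //|].
    by move=> j u jN uH; rewrite f13.2 //; have [] := k5 j u jN uH.
  move=> s4 f4 F4; have f14 := fr_trans f13 f4; have e4 := envP_fr f14 isT isT e.
  have [[eg4 eo4 eb4 EI4 _] _ _ _] := e4.
  have EHn4 : rg s4 vHn = Hn by rewrite f4.1.
  have H4 j : j < Hn -> A s4 aH j = Hl j by move=> jH; rewrite f4.2 // H3.
  have I4 x : x < nv -> inverse H' N x (A s4 aINV x) by move=> xn; rewrite f4.2 //; exact: I3.
  have Er4 : rg s4 vrd = 4 * L by rewrite f4.1.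
  apply: (hr_seq LX); [by []|apply: (hr_rows X64 LX (arcs_rev aok) mA0 mL LGX IX _ _ _ _ eg4 eb4 EI4 EHn4 z1 Er4 H4 l2 H'n I4 _ (PH_rev aok PHl) lL) => //|].
    by move=> j u jN uH; rewrite f14.2 // (Pr_rev _ _ aok); have [] := k5 j u jN uH.
  move=> s5 f5 G5; have f15 := fr_trans f14 f5; have e5 := envP_fr f15 isT isT e.
  have [[[En5 _ _ _] _ _ _ _] _ _ _] := e5.
  have EHn5 : rg s5 vHn = Hn by rewrite f5.1.
  have F5 h v : h < Hn -> v < nv -> A s5 aF (h * nv + v) = Pr (Hl h) v by move=> hH vn; rewrite f5.2 // F4.
  have {}G5 h v : h < Hn -> v < nv -> A s5 aG (h * nv + v) = Pr v (Hl h).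
    by move=> hH vn; rewrite G5 // (Pr_rev _ _ aok).
  have Hn0 : 0 < Hn * nv by rewrite muln_gt0 z1.
  apply: (hr_seq LX); [by []|apply: (hr_map1 X64 LX (p := Hn * nv)) => //|].
  - by rewrite !evE EHn5 En5.
  - by move=> b j _; exact: (smallP X64).
  move=> s6 f6 F6; have f16 := fr_trans f15 f6; have f56 := f6.
  apply: (hr_seq LX); [by []|apply: (hr_map1 X64 LX (p := Hn * nv)) => //|].
  - by rewrite !evE !f6.1 // EHn5 En5.
  - by move=> b j _; exact: (smallP X64).
  move=> s7 f7 G7; have f57 := fr_trans f6 f7.
  apply: (hr_seq LX); [by []|apply: (hr_map1 X64 LX (p := Hn)) => //|].
  - by rewrite !evE f57.1 // EHn5.
  - by move=> b j _; exact: (smallP X64).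
  move=> s8 f8 H8; have f58 := fr_trans f57 f8.
  apply: (hr_seq LX); [by []|apply: hr_asg1 => b; exact: (smallP X64)|].
  move=> s9 f9 E9; have f59 := fr_trans f58 f9.
  have EL9 : rg s9 vL = L by rewrite f59.1 // f15.1.
  have EN9 : rg s9 vHn' = Hn by rewrite -E9 rg_setv eqxx !evE f58.1.
  apply: hr_asg; first by move=> b; exact: (smallP X64).
  split; first by rewrite rg_setv eqxx !evE EL9.
  split=> //; first by rewrite z1 z2.
    move=> j jH; rewrite A_setv // f9.2 // H8 jH !evE f57.2 // f5.2 // H4 //; split=> //; exact: l2.
  move=> j u jH un; rewrite !A_setv // !f9.2 // !f8.2 // f7.2 //.
  by rewrite F6 G7 idx_lt // !evE F5 // f6.2 // G5.
}
- have G0 : L <= G * L by rewrite leq_pmull.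
  have L0 : 0 < L by rewrite expn_gt0.
  have G1 : G <= G * L by rewrite leq_pmulr.
  have -> : 8 * G * (4 * L).+1 = 32 * (G * L) + 8 * G by clear; lia.
  rewrite -(mulnA 100); move: (G * L) (LG.+1) G0 G1 L0 => GL g; clear; lia.
have L0 : 0 < L by rewrite expn_gt0.
set q := Q i; have qE : L * (Hn * (mA + nv)) = q by rewrite /q /Q -/L -/Hn mulnCA mulnA.
have q1 : Hn * (mA + nv) <= q by rewrite -qE leq_pmull.
have q2 : Hn * nv <= Hn * (mA + nv) by rewrite leq_mul2l leq_addl orbT.
have q4 : Hn <= Hn * nv by rewrite leq_pmulr.
have q3 : nv * N <= 4 * (RR * MN).
  apply: leq_trans (_ : nv * (RR * (2 * N0)) <= _).
    rewrite leq_mul2l; apply/orP; right; apply: leq_trans k3 _; rewrite leq_mul2l; apply/orP; right.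
    by move: N00; clear; lia.
  rewrite (_ : nv * _ = 2 * (RR * (N0 * nv))); last by clear; lia.
  rewrite (_ : 4 * _ = 2 * (RR * (2 * mA * nv))); last by clear; lia.
  by rewrite !leq_mul2l leq_mul2r (p_N0m pok) !orbT.
have q5 : 7 * G * (nv * N) <= 28 * G * RR * MN.
  rewrite (_ : 28 * G * RR * MN = 7 * G * (4 * (RR * MN))); last by clear; lia.
  by rewrite leq_mul2l q3 orbT.
have q6 : 8 * G * ((4 * L).+1 * (Hn * (mA + nv))) <= 8 * G * (5 * q).
  by rewrite leq_mul2l; apply/orP; right; rewrite mulSn -mulnA qE; move: q1; clear; lia.
rewrite -/L -/Hn; move: q1 q2 q4 q5 q6 z1.
rewrite (_ : 8 * G * (10 * q) = 2 * (8 * G * (5 * q))); last by clear; lia.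
move: (8 * G * (5 * q)) (8 * G * (_ * _)) (7 * G * _) (28 * G * RR * MN) (Hn * (mA + nv)) (Hn * nv).
by clear; lia.
Qed.

(** The set has at most [6 * RR * N0 / L] vertices and [L ^ 3 >= N0], so its cube is at most
    [216 * RR ^ 3 * N0 ^ 2], and [N0 ^ 2 <= 2 * mA * nv]. *)
Lemma cube_bound (L := 2 ^ ELL) : hsz L * hsz L * hsz L <= 432 * (RR ^ 3 * MN).
Proof.
have [_ _ z3] := hszP pok (leqnn ELL); rewrite -/L in z3.
have h : (hsz L * L) ^ 3 <= (6 * RR * N0) ^ 3 by rewrite leq_exp2r.
rewrite !expnMn in h; rewrite -(leq_pmul2r N00).
have cubeE a : a ^ 3 = a * a * a by rewrite !expnS expn0 muln1 mulnA.
apply: leq_trans (_ : hsz L ^ 3 * L ^ 3 <= _).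
  by rewrite -(cubeE (hsz L)) leq_mul2l (p_ELL3 pok) orbT.
apply: leq_trans h _; rewrite (_ : 6 ^ 3 * RR ^ 3 * N0 ^ 3 = 216 * RR ^ 3 * (N0 * N0) * N0); last first.
  by rewrite (cubeE N0); clear; lia.
rewrite leq_mul2r; apply/orP; right; rewrite (_ : 432 * _ = 216 * RR ^ 3 * (2 * mA * nv)); last by clear; lia.
by rewrite leq_mul2l leq_mul ?orbT // (p_N0m pok).
Qed.

Lemma hr_top s Hl (L := 2 ^ ELL) : envP s -> rg s vL = L -> lev s ELL Hl ->
  hr top s (60 * (G * G * L)) (5000 * (G * G * (RR ^ 3 * MN)))
    (fun s' => known s' (hsz L) Hl (inl Hl (hsz L))).
Proof.
move=> e EL lv; have [l1 l2 l3] := lv; have [z1 z2 z3] := hszP pok (leqnn ELL).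
rewrite -/L in l1 l2 l3 z1 z2 z3; set Hn := hsz L in l1 l2 l3 z1 z2 z3 *.
have L0 : 0 < L by rewrite expn_gt0.
have HLG : Hn <= 2 ^ LG by apply: ltnW; apply: (RR_LG pok); apply: leq_trans z2 _; rewrite leq_pmulr.
have IX' : INF <= X by apply: leq_trans IX; move: mA0; clear; nia.
have LLX : L + L <= X.
  apply: leq_trans LGX; apply: leq_trans (ltnW BB); apply: leq_trans (_ : 8 * nv <= _).
    by have := p_ELL pok; rewrite -/L; move: N0n; clear; lia.
  apply: leq_mul; last by apply: leq_trans (leqnSn nv) _; rewrite -{1}[nv.+1]expn1 leq_pexp2l.
  by rewrite -mulnA leq_pmulr // muln_gt0 RR0 expn_gt0 (ltnW C11).
(* The matrix after [r] squarings, indexed by vertices as in [closure_exact], whereas the array is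
   indexed by positions in the list. *)
pose Cf := fix Cf r a b : nat := if r is r'.+1 then \max_(c < Hn) (Cf r' a (Hl c) + Cf r' (Hl c) b - INF)
  else bf mA tl hd wt (ini INF a) (2 * L) b.
have cl r a b : inl Hl Hn a -> inl Hl Hn b -> Cf r a b <= Pr a b /\
    (hop nv mA tl hd wt INF SC a b <= 2 * L - 1 + 2 ^ r -> Cf r a b = Pr a b).
  apply: (closure_exact aok l3 (k := 2 * L)) => //.
  - by move: L0; clear; lia.
  - move=> r' a' b' c' _ _ [c cN <-].
    exact: (leq_bigmax (F := fun c : 'I_Hn => Cf r' a' (Hl c) + Cf r' (Hl c) b' - INF) (Ordinal cN)).
  move=> r' a' b' _ _ /= m0.
  have [/(_ (leqnn _))[c [cN _ le]] _] := bigmax_geP Hn xpredT (fun c => Cf r' a' (Hl c) + Cf r' (Hl c) b' - INF) m0.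
  exists (Hl c); first by exists c.
  apply/eqP; rewrite eqn_leq le /=.
  exact: (leq_bigmax (F := fun c : 'I_Hn => Cf r' a' (Hl c) + Cf r' (Hl c) b' - INF) (Ordinal cN)).
have inlH c : c < Hn -> inl Hl Hn (Hl c) by exists c.
have ClI r a b : a < Hn -> b < Hn -> Cf r (Hl a) (Hl b) <= INF.
  by move=> aH bH; have [h _] := cl r _ _ (inlH a aH) (inlH b bH); exact: leq_trans h (Pr_INF aok _ _).
(* Shortest paths have fewer than [nv <= 2 ^ LG] arcs, so [LG] squarings are enough. *)
have ClP a b : inl Hl Hn a -> inl Hl Hn b -> Cf LG a b = Pr a b.
  move=> aH bH; have [h1 h2] := cl LG a b aH bH.
  case: (posnP (Pr a b)) => [p0|p0]; first by apply/eqP; rewrite p0 -leqn0 -p0.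
  have [es oe] := opt_ex aok p0; apply: h2; rewrite -(opt_hop aok oe).
  apply: leq_trans (ltnW (opt_size aok oe)) _; apply: leq_trans (leq_addl _ _).
  by apply: ltnW; apply: (RR_LG pok); move: nv0 RR0 N00; clear; nia.
have HH0 : 0 < Hn * Hn by rewrite muln_gt0 z1.
have HHH0 : 0 < Hn * Hn * Hn by rewrite muln_gt0 HH0.
apply: hr_cost.
{ apply: (hr_seq LX); [by []|exact: (hr_getH X64 LX pok (leqnn _) e EL l1)|].
  move=> s1 f1 [EHn1 H1]; have e1 := envP_fr f1 isT isT e; have [eI1 _ _ _] := e1.
  have EL1 : rg s1 vL = L by rewrite f1.1.
  apply: (hr_seq LX); [by []|exact: (hr_treeD X64 LX aok mA0 mL LGX IX eI1 EL1 EHn1 z1 LLX)|].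
  move=> s2 f2 [D2 _]; have f12 := fr_trans f1 f2; have e2 := envP_fr f12 isT isT e.
  have [[[En2 _ _ _] _ _ _ _] _ _ _] := e2.
  have EHn2 : rg s2 vHn = Hn by rewrite f2.1.
  have H2 j : j < Hn -> A s2 aH j = Hl j by move=> jH; rewrite f2.2 // H1.
  apply: (hr_seq LX); [by []|apply: (hr_map1 X64 LX (p := Hn * Hn)) => //|].
  - by rewrite !evE EHn2.
  - by move=> b j _; exact: (smallP X64).
  move=> s3 f3 C3; have f13 := fr_trans f12 f3; have e3 := envP_fr f13 isT isT e.
  pose I r s' := forall a b, a < Hn -> b < Hn -> A s' aC (a * Hn + b) = Cf r (Hl a) (Hl b).
  apply: (hr_seq LX (Q1 := I LG)); first by [].
    apply: (hr_for LX (n := LG) (t := 1 + (5 * G + 1))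
      (w := Hn * Hn * Hn + (5 * G * (Hn * Hn * Hn) + Hn * Hn)) (I := I)) => //.
    - by have [[[_ _ ->]]] := e3.
    - move=> a b aH bH; rewrite C3 idx_lt // !evE EHn2 En2 idx_mod // idx_div // H2 // D2 ?l2 //.
      by rewrite H1.
    - move=> r s' rL f' Ir; set s4 := setv s' vsq r.
      have f4 := fr_setv r (isT : vsq != 0) f'; have f14 := fr_trans f13 f4.
      have e4 := envP_fr f14 isT isT e; have [[[En4 _ EG4 _] _ _ EI4 _] _ _ _] := e4.
      have EHn4 : rg s4 vHn = Hn by rewrite f4.1 // f3.1.
      have C4 a b : a < Hn -> b < Hn -> A s4 aC (a * Hn + b) = Cf r (Hl a) (Hl b) by move=> aH bH; rewrite A_setv // Ir.
      have v4 j : j < Hn * Hn * Hn -> ev s4 j (EG aC (EX %/ $vHn %/ $vHn * $vHn + EX %% $vHn) +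
         EG aC (EX %% $vHn * $vHn + EX %/ $vHn %% $vHn) - $vINF)%ex =
         Cf r (Hl (j %/ Hn %/ Hn)) (Hl (j %% Hn)) + Cf r (Hl (j %% Hn)) (Hl (j %/ Hn %% Hn)) - INF.
        move=> jH; have h1 := div_lt jH; have h2 := mod_lt jH.
        by rewrite !evE EHn4 EI4 !C4 ?(div_lt h1) ?(mod_lt h1).
      apply: (hr_seq LX); [by []|apply: (hr_map1 X64 LX (p := Hn * Hn * Hn)) => //|].
      + by rewrite !evE EHn4.
      + move=> _ j jH; have h1 := div_lt jH; have h2 := mod_lt jH; rewrite v4 //.
        have := ClI r _ _ (div_lt h1) h2; have := ClI r _ _ h2 (mod_lt h1); move: IX'; clear; lia.
      move=> s5 f5 T5; apply: (hr_seq LX); [exact: scan_good|apply: (hr_scan1 X64 LX (T := Hn * Hn * Hn) (l := Hn) (LG := LG)) => //|].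
      + by move=> s6 j f6; rewrite !evE !f6.1 // !f5.1 // EHn4.
      + by move=> s6 j f6; rewrite !evE !f6.1 // !f5.1 // EHn4.
      + by rewrite f5.1.
      + by move=> [_ b2] q j _ _; rewrite big_mkord; apply/bigmax_leqP => t _; exact: b2.
      move=> s6 f6 T6; have f56 := fr_trans f5 f6.
      have EHn6 : rg s6 vHn = Hn by rewrite f56.1.
      apply: (hr_post (Q := fun s7 => forall i, A s7 aC i = if i < Hn * Hn then ev s6 i (EG aT3 (EX * $vHn + ($vHn - #1)))%ex else A s6 aC i)).
        apply: (hr_map1 X64 LX (p := Hn * Hn)) => //; first by rewrite !evE EHn6.
        by move=> b j _; exact: (smallP X64).
      move=> s7 C7 a b aH bH; have ab := idx_lt aH bH.
      have lt : Hn - 1 < Hn by rewrite subn1 ltn_predL.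
      rewrite C7 ab !evE EHn6 T6 ?idx_lt //= subn1 prednK // big_mkord.
      apply: eq_bigr => c _; rewrite T5 idx_lt // v4 ?idx_lt //.
      by rewrite idx_mod // (idx_div (a * Hn + b)) // idx_div // idx_mod.
  move=> s4 f4 C4; have f14 := fr_trans f13 f4; have e4 := envP_fr f14 isT isT e.
  have [[[En4 _ EG4 _] _ _ EI4 _] _ _ _] := e4.
  have EHn4 : rg s4 vHn = Hn by rewrite f4.1 // f3.1.
  have H4 j : j < Hn -> A s4 aH j = Hl j by move=> jH; rewrite f4.2 // f3.2 // H2.
  apply: (hr_seq LX); [by []|apply: (hr_invert (eN := $vHn) (N := Hn) (nv := nv) (LG := LG)) => //|].
    by move=> s' j f'; rewrite !evE f'.1.
  move=> s5 f5 I5; have f15 := fr_trans f14 f5; have e5 := envP_fr f15 isT isT e.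
  have [[[En5 _ _ _] _ _ _ _] _ _ _] := e5.
  have EHn5 : rg s5 vHn = Hn by rewrite f5.1.
  have C5 a b : a < Hn -> b < Hn -> A s5 aC (a * Hn + b) = Pr (Hl a) (Hl b).
    by move=> aH bH; rewrite f5.2 // C4 // ClP //; exact: inlH.
  have I5' c : c < Hn -> exists j, [/\ A s5 aINV (Hl c) = j.+1, j < Hn & Hl j = Hl c].
    move=> cH; have := I5 _ (l2 c cH); case: (A s5 aINV _) => [/(_ c cH)|j [jH Ej]].
      by rewrite H4.
    by exists j; rewrite -H4.
  have Hv0 : 0 < Hn * nv by rewrite muln_gt0 z1.
  apply: (hr_seq LX); [by []|apply: (hr_map1 X64 LX (p := Hn * nv)) => //|].
  - by rewrite !evE EHn5 En5.
  - by move=> b j _; exact: (smallP X64).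
  move=> s6 f6 F6; apply: (hr_seq LX); [by []|apply: (hr_map1 X64 LX (p := Hn * nv)) => //|].
  - by rewrite !evE !f6.1 // EHn5 En5.
  - by move=> b j _; exact: (smallP X64).
  move=> s7 f7 G7; have f67 := fr_trans f6 f7.
  apply: (hr_seq LX); [by []|apply: (hr_map1 X64 LX (p := Hn)) => //|].
  - by rewrite !evE f67.1 // EHn5.
  - by move=> b j _; exact: (smallP X64).
  move=> s8 f8 H8; have f68 := fr_trans f67 f8.
  apply: hr_asg; first by move=> b; exact: (smallP X64).
  split=> //.
  - by rewrite rg_setv eqxx !evE f68.1.
  - by rewrite z1 z2.
  - by move=> j jH; rewrite A_setv // H8 jH !evE f67.2 // f5.2 // H4 //; split=> //; exact: l2.
  move=> j u jH [c cH <-]; rewrite !A_setv // !f8.2 // f7.2 //.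
  have [j' [Ej' j'H EH']] := I5' c cH; have un := l2 c cH.
  rewrite F6 G7 idx_lt // !evE !f6.2 // !f6.1 // En5 EHn5 idx_mod // idx_div // Ej' /= subn1 /=.
  by rewrite !C5 // EH'.
}
- have a1 : G * L <= G * G * L by rewrite -mulnA leq_pmull.
  have a2 : L <= G * L by rewrite leq_pmull.
  have a3 : G * G <= G * G * L by rewrite leq_pmulr.
  have a4 : G <= G * G by rewrite leq_pmulr.
  have a5 : LG * (1 + (5 * G + 1)).+1 <= 5 * (G * G) + 3 * G by clear; nia.
  rewrite -/L (_ : 8 * G * (2 * L).+1 = 16 * (G * L) + 8 * G); last by clear; lia.
  move: (LG * _) (G * L) (G * G * L) (G * G) a1 a2 a3 a4 a5 => x1 x2 x3 x4; clear; lia.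
have q0 := work_Q pok (leqnn ELL); rewrite -/L -/Hn in q0.
have cb := cube_bound; rewrite -/L -/Hn in cb.
set q := Hn * L * (mA + nv) in q0; have qE : L * (Hn * (mA + nv)) = q by rewrite mulnCA mulnA.
have q1 : Hn * (mA + nv) <= q by rewrite -qE leq_pmull.
have q2 : Hn * nv <= Hn * (mA + nv) by rewrite leq_mul2l leq_addl orbT.
have q4 : Hn <= Hn * nv by rewrite leq_pmulr.
have q5 : 7 * G * (nv * Hn) <= 7 * (G * q).
  by rewrite -mulnA !leq_mul2l (mulnC nv) (leq_trans q2 q1) !orbT.
have q6 : 8 * G * ((2 * L).+1 * (Hn * (mA + nv))) <= 24 * (G * q).
  rewrite (_ : 24 * _ = 8 * G * (3 * q)); last by clear; lia.
  by rewrite leq_mul2l; apply/orP; right; rewrite mulSn -mulnA qE; move: q1; clear; lia.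
have h1 : Hn * Hn <= Hn * Hn * Hn by rewrite leq_pmulr.
set T := Hn * Hn * Hn in cb h1 HHH0 *.
have h2 : LG * (T + (5 * G * T + Hn * Hn)).+1 <= 8 * (G * G * T).
  apply: leq_trans (_ : G * (8 * (G * T)) <= _); last by clear; lia.
  apply: leq_mul => //; have : T <= G * T by rewrite leq_pmull.
  by rewrite -(mulnA 5); move: h1 HHH0; clear; lia.
set B := RR ^ 3 * MN in cb *.
have b1 : RR * MN <= B by rewrite /B leq_mul2r -{1}[RR]expn1 leq_pexp2l ?orbT.
have b2 : G * q <= 18 * (G * B).
  by rewrite [18 * _]mulnCA leq_mul2l; apply/orP; right; move: q0 b1; rewrite -mulnA; clear; lia.
have b3 : G * B <= G * G * B by rewrite -mulnA leq_pmull.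
have b4 : G * G * T <= 432 * (G * G * B) by rewrite [432 * _]mulnCA leq_mul2l cb orbT.
have b5 : q <= G * q by rewrite leq_pmull.
have b6 : T <= G * G * T by rewrite leq_pmull.
rewrite -/L -/Hn -/T.
move: q1 q2 q4 q5 q6 h1 h2 b2 b3 b4 b5 b6 z1; move: (7 * G * _) (8 * G * _) (LG * _).
move: (G * G * T) (G * G * B) (G * B) (G * q) (Hn * nv) (Hn * (mA + nv)) (Hn * Hn) => x1 x2 x3 x4 x5 x6 x7 x8 x9 x10.
by clear; lia.
Qed.

End Up.

End Descent.

(** * All distances from the candidate vertices *)

Module Solve.
Import Language Expressions Spawning Simulation Compiler Profits Hitting Hoare Scans BellmanFord Layers Samples Sampling Params LevelUp Ascent Descent.

Definition solve : cmd := up ;; top ;; down.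

Section Up.
Variables X LP : nat.
Hypotheses (X64 : 64 <= X) (LX : 2 ^ LP <= X).
Notation hr := (hr X LP).
Variables (nv mA : nat) (tl hd wt : nat -> nat) (INF SC : nat) (w0 : nat -> nat).
Variables (LG N0 C1 RR ELL HM y : nat) (idx h0 : nat -> nat).
Hypothesis pok : params_ok X nv mA tl hd wt INF SC w0 LG N0 C1 RR ELL HM y idx h0.
Let aok := p_aok pok.
Let nv0 : 0 < nv. Proof. exact: aok_nv aok. Qed.
Let mA0 := p_mA pok.
Let mL := p_mL pok.
Let LGX := p_LGX pok.
Let IX := p_IX pok.
Let N00 : 0 < N0. Proof. by have /andP[] := p_N0 pok. Qed.
Let N0n : N0 <= nv. Proof. by have /andP[] := p_N0 pok. Qed.
Let C11 := p_C1 pok.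
Let RR0 : 0 < RR. Proof. by rewrite (p_RR pok) !muln_gt0 (p_LG pok) (ltnW C11). Qed.
Let BB := p_BB pok.

Notation envI := (envI nv mA LG INF SC tl hd wt).
Notation PH := (PH nv mA tl hd wt INF).

Notation envP := (envP nv mA tl hd wt INF SC LG N0 C1 RR ELL HM idx h0).
Notation hsz := (hsz N0 RR).
Notation Pr := (Pr nv mA tl hd wt INF).
Notation lev := (lev nv mA tl hd wt INF N0 RR HM).
Notation known := (known nv mA tl hd wt INF N0 RR).
Notation MN := (mA * nv).
Notation G := LG.+1.

(** Reading the sets back from memory gives one function for all levels in place of a separate
    witness for each. *)
Definition levf (s : state) (i j : nat) : nat := A s aHS (2 ^ i * HM + j).

Lemma lev_levf s i Hl : lev s i Hl -> lev s i (levf s i).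
Proof.
move=> [l1 l2 l3]; split=> // [j jH|u es v o sz]; first by rewrite /levf l1 //; exact: l2.
have [z [j jH jz] E] := l3 u es v o sz; exists z => //; exists j => //.
by rewrite /levf l1.
Qed.

Lemma hr_down s (H0 := levf s ELL) : envP s -> rg s vL = 2 ^ ELL ->
  (forall i, i <= ELL -> lev s i (levf s i)) -> (forall j, j < N0 -> levf s 0 j = h0 j) ->
  known s (hsz (2 ^ ELL)) H0 (inl H0 (hsz (2 ^ ELL))) ->
  hr down s (2 + ELL.+1 * (100 * G * 2 ^ ELL).+1) (2 + ELL.+1 * (1900 * G * (RR * MN)).+1)
    (fun s' => forall j u, j < N0 -> u < nv -> A s' aF' (j * nv + u) = Pr (h0 j) u).
Proof.
move=> e EL lv l0 kn; have [_ [_ _ _ _ EE] _ _] := e.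
apply: (hr_cost (t := 1 + (ELL.+1 * (100 * G * 2 ^ ELL).+1).+1) (w := 1 + (ELL.+1 * (1900 * G * (RR * MN)).+1).+1)) => //.
apply: (hr_seq LX); [by []|apply: hr_asg1 => _|].
  rewrite !evE EE; apply: leq_trans LGX; apply: leq_trans (_ : 2 ^ ELL <= _); first by rewrite addn1 ltn_expl.
  apply: leq_trans (p_ELL pok) _; apply: ltnW; apply: leq_ltn_trans BB.
  apply: leq_mul; last by apply: leq_trans (leqW N0n) _; rewrite -{1}[nv.+1]expn1 leq_pexp2l.
  by move: RR0; have : 0 < C1 ^ 2 by [rewrite expn_gt0 (ltnW C11)]; clear; nia.
move=> s1 f1 E1; have Et1 : rg s1 vt1 = ELL.+1 by rewrite -E1 rg_setv eqxx !evE EE addn1.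
have e1 := envP_fr f1 isT isT e.
(* The first of the [ELL + 1] iterations stays at the top level: it extends profits known only
   within the set to all vertices. After the last one the set is the candidate list, and [vL] has
   been halved to 0, which is why its value is tracked only for [k <= ELL]. *)
pose J k s' := (k <= ELL -> rg s' vL = 2 ^ (ELL - k)) /\ exists N H' l,
  [/\ known s' N H' (fun u => if k == 0 then inl H0 (hsz (2 ^ ELL)) u else u < nv),
    PH (inl H' N) l, l <= 4 * 2 ^ (ELL - k) &
    k = ELL.+1 -> N = N0 /\ forall j, j < N0 -> H' j = h0 j].
apply: (hr_for LX (n := ELL.+1) (I := J)) => //.
- split; first by rewrite subn0 f1.1.
  have [k1 k2 k3 k4] := kn; have [_ _ l3] := lv ELL (leqnn _).
  exists (hsz (2 ^ ELL)), H0, (2 * 2 ^ ELL - 1); split=> //.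
  + split=> //; first by rewrite f1.1.
    * by move=> j jN; rewrite f1.2 //; exact: k3.
    * by move=> j u jN uH; rewrite !f1.2 //; exact: k4.
  + by rewrite subn0; clear; lia.
- move=> k s' kE f' [EL' [N [H' [l [kn' PHl lL _]]]]].
  have kL : k <= ELL by [].
  set s2 := setv s' vdn k; have f2 := fr_setv k (isT : vdn != 0) f'.
  have f12 := fr_trans f1 f2.
  have e2 := envP_fr f12 isT isT e.
  have iE : ELL - k <= ELL by exact: leq_subr.
  have [m1 m2 m3] := lv _ iE.
  have lv2 : lev s2 (ELL - k) (levf s (ELL - k)).
    by split=> // j jH; rewrite f12.2.
  have kn2 : known s2 N H' (inl (levf s (ELL - k)) (hsz (2 ^ (ELL - k)))).
    have [k1 k2 k3 k4] := kn'; split=> // j u jN uH; apply: k4 => //.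
    case: eqP uH => [->|_]; first by rewrite subn0.
    by move=> [j' j'H <-]; exact: m2.
  apply: hr_weak (hr_down_body X64 LX pok iE e2 (EL' kL) lv2 kn2 PHl lL) _ _ _.
  + by rewrite leq_mul2l leq_pexp2l ?orbT.
  + have := work_Q pok iE; move: (hsz _ * _ * _) => q q0.
    have g1 : G * q <= 18 * (G * (RR * MN)).
      by rewrite [18 * _]mulnCA leq_mul2l; apply/orP; right; move: q0; rewrite -mulnA.
    have g2 : q <= G * q by rewrite leq_pmull.
    move: g1 g2; rewrite (_ : 8 * G * (10 * q) = 80 * (G * q)); last by clear; lia.
    rewrite -(mulnA 1900) -(mulnA (28 * G)) -(mulnA 28).
    by clear; lia.
  move=> s3 [EL3 kn3]; split.
    move=> kk; rewrite EL3; have -> : ELL - k = (ELL - k.+1).+1 by rewrite subnSK.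
    by rewrite expnS mulKn.
  exists (hsz (2 ^ (ELL - k))), (levf s (ELL - k)), (2 * 2 ^ (ELL - k) - 1); split=> //.
    apply: leq_trans (leq_subr _ _) _; case: (ltnP k ELL) => kk.
      by have -> : ELL - k = (ELL - k.+1).+1 by [rewrite subnSK]; rewrite expnS mulnA.
    have -> : ELL - k = 0 by apply/eqP; rewrite subn_eq0.
    by rewrite expn0; have : 0 < 2 ^ (ELL - k.+1) by [rewrite expn_gt0]; clear; lia.
  by move=> [->]; rewrite subnn expn0; split=> // j jN; exact: l0.
move=> s' _ [_ [N [H' [l [[_ _ _ k4] _ _ /(_ erefl)[EN EH]]]]]] j u jN un.
rewrite A_setv // -EH //; have [||-> _] := k4 j u; by rewrite ?EN.
Qed.

Lemma hr_solve s : envP s ->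
  hr solve s (400 * (ELL.+1 * (G * G * RR * 2 ^ ELL))) (12 * 1000 * (ELL.+1 * (G * G * (RR ^ 3 * C1 ^ 2 * MN))))
    (fun s' => forall j u, j < N0 -> u < nv -> A s' aF' (j * nv + u) = Pr (h0 j) u).
Proof.
move=> e; apply: hr_cost.
{ apply: (hr_seq LX); [by []|exact: (hr_up X64 LX pok e)|].
  move=> s1 f1 [EL1 lv1]; have e1 := envP_fr f1 isT isT e.
  have lv i : i <= ELL -> lev s1 i (levf s1 i).
    by move=> iE; have [Hl [h _]] := lv1 i iE; exact: lev_levf h.
  have l0 j : j < N0 -> levf s1 0 j = h0 j.
    move=> jN; have [Hl [[m1 _ _] m4]] := lv1 0 (leq0n _).
    by rewrite -m4 // /levf m1 // expn0.
  apply: (hr_seq LX); [by []|exact: (hr_top X64 LX pok e1 EL1 (lv _ (leqnn _)))|].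
  move=> s2 f2 kn2; have e2 := envP_fr f2 isT isT e1.
  have fE i j : levf s2 i j = levf s1 i j by rewrite /levf f2.2.
  apply: (hr_down e2).
  - by rewrite f2.1.
  - move=> i iE; have := lv i iE => -[m1 m2 m3]; apply: (lev_levf (Hl := levf s1 i)).
    by split=> // j jH; rewrite f2.2 // m1.
  - by move=> j jN; rewrite fE l0.
  - have [k1 k2 k3 k4] := kn2; split=> //; first by move=> j jN; rewrite fE; exact: k3.
    move=> j u jN [j' j'N <-]; rewrite !fE; apply: k4 => //; by exists j'.
}
- have a0 : 0 < 2 ^ ELL by rewrite expn_gt0.
  set a := 2 ^ ELL in a0 *.
  have a1 : G * a <= G * RR * a by rewrite leq_mul2r leq_pmulr ?orbT.
  have a2 : G * RR * a <= G * G * RR * a by rewrite -!mulnA leq_pmull.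
  have a3 : G * G * a <= G * G * RR * a by rewrite leq_mul2r leq_pmulr ?orbT.
  have a4 : 0 < G * G * RR * a by rewrite !muln_gt0 RR0.
  set T := G * G * RR * a in a2 a3 a4 *.
  have b1 : ELL * (100 * G * RR * a).+1 <= ELL * (101 * T).
    by rewrite leq_mul2l; apply/orP; right; rewrite -(mulnA (100 * G)) -(mulnA 100) mulnA; move: a2 a4; clear; lia.
  have b2 : ELL.+1 * (100 * G * a).+1 <= ELL.+1 * (101 * T).
    by rewrite leq_mul2l; apply/orP; right; rewrite -(mulnA 100); move: a1 a2 a4; clear; lia.
  have -> : ELL.+1 * T = ELL * T + T by rewrite mulSn addnC.
  have E1 : ELL * (101 * T) = 101 * (ELL * T) by rewrite mulnCA.
  have E2 : ELL.+1 * (101 * T) = 101 * (ELL * T) + 101 * T by rewrite mulSn mulnCA addnC.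
  rewrite E1 in b1; rewrite E2 in b2; move: b1 b2 a3 a4; rewrite -/a.
  by move: (ELL * _.+1) (ELL.+1 * _) (ELL * T) (G * G * a); clear; lia.
have MN0 : 0 < MN by rewrite muln_gt0 mA0 nv0.
have c0 : 0 < C1 ^ 2 by rewrite expn_gt0 (ltnW C11).
have r0 : 0 < RR ^ 2 by rewrite expn_gt0 RR0.
set T := G * G * (RR ^ 3 * C1 ^ 2 * MN).
have R3 : RR ^ 3 = RR * RR ^ 2 by rewrite -expnS.
have a1 : G * (RR ^ 2 * (C1 ^ 2 * MN)) <= T.
  rewrite /T R3 (_ : G * G * _ = G * RR * (G * (RR ^ 2 * (C1 ^ 2 * MN)))); last by clear; lia.
  by rewrite leq_pmull // muln_gt0.
have a2 : RR ^ 3 * MN <= RR ^ 3 * C1 ^ 2 * MN by rewrite leq_mul2r leq_pmulr ?orbT.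
have a3 : G * G * (RR ^ 3 * MN) <= T by rewrite /T leq_mul2l a2 orbT.
have a5 : RR * MN <= RR ^ 3 * MN by rewrite leq_mul2r -{1}[RR]expn1 leq_pexp2l ?orbT.
have a4 : G * (RR * MN) <= T.
  by apply: leq_trans a3; rewrite -mulnA leq_mul2l (leq_trans a5) ?orbT // leq_pmull.
have a6 : MN <= T.
  by apply: leq_trans a4; rewrite mulnA leq_pmull // muln_gt0.
have a7 : N0 <= 2 * MN.
  by apply: leq_trans (p_N0m pok) _; rewrite leq_mul2l leq_pmulr.
have b1 : ELL * (3000 * G * RR ^ 2 * C1 ^ 2 * MN).+1 <= ELL * (3001 * T).
  rewrite leq_mul2l; apply/orP; right.
  rewrite (_ : 3000 * G * RR ^ 2 * C1 ^ 2 * MN = 3000 * (G * (RR ^ 2 * (C1 ^ 2 * MN)))); last by clear; lia.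
  by move: a1 a6 MN0; clear; lia.
have b2 : ELL.+1 * (1900 * G * (RR * MN)).+1 <= ELL.+1 * (1901 * T).
  by rewrite leq_mul2l; apply/orP; right; rewrite -(mulnA 1900); move: a4 a6 MN0; clear; lia.
have -> : ELL.+1 * T = ELL * T + T by rewrite mulSn addnC.
have E1 : ELL * (3001 * T) = 3001 * (ELL * T) by rewrite mulnCA.
have E2 : ELL.+1 * (1901 * T) = 1901 * (ELL * T) + 1901 * T by rewrite mulSn mulnCA addnC.
rewrite E1 in b1; rewrite E2 in b2; move: b1 b2 a3 a6 a7 MN0.
by move: (ELL * _.+1) (ELL.+1 * _) (ELL * T) (G * G * (RR ^ 3 * MN)); clear; lia.
Qed.

End Up.

End Solve.

(** * Numerical parameters, and arcs read from the input *)

Module InputData.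
Import Language Profits Hitting.

Lemma exp_up_log k : 0 < k -> k <= 2 ^ up_log 2 k <= 2 * k.
Proof.
move=> k0; rewrite up_logP //=; case: (ltnP 1 k) => k1; last first.
  by rewrite (_ : k = 1) //; move: k0 k1; clear; lia.
have /andP[h _] := up_log_bounds (isT : 1 < 2) k1.
have u0 : 0 < up_log 2 k by rewrite up_log_gt0.
by rewrite -(prednK u0) expnS leq_mul2l ltnW.
Qed.

Section Numbers.
Variables (n : nat).
(** Stands for the logarithm of [n]; the summand makes it at least 10, which removes small cases. *)
Definition yl : nat := up_log 2 (n + 1024).
Definition lgl : nat := 16 * yl.
Definition bl : nat := up_log 2 (yl + 2).
(** A power of two between [16 * (yl + 2) ^ 2] and [64 * (yl + 2) ^ 2], large enough for [prim_ok]
    and still polylogarithmic. *)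
Definition c1l : nat := 2 ^ (2 * bl + 4).
Definition rrl : nat := 2 * c1l * lgl.

Lemma yl_exp : n + 1024 <= 2 ^ yl.
Proof. exact: up_logP. Qed.

Lemma yl10 : 10 <= yl.
Proof.
rewrite leqNgt; apply/negP => h; have := yl_exp.
have : 2 ^ yl <= 2 ^ 9 by rewrite leq_pexp2l.
rewrite (_ : 2 ^ 9 = 512) //; lia.
Qed.

Lemma bl_exp : yl + 2 <= 2 ^ bl <= 2 * (yl + 2).
Proof. by apply: exp_up_log; rewrite addn2. Qed.

Lemma bl_le : bl <= yl.
Proof.
apply: up_log_min => //; have := yl10; case: yl => // y y10.
by rewrite expnS; have := ltn_expl y (isT : 1 < 2); lia.
Qed.

Lemma big_ok : 8 * rrl * c1l ^ 2 * n.+2 ^ 4 < 2 ^ lgl.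
Proof.
have n4 : n.+2 ^ 4 <= 2 ^ (4 * yl).
  by rewrite mulnC expnM leq_exp2r //; have := yl_exp; lia.
have r1 : rrl <= 2 ^ (3 * bl + 9).
  rewrite /rrl /c1l /lgl (_ : 3 * bl + 9 = (2 * bl + 4) + bl + 5); last by lia.
  rewrite (expnD 2 (2 * bl + 4 + bl)) (expnD 2 (2 * bl + 4)); have /andP[h _] := bl_exp; rewrite (_ : 2 ^ 5 = 32) //.
  move: (2 ^ (2 * bl + 4)) => a; rewrite (_ : 2 * a * (16 * yl) = a * yl * 32); last by lia.
  by rewrite leq_mul2r leq_mul2l; apply/orP; right; apply/orP; right; lia.
apply: leq_ltn_trans (_ : 8 * 2 ^ (3 * bl + 9) * (2 ^ (2 * bl + 4)) ^ 2 * 2 ^ (4 * yl) < _).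
  by apply: leq_mul => //; rewrite leq_mul2r leq_mul2l r1 !orbT.
have -> : (2 ^ (2 * bl + 4)) ^ 2 = 2 ^ (4 * bl + 8) by rewrite -expnM; congr (2 ^ _); lia.
rewrite (_ : 8 = 2 ^ 3) // -!expnD ltn_exp2l //.
by have := bl_le; have := yl10; rewrite /lgl; lia.
Qed.

(** With too few primes in the interval there would be at most [(yl + 1) * 2 ^ i] below its end,
    those below [2 ^ i] being counted trivially. Chebyshev's bound then gives
    [4 * 4 ^ bl <= (3 * yl + 3) * (yl + 1)], contrary to [2 ^ bl >= yl + 2]. *)
Lemma prim_ok i : i <= yl ->
  yl * 2 ^ i < count prime (iota (2 ^ i) (2 ^ i * c1l - 2 ^ i)).
Proof.
move=> iy; have C1 : 0 < c1l by rewrite expn_gt0.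
set c := count _ _; rewrite ltnNge; apply/negP => cy.
have pc := primes_count (i + (2 * bl + 2)); set bb := i + _ in pc.
have le : (2 ^ bb).*2.+1 <= 2 ^ i * c1l.
  rewrite /c1l -expnD (_ : i + (2 * bl + 4) = bb.+2); last by rewrite /bb; lia.
  by rewrite !expnS; have : 0 < 2 ^ bb by [rewrite expn_gt0]; lia.
have c2 : count prime (iota 0 (2 ^ bb).*2.+1) <= 2 ^ i + c.
  apply: leq_trans (_ : count prime (iota 0 (2 ^ i * c1l)) <= _).
    by rewrite -(subnKC le) iotaD count_cat leq_addr.
  have l2 : 2 ^ i <= 2 ^ i * c1l by rewrite leq_pmulr.
  rewrite -{1}(subnKC l2) iotaD count_cat leq_add2r.
  by apply: leq_trans (count_size _ _) _; rewrite size_iota.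
have h : 2 ^ bb <= bb.+1 * ((yl + 1) * 2 ^ i).
  apply: leq_trans pc _; rewrite leq_mul2l; apply/orP; right; apply: leq_trans c2 _.
  by move: cy; lia.
move: h; rewrite /bb expnD mulnA [X in _ <= X]mulnC leq_mul2l expn_eq0 /= => h.
have /andP[b1 _] := bl_exp; have b2 := bl_le.
have : (yl + 2) * (yl + 2) <= 2 ^ bl * 2 ^ bl by apply: leq_mul.
have e : 2 ^ (2 * bl + 2) = 4 * (2 ^ bl * 2 ^ bl) by rewrite expnD mul2n -addnn expnD mulnC.
have : (i + (2 * bl + 2)).+1 * (yl + 1) <= (3 * yl + 3) * (yl + 1) by rewrite leq_mul2r; apply/orP; right; lia.
by move: h; rewrite e; nia.
Qed.
End Numbers.

Lemma ell_ok N : 0 < N -> 2 ^ (up_log 2 N %/ 3 + 1) <= 4 * N /\ N <= (2 ^ (up_log 2 N %/ 3 + 1)) ^ 3.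
Proof.
move=> N0; have /andP[u1 u2] := exp_up_log N0; split.
  apply: leq_trans (_ : 2 * 2 ^ up_log 2 N <= _); last by lia.
  by rewrite -expnS leq_exp2l //; lia.
by apply: leq_trans u1 _; rewrite -expnM leq_exp2l //; lia.
Qed.

Lemma nth_flatten3 (T : Type) (a b c : T -> nat) (s : seq T) x0 j k : j < size s -> k < 3 ->
  nth 0 (flatten [seq [:: a e; b e; c e] | e <- s]) (3 * j + k) =
  nth 0 [:: a (nth x0 s j); b (nth x0 s j); c (nth x0 s j)] k.
Proof.
elim: s j => // e s IH [|j] js k3.
  by rewrite muln0 add0n /=; move: k3; clear; case: k => [|[|[|]]].
by rewrite (_ : 3 * j.+1 + k = (3 * j + k).+3); [exact: IH|lia].
Qed.

Section InputFacts.
Variables (dir : bool) (n : nat) (G : wgraph dir n) (s : seq ('I_n * 'I_n)).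
Hypothesis es : edge_list G s.
Let m := size s.
Let M := nth 0 (input_words G s).

Lemma input_at j : j < m -> exists u v : 'I_n, [/\ (u, v) \in s,
  M (3 * j + 2) = u, M (3 * j + 3) = v & M (3 * j + 4) = wt G u v].
Proof.
move=> jm; have [[u v] Eu] : exists e, nth e s j = e.
  move: jm; rewrite /m; case: (s) => // e s' jm; exists (nth e (e :: s') j); exact: set_nth_default.
exists u, v; rewrite /M /input_words !(addnS (3 * _)) /= !addn0.
have F k := nth_flatten3 (fun e : 'I_n * 'I_n => e.1 : nat) (fun e => e.2 : nat) (fun e => wt G e.1 e.2) (u, v) (k := k) jm.
have := F 0 isT; have := F 1 isT; have := F 2 isT; rewrite Eu /= addn0 addn1 addn2.
by move=> -> -> ->; rewrite -{1}Eu mem_nth.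
Qed.

Lemma input_of u v : (u, v) \in s -> exists2 j, j < m &
  [/\ M (3 * j + 2) = u, M (3 * j + 3) = v & M (3 * j + 4) = wt G u v].
Proof.
move=> uv; have jm : index (u, v) s < m by rewrite index_mem.
exists (index (u, v) s) => //; rewrite /M /input_words.
rewrite !(addnS (3 * _)) /= !addn0.
have F k := nth_flatten3 (fun e : 'I_n * 'I_n => e.1 : nat) (fun e => e.2 : nat) (fun e => wt G e.1 e.2) (u, v) (k := k) jm.
have := F 0 isT; have := F 1 isT; have := F 2 isT; rewrite !nth_index //= addn0 addn1 addn2.
by move=> -> -> ->.
Qed.

Definition arcs_num : nat := if dir then m.+1 else (2 * m).+1.
(** The sentinel arc 0 is a loop at an additional vertex [n], whence [n + 1] vertices. Listed edge
    [j] is arc [j + 1], and in an undirected graph also the opposite arc [m + j + 1]. *)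
Definition tlf (e : nat) : nat :=
  if e == 0 then n else if m < e then M (3 * ((e - 1) %% m) + 3) else M (3 * ((e - 1) %% m) + 2).
Definition hdf (e : nat) : nat :=
  if e == 0 then n else if m < e then M (3 * ((e - 1) %% m) + 2) else M (3 * ((e - 1) %% m) + 3).
Definition w0f (e : nat) : nat := if e == 0 then 0 else M (3 * ((e - 1) %% m) + 4).

Lemma arcs1 e : 0 < e < arcs_num -> exists u v : 'I_n,
  [/\ adj G u v, tlf e = u, hdf e = v & w0f e = wt G u v].
Proof.
rewrite /arcs_num => /andP[e0 em]; have m0 : 0 < m by move: e0 em; case: (dir); clear; lia.
have jm : (e - 1) %% m < m by rewrite ltn_mod.
have [u [v [uv E1 E2 E3]]] := input_at jm; have [_ adjE _] := es.
have auv : adj G u v by rewrite adjE uv.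
have ne0 : e != 0 by rewrite -lt0n.
rewrite /tlf /hdf /w0f (negbTE ne0); case: ltnP => me; last by exists u, v.
have nd : ~~ dir by move: em me; case: (dir) => //; clear; lia.
by exists v, u; split=> //; [rewrite adj_sym|rewrite E3 wt_sym].
Qed.

Lemma arcs2 u v : adj G u v -> exists e,
  [/\ 0 < e < arcs_num, tlf e = u, hdf e = v & w0f e = wt G u v].
Proof.
move=> auv; have [_ adjE _] := es; move: (auv); rewrite adjE => /orP[/input_of|/andP[nd /input_of]].
  move=> [j jm [E1 E2 E3]]; have lt : (m < j.+1) = false by rewrite ltnNge jm.
  exists j.+1; rewrite /tlf /hdf /w0f /= subn1 /= modn_small // lt.
  by split=> //; rewrite /arcs_num; case: (dir); move: jm; clear; lia.
move=> [j jm [E1 E2 E3]]; have lt : m < (m + j).+1 by rewrite ltnS leq_addr.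
exists (m + j).+1; rewrite /tlf /hdf /w0f /= subn1 /= modnDl modn_small // lt; split=> //; last by rewrite E3 wt_sym // adj_sym.
by rewrite /arcs_num (negbTE nd); move: jm; clear; lia.
Qed.

(** In the undirected case passing to unordered pairs is injective on the list, which never contains
    both orientations of an edge. *)
Lemma size_edges : m <= n * n /\ m <= num_edges G.
Proof.
have [us adjE opp] := es; rewrite /m; split.
  by rewrite -(card_uniqP us); apply: leq_trans (max_card _) _; rewrite card_prod card_ord.
rewrite /num_edges; case: ifP => d.
  rewrite -(card_uniqP us); apply/subset_leq_card/subsetP => -[u v] uv.
  by rewrite inE /= adjE uv.
rewrite -(card_uniqP us) -(card_in_imset (f := fun e : 'I_n * 'I_n => [set e.1; e.2])); last first.
  move=> [u v] [u' v'] uv uv' /= E; have nvu := opp (negbT d) _ _ uv.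
  have : u \in [set u'; v'] by rewrite -E !inE eqxx.
  have : v \in [set u'; v'] by rewrite -E !inE eqxx orbT.
  have : u' \in [set u; v] by rewrite E !inE eqxx.
  have : v' \in [set u; v] by rewrite E !inE eqxx orbT.
  rewrite !inE => /orP[]/eqP e1 /orP[]/eqP e2 /orP[]/eqP e3 /orP[]/eqP e4; subst=> //;
    by rewrite ?uv' // in nvu; case/negP: nvu.
apply/subset_leq_card/subsetP => x /imsetP[[u v] uv ->].
by apply/imsetP; exists (u, v) => //; rewrite inE /= adjE uv.
Qed.

Lemma w0f_le e : e < arcs_num -> w0f e <= max_weight G.
Proof.
case: (posnP e) => [->|e0] em; first by [].
have [|u [v [auv _ _ ->]]] := @arcs1 e; first by rewrite e0.
apply: leq_trans (leq_bigmax u); exact: leq_bigmax_cond.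
Qed.

Lemma input_le i : M i <= maxn n (maxn m (max_weight G)).
Proof.
case: (ltnP i (3 * m + 2)) => im; last first.
  rewrite /M nth_default // /input_words /= (_ : size (flatten _) = 3 * m).
    by move: im; clear; lia.
  by rewrite /m; elim: (s) => //= e s' ->; clear; lia.
case: i im => [|[|i]] im; rewrite /M //=; first by rewrite leq_maxl.
  by rewrite !leq_max leqnn orbT.
have jm : i %/ 3 < m by rewrite ltn_divLR //; move: im; clear; lia.
have [u [v [uv E1 E2 E3]]] := input_at jm; have [_ adjE _] := es.
have auv : adj G u v by rewrite adjE uv.
have wl : wt G u v <= max_weight G by apply: leq_trans (leq_bigmax u); exact: leq_bigmax_cond.
have := divn_eq i 3; have : i %% 3 < 3 by rewrite ltn_mod.
case: (i %% 3) => [|[|[|]]] // _ Ei.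
- by have := E1; rewrite /M (_ : 3 * (i %/ 3) + 2 = i.+2) /= => [->|]; [rewrite leq_max ltnW|lia].
- by have := E2; rewrite /M (_ : 3 * (i %/ 3) + 3 = i.+2) /= => [->|]; [rewrite leq_max ltnW|lia].
- by have := E3; rewrite /M (_ : 3 * (i %/ 3) + 4 = i.+2) /= => [->|]; [rewrite !leq_max wl !orbT|lia].
Qed.

(** A simple cycle has at most [n] arcs of weight at most [max_weight G]; this dictates the size of
    [INF]. *)
Lemma cycle_big c I : simple_cycle G c -> (max_weight G + 1) * n.+2 * n.+1 <= I ->
  n.+2 * cycle_weight G c + size c < I.
Proof.
move=> /and3P[cc uc _] h; apply: leq_trans h.
have sz : size c <= n by rewrite -(card_uniqP uc) -[X in _ <= X]card_ord max_card.
have cw : cycle_weight G c <= size c * max_weight G.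
  rewrite /cycle_weight big_seq (leq_trans (_ : _ <= \sum_(x <- c | x \in c) max_weight G)) //.
    apply: leq_sum => x xc; apply: leq_trans (leq_bigmax x).
    exact: (leq_bigmax_cond (path.next c x) (next_cycle cc xc)).
  by rewrite -big_seq big_const_seq count_predT iter_addn_0 mulnC.
have : size c * max_weight G <= n * max_weight G by rewrite leq_mul2r sz orbT.
move: (cycle_weight G c) (max_weight G) (size c) sz cw => a W k sz h1 h2.
have : n.+2 * a <= n.+2 * (n * W) by rewrite leq_mul2l (leq_trans h1 h2).
by move: sz; clear; nia.
Qed.

End InputFacts.

End InputData.

(** * Setting up scalars and arc tables *)

Module ArcTables.
Import Language Expressions Spawning Simulation Compiler Profits Hitting Hoare Scans BellmanFord Layers Samples Sampling Params LevelUp Ascent Descent Solve InputData.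

(** Triples start at word 2 of the input, so [k] is 2, 3 or 4 for tail, head or weight; the
    remainder modulo [m] sends opposite arcs to the same triple. *)
Definition raw (k : nat) : expr := EG aQ (#3 * ((EX - #1) %% $vm) + #k)%ex.
Definition tlE : expr := EI EX (ELt $vm EX (raw 3) (raw 2)) $vn.
Definition hdE : expr := EI EX (ELt $vm EX (raw 2) (raw 3)) $vn.
Definition w0E : expr := EI EX (raw 4) #0.

(** The input is copied into an array because the frame conditions speak only of arrays with
    positive number. [vC1] is built by repeated doubling. *)
Definition setup_scalars (dir : bool) : cmd :=
  Par aQ (#3 * $vm + #2) EX (EG 0 EX) ;;
  Asg vnv ($vn + #1) ;;
  Asg vmA (if dir then $vm + #1 else #2 * $vm + #1)%ex ;;
  Asg vSC ($vnv + #1) ;;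
  Lg vt1 ($vn + #1024) ;;
  Asg vLG (#16 * $vt1) ;;
  Lg vt2 ($vt1 + #2) ;;
  Asg vrd (#2 * $vt2 + #4) ;;
  Asg vC1 #1 ;;
  For vsq vrd (Asg vC1 ($vC1 + $vC1)) ;;
  Asg vRR (#2 * $vC1 * $vLG).

Definition setup_arcs : cmd :=
  Par aTL $vmA EX tlE ;; Par aHD $vmA EX hdE ;;
  Par aKEY $vmA EX w0E ;; scan true aKEY $vmA $vmA ;;
  Asg vINF ((EG aKEY ($vmA - #1) + #1) * $vSC * $vnv) ;;
  Par aW $vmA EX (EI EX (raw 4 * $vSC + #1) $vINF).

(** If there are few arcs, the candidates are all tails followed by all heads, otherwise all
    vertices. A vertex that is not listed gets index 0 by truncation and is recognised later because
    [h0] does not lead back to it. *)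
Definition setup_levels : cmd :=
  Asg vN0 (ELt (#2 * $vmA) $vnv (#2 * $vmA) $vnv) ;;
  Par aH0 $vN0 EX
    (ELt $vN0 $vnv (ELt EX $vmA (EG aTL EX) (EG aHD (EX - $vmA))) EX) ;;
  invert aH0 aINV $vN0 ;;
  Par aIDX $vnv EX (EG aINV EX - #1) ;;
  Lg vt2 $vN0 ;; Asg vELL ($vt2 %/ #3 + #1) ;; Asg vHM ($vRR * ($vN0 + #1)) ;;
  pre aHD aPf aLf ;; pre aTL aPb aLb.

Section Setup.
Variables (X LP : nat) (dir : bool) (n : nat) (G : wgraph dir n) (s : seq ('I_n * 'I_n)).
Hypotheses (X64 : 64 <= X) (LX : 2 ^ LP <= X).
Hypothesis es : edge_list G s.
Notation hr := (hr X LP).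
Notation m := (size s).
Notation M := (nth 0 (input_words G s)).
Notation nv := n.+1.
Notation mA := (arcs_num dir s).
Notation tl := (tlf G s).
Notation hd := (hdf G s).
Notation w0 := (w0f G s).
Notation SC := n.+2.
Notation LG := (lgl n).
Definition inf : nat := (max_weight G + 1) * SC * nv.
Definition wtf (e : nat) : nat := if e == 0 then inf else w0 e * SC + 1.
Definition n0 : nat := if 2 * mA < nv then 2 * mA else nv.
Definition ell : nat := up_log 2 n0 %/ 3 + 1.
Hypotheses (XG : 2 ^ LG <= X) (XI : inf.+1 * mA <= X) (LPn : n + 1024 <= 2 ^ LP).

Let mA0 : 0 < mA. Proof. by rewrite /arcs_num; case: (dir). Qed.
Let mmA : m < mA. Proof. by rewrite /arcs_num; case: (dir); clear; lia. Qed.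
Let inf0 : 0 < inf. Proof. by rewrite /inf !muln_gt0 addn1. Qed.
Let nX : n + 1024 <= X. Proof. exact: leq_trans LX. Qed.
Let mAX : mA <= X. Proof. by apply: leq_trans XI; rewrite leq_pmull. Qed.
Let infX : inf.+1 <= X. Proof. by apply: leq_trans XI; rewrite leq_pmulr. Qed.
Let lgX : LG <= X. Proof. by apply: leq_trans XG; rewrite ltnW // ltn_expl. Qed.
Let rc : rrl n * n.+2 < 2 ^ LG /\ c1l n < 2 ^ LG.
Proof.
have h := big_ok n; have c0 : 0 < c1l n by rewrite expn_gt0.
have n4 : n.+2 <= n.+2 ^ 4 by rewrite -{1}[n.+2]expn1 leq_pexp2l.
have r0 : 0 < rrl n by rewrite !muln_gt0 c0 /=; have := yl10 n; clear; lia.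
split; apply: leq_ltn_trans h.
  by apply: leq_mul => //; rewrite -mulnA mulnCA leq_pmulr // muln_gt0 expn_gt0 c0.
apply: leq_trans (_ : c1l n ^ 2 <= _); first by rewrite -mulnn leq_pmulr.
rewrite (_ : 8 * rrl n * c1l n ^ 2 * n.+2 ^ 4 = 8 * rrl n * n.+2 ^ 4 * c1l n ^ 2); last exact: mulnAC.
by rewrite leq_pmull // muln_gt0 expn_gt0 muln_gt0 r0.
Qed.
Let mAL : mA <= 2 ^ LG.
Proof.
have [h _] := size_edges es; have y := yl_exp n.
apply: leq_trans (_ : 2 ^ (3 * yl n) <= _); last by rewrite leq_pexp2l // /lgl; clear; lia.
rewrite mulnC expnM; apply: leq_trans (_ : (n + 1024) ^ 3 <= _); last by rewrite leq_exp2r.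
rewrite expnS -mulnn; apply: leq_trans (_ : (2 * m).+1 <= _); first by rewrite /arcs_num; case: (dir); clear; lia.
apply: leq_trans (_ : 1024 * (n * n + 1) <= _); first by move: h; clear; lia.
by apply: leq_mul; [rewrite leq_addl|clear; nia].
Qed.

Lemma max_weightE : \max_(e < mA) w0 e = max_weight G.
Proof.
apply/eqP; rewrite eqn_leq; apply/andP; split.
  by apply/bigmax_leqP => e _; apply: (w0f_le es).
apply/bigmax_leqP => u _; apply/bigmax_leqP => v auv.
have [e [/andP[_ em] _ _ <-]] := arcs2 es auv.
exact: (leq_bigmax (F := fun e : 'I_mA => w0 e) (Ordinal em)).
Qed.

Lemma arcs_okP : arcs_ok nv mA tl hd wtf inf SC w0.
Proof.
split=> //.
- move=> e em; case: (posnP e) => [->|e0]; first by [].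
  by have [|u [v [_ -> _ _]]] := arcs1 es (e := e); [rewrite e0|rewrite ltnW // ltnS].
- move=> e em; case: (posnP e) => [->|e0]; first by [].
  by have [|u [v [_ _ -> _]]] := arcs1 es (e := e); [rewrite e0|rewrite ltnW // ltnS].
by move=> e /andP[e0 _]; rewrite /wtf (gtn_eqF e0).
Qed.

Definition base (t : state) : Prop :=
  [/\ [/\ rg t vn = n, rg t vm = m, rg t vnv = nv & rg t vmA = mA],
      [/\ rg t vSC = SC, rg t vLG = LG, rg t vC1 = c1l n & rg t vRR = rrl n] &
      forall i, i < 3 * m + 2 -> A t aQ i = M i].

Lemma hr_setup_scalars t : rg t vn = n -> rg t vm = m ->
  (forall i, i < 3 * m + 2 -> A t 0 i = M i) ->
  hr (setup_scalars dir) t (20 * LG.+1) (20 * LG.+1 * (nv * mA)) base.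
Proof.
move=> En Em EM; have y10 := yl10 n; have bl1 := bl_le n.
have y2 : yl n + 2 <= n + 1024.
  have /andP[_ h] : n + 1024 <= 2 ^ yl n <= 2 * (n + 1024) by apply: exp_up_log; rewrite addn_gt0 orbT.
  move: h y10; case: (yl n) => [|[|y]] // h y10; have := ltn_expl y (isT : 1 < 2).
  by move: h y10; rewrite !expnS; clear; lia.
apply: hr_cost.
{ apply: (hr_seq LX); [by []|apply: (hr_map1 X64 LX (p := 3 * m + 2)) => //|].
  - by rewrite !evE Em.
  - by rewrite addnS.
  - by move=> b i _; exact: (smallP X64).
  move=> s1 f1 Q1; apply: (hr_seq LX); [by []|apply: hr_asg1 => _|].
    by rewrite !evE f1.1 // En; move: nX; clear; lia.
  move=> s2 f2 E2; have f12 := fr_trans f1 f2.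
  have e2 : rg s2 vnv = nv by rewrite -E2 rg_setv eqxx !evE f1.1 // En addn1.
  have mE : ev s2 0 (if dir then $vm + #1 else #2 * $vm + #1)%ex = mA.
    by rewrite /arcs_num; case: (dir); rewrite !evE f12.1 // Em addn1.
  apply: (hr_seq LX); [by []|by apply: hr_asg1 => _; rewrite mE|].
  move=> s3 f3 E3; have f13 := fr_trans f12 f3.
  have e3 : rg s3 vmA = mA by rewrite -E3 rg_setv eqxx mE.
  have e3n : rg s3 vnv = nv by rewrite f3.1.
  apply: (hr_seq LX); [by []|apply: hr_asg1 => _|].
    by rewrite !evE e3n; move: nX; clear; lia.
  move=> s4 f4 E4; have f14 := fr_trans f13 f4.
  have e4 : rg s4 vSC = SC by rewrite -E4 rg_setv eqxx !evE e3n addn1.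
  have y4 : ev s4 0 ($vn + #1024)%ex = n + 1024 by rewrite !evE f14.1 // En.
  apply: (hr_seq LX (t1 := 1) (w1 := 1) (Q1 := fun s5 => rg s5 vt1 = yl n)); first by [].
    by apply: hr_lg; rewrite y4.
  move=> s5 f5 E5; have f15 := fr_trans f14 f5.
  apply: (hr_seq LX); [by []|by apply: hr_asg1 => _; rewrite !evE E5|].
  move=> s6 f6 E6; have f16 := fr_trans f15 f6.
  have e6 : rg s6 vLG = LG by rewrite -E6 rg_setv eqxx !evE E5.
  have b6 : ev s6 0 ($vt1 + #2)%ex = yl n + 2 by rewrite !evE f6.1 // E5.
  apply: (hr_seq LX (t1 := 1) (w1 := 1) (Q1 := fun s7 => rg s7 vt2 = bl n)); first by [].
    by apply: hr_lg; rewrite b6 //; apply: leq_trans LPn.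
  move=> s7 f7 E7; have f17 := fr_trans f16 f7.
  apply: (hr_seq LX); [by []|apply: hr_asg1 => _|].
    by rewrite !evE E7; apply: leq_trans lgX; rewrite /lgl; move: bl1 y10; clear; lia.
  move=> s8 f8 E8; have f18 := fr_trans f17 f8.
  have e8 : rg s8 vrd = 2 * bl n + 4 by rewrite -E8 rg_setv eqxx !evE E7.
  apply: (hr_seq LX); [by []|by apply: hr_asg1 => _; exact: leq_trans X64|].
  move=> s9 f9 E9; have f19 := fr_trans f18 f9.
  pose I k s' := rg s' vC1 = 2 ^ k.
  apply: (hr_seq LX (Q1 := fun s' => rg s' vC1 = c1l n)); first by [].
    apply: (hr_for LX (n := 2 * bl n + 4) (t := 1) (w := 1) (I := I)) => //.
    - by rewrite f9.1.
    - by rewrite /I -E9 rg_setv.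
    - move=> k s' kb _ Ik; have E : ev (setv s' vsq k) 0 ($vC1 + $vC1)%ex = 2 ^ k.+1.
        by rewrite !evE rg_setv /= Ik expnS mul2n addnn.
      apply: hr_asg => [_|]; last by rewrite /I rg_setv eqxx E.
      by rewrite E; apply: leq_trans XG; apply: leq_trans (ltnW rc.2); rewrite leq_pexp2l.
  move=> s10 f10 E10; have f110 := fr_trans f19 f10.
  have e10 : rg s10 vLG = LG by rewrite f10.1 // f9.1 // f8.1 // f7.1.
  have r10 : ev s10 0 (#2 * $vC1 * $vLG)%ex = rrl n by rewrite !evE e10 E10.
  apply: hr_asg => [_|].
    by rewrite r10; apply: leq_trans XG; apply: leq_trans (ltnW rc.1); rewrite leq_pmulr.
  split.
  - have n10 : rg s10 vnv = nv.
      by rewrite f10.1 // f9.1 // f8.1 // f7.1 // f6.1 // f5.1 // f4.1 // f3.1.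
    have m10 : rg s10 vmA = mA.
      by rewrite f10.1 // f9.1 // f8.1 // f7.1 // f6.1 // f5.1 // f4.1.
    have x10 : rg s10 vn = n by rewrite f110.1.
    have y10' : rg s10 vm = m by rewrite f110.1.
    by split; rewrite rg_setv.
  - have c10 : rg s10 vSC = SC by rewrite f10.1 // f9.1 // f8.1 // f7.1 // f6.1 // f5.1.
    by split; rewrite rg_setv ?eqxx.
  move=> i im; rewrite A_setv // f10.2 // f9.2 // f8.2 // f7.2 // f6.2 // f5.2 // f4.2 // f3.2 // f2.2 //.
  by rewrite Q1 im -EM.
}
- by rewrite /lgl; move: bl1 y10; clear; lia.
have : mA <= nv * mA by rewrite leq_pmull.
have a0 : 0 < nv * mA by rewrite muln_gt0.
have a1 : nv * mA <= LG.+1 * (nv * mA) by rewrite leq_pmull.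
have a2 : LG.+1 <= LG.+1 * (nv * mA) by rewrite leq_pmulr.
rewrite -(mulnA 20) => h; move: h mmA bl1 y10 a1 a2; move: (nv * mA) => v; move: (LG.+1 * v) => u.
by rewrite /lgl; move: mA; clear; lia.
Qed.

Lemma hr_setup_arcs t : base t ->
  hr setup_arcs t (10 * LG.+1) (10 * LG.+1 * (nv * mA)) (fun t' => [/\ rg t' vINF = inf,
    forall e, e < mA -> A t' aTL e = tl e, forall e, e < mA -> A t' aHD e = hd e &
    forall e, e < mA -> A t' aW e = wtf e]).
Proof.
move=> [[En Em Env EmA] [ES EL EC ER] EQ].
have jm e : 0 < e < mA -> (e - 1) %% m < m.
  by move=> /andP[e0 em]; rewrite ltn_mod; move: em; rewrite /arcs_num; case: (dir); move: e0; clear; lia.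
pose keep (t' : state) := [/\ rg t' vn = n, rg t' vm = m, rg t' vmA = mA & forall i, A t' aQ i = A t aQ i].
have rE t' e k : keep t' -> 0 < e < mA -> 1 < k < 5 -> ev t' e (raw k) = M (3 * ((e - 1) %% m) + k).
  move=> [_ k2 _ k4] h kk; rewrite /raw !evE k2 k4 EQ //; have := jm e h; move: kk; clear; lia.
have tE t' e : keep t' -> e < mA -> ev t' e tlE = tl e.
  move=> kp em; have [k1 k2 _ _] := kp; rewrite /tlE /tlf ev_I ev_X ev_ELt !ev_V k1 k2 ev_X.
  by case: (posnP e) => [_ //|e0]; rewrite !rE // e0.
have hE t' e : keep t' -> e < mA -> ev t' e hdE = hd e.
  move=> kp em; have [k1 k2 _ _] := kp; rewrite /hdE /hdf ev_I ev_X ev_ELt !ev_V k1 k2 ev_X.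
  by case: (posnP e) => [_ //|e0]; rewrite !rE // e0.
have wE t' e : keep t' -> e < mA -> ev t' e w0E = w0 e.
  move=> kp em; rewrite /w0E /w0f ev_I ev_X.
  by case: (posnP e) => [_ //|e0]; rewrite !rE // e0.
have kfr V B t' : fr V B t t' -> ~~ has (mem V) [:: vn; vm; vmA] -> aQ \notin B -> keep t'.
  move=> [f1 f2] /=; rewrite !negb_or => /and4P[v1 v2 v3 _] b1.
  by split; rewrite ?f1 // => i; rewrite f2.
have tlX e : e < mA -> tl e <= X.
  by move=> em; have := aok_tl arcs_okP em; move: nX; clear; lia.
have hdX e : e < mA -> hd e <= X.
  by move=> em; have := aok_hd arcs_okP em; move: nX; clear; lia.
have wX e : e < mA -> w0 e * SC + 1 <= X.
  move=> em; apply: leq_trans infX; rewrite addn1 ltnS /inf.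
  apply: leq_trans (leq_pmulr _ _) => //; rewrite leq_mul2r addn1.
  by apply/orP; right; apply: leqW; exact: (w0f_le es).
have w0X e : e < mA -> w0 e <= X.
  by move=> em; apply: leq_trans (wX e em); rewrite mulnS -addnA leq_addr.
apply: hr_cost.
{ apply: (hr_seq LX); [by []|apply: (hr_map1 X64 LX (p := mA)) => //|].
    by move=> _ e em; rewrite tE ?tlX.
  move=> s1 f1 T1; have k1 := kfr _ _ _ f1 isT isT; have [_ _ m1 _] := k1.
  apply: (hr_seq LX); [by []|apply: (hr_map1 X64 LX (p := mA)) => //|].
    by move=> _ e em; rewrite hE ?hdX.
  move=> s2 f2 H2; have f12 := fr_trans f1 f2; have k2 := kfr _ _ _ f12 isT isT; have [_ _ m2 _] := k2.
  apply: (hr_seq LX); [by []|apply: (hr_map1 X64 LX (p := mA)) => //|].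
    by move=> _ e em; rewrite wE ?w0X.
  move=> s3 f3 K3; have f13 := fr_trans f12 f3; have k3 := kfr _ _ _ f13 isT isT; have [_ _ m3 _] := k3.
  apply: (hr_seq LX); [by []|apply: (hr_scan1 X64 LX (T := mA) (l := mA) (LG := LG)) => //|].
  - by move=> s' i f'; rewrite !evE f'.1.
  - by move=> s' i f'; rewrite !evE f'.1.
  - by rewrite f13.1.
  - by move=> [_ b2] r j _ _; rewrite big_mkord; apply/bigmax_leqP => e _; exact: b2.
  move=> s4 f4 K4; have f14 := fr_trans f13 f4; have k4 := kfr _ _ _ f14 isT isT; have [_ _ m4 _] := k4.
  have I4 : ev s4 0 ((EG aKEY ($vmA - #1) + #1) * $vSC * $vnv)%ex = inf.
    rewrite !evE m4 !f14.1 // ES Env; have lt : mA - 1 < mA by rewrite subn1 ltn_predL.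
    have := K4 0 _ lt; rewrite mul0n add0n => -> //=; rewrite subn1 prednK // big_mkord /inf -max_weightE.
    congr ((_ + 1) * _ * _); apply: eq_bigr => e _.
    by rewrite add0n K3 ltn_ord wE.
  apply: (hr_seq LX); [by []|by apply: hr_asg1 => _; rewrite I4 ltnW|].
  move=> s5 f5 E5; have f15 := fr_trans f14 f5; have k5 := kfr _ _ _ f15 isT isT; have [_ _ m5 _] := k5.
  have i5 : rg s5 vINF = inf by rewrite -E5 rg_setv eqxx I4.
  have W5 e : e < mA -> ev s5 e (EI EX (raw 4 * $vSC + #1) $vINF)%ex = wtf e.
    move=> em; rewrite ev_I ev_X /wtf; case: (posnP e) => [_|e0]; first by rewrite ev_V i5.
    by rewrite ev_add ev_mul ev_V ev_C rE // ?e0 // f15.1 // ES /w0f (gtn_eqF e0).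
  apply: (hr_map X64 LX (p := mA)) => //.
    move=> _ e em; rewrite W5 // /wtf; case: eqP => _; [exact: ltnW|exact: wX].
  move=> s6 R6 W6 F6; split; first by rewrite R6.
  - by move=> e em; rewrite F6 // f5.2 // f4.2 // f3.2 // f2.2 // T1 em tE.
  - by move=> e em; rewrite F6 // f5.2 // f4.2 // f3.2 // H2 em hE.
  by move=> e em; rewrite W6 em W5.
}
- by clear; lia.
have : mA <= nv * mA by rewrite leq_pmull.
by move: (nv * mA) mA0; clear; nia.
Qed.

End Setup.

End ArcTables.

(** * Candidate vertices and level parameters *)

Module LevelTables.
Import Language Expressions Spawning Simulation Compiler Profits Hitting Hoare Scans BellmanFord Layers Samples Sampling Params LevelUp Ascent Descent Solve InputData ArcTables.

Section Setup.
Variables (X LP : nat) (dir : bool) (n : nat) (G : wgraph dir n) (s : seq ('I_n * 'I_n)).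
Hypotheses (X64 : 64 <= X) (LX : 2 ^ LP <= X).
Hypothesis es : edge_list G s.
Notation hr := (hr X LP).
Notation m := (size s).
Notation M := (nth 0 (input_words G s)).
Notation nv := n.+1.
Notation mA := (arcs_num dir s).
Notation tl := (tlf G s).
Notation hd := (hdf G s).
Notation w0 := (w0f G s).
Notation SC := n.+2.
Notation LG := (lgl n).
Notation inf := (inf G).
Notation wtf := (wtf G s).
Notation n0 := (n0 dir s).
Notation ell := (ell dir s).
Hypotheses (XG : 2 ^ LG <= X) (XI : inf.+1 * mA <= X) (LPn : n + 1024 <= 2 ^ LP).

Let mA0 : 0 < mA. Proof. by rewrite /arcs_num; case: (dir). Qed.
Let mmA : m < mA. Proof. by rewrite /arcs_num; case: (dir); clear; lia. Qed.
Let inf0 : 0 < inf. Proof. by rewrite /ArcTables.inf !muln_gt0 addn1. Qed.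
Let nX : n + 1024 <= X. Proof. exact: leq_trans LX. Qed.
Let mAX : mA <= X. Proof. by apply: leq_trans XI; rewrite leq_pmull. Qed.
Let infX : inf.+1 <= X. Proof. by apply: leq_trans XI; rewrite leq_pmulr. Qed.
Let lgX : LG <= X. Proof. by apply: leq_trans XG; rewrite ltnW // ltn_expl. Qed.
Let rc : rrl n * n.+2 < 2 ^ LG /\ c1l n < 2 ^ LG.
Proof.
have h := big_ok n; have c0 : 0 < c1l n by rewrite expn_gt0.
have n4 : n.+2 <= n.+2 ^ 4 by rewrite -{1}[n.+2]expn1 leq_pexp2l.
have r0 : 0 < rrl n by rewrite !muln_gt0 c0 /=; have := yl10 n; clear; lia.
split; apply: leq_ltn_trans h.
  by apply: leq_mul => //; rewrite -mulnA mulnCA leq_pmulr // muln_gt0 expn_gt0 c0.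
apply: leq_trans (_ : c1l n ^ 2 <= _); first by rewrite -mulnn leq_pmulr.
rewrite (_ : 8 * rrl n * c1l n ^ 2 * n.+2 ^ 4 = 8 * rrl n * n.+2 ^ 4 * c1l n ^ 2); last exact: mulnAC.
by rewrite leq_pmull // muln_gt0 expn_gt0 muln_gt0 r0.
Qed.
Let mAL : mA <= 2 ^ LG.
Proof.
have [h _] := size_edges es; have y := yl_exp n.
apply: leq_trans (_ : 2 ^ (3 * yl n) <= _); last by rewrite leq_pexp2l // /lgl; clear; lia.
rewrite mulnC expnM; apply: leq_trans (_ : (n + 1024) ^ 3 <= _); last by rewrite leq_exp2r.
rewrite expnS -mulnn; apply: leq_trans (_ : (2 * m).+1 <= _); first by rewrite /arcs_num; case: (dir); clear; lia.
apply: leq_trans (_ : 1024 * (n * n + 1) <= _); first by move: h; clear; lia.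
by apply: leq_mul; [rewrite leq_addl|clear; nia].
Qed.

Let n00 : 0 < n0 <= nv /\ n0 <= 2 * mA.
Proof.
rewrite /ArcTables.n0; move: mA0; clear; move: mA => a a0.
by case: (ltnP (2 * a) n.+1) => h; split; lia.
Qed.

Lemma hr_setup_levels t : base G s t ->
  [/\ rg t vINF = inf, forall e, e < mA -> A t aTL e = tl e, forall e, e < mA -> A t aHD e = hd e &
    forall e, e < mA -> A t aW e = wtf e] ->
  hr setup_levels t (40 * LG.+1) (60 * LG.+1 * (nv * mA)) (fun t' => exists idx h0,
    [/\ params_ok X nv mA tl hd wtf inf SC w0 LG n0 (c1l n) (rrl n) ell (rrl n * (n0 + 1)) (yl n) idx h0,
      envP nv mA tl hd wtf inf SC LG n0 (c1l n) (rrl n) ell (rrl n * (n0 + 1)) idx h0 t',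
      forall u, u < nv -> idx u < n0 & rg t' vn = n]).
Proof.
move=> [[En Em Env EmA] [ES EL EC ER] _] [EI ET EH EW].
have aok := arcs_okP es; have [/andP[N00 N0n] N0m] := n00.
have e0 : envG nv mA LG wtf t by split.
have nL : nv <= 2 ^ LG.
  apply: leq_trans (_ : n + 1024 <= _); first by clear; lia.
  by apply: leq_trans (yl_exp n) _; rewrite leq_pexp2l // /lgl; clear; lia.
apply: hr_cost.
{ have EN0 : ev t 0 (ELt (#2 * $vmA) $vnv (#2 * $vmA) $vnv)%ex = n0 by rewrite !evE EmA Env.
  apply: (hr_seq LX); [by []|apply: hr_asg1 => _|].
    by rewrite EN0; apply: leq_trans N0n _; move: nX; clear; lia.
  move=> t1 f1 E1; have N1 : rg t1 vN0 = n0 by rewrite -E1 rg_setv eqxx EN0.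
  apply: (hr_seq LX); [by []|apply: (hr_map1 X64 LX (p := n0)) => //|].
    move=> b i iN; rewrite !evE; case: ifP => _; last by move: nX iN N0n; clear; lia.
    by case: ifP => _; exact: b.2.
  move=> t2 f2 H2; have f12 := fr_trans f1 f2.
  have {}H2 j : j < n0 -> A t2 aH0 j = if n0 < nv then (if j < mA then tl j else hd (j - mA)) else j.
    move=> jN; rewrite H2 jN !evE N1 !f1.1 // Env EmA; case: ifP => // nN.
    have n0E : n0 = 2 * mA by move: nN; rewrite /ArcTables.n0; case: (ltnP (2 * mA) nv) => //; rewrite ltnn.
    case: (ltnP j mA) => jm; rewrite f1.2 //; [exact: ET|rewrite EH //].
    by move: jN jm; rewrite n0E; clear; lia.
  have H2n j : j < n0 -> A t2 aH0 j < nv.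
    move=> jN; rewrite H2 //; case: ifP => nN; last exact: leq_trans N0n.
    have n0E : n0 = 2 * mA by move: nN; rewrite /ArcTables.n0; case: (ltnP (2 * mA) nv) => //; rewrite ltnn.
    case: (ltnP j mA) => jm; [exact: (aok_tl aok)|apply: (aok_hd aok)].
    by move: jN jm; rewrite n0E; clear; lia.
  apply: (hr_seq LX); [by []|apply: (hr_invert (eN := $vN0) (N := n0) (nv := nv) (LG := LG)) => //|].
  - by rewrite f12.1.
  - by rewrite f12.1.
  - by move=> t' i f'; rewrite !evE f'.1 // f2.1.
  - exact: leq_trans N0n nL.
  move=> t3 f3 I3; have f13 := fr_trans f12 f3.
  apply: (hr_seq LX); [by []|apply: (hr_map1 X64 LX (p := nv)) => //|].
  - by rewrite !evE f13.1.
  - by move=> b i _; exact: (smallP X64).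
  move=> t4 f4 X4; have f14 := fr_trans f13 f4.
  have N4 : rg t4 vN0 = n0 by rewrite f4.1 // f3.1 // f2.1.
  apply: (hr_seq LX (t1 := 1) (w1 := 1) (Q1 := fun t5 => rg t5 vt2 = up_log 2 n0)); first by [].
    apply: hr_lg; last by rewrite rg_setv eqxx !evE N4.
    by rewrite !evE N4; apply: leq_trans N0n _; apply: leq_trans LPn; clear; lia.
  move=> t5 f5 E5; have f15 := fr_trans f14 f5.
  have E5' : ev t5 0 ($vt2 %/ #3 + #1)%ex = ell by rewrite !evE E5.
  apply: (hr_seq LX); [by []|apply: hr_asg1 => _|].
    rewrite E5' /ArcTables.ell; apply: leq_trans nX; apply: leq_trans (_ : up_log 2 n0 + 1 <= _).
      by rewrite leq_add2r leq_div.
    have : up_log 2 n0 <= n0 by apply: up_log_min => //; rewrite ltnW // ltn_expl.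
    by move: N0n; clear; lia.
  move=> t6 f6 E6; have f16 := fr_trans f15 f6.
  have E6' : rg t6 vELL = ell by rewrite -E6 rg_setv eqxx E5'.
  have M6 : ev t6 0 ($vRR * ($vN0 + #1))%ex = rrl n * (n0 + 1).
    by rewrite !evE f16.1 // ER f6.1 // f5.1 // N4.
  apply: (hr_seq LX); [by []|apply: hr_asg1 => _|].
    rewrite M6; apply: leq_trans XG; apply: leq_trans (ltnW rc.1).
    by rewrite leq_mul2l; apply/orP; right; move: N0n; clear; lia.
  move=> t7 f7 E7; have f17 := fr_trans f16 f7.
  have E7' : rg t7 vHM = rrl n * (n0 + 1) by rewrite -E7 rg_setv eqxx M6.
  have g7 : envG nv mA LG wtf t7 by apply: (envG_fr f17) e0.
  have E7e e : e < mA -> A t7 aHD e = hd e by move=> em; rewrite f17.2 // EH.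
  apply: (hr_seq LX); [by []|exact: (hr_pre X64 LX (ltn0Sn n) mA0 mAL XG XI (aok_0 aok) (aok_hd aok) (isT : arr_ok [:: aHD; aPf; aLf]) isT isT g7 E7e)|].
  move=> t8 f8 [P8 L8]; have f18 := fr_trans f17 f8.
  have g8 : envG nv mA LG wtf t8 by apply: (envG_fr f18) e0.
  have E8 e : e < mA -> A t8 aTL e = tl e by move=> em; rewrite f18.2 // ET.
  have hp := hr_pre X64 LX (ltn0Sn n) mA0 mAL XG XI (aok_0 aok) (aok_tl aok) (isT : arr_ok [:: aTL; aPb; aLb]) isT isT g8 E8.
  pose c9 := pre aTL aPb aLb.
  (* The last command is unfolded by hand: the witnesses [idx] and [h0] are tables of the final
     state, which has to be named. *)
  split=> b8; have [o9 a9 b9 [P9 L9]] : [/\ ok X LP c9 t8, tau c9 t8 <= 10 * LG.+1, omg c9 t8 <= 10 * LG.+1 * (nv * mA) &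
     (forall k e, k <= LG -> e < mA -> A (run c9 t8) aPb (k * mA + e) = iter (2 ^ k) (prevf tl) e) /\
     forall v, v < nv -> A (run c9 t8) aLb v = lastf mA tl v] by case: hp => /(_ b8).
  have f9 : fr (wrV c9) (wrA c9) t8 (run c9 t8) by apply: fr_run.
  split; [exact: o9|exact: a9|exact: b9|].
  set t9 := run _ t8 in P9 L9 f9 *; have f19 := fr_trans f18 f9.
  have g9 : envG nv mA LG wtf t9 by apply: (envG_fr f19) e0.
  exists (A t9 aIDX), (A t9 aH0).
  have HE j : A t9 aH0 j = A t2 aH0 j.
    by rewrite f9.2 // f8.2 // f7.2 // f6.2 // f5.2 // f4.2 // f3.2.
  have IE u : u < nv -> A t9 aIDX u = A t3 aINV u - 1.
    by move=> un; rewrite f9.2 // f8.2 // f7.2 // f6.2 // f5.2 // X4 un.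
  have IN u : u < nv -> A t9 aIDX u < n0.
    move=> un; rewrite IE //; have := I3 u un; case: (A t3 aINV u) => [|r] //.
    by move=> [rN _]; rewrite subn1.
  have cov e v : e < mA -> v = tl e \/ v = hd e -> A t9 aH0 (A t9 aIDX v) = v /\ A t9 aIDX v < n0.
    move=> em ve; have vn : v < nv by case: ve => ->; [exact: (aok_tl aok)|exact: (aok_hd aok)].
    have [j jN Hj] : exists2 j, j < n0 & A t2 aH0 j = v.
      case: (ltnP n0 nv) => nN; last first.
        by exists v; [exact: leq_trans vn nN|rewrite H2 ?(leq_trans vn nN) // ltnNge nN].
      have n0E : n0 = 2 * mA by move: nN; rewrite /ArcTables.n0; case: (ltnP (2 * mA) nv) => //; rewrite ltnn.
      case: ve => ->.
        by exists e; [|rewrite H2 ?nN ?em]; rewrite // n0E; move: em; clear; lia.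
      have l1 : mA + e < n0 by rewrite n0E; move: em; clear; lia.
      by exists (mA + e) => //; rewrite H2 // nN ltnNge leq_addr /= addKn.
    split; last exact: IN.
    rewrite IE // HE; have := I3 v vn; case: (A t3 aINV v) => [/(_ j jN)|r [rN Hr]]; first by rewrite Hj.
    by rewrite subn1.
  have [el1 el2] := ell_ok N00.
  have uy : up_log 2 n0 <= yl n.
    apply: up_log_min => //; apply: leq_trans N0n _; apply: leq_trans (yl_exp n); clear; lia.
  split=> //.
  - split=> //.
    + by rewrite N00 N0n.
    + by move=> j jN; rewrite HE H2n.
    + apply: leq_trans N0n _; apply: leq_trans (yl_exp n); clear; lia.
    + move=> i il; apply: prim_ok; apply: leq_trans uy; apply: leq_trans (leq_div (up_log 2 n0) 3).
      by move: il; rewrite /ArcTables.ell; clear; lia.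
    + by rewrite /c1l -{1}(expn0 2) ltn_exp2l // addnS.
    + by rewrite /lgl muln_gt0 /=; have := yl10 n; clear; lia.
    + exact: big_ok.
    + by rewrite addn1.
  - split=> //.
    + split=> //.
      * split=> [e em|k e kL em|v vn]; [by rewrite f19.2 // ET|by rewrite f9.2 // P8|by rewrite f9.2 // L8].
      * by split=> // e em; rewrite f19.2 // EH.
      * by rewrite f19.1.
      * by rewrite f19.1.
    + split.
      * by rewrite f9.1 // f8.1 // f7.1 // f6.1 // f5.1.
      * by rewrite f19.1.
      * by rewrite f19.1.
      * by rewrite f9.1 // f8.1.
      * by rewrite f9.1 // f8.1 // f7.1.
  by rewrite f19.1.
}
- by clear; lia.
have a1 : n0 * nv <= 2 * (nv * mA) by rewrite mulnCA mulnC leq_mul2l N0m orbT.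
have a2 : nv <= nv * mA by rewrite leq_pmulr.
have a0 : 0 < nv * mA by rewrite muln_gt0.
rewrite [n0 * nv]mulnC in a1; move: a0 a1 a2 N0n; clear; move: (nv * n0) => u; move: (nv * mA) => v.
move: n0 (lgl n) => a g v0 h1 h2 h3.
have h4 : 7 * g.+1 * u <= 7 * g.+1 * (2 * v) by rewrite leq_mul2l h1 orbT.
have h5 : v <= g.+1 * v by rewrite leq_pmull.
have E1 : 7 * g.+1 * (2 * v) = 14 * (g.+1 * v) by lia.
have E2 : 10 * g.+1 * v = 10 * (g.+1 * v) by lia.
have E3 : 60 * g.+1 * v = 60 * (g.+1 * v) by lia.
rewrite E2 E3; move: h4; rewrite E1; move: (7 * g.+1 * u) (g.+1 * v) h5 => x z h5 h6.
by lia.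
Qed.

End Setup.

End LevelTables.

(** * Answers for directed graphs, and labels of subtrees *)

Module DirectedAnswer.
Import Language Expressions Spawning Simulation Compiler Profits Hitting Cycles Hoare Scans BellmanFord Layers Samples Sampling Params LevelUp Ascent Descent Solve InputData ArcTables.

(** One more round, read at the source itself, is the maximum over arcs closing a cycle. The tests
    discard the additional vertex and vertices outside the candidate list, which lie on no arc. *)
Definition final_dir : cmd :=
  relax aTL aPf aLf aF' aY $vN0 ;;
  Par aBEST $vnv EX (ELt EX $vn (EEq (EG aH0 (EG aIDX EX)) EX
    (EG aY (EG aIDX EX * $vnv + EX) %/ $vmA) #0) #0).

(** The map to be iterated goes to the parent unless this is the root, so its value stabilises at
    the child of the root; composing it with itself [vLG] times is pointer doubling. Edges with
    equal labels then contribute 0 to the maximum. *)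
Definition final_und : cmd :=
  Asg vHn $vN0 ;; parents aF' ;;
  Par aV2 ($vN0 * $vnv) EX (EEq (EG aPAR EX) (EG aH0 (EX %/ $vnv)) (EX %% $vnv)
    (ELt (EG aPAR EX) $vnv (EG aPAR EX) (EX %% $vnv))) ;;
  For vsq vLG (Par aV2 ($vN0 * $vnv) EX (EG aV2 (EX %/ $vnv * $vnv + EG aV2 EX))) ;;
  Par aQ ($vN0 * $vmA) EX
    (EEq (EEq (EG aTL (EX %% $vmA)) (EG aH0 (EX %/ $vmA)) (EG aHD (EX %% $vmA))
           (EG aV2 (EX %/ $vmA * $vnv + EG aTL (EX %% $vmA))))
         (EEq (EG aHD (EX %% $vmA)) (EG aH0 (EX %/ $vmA)) (EG aTL (EX %% $vmA))
           (EG aV2 (EX %/ $vmA * $vnv + EG aHD (EX %% $vmA)))) #0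
      (EG aF' (EX %/ $vmA * $vnv + EG aTL (EX %% $vmA)) +
       EG aF' (EX %/ $vmA * $vnv + EG aHD (EX %% $vmA)) - $vINF - EG aW (EX %% $vmA))) ;;
  scan true aQ ($vN0 * $vmA) $vmA ;;
  Par aBEST $vnv EX (ELt EX $vn (EEq (EG aH0 (EG aIDX EX)) EX
    (EG aQ (EG aIDX EX * $vmA + ($vmA - #1))) #0) #0).

Section Up.
Variables X LP : nat.
Hypotheses (X64 : 64 <= X) (LX : 2 ^ LP <= X).
Notation hr := (hr X LP).
Variables (nv mA : nat) (tl hd wt : nat -> nat) (INF SC : nat) (w0 : nat -> nat).
Variables (LG N0 C1 RR ELL HM y : nat) (idx h0 : nat -> nat).
Hypothesis pok : params_ok X nv mA tl hd wt INF SC w0 LG N0 C1 RR ELL HM y idx h0.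
Let aok := p_aok pok.
Let nv0 : 0 < nv. Proof. exact: aok_nv aok. Qed.
Let mA0 := p_mA pok.
Let mL := p_mL pok.
Let LGX := p_LGX pok.
Let IX := p_IX pok.
Let N00 : 0 < N0. Proof. by have /andP[] := p_N0 pok. Qed.
Let N0n : N0 <= nv. Proof. by have /andP[] := p_N0 pok. Qed.
Let C11 := p_C1 pok.
Let RR0 : 0 < RR. Proof. by rewrite (p_RR pok) !muln_gt0 (p_LG pok) (ltnW C11). Qed.
Let BB := p_BB pok.

Notation envI := (envI nv mA LG INF SC tl hd wt).
Notation PH := (PH nv mA tl hd wt INF).

Notation envP := (envP nv mA tl hd wt INF SC LG N0 C1 RR ELL HM idx h0).
Notation Pr := (Pr nv mA tl hd wt INF).
Notation MN := (mA * nv).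
Notation G := LG.+1.

Hypothesis idxN : forall u, u < nv -> idx u < N0.

Let nX : nv <= X.
Proof.
apply: leq_trans LGX; apply: ltnW; apply: (RR_LG pok).
by move: nv0 RR0 N00; clear; nia.
Qed.
Let IX' : INF <= X. Proof. by apply: leq_trans IX; move: mA0; clear; nia. Qed.
Let wk : N0 * (mA + nv) <= 3 * MN /\ nv <= MN /\ 0 < MN.
Proof.
have h1 : N0 * mA <= mA * nv by rewrite mulnC leq_mul2l N0n orbT.
have h2 : N0 * nv <= 2 * MN by rewrite mulnA leq_mul2r (p_N0m pok) orbT.
split; first by rewrite mulnDr; move: h1 h2; clear; lia.
by rewrite muln_gt0 mA0 nv0 leq_pmull.
Qed.

Lemma hr_final_dir t n : envP t -> rg t vn = n ->
  (forall j u, j < N0 -> u < nv -> A t aF' (j * nv + u) = Pr (h0 j) u) ->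
  hr final_dir t (10 * G) (20 * (G * MN)) (fun t' => forall u, u < nv ->
    A t' aBEST u = if (u < n) && (h0 (idx u) == u) then
      \max_(e < mA | hd e == u) (Pr u (tl e) - wt e) else 0).
Proof.
move=> e En EF; have [[eg eo _ EI _] [EN _ _ _ _] EX EH] := e; have [Env Em EL EW] := eg.
apply: hr_cost.
{ apply: (hr_seq LX); [by []|apply: (hr_relax X64 LX nv0 mA0 mL LGX IX (aok_0 aok) (aok_tl aok) _ _ eg eo _ N00) => //|].
  - by move=> t' i f'; rewrite !evE f'.1.
  - by move=> i iN; rewrite (divn_eq i nv) EF ?(div_lt iN) ?(mod_lt iN) // (Pr_INF aok).
  move=> t1 f1 Y1; apply: (hr_map X64 LX (p := nv)) => //; first by rewrite !evE f1.1.
    by move=> b i _; exact: (smallP X64).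
  have X1 u : A t1 aIDX u = idx u by rewrite f1.2 // EX.
  have H1 j : A t1 aH0 j = h0 j by rewrite f1.2 // EH.
  move=> t2 R2 B2 F2 u un; rewrite B2 un !evE !f1.1 // En Env Em X1 H1.
  case: ltnP => //= _; case: eqP => // hu; rewrite Y1 ?idxN //.
  have [-> _] := key_max mA (fun e => hd e == u) (fun e => A t aF' (idx u * nv + tl e) - wt e).
  by apply: eq_bigr => e' _; rewrite EF ?idxN ?hu //; exact: (aok_tl aok).
}
- by clear; lia.
have [w1 [w2 w3]] := wk.
have w4 : G * (N0 * (mA + nv)) <= 3 * (G * MN) by rewrite [3 * _]mulnCA leq_mul2l w1 orbT.
have w5 : MN <= G * MN by rewrite leq_pmull.
rewrite -(mulnA 4); move: w2 w4 w5; move: (G * (N0 * _)) => a; move: (G * MN) => b; move: MN => c; clear; lia.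
Qed.

Lemma arc_le u e : e < mA -> Pr u (tl e) - wt e <= Pr u (hd e).
Proof.
move=> em; have tr := triangle aok u (tl e) (hd e).
have c : chain mA tl hd (tl e) [:: e] (hd e) by rewrite /= em !eqxx.
have := chain_Pr aok c; rewrite /wsum big_seq1; have := Pr_INF aok u (tl e).
by move: tr; clear; lia.
Qed.

Lemma Pr_last u x es : opt nv mA tl hd wt INF u es x -> 0 < size es ->
  exists e, [/\ e < mA, hd e = x & Pr u (tl e) = Pr u x + wt e].
Proof.
case/lastP: es => // a e + _; rewrite -cats1 => o; have [o1 o2 E] := opt_cat aok o.
set z := cend hd u a in o1 o2 E; have [c2 w2 _] := o2.
move: c2 w2; rewrite /= /wsum big_seq1 => /and3P[em /eqP tz /eqP hx] w2.
by exists e; split=> //; rewrite tz; move: w2 E; clear; lia.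
Qed.

Lemma Pr_max u x : x != u -> 0 < Pr u x -> Pr u x < INF /\
  \max_(e < mA | hd e == x) (Pr u (tl e) - wt e) = Pr u x.
Proof.
move=> xu p0; have [es o] := opt_ex aok p0; have [c w _] := o.
have s0 : 0 < size es by case: (es) c => //= /eqP E; rewrite E eqxx in xu.
have [e [em ex Ee]] := Pr_last o s0; split.
  have := wsum_size aok c; move: w s0; clear; lia.
apply/eqP; rewrite eqn_leq; apply/andP; split.
  by apply/bigmax_leqP => e' /eqP <-; exact: arc_le (ltn_ord e').
have := leq_bigmax_cond (F := fun e : 'I_mA => Pr u (tl e) - wt e) (P := fun e : 'I_mA => hd e == x) (Ordinal em).
by rewrite /= ex eqxx Ee addnK; apply.
Qed.

(** Each step to a parent shortens the shortest path by one arc, so [2 ^ LG >= nv] steps reach a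
    fixed point and one step more changes nothing; this yields the recursion for [lab]. The guard
    [p x < nv] concerns unreachable vertices, whose parents are unspecified. *)
Lemma labels u (p : nat -> nat) (f := fun x => if p x == u then x else if p x < nv then p x else x)
    (lab := iter (2 ^ LG) f) : u < nv ->
  parent_of nv mA INF tl hd wt (Pr u) p ->
  (forall x, x < nv -> x != u -> 0 < Pr u x -> exists e, [/\ e < mA, hd e = x, p x = tl e & Pr u (tl e) = Pr u x + wt e]) /\
  (forall x, x < nv -> x != u -> 0 < Pr u x -> lab x = if p x == u then x else lab (p x)).
Proof.
move=> un pp.
have parP x : x < nv -> x != u -> 0 < Pr u x -> exists e, [/\ e < mA, hd e = x, p x = tl e & Pr u (tl e) = Pr u x + wt e].
  move=> xn xu p0; have [lt mx] := Pr_max xu p0.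
  have := pp x xn; rewrite (ltn_eqF lt) mx => /(_ p0)[e [e1 e2 e3 e4]].
  by exists e; split=> //; move: e4 p0; clear; lia.
have prd x es : x < nv -> x != u -> opt nv mA tl hd wt INF u es x -> exists e es',
  [/\ p x = tl e, tl e < nv, 0 < Pr u (tl e), opt nv mA tl hd wt INF u es' (tl e) & (size es').+1 = size es].
  move=> xn xu o; have [c w p0] := o; have [e [em ex px Ee]] := parP x xn xu p0.
  have p1 : 0 < Pr u (tl e) by rewrite Ee; move: p0; clear; lia.
  have [es' o'] := opt_ex aok p1; have [c' w' _] := o'.
  exists e, es'; split=> //; first exact: (aok_tl aok).
  have o2 : opt nv mA tl hd wt INF u (es' ++ [:: e]) x.
    split=> //; first by rewrite chain_cat (chain_end c') c' /= em ex !eqxx.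
    by rewrite wsum_cat /wsum big_seq1; move: w' Ee; rewrite /wsum; clear; lia.
  by rewrite (opt_hop aok o) -(opt_hop aok o2) size_cat addn1.
have st k : forall x es, x < nv -> x != u -> opt nv mA tl hd wt INF u es x -> size es <= k.+1 -> f (iter k f x) = iter k f x.
  elim: k => [|k IH] x es xn xu o sz; have [e [es' [px tn p1 o' sE]]] := prd x es xn xu o.
    have s0 : size es' = 0 by move: sz; rewrite -sE; clear; lia.
    have [c' _ _] := o'; move: c'; rewrite (size0nil s0) /= => /eqP ut.
    by rewrite /= /f px -ut eqxx.
  case: (eqVneq (p x) u) => pu.
    have fx : f x = x by rewrite /f pu eqxx.
    have itx j : iter j f x = x by elim: j => //= j ->.
    by rewrite itx fx.
  have fx : f x = p x by rewrite /f (negbTE pu) px tn.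
  rewrite !iterSr fx px; apply: (IH _ es') => //; first by rewrite -px.
  by move: sz; rewrite -sE.
split=> // x xn xu p0; have [es o] := opt_ex aok p0.
have [e [em ex px Ee]] := parP x xn xu p0.
case: (eqVneq (p x) u) => pu.
  have fx : f x = x by rewrite /f pu eqxx.
  by rewrite /lab; elim: (2 ^ LG) => //= j ->.
have fx : f x = p x by rewrite /f (negbTE pu) px (aok_tl aok em).
rewrite /lab -fx -iterSr /= (st _ x es) //.
apply: leq_trans (ltnW (opt_size aok o)) _; apply: leqW; apply: ltnW.
by apply: (RR_LG pok); move: nv0 RR0 N00; clear; nia.
Qed.

End Up.

End DirectedAnswer.

(** * Answers for undirected graphs *)

Module UndirectedAnswer.
Import Language Expressions Spawning Simulation Compiler Profits Hitting Cycles Hoare Scans BellmanFord Layers Samples Sampling Params LevelUp Ascent Descent Solve InputData ArcTables LevelTables DirectedAnswer.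

Section Up.
Variables X LP : nat.
Hypotheses (X64 : 64 <= X) (LX : 2 ^ LP <= X).
Notation hr := (hr X LP).
Variables (nv mA : nat) (tl hd wt : nat -> nat) (INF SC : nat) (w0 : nat -> nat).
Variables (LG N0 C1 RR ELL HM y : nat) (idx h0 : nat -> nat).
Hypothesis pok : params_ok X nv mA tl hd wt INF SC w0 LG N0 C1 RR ELL HM y idx h0.
Let aok := p_aok pok.
Let nv0 : 0 < nv. Proof. exact: aok_nv aok. Qed.
Let mA0 := p_mA pok.
Let mL := p_mL pok.
Let LGX := p_LGX pok.
Let IX := p_IX pok.
Let N00 : 0 < N0. Proof. by have /andP[] := p_N0 pok. Qed.
Let N0n : N0 <= nv. Proof. by have /andP[] := p_N0 pok. Qed.
Let C11 := p_C1 pok.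
Let RR0 : 0 < RR. Proof. by rewrite (p_RR pok) !muln_gt0 (p_LG pok) (ltnW C11). Qed.
Let BB := p_BB pok.

Notation envI := (envI nv mA LG INF SC tl hd wt).
Notation PH := (PH nv mA tl hd wt INF).

Notation envP := (envP nv mA tl hd wt INF SC LG N0 C1 RR ELL HM idx h0).
Notation Pr := (Pr nv mA tl hd wt INF).
Notation MN := (mA * nv).
Notation G := LG.+1.

Hypothesis idxN : forall u, u < nv -> idx u < N0.

Let nX : nv <= X.
Proof.
apply: leq_trans LGX; apply: ltnW; apply: (RR_LG pok).
by move: nv0 RR0 N00; clear; nia.
Qed.
Let IX' : INF <= X. Proof. by apply: leq_trans IX; move: mA0; clear; nia. Qed.
Let wk : N0 * (mA + nv) <= 3 * MN /\ nv <= MN /\ 0 < MN.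
Proof.
have h1 : N0 * mA <= mA * nv by rewrite mulnC leq_mul2l N0n orbT.
have h2 : N0 * nv <= 2 * MN by rewrite mulnA leq_mul2r (p_N0m pok) orbT.
split; first by rewrite mulnDr; move: h1 h2; clear; lia.
by rewrite muln_gt0 mA0 nv0 leq_pmull.
Qed.

Lemma hr_final_und t n : envP t -> rg t vn = n ->
  (forall j u, j < N0 -> u < nv -> A t aF' (j * nv + u) = Pr (h0 j) u) ->
  hr final_und t (20 * G) (60 * (G * MN)) (fun t' => forall u, u < nv ->
    if (u < n) && (h0 (idx u) == u) then exists par lab : nat -> nat,
      [/\ forall x, x < nv -> x != u -> 0 < Pr u x -> exists e, [/\ e < mA, hd e = x, par x = tl e & Pr u (tl e) = Pr u x + wt e],
          forall x, x < nv -> x != u -> 0 < Pr u x -> lab x = if par x == u then x else lab (par x) &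
          A t' aBEST u = \max_(e < mA | (if tl e == u then hd e else lab (tl e)) != (if hd e == u then tl e else lab (hd e)))
            (Pr u (tl e) + Pr u (hd e) - INF - wt e)]
    else A t' aBEST u = 0).
Proof.
move=> e En EF; have [_ [EN _ _ _ _] _ _] := e.
have NM0 : 0 < N0 * mA by rewrite muln_gt0 N00.
have NN0 : 0 < N0 * nv by rewrite muln_gt0 N00.
apply: hr_cost.
{ apply: (hr_seq LX); [by []|apply: hr_asg1 => b; exact: (smallP X64)|].
  move=> t1 f1 E1; have e1 := envP_fr f1 isT isT e; have [eI1 [EN1 _ _ _ _] _ _] := e1.
  have H1 : rg t1 vHn = N0 by rewrite -E1 rg_setv eqxx !evE.
  have F1 i : i < N0 * nv -> A t1 aF' i <= INF.
    by move=> iN; rewrite f1.2 // (divn_eq i nv) EF ?(div_lt iN) ?(mod_lt iN) // (Pr_INF aok).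
  apply: (hr_seq LX); [by []|exact: (hr_parents X64 LX aok mA0 mL LGX IX eI1 H1 N00 (isT : 0 < aF' <= 64) isT nX F1)|].
  move=> t2 f2 P2; have f12 := fr_trans f1 f2; have e2 := envP_fr f12 isT isT e.
  have [[[Env2 Em2 _ _] _ _ _ _] [EN2 _ _ _ _] EX2 EH2] := e2.
  pose p j x := A t2 aPAR (j * nv + x).
  pose f j x := if p j x == h0 j then x else if p j x < nv then p j x else x.
  have fn j x : x < nv -> f j x < nv by move=> xn; rewrite /f; case: ifP => // _; case: ifP.
  have itn j k x : x < nv -> iter k (f j) x < nv by move=> xn; elim: k => //= k; exact: fn.
  have pp j : j < N0 -> parent_of nv mA INF tl hd wt (Pr (h0 j)) (p j).
    move=> jN x xn; have := P2 j jN x xn; rewrite f1.2 // EF // -/(p j x).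
    have E : \max_(e < mA | hd e == x) (A t1 aF' (j * nv + tl e) - wt e) = \max_(e < mA | hd e == x) (Pr (h0 j) (tl e) - wt e).
      by apply: eq_bigr => e' _; rewrite f1.2 // EF //; exact: (aok_tl aok).
    rewrite E; case: ifP => // _ h /h[e' [q1 q2 q3 q4]]; exists e'; split=> //.
    by rewrite -q4 f1.2 // EF //; exact: (aok_tl aok).
  apply: (hr_seq LX); [by []|apply: (hr_map1 X64 LX (p := N0 * nv)) => //|].
  - by rewrite !evE EN2 Env2.
  - move=> b i iN; have xX : i %% nv <= X by apply: leq_trans nX; exact: ltnW (mod_lt iN).
    by rewrite !evE Env2; case: ifP => // _; case: ifP => // _; exact: b.2.
  move=> t3 f3 V3; have f13 := fr_trans f12 f3; have e3 := envP_fr f13 isT isT e.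
  pose I k t' := forall j x, j < N0 -> x < nv -> A t' aV2 (j * nv + x) = iter (2 ^ k) (f j) x.
  apply: (hr_seq LX (Q1 := I LG)); first by [].
    apply: (hr_for LX (n := LG) (t := 1) (w := N0 * nv) (I := I)) => //.
    - by have [[[_ _ ->]]] := e3.
    - by move=> j x jN xn; rewrite V3 idx_lt // !evE Env2 EH2 idx_mod // idx_div.
    - move=> k t' kL f' Ik; have f4 := fr_setv k (isT : vsq != 0) f'.
      have [[[Env4 _ _ _] _ _ _ _] [EN4 _ _ _ _] _ _] := envP_fr (fr_trans f13 f4) isT isT e.
      apply: (hr_map X64 LX (p := N0 * nv)) => //; first by rewrite !evE EN4 Env4.
        by move=> b i _; exact: (smallP X64).
      move=> t5 _ V5 _ j x jN xn; rewrite V5 idx_lt // !evE Env4 idx_div // !A_setv // Ik // Ik ?itn //.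
      by rewrite expnS mul2n -addnn iterD.
  move=> t4 f4 V4; have f14 := fr_trans f13 f4; have e4 := envP_fr f14 isT isT e.
  have [[[Env4 Em4 EG4 EW4] [ET4 _ _] [EH4 _ _] EI4 _] [EN4 _ _ _ _] EX4 EHH4] := e4.
  pose lab j := iter (2 ^ LG) (f j).
  pose cond j e := (if tl e == h0 j then hd e else lab j (tl e)) == (if hd e == h0 j then tl e else lab j (hd e)).
  pose val j e := if cond j e then 0 else Pr (h0 j) (tl e) + Pr (h0 j) (hd e) - INF - wt e.
  have F4 j x : j < N0 -> x < nv -> A t4 aF' (j * nv + x) = Pr (h0 j) x by move=> jN xn; rewrite f14.2 // EF.
  have Q4 i : i < N0 * mA -> ev t4 i (EEq (EEq (EG aTL (EX %% $vmA)) (EG aH0 (EX %/ $vmA)) (EG aHD (EX %% $vmA))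
           (EG aV2 (EX %/ $vmA * $vnv + EG aTL (EX %% $vmA))))
         (EEq (EG aHD (EX %% $vmA)) (EG aH0 (EX %/ $vmA)) (EG aTL (EX %% $vmA))
           (EG aV2 (EX %/ $vmA * $vnv + EG aHD (EX %% $vmA)))) #0
      (EG aF' (EX %/ $vmA * $vnv + EG aTL (EX %% $vmA)) +
       EG aF' (EX %/ $vmA * $vnv + EG aHD (EX %% $vmA)) - $vINF - EG aW (EX %% $vmA)))%ex = val (i %/ mA) (i %% mA).
    move=> iN; have jN := div_lt iN; have em := mod_lt iN.
    have tn := aok_tl aok em; have hn := aok_hd aok em.
    by rewrite !evE Em4 Env4 EI4 ET4 // EH4 // EHH4 EW4 // !V4 // !F4.
  have vX j e' : val j e' <= X.
    rewrite /val; case: ifP => // _; apply: leq_trans IX'.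
    have := Pr_INF aok (h0 j) (tl e'); have := Pr_INF aok (h0 j) (hd e'); clear; lia.
  apply: (hr_seq LX); [by []|apply: (hr_map1 X64 LX (p := N0 * mA)) => //|].
  - by rewrite !evE EN4 Em4.
  - by move=> _ i iN; rewrite Q4.
  move=> t5 f5 Q5; have f15 := fr_trans f14 f5.
  have [[[Env5 Em5 EG5 _] _ _ _ _] [EN5 _ _ _ _] _ _] := envP_fr f15 isT isT e.
  apply: (hr_seq LX); [by []|apply: (hr_scan1 X64 LX (T := N0 * mA) (l := mA) (LG := LG)) => //|].
  - by move=> t' i f'; rewrite !evE !f'.1 // EN5 Em5.
  - by move=> t' i f'; rewrite !evE !f'.1 // Em5.
  - by move=> [_ b2] r j _ _; rewrite big_mkord; apply/bigmax_leqP => z _; exact: b2.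
  move=> t6 f6 Q6; have f16 := fr_trans f15 f6.
  have [[[Env6 Em6 _ _] _ _ _ _] _ EX6 EH6] := envP_fr f16 isT isT e.
  apply: (hr_map X64 LX (p := nv)) => //.
    by move=> b i _; exact: (smallP X64).
  have n6 : rg t6 vn = n by rewrite f16.1.
  move=> t7 _ B7 _ u un; rewrite B7 un !evE n6 Em6 EX6 EH6.
  case: ltnP => //= _; case: eqP => // hu; have uN := idxN un.
  have pu : parent_of nv mA INF tl hd wt (Pr u) (p (idx u)) by have := pp _ uN; rewrite hu.
  have lb := labels pok un pu; have l1 := proj1 lb; have l2 := proj2 lb.
  have fE : f (idx u) = fun x => if p (idx u) x == u then x else if p (idx u) x < nv then p (idx u) x else x by rewrite /f hu.
  exists (p (idx u)), (lab (idx u)); split; [exact: l1|by rewrite /lab fE|].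
  have lt : mA - 1 < mA by rewrite subn1 ltn_predL.
  rewrite Q6 ?idx_lt //= subn1 prednK // big_mkord [RHS]big_mkcond /=.
  apply: eq_bigr => e' _; rewrite Q5 idx_lt // Q4 ?idx_lt // idx_div // idx_mod // /val /cond hu.
  by case: ifP.
}
- by clear; lia.
have [w1 [w2 w3]] := wk.
have w4 : G * (N0 * (mA + nv)) <= 3 * (G * MN) by rewrite [3 * _]mulnCA leq_mul2l w1 orbT.
have w5 : MN <= G * MN by rewrite leq_pmull.
have w6 : N0 * mA <= MN by rewrite mulnC leq_mul2l N0n orbT.
have w7 : N0 * nv <= 2 * MN by rewrite mulnA leq_mul2r (p_N0m pok) orbT.
have w8 : LG * (N0 * nv).+1 <= G * (3 * MN).
  by apply: leq_mul => //; move: w7 w3; clear; lia.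
have w9 : G * (N0 * mA) <= G * MN by rewrite leq_mul2l w6 orbT.
rewrite -(mulnA 4) -(mulnA 5); move: w2 w3 w4 w5 w6 w7 w9; rewrite [G * (3 * _)]mulnCA in w8; move: w8.
move: (G * (N0 * (mA + nv))) => a; move: (G * (N0 * mA)) => a'; move: (LG * _) => d.
move: (N0 * mA) => q; move: (N0 * nv) => r; move: (G * MN) => z; move: MN => c; clear; lia.
Qed.

End Up.

End UndirectedAnswer.

(** * The complete program and its output *)

Module Assembly.
Import Language Expressions Spawning Simulation Compiler Profits Hitting Cycles Hoare Scans BellmanFord Layers Samples Sampling Params LevelUp Ascent Descent Solve InputData ArcTables LevelTables DirectedAnswer UndirectedAnswer.

Definition body (dir : bool) : cmd :=
  setup_scalars dir ;; setup_arcs ;; setup_levels ;; solve ;;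
  (if dir then final_dir else final_und).

Definition answer (e : expr) : expr := EI e (($vINF - e) %/ $vSC + #1)%ex #0.

Definition min_out : cmd :=
  scan true aBEST $vnv $vnv ;; Par 0 #1 EX (answer (EG aBEST ($vnv - #1))).

(** The output cells may overlap with cells of arrays; this is harmless because all reads of a
    parallel step precede its writes. *)
Definition all_out : cmd := Par 0 $vnv EX (answer (EG aBEST EX)).

(** Variable 0 becomes the length of the input, so that the arrays start right after it. *)
Definition main (dir b : bool) : cmd :=
  Asg vn (EG 0 #0) ;; Asg vm (EG 0 #1) ;; Asg 0 (#3 * $vm + #2) ;; body dir ;;
  (if b then min_out else all_out).

(** Writing raw memory may destroy arrays, so this rule gives no frame; it is meant for the final
    output. *)
Lemma hr_raw X LP s P v p (Q : state -> Prop) : ev s 0 P = p -> 0 < p ->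
  (bd X s -> forall i, i < p -> ev s i v <= X) ->
  (forall s', (forall i, i < p -> mm s' i = ev s i v) -> Q s') ->
  hr X LP (Par 0 P EX v) s 1 p Q.
Proof.
move=> EP p0 vX q; split=> b; rewrite /= EP; split=> //; first by split=> //; exact: vX.
by apply: q => i ip; exact: (@pwr_at s 0 EX v p i).
Qed.

Section Setup.
Variables (X LP : nat) (dir : bool) (n : nat) (G : wgraph dir n) (s : seq ('I_n * 'I_n)).
Hypotheses (X64 : 64 <= X) (LX : 2 ^ LP <= X).
Hypothesis es : edge_list G s.
Notation hr := (hr X LP).
Notation m := (size s).
Notation M := (nth 0 (input_words G s)).
Notation nv := n.+1.
Notation mA := (arcs_num dir s).
Notation tl := (tlf G s).
Notation hd := (hdf G s).
Notation w0 := (w0f G s).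
Notation SC := n.+2.
Notation LG := (lgl n).
Notation inf := (inf G).
Notation wtf := (wtf G s).
Notation n0 := (n0 dir s).
Notation ell := (ell dir s).
Hypotheses (XG : 2 ^ LG <= X) (XI : inf.+1 * mA <= X) (LPn : n + 1024 <= 2 ^ LP).

Let mA0 : 0 < mA. Proof. by rewrite /arcs_num; case: (dir). Qed.
Let mmA : m < mA. Proof. by rewrite /arcs_num; case: (dir); clear; lia. Qed.
Let inf0 : 0 < inf. Proof. by rewrite /ArcTables.inf !muln_gt0 addn1. Qed.
Let nX : n + 1024 <= X. Proof. exact: leq_trans LX. Qed.
Let mAX : mA <= X. Proof. by apply: leq_trans XI; rewrite leq_pmull. Qed.
Let infX : inf.+1 <= X. Proof. by apply: leq_trans XI; rewrite leq_pmulr. Qed.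
Let lgX : LG <= X. Proof. by apply: leq_trans XG; rewrite ltnW // ltn_expl. Qed.
Let rc : rrl n * n.+2 < 2 ^ LG /\ c1l n < 2 ^ LG.
Proof.
have h := big_ok n; have c0 : 0 < c1l n by rewrite expn_gt0.
have n4 : n.+2 <= n.+2 ^ 4 by rewrite -{1}[n.+2]expn1 leq_pexp2l.
have r0 : 0 < rrl n by rewrite !muln_gt0 c0 /=; have := yl10 n; clear; lia.
split; apply: leq_ltn_trans h.
  by apply: leq_mul => //; rewrite -mulnA mulnCA leq_pmulr // muln_gt0 expn_gt0 c0.
apply: leq_trans (_ : c1l n ^ 2 <= _); first by rewrite -mulnn leq_pmulr.
rewrite (_ : 8 * rrl n * c1l n ^ 2 * n.+2 ^ 4 = 8 * rrl n * n.+2 ^ 4 * c1l n ^ 2); last exact: mulnAC.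
by rewrite leq_pmull // muln_gt0 expn_gt0 muln_gt0 r0.
Qed.
Let mAL : mA <= 2 ^ LG.
Proof.
have [h _] := size_edges es; have y := yl_exp n.
apply: leq_trans (_ : 2 ^ (3 * yl n) <= _); last by rewrite leq_pexp2l // /lgl; clear; lia.
rewrite mulnC expnM; apply: leq_trans (_ : (n + 1024) ^ 3 <= _); last by rewrite leq_exp2r.
rewrite expnS -mulnn; apply: leq_trans (_ : (2 * m).+1 <= _); first by rewrite /arcs_num; case: (dir); clear; lia.
apply: leq_trans (_ : 1024 * (n * n + 1) <= _); first by move: h; clear; lia.
by apply: leq_mul; [rewrite leq_addl|clear; nia].
Qed.

Notation TB := (ell.+1 * (LG.+1 * LG.+1 * rrl n * 2 ^ ell)).
Notation WB := (ell.+1 * (LG.+1 * LG.+1 * (rrl n ^ 3 * c1l n ^ 2 * (nv * mA)))).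
Notation cyc_spec := (cyc_spec G inf SC).

Let mAp : 0 < mA. Proof. by rewrite /arcs_num; case: (dir). Qed.
Let nvX : n + 1024 <= X. Proof. exact: leq_trans LX. Qed.

Lemma units : [/\ 0 < TB, LG.+1 <= TB, nv * mA <= WB & LG.+1 * (nv * mA) <= WB].
Proof.
have c0 : 0 < c1l n by rewrite expn_gt0.
have r0 : 0 < rrl n by rewrite !muln_gt0 c0 /=; have := yl10 n; clear; lia.
have k0 : 0 < rrl n ^ 3 * c1l n ^ 2 by rewrite muln_gt0; apply/andP; split; rewrite expn_gt0 ?r0 ?c0.
have e0 : 0 < ell.+1 * (LG.+1 * rrl n * 2 ^ ell) by rewrite muln_gt0 /= muln_gt0 expn_gt0 /= andbT muln_gt0 r0.
have E1 : TB = LG.+1 * (ell.+1 * (LG.+1 * rrl n * 2 ^ ell)).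
  by move: (2 ^ ell) (rrl n) LG.+1 ell.+1; clear; lia.
have h : LG.+1 <= TB by rewrite E1 leq_pmulr.
have E2 : WB = ell.+1 * LG.+1 * (rrl n ^ 3 * c1l n ^ 2) * (LG.+1 * (nv * mA)).
  by move: (rrl n ^ 3 * c1l n ^ 2) (nv * mA) LG.+1 ell.+1; clear; lia.
have w : LG.+1 * (nv * mA) <= WB by rewrite E2 leq_pmull // muln_gt0.
by split=> //; [apply: leq_trans h|apply: leq_trans w; rewrite leq_pmull].
Qed.

Lemma hr_body t : rg t vn = n -> rg t vm = m -> (forall i, i < 3 * m + 2 -> A t 0 i = M i) ->
  hr (body dir) t (500 * TB) (13 * 1000 * WB) (fun t' =>
    [/\ rg t' vnv = nv, rg t' vINF = inf, rg t' vSC = SC, rg t' vLG = LG &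
     [/\ forall u : 'I_n, cyc_spec (fun c => simple_cycle G c && (u \in c)) (A t' aBEST u),
      A t' aBEST n = 0 & forall u, u < nv -> A t' aBEST u <= inf]]).
Proof.
move=> En Em EM; have [u1 u2 u3 u4] := units; apply: hr_cost.
{ apply: (hr_seq LX); [by case: (dir)|exact: (hr_setup_scalars X64 LX XG XI LPn En Em EM)|].
  move=> t1 f1 b1; apply: (hr_seq LX); [by []|exact: (hr_setup_arcs X64 LX es XG XI LPn b1)|].
  move=> t2 f2 [i2 T2 H2 W2].
  have b2 : base G s t2.
    have [[q1 q2 q3 q4] [q5 q6 q7 q8] q9] := b1.
    by split; [split; rewrite f2.1|split; rewrite f2.1|move=> i im; rewrite f2.2 // q9].
  apply: (hr_seq LX); [by []|exact: (hr_setup_levels X64 LX es XG XI LPn b2 (And4 i2 T2 H2 W2))|].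
  move=> t3 f3 [idx [h0 [pok e3 IN En3]]].
  apply: (hr_seq LX); [by []|exact: (hr_solve X64 LX pok e3)|].
  move=> t4 f4 F4; have e4 := envP_fr f4 isT isT e3.
  have En4 : rg t4 vn = n by rewrite f4.1.
  have aok := p_aok pok; have a1 := arcs1 es; have a2 := arcs2 es.
  have big c : simple_cycle G c -> SC * cycle_weight G c + size c < inf.
    by move=> sc; apply: cycle_big sc (leqnn _).
  (* Every vertex of a cycle is the tail of an arc, hence correctly numbered. *)
  have noc u : h0 (idx (nat_of_ord u)) != u -> cyc_spec (fun c => simple_cycle G c && ((u : 'I_n) \in c)) 0.
    move=> hu; split=> // c /andP[/and3P[cc _ _] uc]; case/negP: hu.
    have [e [/andP[_ em] te _ _]] := a2 _ _ (next_cycle cc uc).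
    have [h _] := p_cov pok em (or_introl (esym te)).
    exact/eqP.
  pose QQ t' := forall u, u < nv -> (if (u < n) && (h0 (idx u) == u) then
      (forall v : 'I_n, v = u :> nat -> cyc_spec (fun c => simple_cycle G c && (v \in c)) (A t' aBEST u)) /\ A t' aBEST u <= inf
    else A t' aBEST u = 0).
  have QQok t' V B : fr V B t4 t' -> ~~ has (mem V) [:: vnv; vINF; vSC; vLG] -> QQ t' ->
    [/\ rg t' vnv = nv, rg t' vINF = inf, rg t' vSC = SC, rg t' vLG = LG &
     [/\ forall u : 'I_n, cyc_spec (fun c => simple_cycle G c && (u \in c)) (A t' aBEST u),
      A t' aBEST n = 0 & forall u, u < nv -> A t' aBEST u <= inf]].
    move=> [f _] /=; rewrite !negb_or => /and5P[v1 v2 v3 v4 _] q.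
    have [[[Env _ EL _] _ _ EI ES] _ _ _] := e4.
    split; rewrite ?f //; split.
    - move=> u; have := q u (leqW (ltn_ord u)); rewrite ltn_ord /=; case: ifP => [_ [h _]|h ->]; first exact: h.
      by apply: noc; rewrite h.
    - by have := q n (leqnn _); rewrite ltnn.
    by move=> u un; have := q u un; case: ifP => [_ []|_ ->].
  have [y2 y3] : TB = TB /\ WB = WB by [].
  apply: (hr_cost (t := 20 * LG.+1) (w := 60 * (LG.+1 * (mA * nv)))); [|exact: leqnn|exact: leqnn].
  split=> b4.
  have key : [/\ ok X LP (if dir then final_dir else final_und) t4, tau (if dir then final_dir else final_und) t4 <= 20 * LG.+1,
     omg (if dir then final_dir else final_und) t4 <= 60 * (LG.+1 * (mA * nv)) & QQ (run (if dir then final_dir else final_und) t4)].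
    have [d|d] : dir \/ ~~ dir by case: (dir); [left|right].
      have cE : (if dir then final_dir else final_und) = final_dir by rewrite d.
      rewrite cE; have [/(_ b4)[o1 o2 o3 o4]] := hr_final_dir X64 LX pok IN e4 En4 F4.
      split=> //; [by apply: leq_trans o2 _; rewrite leq_mul2r|by apply: leq_trans o3 _; rewrite leq_mul2r orbT|].
      move=> u un; have := o4 u un; case: ifP => // /andP[un' hu] ->; split.
        move=> v vu; rewrite -vu; exact: (directed_cyc aok a1 a2 v d).
      by apply/bigmax_leqP => e _; apply: leq_trans (leq_subr _ _) (Pr_INF aok _ _).
    have cE : (if dir then final_dir else final_und) = final_und by rewrite (negbTE d).
    rewrite cE; have [/(_ b4)[o1 o2 o3 o4]] := hr_final_und X64 LX pok IN e4 En4 F4.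
    split=> // u un; have := o4 u un; case: ifP => // /andP[un' hu] [par [lab [h1 h2 ->]]]; split.
      move=> v vu; subst u; apply: (und_cyc aok a1 a2 d (par := par) (lab := lab)).
      - by move=> x xn; apply: h1; exact: leqW.
      - by move=> x xn; apply: h2; exact: leqW.
    apply/bigmax_leqP => e _; have := Pr_INF aok u (tlf G s e); have := Pr_INF aok u (hdf G s e).
    by move: (Profits.Pr _ _ _ _ _ _ _ (tlf _ _ _)) (Profits.Pr _ _ _ _ _ _ _ (hdf _ _ _)); clear; lia.
  have [k1 k2 k3 k4] := key; split=> //; apply: (QQok _ _ _ (fr_run _ _) _ k4); by case: (dir).
}
- move: u2; move: (ell.+1 * (LG.+1 * LG.+1 * rrl n * 2 ^ ell)) => z; move: (lgl n) => g; clear; lia.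
rewrite [mA * nv]mulnC; move: u3 u4.
have E q : q * LG.+1 * (nv * mA) = q * (LG.+1 * (nv * mA)) by rewrite -mulnA.
rewrite (E 20) (E 10) (E 60).
move: (ell.+1 * (LG.+1 * LG.+1 * (rrl n ^ 3 * c1l n ^ 2 * (nv * mA)))) => z.
by move: (LG.+1 * (nv * mA)) => a; clear; lia.
Qed.

Lemma hr_out b t : rg t vnv = nv -> rg t vINF = inf -> rg t vSC = SC -> rg t vLG = LG ->
  (forall u : 'I_n, cyc_spec (fun c => simple_cycle G c && (u \in c)) (A t aBEST u)) ->
  A t aBEST n = 0 -> (forall u, u < nv -> A t aBEST u <= inf) ->
  hr (if b then min_out else all_out) t (6 * TB) (7 * WB) (fun t' =>
    if b then minimum_weight_cycle G (mm t') else all_nodes_shortest_cycles G (mm t')).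
Proof.
move=> Env EI ES EL cyc B0 Ble; have [u1 u2 u3 u4] := units.
have big c : simple_cycle G c -> SC * cycle_weight G c + size c < inf.
  by move=> sc; apply: cycle_big sc (leqnn _).
have av t' i e : rg t' vINF = inf -> rg t' vSC = SC ->
   ev t' i (answer e) = (if ev t' i e == 0 then 0 else ((inf - ev t' i e) %/ SC).+1).
  by move=> q1 q2; rewrite /answer !evE q1 q2 addn1.
have aX x : (if x == 0 then 0 else ((inf - x) %/ SC).+1) <= X.
  by case: ifP => // _; apply: leq_trans infX; rewrite ltnS (leq_trans (leq_div _ _)) // leq_subr.
case: b.
  apply: (hr_cost (t := 5 * LG.+1 + 1) (w := 5 * LG.+1 * nv + 1)).
  - apply: (hr_seq LX); [by []|apply: (hr_scan1 X64 LX (T := nv) (l := nv) (LG := LG)) => //|].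
    + by move=> t' i f'; rewrite !evE f'.1.
    + by move=> t' i f'; rewrite !evE f'.1.
    + apply: leq_trans (_ : n + 1024 <= _); first by clear; lia.
      by apply: leq_trans (yl_exp n) _; rewrite leq_pexp2l // /lgl; clear; lia.
    + by move=> [_ b2] r j _ _; rewrite big_mkord; apply/bigmax_leqP => z _; exact: b2.
    move=> t1 f1 S1; apply: (@hr_raw X LP t1 _ _ 1) => //.
      by move=> b1 i _; rewrite av ?f1.1.
    move=> t2 H2; have := H2 0 isT; rewrite av ?f1.1 // => E.
    (* The additional vertex [n] contributes 0 to the maximum. *)
    have Em : ev t1 0 (EG aBEST ($vnv - #1))%ex = \max_(u < n) A t aBEST u.
      rewrite !evE f1.1 // Env subn1 /=; have := S1 0 n (leqnn _) (leqnn _); rewrite mul0n add0n => ->.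
      by rewrite /= big_mkord big_ord_recr /= add0n B0 maxn0.
    rewrite /minimum_weight_cycle E Em; apply: (cyc_decode (arcs_okP es) big) => //.
    apply: cyc_spec_eq (cyc_spec_max cyc) => c.
    apply/existsP/idP => [[u /andP[]]|sc]; first by [].
    have c0 : 0 < size c.
      by move: (sc) => /and3P[_ _ sz]; apply: leq_trans sz; clear; case: (dir).
    by case: c sc c0 => [|u c] sc // _; exists u; rewrite sc mem_head.
  - by move: u1 u2; move: (ell.+1 * (LG.+1 * LG.+1 * rrl n * 2 ^ ell)) => z; move: (lgl n) => g; clear; lia.
  have h : LG.+1 * nv <= LG.+1 * (nv * mA) by rewrite leq_mul2l leq_pmulr.
  have h' : 0 < nv * mA by rewrite muln_gt0.
  rewrite -(mulnA 5); move: h h' u3 u4; move: (ell.+1 * (LG.+1 * LG.+1 * (rrl n ^ 3 * c1l n ^ 2 * (nv * mA)))) => z; move: (LG.+1 * (nv * mA)) => a; move: (nv * mA) => d; move: (LG.+1 * nv); clear; lia.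
apply: (hr_cost (t := 1) (w := nv)).
- apply: (@hr_raw X LP t _ _ nv) => //; first by move=> b1 i _; rewrite av.
  move=> t2 H2 u; rewrite H2 ?(leqW (ltn_ord u)) // av //.
  by apply: (cyc_decode (arcs_okP es) big _ (cyc u)) => c /andP[].
- by move: u1; move: (ell.+1 * (LG.+1 * LG.+1 * rrl n * 2 ^ ell)) => z; clear; lia.
apply: leq_trans (_ : nv * mA <= _); first by rewrite leq_pmulr.
by move: u3; move: (ell.+1 * (LG.+1 * LG.+1 * (rrl n ^ 3 * c1l n ^ 2 * (nv * mA)))) => z; move: (nv * mA) => d; clear; lia.
Qed.

End Setup.

End Assembly.

(** * Polylogarithmic factors and execution on the machine *)

Module Execution.
Import Language Expressions Spawning Simulation Compiler Profits Hitting Cycles Hoare Scans BellmanFord Layers Samples Sampling Params LevelUp Ascent Descent Solve InputData ArcTables LevelTables DirectedAnswer UndirectedAnswer Assembly.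

(** Measured against [yl], which is never 0, so that the bounds hold for every [n]. *)
Definition polylog (f : nat -> nat) : Prop := exists c k, forall n, f n <= c * yl n ^ k.

Lemma yl_gt0 n : 0 < yl n. Proof. exact: leq_trans (yl10 n). Qed.

Lemma polylog_const a : polylog (fun=> a).
Proof. by exists a, 0 => n; rewrite expn0 muln1. Qed.

Lemma polylog_le f g : (forall n, f n <= g n) -> polylog g -> polylog f.
Proof. by move=> fg [c [k h]]; exists c, k => n; apply: leq_trans (fg n) (h n). Qed.

Lemma polylog_yl : polylog yl.
Proof. by exists 1, 1 => n; rewrite mul1n expn1. Qed.

Lemma polylog_mul f g : polylog f -> polylog g -> polylog (fun n => f n * g n).
Proof.
move=> [c [k h]] [c' [k' h']]; exists (c * c'), (k + k') => n.
by rewrite expnD mulnACA leq_mul.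
Qed.

Lemma polylog_add f g : polylog f -> polylog g -> polylog (fun n => f n + g n).
Proof.
move=> [c [k h]] [c' [k' h']]; exists (c + c'), (k + k') => n.
rewrite mulnDl leq_add //; [apply: leq_trans (h n) _|apply: leq_trans (h' n) _];
  by rewrite leq_mul2l leq_pexp2l ?yl_gt0 ?leq_addr ?leq_addl ?orbT.
Qed.

Lemma polylog_exp f j : polylog f -> polylog (fun n => f n ^ j).
Proof.
move=> pf; elim: j => [|j IH]; first exact: (polylog_const 1).
by apply: polylog_le (polylog_mul pf IH) => n; rewrite expnS.
Qed.

Lemma polylog_c1l : polylog c1l.
Proof.
apply: (@polylog_le _ (fun n => 16 * (2 * (yl n + 2)) ^ 2)) => [n|].
  rewrite /c1l addnC expnD (mulnC 2) expnM leq_mul2l /= leq_exp2r //.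
  by have /andP[] := bl_exp n.
apply: polylog_mul (polylog_const _) _; apply: polylog_exp.
apply: polylog_mul (polylog_const _) _; exact: polylog_add polylog_yl (polylog_const _).
Qed.

Lemma polylog_lgl : polylog lgl.
Proof. exact: polylog_mul (polylog_const _) polylog_yl. Qed.

Lemma polylog_rrl : polylog rrl.
Proof. exact: polylog_mul (polylog_mul (polylog_const _) polylog_c1l) polylog_lgl. Qed.

Lemma polylog_units : polylog (fun n => (yl n + 2) * ((lgl n + 1) * (lgl n + 1) * (rrl n ^ 3 * c1l n ^ 2)) +
  (yl n + 2) * ((lgl n + 1) * (lgl n + 1) * rrl n)).
Proof.
have y2 := polylog_add polylog_yl (polylog_const 2).
have l1 := polylog_add polylog_lgl (polylog_const 1).
apply: polylog_add; apply: polylog_mul y2 _; apply: polylog_mul (polylog_mul l1 l1) _.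
  exact: polylog_mul (polylog_exp 3 polylog_rrl) (polylog_exp 2 polylog_c1l).
exact: polylog_rrl.
Qed.

Lemma ell_le dir n (s : seq ('I_n * 'I_n)) : ell dir s <= yl n + 1.
Proof.
rewrite /ell leq_add2r; apply: leq_trans (leq_div _ _) _; apply: up_log_min => //.
apply: leq_trans (yl_exp n); rewrite /n0; case: (ltnP (2 * arcs_num dir s) n.+1) => h; lia.
Qed.

Lemma arcs_le dir n (G : wgraph dir n) s : edge_list G s -> n.+1 * arcs_num dir s <= 2 ^ (4 * yl n).
Proof.
move=> es; have [h _] := size_edges es; have y := yl_exp n.
have -> : 4 * yl n = yl n + yl n * 3 by lia.
rewrite expnD expnM; apply: leq_mul; first by apply: leq_trans y; lia.
apply: leq_trans (_ : (n + 1024) ^ 3 <= _); last by rewrite leq_exp2r.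
rewrite expnS -mulnn; apply: leq_trans (_ : (2 * size s).+1 <= _); first by rewrite /arcs_num; case: (dir); lia.
apply: leq_trans (_ : 1024 * (n * n + 1) <= _); first by move: h; clear; lia.
by apply: leq_mul; [rewrite leq_addl|clear; nia].
Qed.

Lemma main_ok dir b X LP n (G : wgraph dir n) s (t := St (fun=> 0) (nth 0 (input_words G s)))
    (TB := (ell dir s).+1 * ((lgl n).+1 * (lgl n).+1 * rrl n * 2 ^ ell dir s))
    (WB := (ell dir s).+1 * ((lgl n).+1 * (lgl n).+1 * (rrl n ^ 3 * c1l n ^ 2 * (n.+1 * arcs_num dir s)))) :
  64 <= X -> 2 ^ LP <= X -> edge_list G s -> 2 ^ lgl n <= X -> (inf G).+1 * arcs_num dir s <= X ->
  n + 1024 <= 2 ^ LP -> (forall i, mm t i <= X) -> 3 * size s + 2 <= X ->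
  [/\ ok X LP (main dir b) t, tau (main dir b) t <= 510 * TB, omg (main dir b) t <= 14 * 1000 * WB &
    if b then minimum_weight_cycle G (mm (run (main dir b) t))
    else all_nodes_shortest_cycles G (mm (run (main dir b) t))].
Proof.
move=> X64 LX es XG XI LPn MX mX.
have [u1 u2 u3 u4] := @units dir n s; rewrite -/TB -/WB in u1 u2 u3 u4.
pose t1 := setv t vn n; pose t2 := setv t1 vm (size s); pose t3 := setv t2 0 (3 * size s + 2).
have nX : n + 1024 <= X by apply: leq_trans LX.
have b3 : bd X t3.
  split=> [x|a]; last exact: MX.
  rewrite /t3 /t2 /t1 /t !rg_setv; do ?[case: ifP => _]; rewrite //=; move: mX nX; clear; lia.
have raw3 i : i < 3 * size s + 2 -> A t3 0 i = nth 0 (input_words G s) i by [].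
have := hr_body X64 LX es XG XI LPn (erefl : rg t3 vn = n) (erefl : rg t3 vm = size s) raw3.
rewrite -/TB -/WB => -[/(_ b3)[o1 a1 w1 [q1 q2 q3 q4 [q5 q6 q7]]]].
set t4 := run _ t3 in q1 q2 q3 q4 q5 q6 q7.
have := hr_out X64 LX es XG XI b q1 q2 q3 q4 q5 q6 q7.
rewrite -/TB -/WB => -[/(_ (bd_run LX b3 o1))[o2 a2 w2 q]].
split.
- have sX : size s <= X by move: mX; clear; lia.
  split; first by exact: (leq_trans (leq_addr 1024 n) nX).
  split; first by exact: sX.
  by split; [exact: mX|split; [exact: o1|exact: o2]].
- have -> : tau (main dir b) t = 1 + (1 + (1 + (tau (body dir) t3 + tau (if b then min_out else all_out) t4))) by [].
  by move: a1 a2 u1; generalize TB; clear; lia.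
- have -> : omg (main dir b) t = 1 + (1 + (1 + (omg (body dir) t3 + omg (if b then min_out else all_out) t4))) by [].
  have : 0 < n.+1 * arcs_num dir s by rewrite muln_gt0 /arcs_num; case: (dir).
  by move: w1 w2 u3; generalize WB; clear; lia.
exact: q.
Qed.

Lemma exec_main dir b : exists wc c k, forall n (G : wgraph dir n) s, edge_list G s ->
  exists t work M, [/\ exec (word_size G wc) (prog_of (main dir b)) (init_config G s) t work M,
    if b then minimum_weight_cycle G M else all_nodes_shortest_cycles G M,
    t <= c * yl n ^ k * 2 ^ ell dir s & work <= c * yl n ^ k * (n.+1 * arcs_num dir s)].
Proof.
have [c [k ck]] := polylog_units.
(* The work is at most [d * y ^ k * 2 ^ (4 * y)], hence at most [2 ^ (a * y)], using [d <= 2 ^ d]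
   and [y ^ k <= 2 ^ (y * k)]. *)
pose d := 14 * 1000 * c; pose a := d + k + 4.
(* Exponent for [X = B ^ E]: since [2 ^ y <= B ^ 2], the first term covers [2 ^ LP] and [2 ^ lgl n],
   the second the literals and register numbers of the program, the last the size of the input and
   of [inf]. *)
pose E := 2 * (a + 16) + (cmax (main dir b)).+1 + 10.
pose z := (csz (main dir b)).+2; pose sz := size (prog_of (main dir b)) + 31 + 11 * a.
(* [B] has at most 11 times as many bits as [n + max_weight G], 10 of them for the summand 1024, and
   expressions stay below [X ^ z]. All three constants are chosen before the graph. *)
exists (11 * E * z + 1), (2 * (sz * d)), k.+1 => n G s es.
set TB := (ell dir s).+1 * ((lgl n).+1 * (lgl n).+1 * rrl n * 2 ^ ell dir s).
set WB := (ell dir s).+1 * ((lgl n).+1 * (lgl n).+1 * (rrl n ^ 3 * c1l n ^ 2 * (n.+1 * arcs_num dir s))).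
have y0 := yl_gt0 n; have el := ell_le dir s; set y := yl n in y0 el.
have TBle : TB <= c * y ^ k * 2 ^ ell dir s.
  rewrite /TB mulnA leq_mul2r; apply/orP; right; apply: leq_trans (ck n); apply: leq_trans (leq_addl _ _).
  by rewrite !addn1 leq_mul // -/y; move: el; clear; lia.
have WBle : WB <= c * y ^ k * (n.+1 * arcs_num dir s).
  rewrite /WB 2!mulnA leq_mul2r; apply/orP; right; apply: leq_trans (ck n); apply: leq_trans (leq_addr _ _).
  by rewrite !addn1 -mulnA leq_mul // -/y; move: el; clear; lia.
pose LP := a * y; pose B := n + max_weight G + 1024; pose X := B ^ E.
have B0 : 0 < B by rewrite /B addnS.
have B2 : 2 <= B by rewrite /B; clear; lia.
have BX j : j <= E -> B ^ j <= X by move=> jE; rewrite leq_pexp2l.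
have yB : 2 ^ y <= B ^ 2.
  have /andP[_ h] : n + 1024 <= 2 ^ y <= 2 * (n + 1024) by apply: exp_up_log; rewrite addn_gt0 orbT.
  by apply: leq_trans h _; rewrite -mulnn leq_mul // /B; clear; lia.
have pow j : j <= a + 16 -> 2 ^ (j * y) <= X.
  move=> ja; apply: leq_trans (_ : (B ^ 2) ^ j <= _); first by rewrite mulnC expnM leq_expl.
  by rewrite -expnM; apply: BX; rewrite /E; move: ja; clear; lia.
have LX : 2 ^ LP <= X by apply: pow; rewrite leq_addr.
have XG : 2 ^ lgl n <= X by apply: pow; rewrite leq_addl.
have X64 : 64 <= X by apply: leq_trans (BX 1 _); rewrite ?expn1 /B /E; clear; lia.
have [mn _] := size_edges es.
have XI : (inf G).+1 * arcs_num dir s <= X.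
  apply: leq_trans (BX 7 _); last by rewrite /E; clear; lia.
  have i3 : (inf G).+1 <= B ^ 4.
    have : inf G <= B ^ 3.
      by rewrite /inf !expnS expn0 muln1 mulnA; apply: leq_mul; [apply: leq_mul|]; rewrite /B; clear; lia.
    have : 0 < B ^ 3 by rewrite expn_gt0 B0.
    by rewrite [B ^ 4]expnS; move: B2; move: (B ^ 3) (inf G) (B); clear; nia.
  rewrite (expnD B 4 3); apply: leq_mul => //.
  apply: leq_trans (_ : (2 * size s).+1 <= _); first by rewrite /arcs_num; case: (dir); clear; lia.
  apply: leq_trans (_ : 1024 * (n * n + 1) <= _); first by move: mn; clear; lia.
  by rewrite expnS -mulnn; apply: leq_mul; rewrite /B; clear; [lia|nia].
have cm : (cmax (main dir b)).+1 <= X.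
  apply: leq_trans (_ : 2 ^ (cmax (main dir b)).+1 <= _); first by rewrite ltnW // ltn_expl.
  by apply: leq_trans (leq_expl _ B2) (BX _ _); rewrite /E; clear; lia.
have LPn : n + 1024 <= 2 ^ LP.
  by apply: leq_trans (yl_exp n) _; rewrite leq_pexp2l // /LP /a leq_pmull // addn4.
have MX i : nth 0 (input_words G s) i <= X.
  apply: leq_trans (input_le es i) _; apply: leq_trans (BX 2 _); last by rewrite /E; clear; lia.
  by rewrite -mulnn !geq_max /B; move: mn; clear=> mn; apply/and3P; split; nia.
have mX : 3 * size s + 2 <= X.
  apply: leq_trans (BX 3 _); last by rewrite /E; clear; lia.
  apply: leq_trans (_ : 1024 * (n * n + 1) <= _); first by move: mn; clear; lia.
  by rewrite expnS -mulnn; apply: leq_mul; rewrite /B; clear; [lia|nia].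
have [o1 a1 w1 q] := main_ok b X64 LX es XG XI LPn MX mX; rewrite -/TB -/WB in a1 w1.
have Wd : omg (main dir b) (St (fun=> 0) (nth 0 (input_words G s))) <= d * y ^ k * (n.+1 * arcs_num dir s).
  apply: leq_trans w1 _; rewrite /d -(mulnA (14 * 1000)) -(mulnA (14 * 1000)) leq_mul2l.
  by rewrite WBle orbT.
have oL : omg (main dir b) (St (fun=> 0) (nth 0 (input_words G s))) <= 2 ^ LP.
  apply: leq_trans Wd _; apply: leq_trans (_ : 2 ^ d * 2 ^ (y * k) * 2 ^ (4 * y) <= _).
    apply: leq_mul; last exact: arcs_le es.
    by apply: leq_mul; [rewrite ltnW // ltn_expl|rewrite expnM leq_expl // ltnW // ltn_expl].
  rewrite -!expnD leq_pexp2l // /LP /a; have : d <= d * y by rewrite leq_pmulr.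
  by generalize d => e h; rewrite !mulnDl (mulnC y k) !leq_add2r.
have cd : 510 * c <= d by rewrite /d; generalize c; clear; lia.
clearbody d.
have wfm : wf (main dir b) by case: (dir); case: (b).
have Xw : X ^ z < 2 ^ word_size G (11 * E * z + 1).
  rewrite /word_size; set T := (trunc_log 2 _).+1.
  have BT : B <= 2 ^ (11 * T).
    have h : n + max_weight G < 2 ^ T by first [apply: trunc_log_ltn|apply: leq_ltn_trans (@trunc_log_ltn 2 _ isT); clear; lia].
    rewrite (_ : 11 * T = T + 10 * T); last by clear; lia.
    rewrite expnD; apply: leq_trans (_ : 2 ^ T * 2 ^ 10 <= _); last by apply: leq_mul => //; rewrite leq_pexp2l // leq_pmulr.
    rewrite (_ : 2 ^ 10 = 1024) // /B; move: h; generalize (2 ^ T) (n + max_weight G); clear; lia.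
  rewrite /X -expnM; apply: leq_ltn_trans (leq_expl (E * z) BT) _.
  rewrite -expnM ltn_exp2l //; have T0 : 0 < T by [].
  by move: T0; generalize T E z; clear; nia.
have [t [w [ex tt ww]]] := exec_cmd wfm cm X64 LX Xw MX o1 oL.
have h : size (prog_of (main dir b)) + 11 * LP + 31 <= sz * y.
  rewrite /sz /LP; move: y0; generalize (size (prog_of (main dir b))) a y => p e [|u] // _.
  by rewrite !mulnS !mulnDl; clear; nia.
clearbody sz.
exists t, w, (mm (run (main dir b) (St (fun=> 0) (nth 0 (input_words G s))))); split=> //.
- apply: leq_trans tt _; apply: leq_trans (leq_mul h a1) _.
  apply: leq_trans (_ : sz * y * (510 * (c * y ^ k * 2 ^ ell dir s)) <= _).
    by apply: leq_mul => //; apply: leq_mul.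
  have -> : sz * y * (510 * (c * y ^ k * 2 ^ ell dir s)) = sz * (510 * c) * (y * y ^ k) * 2 ^ ell dir s.
    by generalize (y ^ k) (2 ^ ell dir s) c sz y; clear; nia.
  rewrite (expnS y k); apply: leq_mul => //; apply: leq_mul => //.
  by apply: leq_trans (_ : sz * d <= _); [apply: leq_mul|rewrite leq_pmull].
apply: leq_trans ww _; apply: leq_trans (_ : 2 * (sz * y) * (d * y ^ k * (n.+1 * arcs_num dir s)) <= _).
  by apply: leq_mul => //; apply: leq_mul.
rewrite (expnS y k); apply: eq_leq; generalize (y ^ k) (n.+1 * arcs_num dir s) d sz y; clear; nia.
Qed.

End Execution.

(** * Passage to real bounds *)

Module Estimates.
Import Language Expressions Spawning Simulation Compiler InputData ArcTables.

(** The cube is at most [8 * 2 ^ up_log 2 N0], with [N0] the value [n0 dir s], hence at most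
    [16 * (n + 1)], which is below [27 * n] from [n = 2] on. *)
Lemma ell_cube dir n (s : seq ('I_n * 'I_n)) : 1 < n -> (2 ^ ell dir s) ^ 3 <= 27 * n.
Proof.
move=> n1; have N0 : 0 < n0 dir s by rewrite /n0; case: ifP => // _; rewrite /arcs_num; case: (dir).
have Nn : n0 dir s <= n.+1 by rewrite /n0; case: (ltnP (2 * arcs_num dir s) n.+1) => // /ltnW.
have /andP[_ u2] := exp_up_log N0; rewrite -expnM.
apply: leq_trans (_ : 2 ^ (3 + up_log 2 (n0 dir s)) <= _).
  by rewrite leq_exp2l // /ell; clear; lia.
by rewrite expnD (_ : 2 ^ 3 = 8) //; move: u2 Nn n1; clear; lia.
Qed.

Import Order.TTheory GRing.Theory Num.Theory.
Local Open Scope ring_scope.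

Lemma yl_ln (R : realType) n : (1 < n)%N -> (yl n)%:R <= 12%:R / ln 2%:R * ln n%:R :> R.
Proof.
move=> n1; have n0 : (0 < n)%N by exact: ltnW.
have z1 : (0 < trunc_log 2 n)%N by rewrite trunc_log_gt0.
have zl : (2 ^ trunc_log 2 n <= n)%N by apply: trunc_logP.
have zu : (n < 2 ^ (trunc_log 2 n).+1)%N by apply: trunc_log_ltn.
set z := trunc_log 2 n in z1 zl zu.
(* [n + 1024 <= 2 ^ (z + 11)], and [z + 11 <= 12 * z] because [z >= 1]. *)
have yz : (yl n <= 12 * z)%N.
  apply: leq_trans (_ : (z.+1 + 10 <= _)%N); last by move: z1; clear; lia.
  apply: up_log_min => //; rewrite expnD (_ : (2 ^ 10 = 1024)%N) //.
  by move: zu n1; move: (2 ^ z.+1)%N => a; clear; lia.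
have l2 : 0 < ln 2%:R :> R by apply: ln_gt0; rewrite ltr1n.
have h : z%:R * ln 2%:R <= ln n%:R :> R.
  rewrite mulr_natl -lnXn ?ltr0n // -natrX ler_ln ?posrE ?ltr0n ?expn_gt0 //.
  by rewrite ler_nat.
apply: le_trans (_ : (12 * z)%:R <= _); first by rewrite ler_nat.
rewrite natrM -mulrA ler_wpM2l // mulrC ler_pdivlMr //.
Qed.

Lemma cube_root (R : realType) n : (n%:R `^ (1 / 3%:R)) ^+ 3 = n%:R :> R.
Proof.
by rewrite -powR_mulrn ?powR_ge0 // -powRrM mul1r mulVf ?powRr1 // pnatr_eq0.
Qed.

Lemma real_bounds (R : realType) dir n (s : seq ('I_n * 'I_n)) c k t work e :
  (1 < n)%N -> (size s <= e)%N ->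
  (t <= c * yl n ^ k * 2 ^ ell dir s)%N -> (work <= c * yl n ^ k * (n.+1 * arcs_num dir s))%N ->
  let C : R := 6%:R * c%:R * (12%:R / ln 2%:R) ^+ k in
  work%:R <= C * ln n%:R ^+ k * ((maxn e 1)%:R * n%:R) /\
  t%:R <= C * ln n%:R ^+ k * n%:R `^ (1 / 3%:R).
Proof.
move=> n1 se tt ww C; set A : R := 12%:R / ln 2%:R.
have yA : (yl n)%:R ^+ k <= (A * ln n%:R) ^+ k :> R.
  by apply: lerXn2r; rewrite ?nnegrE ?(le_trans _ (yl_ln R n1)) ?yl_ln.
have cy : (c * yl n ^ k)%:R <= c%:R * (A ^+ k * ln n%:R ^+ k) :> R.
  by rewrite natrM natrX -exprMn ler_wpM2l.
have r0 : 0 <= c%:R * (A ^+ k * ln n%:R ^+ k) :> R by apply: le_trans cy.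
(* [n + 1 <= 2 n], and the at most [2 m + 1] arcs are at most three times the maximum of [e] and
   1. *)
have W0 : (n.+1 * arcs_num dir s <= 6 * (maxn e 1 * n))%N.
  have a1 : (arcs_num dir s <= 3 * maxn e 1)%N.
    rewrite /arcs_num; have := leq_maxl e 1; have := leq_maxr e 1; move: se; move: (maxn e 1) => x.
    by case: (dir); clear; lia.
  apply: leq_trans (leq_mul (_ : n.+1 <= 2 * n)%N a1) _; first by move: n1; clear; lia.
  by move: (maxn e 1) => x; clear; lia.
split.
  apply: le_trans (_ : (c * yl n ^ k * (n.+1 * arcs_num dir s))%:R <= _); first by rewrite ler_nat.
  rewrite natrM; apply: le_trans (ler_pM _ _ cy (_ : _ <= (6 * (maxn e 1 * n))%:R)) _ => //; first by rewrite ler_nat.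
  rewrite !natrM /C -/A le_eqVlt; apply/orP; left; apply/eqP.
  rewrite !mulrA [c%:R * _ * _ * 6%:R]mulrC !mulrA //.
apply: le_trans (_ : (c * yl n ^ k * 2 ^ ell dir s)%:R <= _); first by rewrite ler_nat.
(* The cube root of 27 would do; 6 lets time and work share the constant [C]. *)
have b3 : (2 ^ ell dir s)%:R <= 6%:R * n%:R `^ (1 / 3%:R) :> R.
  have p0 : 0 <= n%:R `^ (1 / 3%:R) :> R by exact: powR_ge0.
  rewrite -(ler_pXn2r (isT : (0 < 3)%N)) ?nnegrE ?mulr_ge0 // exprMn cube_root -!natrX -natrM ler_nat.
  apply: leq_trans (ell_cube dir s n1) _; rewrite leq_mul2r; apply/orP; right.
  by rewrite (_ : (6 ^ 3 = 216)%N).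
rewrite natrM; apply: le_trans (ler_pM _ _ cy b3) _ => //.
rewrite /C -/A le_eqVlt; apply/orP; left; apply/eqP.
by rewrite !mulrA [c%:R * _ * _ * 6%:R]mulrC !mulrA.
Qed.

End Estimates.

(** * Solvability for both problems and both kinds of graphs *)

Module Conclusion.
Import Language Expressions Spawning Simulation Compiler InputData ArcTables Assembly Execution Estimates.

Local Open Scope ring_scope.

Lemma solvable_main (R : realType) dir b : exists (prog : program) (c k : nat) (C : R),
  forall n (G : wgraph dir n) s, edge_list G s -> exists (t work : nat) (M : memory),
    [/\ exec (word_size G c) prog (init_config G s) t work M,
        if b then minimum_weight_cycle G M else all_nodes_shortest_cycles G M
      & (1 < n)%N ->
        work%:R <= C * ln n%:R ^+ k * ((maxn (num_edges G) 1)%:R * n%:R) /\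
        t%:R <= C * ln n%:R ^+ k * n%:R `^ (1 / 3%:R)].
Proof.
have [wc [c [k H]]] := exec_main dir b.
exists (prog_of (main dir b)), wc, k, (6%:R * c%:R * (12%:R / ln 2%:R) ^+ k) => n G s es.
have [t [work [M [ex q tt ww]]]] := H n G s es; exists t, work, M; split=> // n1.
by have [_ se] := size_edges es; exact: real_bounds n1 se tt ww.
Qed.

End Conclusion.

Local Open Scope ring_scope.

(* [maxn m 1] only matters for edgeless graphs, on which no algorithm meets a
   bound of 0. *)
Theorem theorem5 (R : realType) (dir : bool) :
  pram_solvable (@minimum_weight_cycle dir)
    (fun n m => (maxn m 1)%:R * n%:R : R) (fun n m => n%:R `^ (1 / 3%:R)) /\
  pram_solvable (@all_nodes_shortest_cycles dir)
    (fun n m => (maxn m 1)%:R * n%:R : R) (fun n m => n%:R `^ (1 / 3%:R)).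
Proof. by split; [exact: (Conclusion.solvable_main R dir true)|exact: (Conclusion.solvable_main R dir false)]. Qed.
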